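(* Let $p\ge0$ be an integer, $f\in L^2(\Omega)$, $g\in H^{1/2}(\partial\Omega)$, and suppose the quadrature condition holds: for every $T\in\mathcal T_h$ and $1\le i\le n_p$, the polynomial $\psi_i^T$ of minimal degree with $\psi_i^T(x_j^T)=\delta_{ij}$ for all $1\le j\le n_p$ belongs to $\mathcal P_p(T)$. Given $\psi_h^0\in V_h^p$ and positive step sizes $\{\alpha_k\}_{k\ge1}$, let $(\bm q_h^k,u_h^k,\psi_h^k)\in\bm\Sigma_{h,\mathrm{div}}^p\times V_h^p\times V_h^p$, $k\ge1$, be the proximal iterates satisfying $$\begin{aligned}\alpha_k(\nabla\cdot\bm q_h^k,v_h)+(\psi_h^k,v_h)&=\alpha_k(f,v_h)+(\psi_h^{k-1},v_h)&&\forall v_h\in V_h^p,\\ (A^{-1}\bm q_h^k,\bm v_h)-(\nabla\cdot\bm v_h,u_h^k)&=-\langle g,\bm v_h\cdot\bm n\rangle_{\partial\Omega}&&\forall\bm v_h\in\bm\Sigma_{h,\mathrm{div}}^p,\\ (u_h^k,q_h)-(\mathcal U(\psi_h^k),q_h)_h&=0&&\forall q_h\in V_h^p.\end{aligned}$$ Then the iterates $(\bm q_h^k,u_h^k)$ converge, as $k\to\infty$, to the solution $(\bm q_h^*,u_h^* )\in\bm\Sigma_{h,\mathrm{div}}^p\times\Lambda_h$ of the discrete mixed variational inequality $$\begin{aligned}(A^{-1}\bm q_h^*,\bm r_h)-(u_h^*,\nabla\cdot\bm r_h)&=-\langle g,\bm r_h\cdot\bm n\rangle_{\partial\Omega}&&\forall\bm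 r_h\in\bm\Sigma_{h,\mathrm{div}}^p,\\ (\nabla\cdot\bm q_h^*-f,v_h-u_h^* )&\ge0&&\forall v_h\in\Lambda_h.\end{aligned}$$ Further, there is a constant $C$ independent of $h$ such that for any $\ell\ge1$ $$\|u_h^\ell-u_h^*\|_{\mathrm{DG}}^2+\|A^{-1/2}(\bm q_h^\ell-\bm q_h^* )\|_{L^2(\Omega)}^2\le C\,\frac{D_h(u_h^*,u_h^0)}{\sum_{k=1}^\ell\alpha_k},$$ where $u_h^0\in V_h^p$ is defined by $(u_h^0,q_h)=(\mathcal U(\psi_h^0),q_h)_h$ for all $q_h\in V_h^p$.
   Context: $\Omega\subset\mathbb{R}^d$, $d\in\{2,3\}$, is an open bounded polygonal/polyhedral domain with outward normal $\bm n$; $A\in L^\infty(\Omega;\mathbb{R}^{d\times d})$ is symmetric with eigenvalues uniformly bounded below and above by positive constants. $(\cdot,\cdot)$ is the $L^2(\Omega)$ inner product. $\underline u,\overline u\in H^1(\Omega)\cap C(\overline\Omega)$ with $\underline u\le\overline u$ (also $\overline u=+\infty$ is allowed). Entropy and superposition operators: for a.e. $x$ (and in particular at the quadrature points) $R(x,\cdot):\mathbb{R}\to\mathbb{R}\cup\{+\infty\}$ is strictly convex on its domain $\{y:R(x,y)<\infty\}=[\underline u(x),\overline u(x)]\cap\mathbb{R}$, differentiable on $(\underline u(x),\overline u(x))$, with $R(x,y)/|y|\to\infty$ as $|y|\to\infty$, and $\Upsilon(x,\cdot)=(\frac{\partial}{\partial y}R(x,\cdot))^{-1}$ is an increasing bijection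 from $\mathbb{R}$ onto $(\underline u(x),\overline u(x))$. Set $\mathcal U(\psi)(x)=\Upsilon(x,\psi(x))$, $\mathcal R(u)(x)=R(x,u(x))$, $\mathcal R'(u)(x)=\frac{\partial}{\partial y}R(x,u(x))$. $\mathcal T_h$ ranges over a shape-regular family of conforming partitions of $\Omega$ into elements $T$, each the image of a reference element $\hat T$ (a simplex, or a square/cube) under an affine map $\Phi_T$; $h$ is the maximal element diameter; $\mathcal E_h$ is the set of all facets (boundary facets included), $h_E$ the diameter of $E$. $\mathcal P_p(\hat T)$ denotes polynomials of total degree $\le p$ if $\hat T$ is a simplex, and of degree $\le p$ in each variable if $\hat T$ is a square/cube; $\mathcal P_p(T)=\{\hat v\circ\Phi_T^{-1}:\hat v\in\mathcal P_p(\hat T)\}$. $\mathrm{RT}_p(\hat T)=[\mathcal P_p(\hat T)]^d+\mathbf x\,\mathcal P_p(\hat T)$ is the Raviart–Thomas element of degree $p$. $\bm\Sigma_{h,\mathrm{div}}^p=\{\mathbf r_h\in H(\mathrm{div};\Omega):\mathbf r_h|_T=\frac1{\det\Phi_T'}\Phi_T'\hat{\mathbf r}\circ\Phi_T^{-1},\ \hat{\mathbf r}\in\mathrm{RT}_p(\hat T)\ \forall T\}$, $V_h^p=\{v_h\in L^2(\Omega):v_h|_T\in\mathcal P_p(T)\ \forall T\}$. Quadrature: $\{(\hat x_i,\hat w_i)\}_{i=1}^{n_p}$ is a rule on $\hat T$ with positive weights, exact for $\mathcal P_{2p}(\hat T)$; $x_i^T=\Phi_T(\hat x_i)$, $w_i^T=\frac{|T|}{|\hat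 T|}\hat w_i$, $(a,b)_h=\sum_T\sum_{i=1}^{n_p}a(x_i^T)b(x_i^T)w_i^T$ (values taken from within $T$). $\Lambda_h=\{v_h\in V_h^p:\underline u(x_i^T)\le v_h(x_i^T)\le\overline u(x_i^T)\ \forall i,T\}$. For $u_h\in\Lambda_h$ and $v_h\in V_h^p$ with $\underline u(x_i^T)<v_h(x_i^T)<\overline u(x_i^T)$ for all $i,T$, the discrete Bregman distance is $D_h(u_h,v_h)=(\mathcal R(u_h)-\mathcal R(v_h),1)_h-(\mathcal R'(v_h),u_h-v_h)_h$. $\|v\|_{\mathrm{DG}}^2=\sum_T\|A^{1/2}\nabla v\|_{L^2(T)}^2+\sum_{E\in\mathcal E_h}h_E^{-1}\|[v]\|_{L^2(E)}^2$, with $[v]$ the difference of the two traces on interior facets and the trace on boundary facets.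
   Formalization: Convergence of the iterates is claimed only when the step sizes have divergent sum (it fails for summable ones; the estimate keeps all positive steps); on squares/cubes RT_p is the actual Raviart–Thomas element, i.e. x P_p taken componentwise, since the literal formula breaks the h-uniform bound. *)

(* Defs.v *)
From HB Require Import structures.
From mathcomp Require Import all_boot all_order all_algebra.
From mathcomp Require Import all_classical all_reals all_analysis.
Set Implicit Arguments.
Unset Strict Implicit.
Unset Printing Implicit Defensive.
Import Order.TTheory GRing.Theory Num.Theory.
Import numFieldNormedType.Exports.
Local Open Scope classical_set_scope.
Local Open Scope ring_scope.

(* Points of R^d are row vectors 'rV[R]_d; the library     *)
(* norm on them is the sup norm, so Euclidean lengths go through enorm.        *)

Definition rV_display : measure_display -> measure_display.
Proof. exact. Qed.

Section measurable_rV.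
Variables (R : realType) (n : nat).

Let coords (i : 'I_n) (x : 'rV[R]_n) : R := x 0 i.

Let rV_set0 : g_sigma_preimage coords set0.
Proof. exact: sigma_algebra0. Qed.

Let rV_setC A : g_sigma_preimage coords A -> g_sigma_preimage coords (~` A).
Proof. exact: sigma_algebraC. Qed.

Let rV_bigcup (F : _^nat) : (forall i, g_sigma_preimage coords (F i)) ->
  g_sigma_preimage coords (\bigcup_i (F i)).
Proof. exact: sigma_algebra_bigcup. Qed.

HB.instance Definition _ := @isMeasurable.Build
  (rV_display default_measure_display) 'rV[R]_n (g_sigma_preimage coords)
  rV_set0 rV_setC rV_bigcup.

End measurable_rV.

Section lebesgue_rV.
Variable R : realType.

Lemma measurable_coord n (i : 'I_n) :
  measurable_fun setT (fun x : 'rV[R]_n => x 0 i).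
Proof.
move=> _ Y mY; rewrite setTI; apply: sub_sigma_algebra => /=.
rewrite -bigcup_seq/=; exists i => /=; first by rewrite mem_index_enum.
by exists Y => //; rewrite setTI.
Qed.

Lemma measurable_fun_rV d (T : measurableType d) n (f : T -> 'rV[R]_n) :
  (forall i, measurable_fun setT (fun t => f t 0 i)) -> measurable_fun setT f.
Proof.
move=> mf.
have : g_sigma_preimage (fun i t => f t 0 i) `<=` measurable.
  apply: smallest_sub; first exact: sigma_algebra_measurable.
  case: n => [|n] in f mf *; first by rewrite big_ord0.
  rewrite -bigcup_mkord_ord; apply: bigcup_sub => i Ii.
  by move=> A [B mB <-]; exact: mf.
rewrite (g_sigma_preimage_comp (fun i (x : 'rV[R]_n) => x 0 i : R) f) => h.
by move=> _ A mA; apply: h; exists A.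
Qed.

Definition rV_cons n (p : measurableTypeR R * 'rV[R]_n) : 'rV[R]_n.+1 :=
  \row_i (if unlift ord0 i is Some j then p.2 0 j else p.1).

Lemma measurable_rV_cons n : measurable_fun setT (@rV_cons n).
Proof.
apply: measurable_fun_rV => i; case: (unliftP ord0 i) => [j|] ->.
  under eq_fun do rewrite mxE liftK.
  exact: (measurableT_comp (measurable_coord j) measurable_snd).
under eq_fun do rewrite mxE unlift_none.
move=> mD Y mY.
exact: (@measurable_fst _ _ (measurableTypeR R) 'rV[R]_n mD Y mY).
Qed.

Section step.
Variables (n : nat) (mu : {sigma_finite_measure set 'rV[R]_n -> \bar R}).

Definition lebesgue_cons : set 'rV[R]_n.+1 -> \bar R :=
  pushforward (lebesgue_measure \x mu)%E (@rV_cons n).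

Let cons0 : lebesgue_cons set0 = 0.
Proof. by rewrite /lebesgue_cons /pushforward preimage_set0 measure0. Qed.

Let cons_ge0 A : (0 <= lebesgue_cons A)%E.
Proof. by rewrite /lebesgue_cons /pushforward; exact: measure_ge0. Qed.

Let measurable_preimage_cons A :
  measurable A -> measurable (@rV_cons n @^-1` A).
Proof. by move=> mA; rewrite -[X in measurable X]setTI; exact: measurable_rV_cons. Qed.

Let cons_sigma_additive : semi_sigma_additive lebesgue_cons.
Proof.
move=> F mF tF mUF; rewrite /lebesgue_cons /pushforward preimage_bigcup.
apply: measure_semi_sigma_additive.
- by move=> k; exact: measurable_preimage_cons.
- apply/trivIsetP => /= i j _ _ ij; rewrite -preimage_setI.
  by move/trivIsetP : tF => /(_ _ _ _ _ ij) ->//; rewrite preimage_set0.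
- by rewrite -preimage_bigcup; exact: measurable_preimage_cons.
Qed.

HB.instance Definition _ := isMeasure.Build _ _ _ lebesgue_cons
  cons0 cons_ge0 cons_sigma_additive.

Let cons_sigma_finite : sigma_finite setT lebesgue_cons.
Proof.
have /sigma_finiteP[F [TF ndF Foo]] := sigma_finiteT (@lebesgue_measure R).
have /sigma_finiteP[G [TG ndG Goo]] := sigma_finiteT mu.
pose uncons (x : 'rV[R]_n.+1) : measurableTypeR R * 'rV[R]_n :=
  (x 0 ord0, \row_j x 0 (lift ord0 j)).
have munc : measurable_fun setT uncons.
  apply/measurable_fun_pairP; split => /=.
    by move=> mD Y mY; exact: (measurable_coord ord0 mD mY).
  apply: measurable_fun_rV => j; under eq_fun do rewrite /= mxE.
  exact: measurable_coord.
have consK : cancel (@rV_cons n) uncons.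
  move=> [a v]; rewrite /uncons/= mxE unlift_none; congr (_, _).
  by apply/rowP => j; rewrite !mxE liftK.
exists (fun k => uncons @^-1` (F k `*` G k)).
  rewrite -preimage_bigcup; apply/esym/seteqP; split => // x _ /=.
  have [k _ Fk] : (\bigcup_k F k) (x 0 ord0) by rewrite -TF.
  have [l _ Gl] : (\bigcup_k G k) (\row_j x 0 (lift ord0 j)) by rewrite -TG.
  exists (maxn k l) => //; split => /=.
  - by move: Fk; exact/subsetPset/ndF/leq_maxl.
  - by move: Gl; exact/subsetPset/ndG/leq_maxr.
move=> k; have [mF Fk] := Foo k; have [mG Gk] := Goo k; split.
  by rewrite -[X in measurable X]setTI; apply: munc => //; exact: measurableX.
rewrite /lebesgue_cons /pushforward (_ : _ @^-1` _ = F k `*` G k).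
  by rewrite product_measure1E// lte_mul_pinfty// ge0_fin_numE.
rewrite -comp_preimage (_ : uncons \o _ = id) ?preimage_id//.
exact/funext/consK.
Qed.

HB.instance Definition _ := Measure_isSigmaFinite.Build _ _ _ lebesgue_cons
  cons_sigma_finite.

End step.

(* d-dimensional Lebesgue measure (on Borel sets), as an iterated product.     *)
Fixpoint lebesgue_rV n : {sigma_finite_measure set 'rV[R]_n -> \bar R} :=
  match n with
  | 0 => @dirac _ 'rV[R]_0 0 R
  | n'.+1 => lebesgue_cons (lebesgue_rV n')
  end.

End lebesgue_rV.

Lemma lebesgue_rV_box (R : realType) n (A : 'I_n -> set R) :
  (forall i, measurable (A i)) ->
  measurable [set x : 'rV[R]_n | forall i, A i (x 0 i)] /\
  (lebesgue_rV R n [set x : 'rV[R]_n | forall i, A i (x 0%R i)] =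
   \prod_(i < n) (lebesgue_measure (A i : set (measurableTypeR R)) : \bar R))%E.
Proof.
move=> mA; split.
  rewrite (_ : [set _ | _] = \bigcap_(i in [set: 'I_n])
      ((fun x : 'rV[R]_n => x 0 i) @^-1` A i)).
    apply: fin_bigcap_measurable => // i _.
    by rewrite -[X in measurable X]setTI; exact: measurable_coord.
  by apply/seteqP; split => [x h i _|x h i]; apply: h.
elim: n A mA => [A mA|n IH A mA].
  rewrite big_ord0 /= diracE mem_set//= => -[]//.
have mB : measurable [set x : 'rV[R]_n | forall i, A (lift ord0 i) (x 0 i)].
  rewrite (_ : [set _ | _] = \bigcap_(i in [set: 'I_n])
      ((fun x : 'rV[R]_n => x 0 i) @^-1` A (lift ord0 i))).
    apply: fin_bigcap_measurable => // i _.
    by rewrite -[X in measurable X]setTI; exact: measurable_coord.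
  by apply/seteqP; split => [x h i _|x h i]; apply: h.
rewrite big_ord_recl -IH//= /lebesgue_cons /pushforward.
rewrite [X in _ X = _](_ : _ =
    (A ord0 : set (measurableTypeR R)) `*`
    [set x : 'rV[R]_n | forall i, A (lift ord0 i) (x 0%R i)]).
  by apply: (@product_measure1E _ _ (measurableTypeR R) 'rV[R]_n R
    (@lebesgue_measure R) (lebesgue_rV R n) (A ord0)); [exact: mA|exact: mB].
apply/seteqP; split => -[a v] /= h.
  split.
    by have := h ord0; rewrite mxE unlift_none.
  by move=> i; have := h (lift ord0 i); rewrite mxE liftK.
move=> i; rewrite mxE; case: (unliftP ord0 i) => [j|] -> ; [exact: h.2|exact: h.1].
Qed.

Section function_spaces.
Variables (R : realType) (d : nat).
Implicit Types (Om D : set 'rV[R]_d) (u phi : 'rV[R]_d -> R)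
  (r : 'rV[R]_d -> 'rV[R]_d).

Definition dot (x y : 'rV[R]_d) : R := \sum_i x 0 i * y 0 i.

Definition enorm (x : 'rV[R]_d) : R := Num.sqrt (dot x x).

Definition ball2 (c : 'rV[R]_d) (rho : R) : set 'rV[R]_d :=
  [set x | enorm (x - c) <= rho].

Definition diam D : R := sup [set enorm (z.1 - z.2) | z in D `*` D].

Definition vol D : R := fine (lebesgue_rV R d D).

Definition ip Om (u v : 'rV[R]_d -> R) : R :=
  \int[lebesgue_rV R d]_(x in Om) (u x * v x).

Definition ipv Om (r s : 'rV[R]_d -> 'rV[R]_d) : R :=
  \int[lebesgue_rV R d]_(x in Om) dot (r x) (s x).

Definition L2 Om u : Prop :=
  measurable_fun Om u /\
  (\int[lebesgue_rV R d]_(x in Om) ((u x) ^+ 2)%:E < +oo)%E.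

Definition L2v Om r : Prop := forall i, L2 Om (fun x => r x 0 i).

Definition norm2 Om u : R := Num.sqrt (ip Om u u).

Definition partial (i : 'I_d) u (x : 'rV[R]_d) : R := 'D_(delta_mx 0 i) u x.

Definition grad u (x : 'rV[R]_d) : 'rV[R]_d := \row_i partial i u x.

Fixpoint Ck (k : nat) phi : Prop :=
  continuous phi /\
  if k is k'.+1 then
    (forall x (i : 'I_d), derivable phi x (delta_mx 0 i)) /\
    (forall i, Ck k' (partial i phi))
  else True.

(* C_c^infty(Om), extended by zero *)
Definition test_function Om phi : Prop :=
  (forall k, Ck k phi) /\
  exists S : set 'rV[R]_d,
    [/\ compact S, S `<=` Om & forall x, ~ S x -> phi x = 0].

Definition is_weak_grad Om u r : Prop :=
  L2v Om r /\
  forall phi, test_function Om phi -> forall i,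
    ip Om u (partial i phi) = - ip Om (fun x => r x 0 i) phi.

Definition H1 Om u : Prop := L2 Om u /\ exists r, is_weak_grad Om u r.

Definition weak_grad Om u : 'rV[R]_d -> 'rV[R]_d :=
  xget (fun=> 0) [set r | is_weak_grad Om u r].

Definition is_weak_div Om r u : Prop :=
  L2 Om u /\
  forall phi, test_function Om phi -> ipv Om r (grad phi) = - ip Om u phi.

Definition Hdiv Om r : Prop := L2v Om r /\ exists u, is_weak_div Om r u.

(* the weak divergence, determined almost everywhere, of r in H(div; Om) *)
Definition weak_div Om r : 'rV[R]_d -> R :=
  xget (fun=> 0) [set u | is_weak_div Om r u].

Definition Hdiv_norm Om r : R :=
  Num.sqrt (ipv Om r r + ip Om (weak_div Om r) (weak_div Om r)).

(* <g, r . n>_(boundary of Om), the H^(1/2) - H^(-1/2) duality between a trace *)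
(* g and the normal trace of r in H(div; Om).  H^(1/2) of the boundary is the   *)
(* trace space of H^1(Om), and g is represented by a function G in H^1(Om)      *)
(* whose trace is g; the value does not depend on the choice of G.              *)
Definition boundary_pairing Om (G : 'rV[R]_d -> R) r : R :=
  ipv Om (weak_grad Om G) r + ip Om G (weak_div Om r).

Definition coefficient Om (A : 'rV[R]_d -> 'M[R]_d) : Prop :=
  [/\ forall i j, measurable_fun Om (fun x => A x i j),
      exists M : R, {ae lebesgue_rV R d, forall x, Om x ->
        forall i j, `|A x i j| <= M},
      {ae lebesgue_rV R d, forall x, Om x -> (A x)^T = A x} &
      exists a0 a1 : R, [/\ 0 < a0, 0 < a1 &
        {ae lebesgue_rV R d, forall x, Om x ->
          forall lam, eigenvalue (A x) lam -> a0 <= lam <= a1}]].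

(* row-vector forms of x |-> A(x) r(x) and x |-> A(x)^-1 r(x) *)
Definition applyA (A : 'rV[R]_d -> 'M[R]_d) r x : 'rV[R]_d := r x *m (A x)^T.

Definition applyAinv (A : 'rV[R]_d -> 'M[R]_d) r x : 'rV[R]_d :=
  r x *m (invmx (A x))^T.

Definition H1C Om u : Prop := H1 Om u /\ {within closure Om, continuous u}.

End function_spaces.

Section entropy.
Variable R : realType.

(* lo and hi are the ends of the effective domain at a point x, rho = R(x, .)  *)
(* and ups = Upsilon(x, .) *)
Record entropy_at (lo : R) (hi : \bar R) (rho : R -> \bar R) (ups : R -> R) :
    Prop := EntropyAt {
  entropy_ninfty : forall y, rho y != -oo%E;
  entropy_domain : forall y,
    (rho y < +oo)%E <-> (lo%:E <= y%:E /\ y%:E <= hi)%E;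
  entropy_strictly_convex : forall y z t : R,
    (rho y < +oo)%E -> (rho z < +oo)%E -> y != z -> 0 < t < 1 ->
    (rho (t * y + (1 - t) * z)%R < t%:E * rho y + (1 - t)%:E * rho z)%E;
  entropy_differentiable : forall y, lo < y -> (y%:E < hi)%E ->
    derivable (fine \o rho) y 1;
  entropy_superlinear_pinfty :
    (rho y * (`|y|^-1)%:E)%E @[y --> +oo%R] --> +oo%E;
  entropy_superlinear_ninfty :
    (rho y * (`|y|^-1)%:E)%E @[y --> -oo%R] --> +oo%E;
  upsilon_range : forall s, lo < ups s /\ ((ups s)%:E < hi)%E;
  upsilon_increasing : {homo ups : s t / s < t};
  upsilonK : forall s, derive1 (fine \o rho) (ups s) = s;
  upsilonKV : forall y, lo < y -> (y%:E < hi)%E ->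
    ups (derive1 (fine \o rho) y) = y }.

End entropy.

Inductive ref_shape := Simplex | Cube.

Section reference_cell.
Variable R : realType.

(* P_p of the reference cell: total degree for the simplex, degree in each     *)
(* variable for the cube *)
Definition ref_poly d (K : ref_shape) (p : nat) (v : 'rV[R]_d -> R) : Prop :=
  exists c : {ffun 'I_d -> 'I_p.+1} -> R, forall x,
    v x = \sum_(m : {ffun 'I_d -> 'I_p.+1} |
              if K is Simplex then (\sum_i m i <= p)%N else true)
            c m * \prod_i x 0 i ^+ m i.

(* RT_p on the reference cell.  On the simplex, [P_p]^d + x P_p.  On the       *)
(* square or cube the Raviart-Thomas element has i-th component in             *)
(* P_p + x_i P_p, that is of degree p + 1 in x_i and p in the other variables, *)
(* so that the factor multiplying x is taken componentwise.                    *)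
Definition RT d (K : ref_shape) (p : nat) (r : 'rV[R]_d -> 'rV[R]_d) : Prop :=
  match K with
  | Simplex => exists (a : 'rV[R]_d -> 'rV[R]_d) (b : 'rV[R]_d -> R),
      [/\ forall i, ref_poly Simplex p (fun x => a x 0 i),
          ref_poly Simplex p b &
          forall x, r x = a x + b x *: x]
  | Cube => exists a b : 'rV[R]_d -> 'rV[R]_d,
      [/\ forall i, ref_poly Cube p (fun x => a x 0 i),
          forall i, ref_poly Cube p (fun x => b x 0 i) &
          forall x i, r x 0 i = a x 0 i + b x 0 i * x 0 i]
  end.

(* The reference cells {x_i >= 0, sum_i x_i <= 1} and [0, 1]^d, each given by  *)
(* one affine inequality facet_form j x >= 0 per facet. *)
Definition facet_ix (d : nat) (K : ref_shape) : finType :=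
  match K with Simplex => option 'I_d | Cube => ('I_d * bool)%type end.

Definition facet_form d (K : ref_shape) : facet_ix d K -> 'rV[R]_d -> R :=
  match K with
  | Simplex => fun j x => if j is Some i then x 0 i else 1 - \sum_i x 0 i
  | Cube => fun j x => if j.2 then 1 - x 0 j.1 else x 0 j.1
  end.

Definition ref_cell d (K : ref_shape) : set 'rV[R]_d :=
  [set x | forall j : facet_ix d K, 0 <= facet_form j x].

Definition insert_coord d (i : 'I_d) (a : R) (t : 'rV[R]_d.-1) : 'rV[R]_d :=
  \row_j (if unlift i j is Some k then t 0 k else a).

(* affine parametrization of the j-th facet over the (d-1)-dimensional         *)
(* reference cell; on the slanted facet of the simplex t |-> (t, 1 - sum_k t_k)*)
Definition facet_par d (K : ref_shape) :
    facet_ix d K -> 'rV[R]_d.-1 -> 'rV[R]_d :=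
  match K with
  | Simplex => fun j t =>
      if j is Some i then insert_coord i 0 t
      else \row_j (if (insub (j : nat) : option 'I_d.-1) is Some k
                   then t 0 k else 1 - \sum_k t 0 k)
  | Cube => fun j t => insert_coord j.1 (j.2)%:R t
  end.

End reference_cell.

(* A finite family of cells, each the image of the reference cell under the    *)
(* invertible affine map x |-> jac T x + offset T. *)
Record mesh (R : realType) (d : nat) (K : ref_shape) := Mesh {
  nelt : nat;
  jac : 'I_nelt -> 'M[R]_d;
  offset : 'I_nelt -> 'rV[R]_d;
  jac_unit : forall T, jac T \in unitmx }.

Notation elt M := 'I_(nelt M).

Section mesh.
Variables (R : realType) (d : nat) (K : ref_shape) (M : mesh R d K).

Definition Phi (T : elt M) (x : 'rV[R]_d) : 'rV[R]_d :=
  x *m (jac T)^T + offset T.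

Definition Phi_inv (T : elt M) (x : 'rV[R]_d) : 'rV[R]_d :=
  (x - offset T) *m (invmx (jac T))^T.

Definition cell (T : elt M) : set 'rV[R]_d := Phi T @` @ref_cell R d K.

(* the face of T cut out by a set S of its facets (T itself if S is empty) *)
Definition face (T : elt M) (S : {set facet_ix d K}) : set 'rV[R]_d :=
  Phi T @` [set x | ref_cell K x /\ forall j, j \in S -> facet_form j x = 0].

Definition conforming_partition (Om : set 'rV[R]_d) : Prop :=
  [/\ closure Om = \bigcup_(T in [set: elt M]) cell T,
      forall T T', T != T' -> interior (cell T) `&` interior (cell T') = set0 &
      forall T T', exists S S',
        cell T `&` cell T' = face T S /\ cell T `&` cell T' = face T' S'].

(* Piecewise functions are kept as one function per element, defined on all of *)
(* R^d (for piecewise polynomials, the polynomial itself), so that the values  *)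
(* from within T at boundary points of T are at hand.  assemble returns the        *)
(* function on the domain, which is determined off the element boundaries.     *)
Definition assemble (V : nmodType) (v : elt M -> 'rV[R]_d -> V) (x : 'rV[R]_d) : V :=
  \sum_(T : elt M | `[< interior (cell T) x >]) v T x.

Definition polyT (p : nat) (T : elt M) (v : 'rV[R]_d -> R) : Prop :=
  exists2 vh, ref_poly K p vh & forall x, v x = vh (Phi_inv T x).

Definition Vh (p : nat) (v : elt M -> 'rV[R]_d -> R) : Prop :=
  forall T, polyT p T (v T).

Definition Sigmah (Om : set 'rV[R]_d) (p : nat)
    (r : elt M -> 'rV[R]_d -> 'rV[R]_d) : Prop :=
  Hdiv Om (assemble r) /\
  forall T, exists2 rh, RT K p rh &
    forall x, r T x = (\det (jac T))^-1 *: (rh (Phi_inv T x) *m (jac T)^T).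

(* A side is an element together with one of its facets; an interior facet of  *)
(* the mesh carries two sides, a boundary facet carries one. *)
Definition side : finType := (elt M * facet_ix d K)%type.

Definition facet (s : side) : set 'rV[R]_d := face s.1 [set s.2].

Definition same_facet : rel side := [rel s s' | `[< facet s = facet s' >]].

(* E_h, one side being chosen for each facet *)
Definition facets : {set side} :=
  transversal (equivalence_partition same_facet [set: side]) [set: side].

Definition opposite (s : side) : option side :=
  [pick s' | (s' != s) && same_facet s s'].

(* up to sign, which depends on the chosen side *)
Definition jump (v : elt M -> 'rV[R]_d -> R) (s : side) (x : 'rV[R]_d) : R :=
  v s.1 x - (if opposite s is Some s' then v s'.1 x else 0).

(* integral of w over the facet of s with respect to the surface measure: the  *)
(* Gram factor of the affine parametrization times a (d-1)-dimensional integral*)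
Definition facet_integral (s : side) (w : 'rV[R]_d -> R) : R :=
  let F t := Phi s.1 (facet_par s.2 t) in
  let J := \matrix_(k < d.-1) (F (delta_mx 0 k) - F 0) in
  Num.sqrt (\det (J *m J^T)) *
  \int[lebesgue_rV R d.-1]_(t in @ref_cell R d.-1 K) w (F t).

(* |A^(1/2) xi|^2 is written (A xi) . xi *)
Definition dg_norm_sq (A : 'rV[R]_d -> 'M[R]_d) (v : elt M -> 'rV[R]_d -> R) : R :=
  \sum_(T : elt M) ipv (interior (cell T)) (applyA A (grad (v T))) (grad (v T))
  + \sum_(s in facets)
      (diam (facet s))^-1 * facet_integral s (fun x => jump v s x ^+ 2).

End mesh.

Section polyhedral.
Variables (R : realType) (d : nat).

(* a bounded domain whose closure is a finite union of simplices, and which    *)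
(* does not lie on both sides of its boundary (no slits) *)
Definition polyhedral_domain (Om : set 'rV[R]_d) : Prop :=
  [/\ open Om, Om !=set0, bounded_set Om, connected Om &
      interior (closure Om) = Om /\
      exists M : mesh R d Simplex,
        closure Om = \bigcup_(T in [set: elt M]) cell T].

Definition shape_regular (K : ref_shape) (F : set (mesh R d K)) : Prop :=
  exists2 sigma : R, 0 < sigma & forall M, F M -> forall T : elt M,
    exists (c : 'rV[R]_d) (rho : R),
      [/\ 0 < rho, ball2 c rho `<=` cell T & diam (cell T) <= sigma * rho].

End polyhedral.

Section quadrature.
Variables (R : realType) (d : nat) (K : ref_shape) (n : nat).
Variables (xq : 'I_n -> 'rV[R]_d) (wq : 'I_n -> R).

Definition quadrature_rule (p : nat) : Prop :=
  [/\ forall i, ref_cell K (xq i), forall i, 0 < wq i &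
      forall v, ref_poly K (2 * p) v ->
        \int[lebesgue_rV R d]_(x in @ref_cell R d K) v x =
        \sum_i wq i * v (xq i)].

Variable M : mesh R d K.

Definition xT (T : elt M) (i : 'I_n) : 'rV[R]_d := Phi T (xq i).

Definition wT (T : elt M) (i : 'I_n) : R :=
  vol (cell T) / vol (@ref_cell R d K) * wq i.

Definition ipq (a b : elt M -> 'rV[R]_d -> R) : R :=
  \sum_(T : elt M) \sum_(i < n) a T (xT T i) * b T (xT T i) * wT T i.

Definition nodal (T : elt M) (i : 'I_n) (v : 'rV[R]_d -> R) : Prop :=
  forall j, v (xT T j) = (i == j)%:R.

Definition quadrature_condition (p : nat) : Prop :=
  forall (T : elt M) (i : 'I_n), exists (m : nat) (psi : 'rV[R]_d -> R),
    [/\ polyT m T psi, nodal T i psi,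
        forall m' phi, polyT m' T phi -> nodal T i phi -> (m <= m')%N &
        polyT p T psi].

Definition Lambdah (p : nat) (lo : 'rV[R]_d -> R) (hi : 'rV[R]_d -> \bar R)
    (v : elt M -> 'rV[R]_d -> R) : Prop :=
  Vh p v /\ forall T i,
    lo (xT T i) <= v T (xT T i) /\ ((v T (xT T i))%:E <= hi (xT T i))%E.

Variable rho : 'rV[R]_d -> R -> \bar R.

Definition entropy_op (v : elt M -> 'rV[R]_d -> R) : elt M -> 'rV[R]_d -> R :=
  fun T x => fine (rho x (v T x)).

Definition entropy_derive_op (v : elt M -> 'rV[R]_d -> R) :
    elt M -> 'rV[R]_d -> R :=
  fun T x => derive1 (fine \o rho x) (v T x).

Definition bregman (u v : elt M -> 'rV[R]_d -> R) : R :=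
  ipq (entropy_op u - entropy_op v) (fun _ _ => 1)
  - ipq (entropy_derive_op v) (u - v).

Definition upsilon_op (ups : 'rV[R]_d -> R -> R)
    (v : elt M -> 'rV[R]_d -> R) : elt M -> 'rV[R]_d -> R :=
  fun T x => ups x (v T x).

End quadrature.

Section method.
Variables (R : realType) (d : nat) (K : ref_shape) (Om : set 'rV[R]_d).
Variables (A : 'rV[R]_d -> 'M[R]_d) (f G : 'rV[R]_d -> R) (p : nat).
Variables (n : nat) (xq : 'I_n -> 'rV[R]_d) (wq : 'I_n -> R).
Variable M : mesh R d K.

(* q 0 plays no role; the last equation for k = 0 defines u 0 from psi 0 *)
Definition proximal_iterates (ups : 'rV[R]_d -> R -> R) (alpha : nat -> R)
    (q : nat -> elt M -> 'rV[R]_d -> 'rV[R]_d)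
    (u psi : nat -> elt M -> 'rV[R]_d -> R) : Prop :=
  [/\ forall k, Vh p (u k) /\ Vh p (psi k),
      forall k, (0 < k)%N -> Sigmah Om p (q k),
      forall k, (0 < k)%N -> forall v : elt M -> 'rV[R]_d -> R, Vh p v ->
        alpha k * ip Om (weak_div Om (assemble (q k))) (assemble v)
          + ip Om (assemble (psi k)) (assemble v)
        = alpha k * ip Om f (assemble v) + ip Om (assemble (psi k.-1)) (assemble v),
      forall k, (0 < k)%N ->
        forall r : elt M -> 'rV[R]_d -> 'rV[R]_d, Sigmah Om p r ->
        ipv Om (applyAinv A (assemble (q k))) (assemble r)
          - ip Om (weak_div Om (assemble r)) (assemble (u k))
        = - boundary_pairing Om G (assemble r) &
      forall k (v : elt M -> 'rV[R]_d -> R), Vh p v ->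
        ip Om (assemble (u k)) (assemble v) - ipq xq wq (upsilon_op ups (psi k)) v = 0].

Definition variational_inequality (lo : 'rV[R]_d -> R)
    (hi : 'rV[R]_d -> \bar R) (q : elt M -> 'rV[R]_d -> 'rV[R]_d)
    (u : elt M -> 'rV[R]_d -> R) : Prop :=
  [/\ Sigmah Om p q, Lambdah xq p lo hi u,
      forall r : elt M -> 'rV[R]_d -> 'rV[R]_d, Sigmah Om p r ->
        ipv Om (applyAinv A (assemble q)) (assemble r)
          - ip Om (assemble u) (weak_div Om (assemble r))
        = - boundary_pairing Om G (assemble r) &
      forall v : elt M -> 'rV[R]_d -> R, Lambdah xq p lo hi v ->
        0 <= ip Om (weak_div Om (assemble q) - f) (assemble (v - u))].

End method.

(* Main.v *)
(* The discrete problem is a saddle point problem on finite-dimensional spaces.  Its only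
   h-dependent ingredient is an inf-sup estimate in a broken H^1 norm: for v in V_h one
   takes on each element a Raviart-Thomas field whose normal components are scaled jumps of
   v, minus a multiple of a bubble field W grad v with no normal components, where W is a
   degenerate weight on the reference cell; by norm equivalence on polynomials this field
   tests v coercively and its norm is bounded by the broken norm, with constants that depend
   only on the shape regularity.  Hence the DG norm of the error in u is bounded by the
   A^-1-norm of the error in q.  For the rate, let E_k be the squared error in q and V_k >= 0
   the residual of the variational inequality at u^k.  The three-point identity for the
   Bregman distance gives alpha_k (E_k + V_k) <= D(u*, u^(k-1)) - D(u*, u^k), and since
   Upsilon is increasing the energy gap E_k / 2 + V_k is nonincreasing in k; summing, E_l is
   at most 2 D(u*, u^0) / sum alpha_k. *)
Require Import Defs.
From HB Require Import structures.
From mathcomp Require Import all_boot all_order all_algebra.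
From mathcomp Require Import all_classical all_reals all_analysis.
From mathcomp Require Import perm measurable_realfun ring lra.
Set Implicit Arguments.
Unset Strict Implicit.
Unset Printing Implicit Defensive.
Import Order.TTheory GRing.Theory Num.Theory.
Import numFieldNormedType.Exports.
Local Open Scope classical_set_scope.
Local Open Scope ring_scope.

(** Two obstacles shape the proof. First, a field assembled from elementwise polynomials lies in
    H(div) when its fluxes match on shared facets. Conformity only says that two cells meet in a
    face of both, so it has to be derived that at most two sides carry a facet, that their conormals
    are opposite, and that a facet with a single side lies outside the open domain. Parametrizations
    of a facet from its two sides differ by an automorphism of the reference facet; for cubes this
    map must be shown to send each variable to a single variable, since degree in each variable is
    not affinely invariant. Second, the nonlinear equation is only given weakly. Exactness of the
    rule and the quadrature condition make the quadrature points a nodal set for V_h with a diagonal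
    L^2 product, so u^k = Upsilon(psi^k) holds at each node and every Bregman inequality is a sum of
    scalar ones. Constants that depend on the mesh enter only the convergence claim; the rate uses
    constants of the reference cell, the degree, the shape regularity and the spectral bounds of
    A. *)

Definition image_measure d1 d2 (X : measurableType d1) (Y : measurableType d2)
    (R : realType) (m : {measure set X -> \bar R}) (f : X -> Y)
    (mf : measurable_fun setT f) : {measure set Y -> \bar R} :=
  measure_function_pushforward__canonical__measure_function_Measure m mf.

(** * Affine changes of variable for Lebesgue measure *)

Section lebesgue_line.
Variable R : realType.
Local Notation mu := (@lebesgue_measure R).

Definition affine_line (a b : R) (x : measurableTypeR R) : measurableTypeR R :=
  a * x + b.

Lemma measurable_affine_line (a b : R) : measurable_fun setT (affine_line a b).
Proof.
apply: (@measurable_funD _ _ R setT (fun x => a * x) (cst b)) => //.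
exact: (@measurable_funM _ _ R setT (cst a) id).
Qed.

(** Lebesgue measure is determined by half-open intervals, and there the scaled pushforward is an
    explicit length. A negative slope turns []c, e]] into an interval closed on the left, of the
    same length; hence the two cases. *)
Lemma lebesgue_measure_affine (a b : R) (A : set (measurableTypeR R)) :
  a != 0 -> measurable A ->
  (mu A = `|a|%:E * pushforward mu
    (affine_line a b) A)%E.
Proof.
move=> a0 mA.
have mphi := measurable_affine_line a b.
pose m1 := image_measure mu mphi.
have -> : (`|a|%:E * pushforward mu
    (affine_line a b) A)%E =
  mscale (`|a|%:nng) m1 A by [].
apply: lebesgue_measure_unique => //= _ [[c e]] _ <-.
rewrite /mscale/= /pushforward.
have [ap|an] : a > 0 \/ a < 0 by move: a0; rewrite neq_lt => /orP[]; [right|left].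
- rewrite (_ : affine_line a b @^-1` _ = `](c - b) / a, (e - b) / a]%classic).
    rewrite !lebesgue_measure_itv/= !lte_fin ltr_pdivrMr// divfK// ltrD2r gtr0_norm//.
    case: ifPn => _; last by rewrite mule0.
    by rewrite -!EFinD -EFinM; congr EFin; field.
  apply/seteqP; split => x; rewrite /affine_line/= !in_itv/= ltr_pdivrMr// ler_pdivlMr//;
    by rewrite ltrBlDr lerBrDr (mulrC x).
- rewrite (_ : affine_line a b @^-1` _ = `[(e - b) / a, (c - b) / a[%classic).
    rewrite !lebesgue_measure_itv/= !lte_fin ltr_ndivrMr// divfK// ltrD2r ltr0_norm//.
    case: ifPn => _; last by rewrite mule0.
    by rewrite -!EFinD -EFinM; congr EFin; field.
  apply/seteqP; split => x; rewrite /affine_line/= !in_itv/= ltr_ndivlMr// ler_ndivrMr//;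
    by rewrite ltrBlDr lerBrDr (mulrC x) andbC.
Qed.

Lemma ge0_integral_affine_line (a b : R) (f : measurableTypeR R -> \bar R) :
  a != 0 -> measurable_fun setT f -> (forall x, 0 <= f x)%E ->
  (\int[mu]_x f x = `|a|%:E * \int[mu]_x f (affine_line a b x))%E.
Proof.
move=> a0 mf f0.
have mphi := measurable_affine_line a b.
pose m1 := image_measure mu mphi.
pose k := NngNum (normr_ge0 a).
transitivity (\int[mscale k m1]_x f x)%E.
  apply: eq_measure_integral => A mA _.
  exact: (lebesgue_measure_affine b a0).
rewrite ge0_integral_mscale//=; congr (_ * _)%E.
rewrite (_ : \int[_]_x f x =
  \int[pushforward mu (affine_line a b)]_x f x)%E//.
by rewrite ge0_integral_pushforward.
Qed.

End lebesgue_line.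

Section lebesgue_space.
Variable R : realType.
Local Notation mu := (@lebesgue_measure R).
Local Notation lam n := (lebesgue_rV R n).

(** Measurable boxes are stable under intersection, generate the sigma-algebra and contain an
    exhausting sequence of finite measure, so the uniqueness theorem for measures applies.
    Insertions and permutations of coordinates are later checked on boxes only. *)
Lemma lebesgue_rV_unique n (m : {measure set 'rV[R]_n -> \bar R}) :
  (forall A : 'I_n -> set R, (forall i, measurable (A i)) ->
    m [set x | forall i, A i (x 0 i)] =
    (\prod_(i < n) mu (A i : set (measurableTypeR R)))%E) ->
  forall X, measurable X -> lam n X = m X.
Proof.
move=> mE X mX.
pose G : set (set 'rV[R]_n) := [set B | exists A : 'I_n -> set R,
  (forall i, measurable (A i)) /\ B = [set x : 'rV[R]_n | forall i, A i (x 0 i)]].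
have /sigma_finiteP[F [TF ndF Foo]] := sigma_finiteT mu.
apply: (measure_unique G (fun k => [set x : 'rV[R]_n | forall i, F k (x 0 i)])) => //.
- apply/seteqP; split.
    apply: sub_sigma_algebra2 => B.
    rewrite {}/G; case: n {m mE X mX} B => [|n] B; first by rewrite big_ord0.
    rewrite -bigcup_mkord_ord => -[i _ [C mC <-]].
    exists (fun j => if j == inord i then C else setT); split.
      by move=> j; case: ifPn.
    apply/seteqP; split => x /=.
      by move=> [_ Cx] j; case: ifPn => // /eqP ->.
    by move=> /(_ (inord i)); rewrite eqxx.
  apply: smallest_sub; first exact: sigma_algebra_measurable.
  by move=> B [A [mA ->]]; exact: (lebesgue_rV_box mA).1.
- move=> _ _ [A [mA ->]] [B [mB ->]]; exists (fun i => A i `&` B i); split.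
    by move=> i; exact: measurableI.
  by apply/seteqP; split => x /= => [[h1 h2] i|h]; split => // i; have [] := h i.
- by move=> k; exists (fun=> F k); split => // i; have [] := Foo k.
- apply/seteqP; split => // x _ /=.
  have h i : exists k, F k (x 0 i).
    have : [set: R] (x 0 i) by []. by rewrite TF => -[k _ ?]; exists k.
  have [k hk] := choice h; exists (\max_(i < n) k i) => //= i.
  by move: (hk i); exact/subsetPset/ndF/leq_bigmax.
- by move=> _ [A [mA ->]]; rewrite mE//; exact: (lebesgue_rV_box mA).2.
- move=> k; have mFk (i : 'I_n) : measurable (F k : set R) by have [] := Foo k.
  have /= -> := (lebesgue_rV_box mFk).2.
  suff /andP[] : (0 <= \prod_(i < n) mu (F k))%E && (\prod_(i < n) mu (F k) < +oo)%E by [].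
  elim/big_ind: _ => [|x y /andP[x0 xoo] /andP[y0 yoo]|i _].
  - by rewrite lee01 ltry.
  - by rewrite mule_ge0// lte_mul_pinfty// ge0_fin_numE.
  - by rewrite measure_ge0; have [] := Foo k.
Qed.


Section insert.
Variables (n : nat) (i : 'I_n.+1).

Definition insert_pair (z : measurableTypeR R * 'rV[R]_n) : 'rV[R]_n.+1 :=
  insert_coord i z.1 z.2.

Lemma measurable_insert_pair : measurable_fun setT insert_pair.
Proof.
apply: measurable_fun_rV => j; rewrite /insert_pair /insert_coord.
case: (unliftP i j) => [k|] ->.
  under eq_fun do rewrite mxE liftK.
  exact: (measurableT_comp (measurable_coord k) measurable_snd).
under eq_fun do rewrite mxE unlift_none.
move=> mD Y mY.
exact: (@measurable_fst _ _ (measurableTypeR R) 'rV[R]_n mD Y mY).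
Qed.

(** The measure is built by peeling off coordinate 0. That any other coordinate can be peeled off
    first is what slicing a cell along an arbitrary axis requires. *)
Lemma lebesgue_rV_insert (X : set 'rV[R]_n.+1) : measurable X ->
  lam n.+1 X = pushforward (mu \x lam n)%E insert_pair X.
Proof.
move=> mX.
apply: (@lebesgue_rV_unique n.+1 (image_measure (mu \x lam n)%E measurable_insert_pair)) => // A mA.
rewrite /image_measure/= /pushforward.
have mB : measurable [set x : 'rV[R]_n | forall k, A (lift i k) (x 0 k)].
  by have [] := @lebesgue_rV_box R n (fun k => A (lift i k)) (fun k => mA _).
have -> : insert_pair @^-1` [set x | forall j, A j (x 0 j)] =
    (A i : set (measurableTypeR R)) `*`
    [set x : 'rV[R]_n | forall k, A (lift i k) (x 0 k)].
  apply/seteqP; split => -[a t] /=; rewrite /insert_pair/= => h.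
    split; first by have := h i; rewrite mxE unlift_none.
    by move=> k; have := h (lift i k); rewrite mxE liftK.
  by move=> j; rewrite mxE; case: (unliftP i j) => [k|] ->; [exact: h.2|exact: h.1].
rewrite product_measure1E//=.
have /= -> := (@lebesgue_rV_box R n (fun k => A (lift i k)) (fun k => mA _)).2.
by rewrite [RHS](bigD1_ord i).
exact: mA.
Qed.

End insert.

End lebesgue_space.

Section change_of_variables.
Variable R : realType.
Local Notation mu := (@lebesgue_measure R).
Local Notation lam n := (lebesgue_rV R n).

Section fubini_coordinate.
Variables (n : nat) (i : 'I_n.+1) (f : 'rV[R]_n.+1 -> \bar R).
Hypotheses (mf : measurable_fun setT f) (f0 : forall x, (0 <= f x)%E).

Lemma measurable_fun_insert : measurable_fun setT (f \o insert_pair i).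
Proof. exact: measurableT_comp mf (measurable_insert_pair i). Qed.

Lemma integral_insert_pair :
  (\int[lam n.+1]_x f x = \int[(mu \x lam n)%E]_z f (insert_pair i z))%E.
Proof.
transitivity (\int[image_measure (mu \x lam n)%E (@measurable_insert_pair R n i)]_x f x)%E.
  by apply: eq_measure_integral => X mX _; exact: lebesgue_rV_insert.
transitivity (\int[pushforward (mu \x lam n)%E (insert_pair i)]_x f x)%E => //.
by rewrite ge0_integral_pushforward//; exact: measurable_insert_pair.
Qed.

Lemma ge0_integral_insert1 :
  (\int[lam n.+1]_x f x = \int[mu]_a \int[lam n]_t f (insert_coord i a t))%E.
Proof.
rewrite integral_insert_pair.
exact: (fubini_tonelli1 (f \o insert_pair i) measurable_fun_insert (fun z => f0 _)).
Qed.

Lemma ge0_integral_insert2 :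
  (\int[lam n.+1]_x f x = \int[lam n]_t \int[mu]_a f (insert_coord i a t))%E.
Proof.
rewrite integral_insert_pair.
exact: (fubini_tonelli2 (f \o insert_pair i) measurable_fun_insert (fun z => f0 _)).
Qed.

Lemma measurable_insertl t :
  measurable_fun setT (fun a : measurableTypeR R => f (insert_coord i a t)).
Proof.
exact: (measurableT_comp measurable_fun_insert (measurable_pair2 t)).
Qed.

Lemma measurable_insertr (a : R) : measurable_fun setT (fun t => f (insert_coord i a t)).
Proof.
exact: (measurableT_comp measurable_fun_insert (measurable_pair1 (a : measurableTypeR R))).
Qed.

Lemma measurable_integral_insertr :
  measurable_fun setT (fun a : measurableTypeR R => \int[lam n]_t f (insert_coord i a t))%E.
Proof.
exact: (measurable_fun_fubini_tonelli_F (m2 := lam n) (f \o insert_pair i) measurable_fun_insert (fun z => f0 _)).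
Qed.

End fubini_coordinate.

(** Here [k] is the absolute Jacobian of [T]. Testing with all nonnegative measurable functions
    makes the property stable under composition without integrability side conditions. *)
Definition rescales n (T : 'rV[R]_n -> 'rV[R]_n) (k : R) :=
  forall f : 'rV[R]_n -> \bar R, measurable_fun setT f -> (forall x, 0 <= f x)%E ->
  (\int[lam n]_x f x = k%:E * \int[lam n]_x f (T x))%E.

Lemma rescales_comp n (T U : 'rV[R]_n -> 'rV[R]_n) (k l : R) :
  measurable_fun setT U -> rescales T k -> rescales U l -> rescales (U \o T) (l * k).
Proof.
move=> mU hT hU f mf f0.
rewrite (hU f mf f0) (hT (f \o U) (measurableT_comp mf mU) (fun x => f0 _)).
by rewrite muleA EFinM.
Qed.

Lemma measurable_affine_map m n (A : 'M[R]_(m, n)) (b : 'rV[R]_n) :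
  measurable_fun setT (fun x : 'rV[R]_m => x *m A + b).
Proof.
apply: measurable_fun_rV => j; under eq_fun do rewrite !mxE.
apply: measurable_realfun.measurable_funD => //; apply: measurable_sum => k.
by apply: measurable_realfun.measurable_funM => //; exact: measurable_coord.
Qed.

Lemma rescales_perm n (s : 'S_n) : rescales (fun x => x *m perm_mx s) 1.
Proof.
have mT : measurable_fun setT (fun x : 'rV[R]_n => x *m perm_mx s).
  have := measurable_affine_map (perm_mx s : 'M[R]_n) 0.
  by under eq_fun do rewrite addr0.
move=> f mf f0; rewrite mul1e.
transitivity (\int[image_measure (lam n) mT]_x f x)%E; last first.
  by rewrite [LHS](ge0_integral_pushforward mT).
apply: eq_measure_integral => X mX _; apply: lebesgue_rV_unique => // A mA.
rewrite /image_measure/= /pushforward.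
have -> : (fun x : 'rV[R]_n => x *m perm_mx s) @^-1` [set x | forall i, A i (x 0 i)] =
    [set x : 'rV[R]_n | forall i, A (s i) (x 0 i)].
  have E (x : 'rV[R]_n) i : (x *m perm_mx s) 0 (s i) = x 0 i.
    rewrite mxE (bigD1 i)//= !mxE eqxx mulr1 big1 ?addr0// => j ji.
    by rewrite !mxE (inj_eq perm_inj) (negbTE ji) mulr0.
  apply/seteqP; split => x /= h i; first by rewrite -E.
  by rewrite -(permKV s i) E.
have /= -> := (@lebesgue_rV_box R n (fun i => A (s i)) (fun i => mA _)).2.
by rewrite [RHS](reindex_inj (@perm_inj _ s)).
Qed.

Definition tail n (x : 'rV[R]_n.+1) : 'rV[R]_n := \row_k x 0 (lift ord0 k).

Lemma insert0K n (a : R) (t : 'rV[R]_n) : tail (@insert_coord R n.+1 ord0 a t) = t.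
Proof. by apply/rowP => k; rewrite !mxE liftK. Qed.

Lemma insert0E n (a : R) (t : 'rV[R]_n) : (@insert_coord R n.+1 ord0 a t) 0 0 = a.
Proof. by rewrite mxE unlift_none. Qed.

(** With the tail held fixed by Tonelli, the map is a translation in coordinate 0. *)
Lemma rescales_shear n (c : 'cV[R]_n) :
  rescales (fun x : 'rV[R]_n.+1 =>
    @insert_coord R n.+1 ord0 (x 0 0 + (tail x *m c) 0 0) (tail x)) 1.
Proof.
move=> f mf f0; rewrite mul1e [LHS](ge0_integral_insert2 ord0)// [RHS](ge0_integral_insert2 ord0)//.
- apply: eq_integral => t _.
  rewrite [LHS](ge0_integral_affine_line ((t *m c) 0 0) (oner_neq0 R))//; last exact: measurable_insertl.
  rewrite normr1 mul1e; apply: eq_integral => a _.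
  by rewrite insert0K insert0E /affine_line mul1r.
- apply: (measurableT_comp mf); apply: measurable_fun_rV => j.
  case: (unliftP ord0 j) => [k|] ->.
    under eq_fun do rewrite mxE liftK mxE.
    exact: measurable_coord.
  under eq_fun do rewrite mxE unlift_none mxE.
  apply: measurable_realfun.measurable_funD; first exact: measurable_coord.
  apply: measurable_sum => k; apply: measurable_realfun.measurable_funM => //.
  under eq_fun do rewrite mxE.
  exact: measurable_coord.
Qed.

Lemma rescales_block n (a b : R) (u v : 'rV[R]_n) (S : 'M[R]_n) (k : R) :
  a != 0 -> 0 <= k -> (forall w : 'rV[R]_n, rescales (fun t => t *m S + w) k) ->
  rescales (fun x : 'rV[R]_n.+1 =>
    @insert_coord R n.+1 ord0 (a * x 0 0 + b) (tail x *m S + (x 0 0 *: u + v))) (`|a| * k).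
Proof.
move=> a0 k0 IH f mf f0.
have mg : measurable_fun setT (fun x : 'rV[R]_n.+1 =>
    f (@insert_coord R n.+1 ord0 (a * x 0 0 + b) (tail x *m S + (x 0 0 *: u + v)))).
  apply: (measurableT_comp mf); apply: measurable_fun_rV => j.
  case: (unliftP ord0 j) => [l|] ->.
    under eq_fun do rewrite mxE liftK !mxE.
    apply: measurable_realfun.measurable_funD.
      apply: measurable_sum => m; apply: measurable_realfun.measurable_funM => //.
      under eq_fun do rewrite mxE.
      exact: measurable_coord.
    apply: measurable_realfun.measurable_funD => //.
    by apply: measurable_realfun.measurable_funM => //; exact: measurable_coord.
  under eq_fun do rewrite mxE unlift_none.
  apply: measurable_realfun.measurable_funD => //.
  by apply: measurable_realfun.measurable_funM => //; exact: measurable_coord.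
rewrite [LHS](ge0_integral_insert1 ord0)// [in RHS](ge0_integral_insert1 ord0)//.
rewrite (ge0_integral_affine_line b a0); last 2 first.
- exact: measurable_integral_insertr.
- by move=> x; apply: integral_ge0.
rewrite EFinM -muleA; congr (_ * _)%E.
rewrite -ge0_integralZl//=; last 2 first.
- exact: (measurable_integral_insertr ord0 mg (fun x => f0 _)).
- by move=> x _; apply: integral_ge0.
apply: eq_integral => x _.
rewrite (IH (x *: u + v)); last 2 first.
- exact: measurable_insertr.
- by [].
by congr (_ * _)%E; apply: eq_integral => t _; rewrite insert0K insert0E.
Qed.

(** Block Gaussian elimination, by induction on the dimension. If the corner entry is nonzero, [B]
    is a unipotent lower factor, which acts as a shear, times a block upper triangular factor whose
    lower block is the Schur complement [S]; the induction hypothesis handles [S] in the inner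
    integral. Otherwise a transposition brings a nonzero entry of the first column to the corner. *)
Lemma rescales_affine n (A : 'M[R]_n) (b : 'rV[R]_n) :
  A \in unitmx -> rescales (fun x => x *m A + b) `|\det A|.
Proof.
elim: n A b => [A b _|n IH A b uA].
  move=> f mf f0; rewrite det_mx00 normr1 mul1e; apply: eq_integral => x _.
  by congr f; apply/rowP => -[].
have H (B : 'M[R]_n.+1) : B \in unitmx -> B 0 0 != 0 ->
    rescales (fun x => x *m B + b) `|\det B|.
  move=> uB B0.
  pose c := (B 0 0)^-1 *: dlsubmx (B : 'M[R]_(1 + n)).
  pose S : 'M[R]_n := drsubmx (B : 'M[R]_(1 + n)) - c *m ursubmx (B : 'M[R]_(1 + n)).
  have BE : B = (block_mx 1%:M 0 c 1%:M : 'M[R]_(1 + n)) *m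
      (block_mx (ulsubmx (B : 'M[R]_(1 + n))) (ursubmx (B : 'M[R]_(1 + n))) 0 S : 'M[R]_(1 + n)).
    rewrite -[LHS](@submxK R 1 n 1 n) mulmx_block !mul1mx !mul0mx !addr0.
    have -> : ulsubmx (B : 'M[R]_(1 + n)) = (B 0 0)%:M.
      apply/matrixP => i j; rewrite !ord1 !mxE eqxx mulr1n; congr (B _ _); exact/val_inj.
    rewrite mul_mx_scalar /c scalerA divff// scale1r -/c.
    by rewrite /S addrCA subrr addr0.
  have detB : \det B = B 0 0 * \det S.
    rewrite {1}BE det_mulmx.
    have -> : forall c' : 'M[R]_(n, 1), \det (block_mx 1%:M 0 c' 1%:M : 'M[R]_(1 + n)) = 1.
      by move=> c'; rewrite det_lblock !det1 mul1r.
    have -> : forall x (b' : 'M[R]_(1, n)),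
        \det (block_mx x b' 0 S : 'M[R]_(1 + n)) = x 0 0 * \det S.
      by move=> x b'; rewrite det_ublock det_mx11.
    rewrite mul1r !mxE; congr (B _ _ * _); exact/val_inj.
  have uS : S \in unitmx.
    move: uB; rewrite !unitmxE detB !unitfE => /negP h; apply/negP => /eqP S0.
    by apply: h; rewrite S0 mulr0.
  have rE (l : 'I_n) : rshift 1 l = lift ord0 l by exact/val_inj.
  have lE : lshift n (0 : 'I_1) = 0 by exact/val_inj.
  have cE l : c l 0 = (B 0 0)^-1 * B (lift ord0 l) 0 by rewrite !mxE lE rE.
  have SE l k : S l k = B (lift ord0 l) (lift ord0 k) - c l 0 * B 0 (lift ord0 k).
    by rewrite mxE [X in _ + X]mxE [(c *m _) l k]mxE big_ord1 !mxE lE !rE.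
  pose T1 (x : 'rV[R]_n.+1) := @insert_coord R n.+1 ord0 (x 0 0 + (tail x *m c) 0 0) (tail x).
  pose u := \row_j B 0 (lift ord0 j).
  pose T2 (x : 'rV[R]_n.+1) := @insert_coord R n.+1 ord0 (B 0 0 * x 0 0 + b 0 0)
    (tail x *m S + (x 0 0 *: u + tail b)).
  have TE (x : 'rV[R]_n.+1) : x *m B + b = T2 (T1 x).
    apply/rowP => j; rewrite /T2 /T1 insert0E insert0K.
    case: (unliftP ord0 j) => [k|] ->.
      rewrite [RHS]mxE liftK !mxE big_ord_recl !addrA; congr (_ + _).
      rewrite mulrDl addrCA; congr (_ + _).
      rewrite mulr_suml -big_split; apply: eq_bigr => l _ /=.
      by rewrite SE [tail x 0 l]mxE; ring.
    rewrite [RHS]mxE unlift_none !mxE big_ord_recl; congr (_ + _).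
    rewrite mulrDr mulrC; congr (_ + _); rewrite mulr_sumr; apply: eq_bigr => l _.
    by rewrite cE [tail x 0 l]mxE; field.
  rewrite (_ : (fun x => _) = T2 \o T1); last by apply/funext => x; exact: TE.
  rewrite detB normrM -[_ * `|_|]mulr1; apply: rescales_comp.
  - apply: measurable_fun_rV => j; case: (unliftP ord0 j) => [l|] ->.
      under eq_fun do rewrite mxE liftK !mxE.
      apply: measurable_realfun.measurable_funD.
        apply: measurable_sum => m; apply: measurable_realfun.measurable_funM => //.
        under eq_fun do rewrite mxE.
        exact: measurable_coord.
      apply: measurable_realfun.measurable_funD => //.
      by apply: measurable_realfun.measurable_funM => //; exact: measurable_coord.
    under eq_fun do rewrite mxE unlift_none.
    apply: measurable_realfun.measurable_funD => //.
    by apply: measurable_realfun.measurable_funM => //; exact: measurable_coord.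
  - exact: rescales_shear.
  - by apply: rescales_block => // w; apply: IH.
have [i Ai] : exists i, A i 0 != 0.
  apply: contrapT => /forallNP h; move: uA; rewrite unitmxE.
  rewrite (expand_det_col _ 0) big1 ?unitr0// => i _.
  by have /negP/negbNE/eqP -> := h i; rewrite mul0r.
pose s := tperm 0 i.
have AE : A = perm_mx s *m (perm_mx s *m A).
  by rewrite mulmxA -perm_mxM tperm2 perm_mx1 mul1mx.
have detE : `|\det A| = `|\det (perm_mx s *m A)|.
  by rewrite det_mulmx det_perm normrM normrX normrN1 expr1n mul1r.
rewrite detE -[X in rescales _ X]mulr1.
rewrite (_ : (fun x => _) = (fun x => x *m (perm_mx s *m A) + b) \o (fun x => x *m perm_mx s)).
  apply: rescales_comp; first exact: measurable_affine_map.
    exact: rescales_perm.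
  apply: H; first by rewrite unitmx_mul unitmx_perm.
  by rewrite -row_permE mxE tpermL.
by apply/funext => x /=; rewrite [in LHS]AE mulmxA.
Qed.

End change_of_variables.

(** * Continuous functions, boxes and null sets *)

Section continuous_rV.
Variable R : realType.
Local Notation mu := (@lebesgue_measure R).
Local Notation lam n := (lebesgue_rV R n).

Lemma continuous_to_rV (T : topologicalType) n (f : T -> 'rV[R]_n) :
  (forall j, continuous (fun t => f t 0 j)) -> continuous f.
Proof.
move=> cf t U [P hP PU]; apply: (@filterS _ _ _ [set s | forall j, P 0 j (f s 0 j)]).
  by move=> s h; apply: PU => i j; rewrite ord1.
by apply: filter_forall => j; apply: cf; exact: hP.
Qed.

Lemma continuous_linear_form m n (A : 'M[R]_(m, n)) j :
  continuous (fun x : 'rV[R]_m => (x *m A) 0 j).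
Proof.
rewrite (_ : (fun x => _) = (fun x : 'rV[R]_m => \sum_k x 0 k * A k j)); last first.
  by apply/funext => y; rewrite mxE.
apply: continuous_big => [|k _ x]; first exact: add_continuous.
by apply: (@continuousM _ _ (fun x : 'rV[R]_m => x 0 k) (cst _));
  [exact: coord_continuous|exact: cst_continuous].
Qed.

Lemma continuous_affine_map m n (A : 'M[R]_(m, n)) (b : 'rV[R]_n) :
  continuous (fun x : 'rV[R]_m => x *m A + b).
Proof.
apply: continuous_to_rV => j.
rewrite (_ : (fun x => _) = (fun x : 'rV[R]_m => (x *m A) 0 j + b 0 j)); last first.
  by apply/funext => x; rewrite mxE.
move=> x; apply: (@continuousD _ _ _ (fun x : 'rV[R]_m => (x *m A) 0 j) (cst _));
  [exact: continuous_linear_form|exact: cst_continuous].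
Qed.

Definition inbox n (M : R) : set 'rV[R]_n := [set x | forall i, `|x 0 i| <= M].

(** The sigma-algebra is generated by the coordinates, not by open sets. An open set is the
    countable union of the rational open boxes that it contains. *)
Lemma open_measurable_rV n (U : set 'rV[R]_n) : open U -> measurable U.
Proof.
move=> oU.
pose F (q : {ffun 'I_n -> rat * rat}) : set 'rV[R]_n :=
  [set x | forall i, `]ratr (q i).1, ratr (q i).2[%classic (x 0 i)].
have mF q : measurable (F q).
  by apply: (lebesgue_rV_box (A := fun i => `]ratr (q i).1, ratr (q i).2[%classic) _).1 => i.
pose G k : set 'rV[R]_n :=
  if unpickle k is Some q then if `[< F q `<=` U >] then F q else set0 else set0.
have -> : U = \bigcup_k G k.
  apply/seteqP; split => [x Ux|x [k _]]; last first.
    by rewrite /G; case: (unpickle k) => // q; case: asboolP => // + Fx; exact.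
  have : nbhs x U by exact: open_nbhs_nbhs.
  move=> /nbhs_ballP[e /= e0 eU].
  have h i : exists q : rat * rat,
      [/\ x 0 i - e < ratr q.1, ratr q.1 < x 0 i, x 0 i < ratr q.2 & ratr q.2 < x 0 i + e].
    have /rat_in_itvoo[q1] : x 0 i - e < x 0 i by rewrite ltrBlDr ltrDl.
    have /rat_in_itvoo[q2] : x 0 i < x 0 i + e by rewrite ltrDl.
    rewrite !in_itv/= => /andP[? ?] /andP[? ?].
    by exists (q1, q2).
  have [q hq] := choice h; pose q' : {ffun 'I_n -> rat * rat} := [ffun i => q i].
  exists (pickle q') => //; rewrite /G pickleK; case: asboolP => [_|].
    by move=> i; rewrite /= ffunE in_itv/=; have [_ -> -> _] := hq i.
  case=> y Fy; apply: eU; split => // i j; rewrite ord1.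
  have := Fy j; rewrite /= ffunE in_itv/= => /andP[y1 y2].
  have [h1 h2 h3 h4] := hq j.
  rewrite /ball/= distrC ltr_distl; apply/andP; split; first exact: lt_trans h1 y1.
  exact: lt_trans y2 h4.
by apply: bigcupT_measurable => k; rewrite /G; case: (unpickle k) => // q; case: ifP.
Qed.

Lemma closed_measurable_rV n (U : set 'rV[R]_n) : closed U -> measurable U.
Proof. by move=> /closed_openC/open_measurable_rV/measurableC; rewrite setCK. Qed.

Lemma continuous_measurable_rV n (f : 'rV[R]_n -> R) :
  continuous f -> measurable_fun setT f.
Proof.
move=> /continuousP cf; apply: (measurability _ (RGenOpens.measurableE R)).
move=> _ [_ [a [b ->] <-]]; rewrite setTI; apply: open_measurable_rV.
exact/cf/interval_open.
Qed.

Lemma compact_inbox n M : compact (@inbox n M).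
Proof.
have := @rV_compact R n (fun=> `[- M, M]%classic) (fun=> @segment_compact _ _ _).
by congr compact; apply/seteqP; split => x h i; have := h i; rewrite /= in_itv/= ler_norml.
Qed.

Lemma measurable_inbox n M : measurable (@inbox n M).
Proof.
rewrite (_ : inbox M = [set x | forall i, `[- M, M]%classic (x 0 i)]).
  by apply: (lebesgue_rV_box (A := fun=> `[- M, M]%classic) _).1 => i.
by apply/seteqP; split => x h i; have := h i; rewrite /= in_itv/= ler_norml.
Qed.

Lemma inbox_fin n M : (lam n (inbox M) < +oo)%E.
Proof.
rewrite (_ : inbox M = [set x | forall i, `[- M, M]%classic (x 0 i)]); last first.
  by apply/seteqP; split => x h i; have := h i; rewrite /= in_itv/= ler_norml.
have /= -> := (@lebesgue_rV_box R n (fun=> `[- M, M]%classic) (fun=> measurable_itv _)).2.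
suff /andP[] : (0 <= \prod_(i < n) mu `[(- M)%R, M] < +oo)%E by [].
elim/big_ind: _ => [|x y /andP[x0 xoo] /andP[y0 yoo]|i _].
- by rewrite lee01 ltry.
- by rewrite mule_ge0// lte_mul_pinfty// ge0_fin_numE.
- rewrite measure_ge0/= lebesgue_measure_itv/=; case: ifP => _; by rewrite ?ltry.
Qed.

Lemma sub_inbox_fin n M (D : set 'rV[R]_n) : measurable D -> D `<=` inbox M ->
  (lam n D < +oo)%E.
Proof.
move=> mD DM; apply: le_lt_trans (inbox_fin n M).
by apply: le_measure; rewrite ?inE//; exact: measurable_inbox.
Qed.

Lemma continuous_bounded_on n (f : 'rV[R]_n -> R) M : continuous f ->
  exists2 C, 0 <= C & forall x, inbox M x -> `|f x| <= C.
Proof.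
move=> cf; have : {within inbox M, continuous f} by exact: continuous_subspaceT.
move=> /continuous_compact/(_ (@compact_inbox n M))/compact_bounded[C [_ hC]].
exists (`|C| + 1); first by rewrite addr_ge0.
by move=> x Mx; apply: (hC (`|C| + 1)); [rewrite (le_lt_trans (ler_norm _))// ltrDl|exists x].
Qed.

Lemma continuous_integrable n (f : 'rV[R]_n -> R) M (D : set 'rV[R]_n) :
  continuous f -> measurable D -> D `<=` inbox M ->
  (lam n).-integrable D (EFin \o f).
Proof.
move=> cf mD DM; apply: measurable_bounded_integrable => //.
- exact: sub_inbox_fin DM.
- by apply: measurable_funTS; exact: continuous_measurable_rV.
- have [C C0 hC] := continuous_bounded_on M cf.
  exists C; split; rewrite ?num_real// => y Cy x /DM/hC.
  by move=> /le_trans; apply; exact: ltW.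
Qed.

Section affine.
Variables (n : nat) (A : 'M[R]_n) (b : 'rV[R]_n).
Hypothesis uA : A \in unitmx.
Let T (x : 'rV[R]_n) := x *m A + b.

Lemma det_norm_gt0 : 0 < `|\det A|.
Proof. by rewrite normr_gt0 -unitfE -unitmxE. Qed.

Lemma lebesgue_rV_affine (E : set 'rV[R]_n) : measurable E ->
  lam n E = (`|\det A|%:E * lam n (T @^-1` E))%E.
Proof.
move=> mE.
have := rescales_affine b uA (f := fun x => (\1_E x)%:E).
rewrite -[X in X = _](_ : lam n E = _); last by rewrite integral_indic ?setIT.
move=> -> //; last first.
  by apply/measurable_EFinP; exact: measurable_indic.
congr (_ * _)%E; rewrite (_ : (fun x => _) = (fun x => (\1_(T @^-1` E) x)%:E))//.
rewrite integral_indic ?setIT//.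
by rewrite -[X in measurable X]setTI; exact: measurable_affine_map.
Qed.

(** [rescales_affine] applies to the positive and negative parts of the function extended by zero;
    integrability makes both integrals finite, so their difference may be taken. *)
Lemma Rintegral_affine (E : set 'rV[R]_n) (f : 'rV[R]_n -> R) :
  measurable E -> measurable_fun setT f -> (lam n).-integrable E (EFin \o f) ->
  \int[lam n]_(x in E) f x = `|\det A| * \int[lam n]_(x in T @^-1` E) f (T x).
Proof.
move=> mE mf fi.
pose g := (EFin \o f) \_ E.
have mT : measurable_fun setT T := measurable_affine_map A b.
have mg : measurable_fun setT g.
  by apply/(measurable_restrictT _ mE); apply: measurable_funTS; exact/measurable_EFinP.
have hr := rescales_affine b uA.
have gT : g \o T = (EFin \o (f \o T)) \_ (T @^-1` E).
  by apply/funext => x; rewrite /g /= !patchE/=.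
rewrite /Rintegral [in LHS]integral_mkcond -/g.
rewrite [in RHS]integral_mkcond.
set h := (X in _ = _ * fine (integral _ _ X)).
have -> : h = g \o T by rewrite gT.
clear h.
have gi : (lam n).-integrable setT g by apply/integrable_restrict; rewrite ?setTI.
have gTi : (lam n).-integrable setT (g \o T).
  apply/integrableP; split; first exact: measurableT_comp.
  move/integrableP : gi => [_]; rewrite (hr (fun x => `|g x|)%E)//.
    move=> h; rewrite ltey; apply/eqP => oo; move: h; rewrite oo.
    by rewrite gt0_muley ?lte_fin ?det_norm_gt0.
  exact: measurableT_comp.
rewrite integralE (hr (g^\+)%E)//; last exact: measurable_funepos.
rewrite (hr (g^\-)%E)//; last exact: measurable_funeneg.
have gp : (\int[lam n]_x (g \o T)^\+ x \is a fin_num)%E.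
  by apply: integrable_fin_num => //; exact: integrable_funepos.
have gn : (\int[lam n]_x (g \o T)^\- x \is a fin_num)%E.
  by apply: integrable_fin_num => //; exact: integrable_funeneg.
rewrite [in RHS]integralE.
have -> : (\int[lam n]_x g^\+ (x *m A + b)%R)%E = (\int[lam n]_x (g \o T)^\+ x)%E.
  by rewrite funepos_comp.
have -> : (\int[lam n]_x g^\- (x *m A + b)%R)%E = (\int[lam n]_x (g \o T)^\- x)%E.
  by rewrite funeneg_comp.
rewrite -muleBr//; last exact: fin_num_adde_defr.
by rewrite fineM// fin_numB gp gn.
Qed.

End affine.

(** Sliced along a coordinate with nonzero coefficient, the hyperplane meets each line in one
    point. *)
Lemma null_hyperplane n (a : 'cV[R]_n) (c : R) : a != 0 ->
  lam n [set x : 'rV[R]_n | (x *m a) 0 0 = c] = 0%E.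
Proof.
case: n a => [a|n a a0]; first by rewrite (_ : a = 0) ?eqxx//; apply/colP => -[].
have [i ai] : exists i, a i 0 != 0.
  apply: contrapT => /forallNP h; move/eqP: a0; apply; apply/colP => i.
  by have /negP/negbNE/eqP -> := h i; rewrite mxE.
set H := [set _ | _].
have mH : measurable H.
  apply: closed_measurable_rV.
  by apply: (continuous_closedP _).1 (@closed_eq _ c); exact: continuous_linear_form.
rewrite -[H]setIT -integral_indic// (ge0_integral_insert2 i)//; last first.
  by apply/measurable_EFinP; exact: measurable_indic.
apply: integral0_eq => t _.
pose s := \sum_k t 0 k * a (lift i k) 0.
rewrite (_ : (fun x => _) = (fun x => (\1_[set (c - s) / a i 0] x)%:E)).
  by rewrite integral_indic// setIT; exact: lebesgue_measure_set1.
apply/funext => x; rewrite !indicE; congr ((nat_of_bool _)%:R%:E).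
have e : (insert_coord i x t *m a) 0 0 = x * a i 0 + s.
  rewrite mxE (bigD1_ord i)//= mxE unlift_none; congr (_ + _).
  by apply: eq_bigr => k _; rewrite mxE liftK.
have -> : (insert_coord i x t \in H) = (x * a i 0 + s == c).
  apply/idP/eqP => [|h]; first by rewrite inE /H /= e.
  by rewrite inE /H /= e.
apply/eqP/idP => [<-|]; rewrite inE /=; first by field.
by move=> ->; field.
Qed.

End continuous_rV.

Section coordinate_calculus.
Variable R : realType.
Local Notation mu := (@lebesgue_measure R).
Local Notation lam n := (lebesgue_rV R n).

Lemma continuous_insert n (i : 'I_n.+1) (t : 'rV[R]_n) :
  continuous (fun a : R => @insert_coord R n.+1 i a t).
Proof.
apply: continuous_to_rV => j a; case: (unliftP i j) => [k|] ->.
  rewrite (_ : (fun x => _) = cst (t 0 k)); first exact: cst_continuous.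
  by apply/funext => b; rewrite mxE liftK.
rewrite (_ : (fun x => _) = id); first exact: cvg_id.
by apply/funext => b; rewrite mxE unlift_none.
Qed.

(** Meant for the reference cell, which is the region between 0 and the graph of [l] over a cell of
    one dimension less. Continuity on a bounded set provides the integrability for the signed form
    of Fubini. *)
Lemma Rintegral_insert n (i : 'I_n.+1) (f : 'rV[R]_n.+1 -> R) (D : set 'rV[R]_n.+1)
    (E : set 'rV[R]_n) (l : 'rV[R]_n -> R) M :
  continuous f -> measurable D -> D `<=` inbox M ->
  (forall a t, D (insert_coord i a t) <-> E t /\ 0 <= a <= l t) ->
  \int[lam n.+1]_(x in D) f x =
  \int[lam n]_(t in E) \int[mu]_(a in `[0, l t]) f (insert_coord i a t).
Proof.
move=> cf mD DM hD.
pose g := (EFin \o f) \_ D.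
have fi : (lam n.+1).-integrable D (EFin \o f) by exact: continuous_integrable DM.
have gi : (lam n.+1).-integrable setT g by apply/integrable_restrict; rewrite ?setTI.
have mg : measurable_fun setT g by exact: measurable_int gi.
have gpi : (mu \x lam n)%E.-integrable setT (g \o insert_pair i).
  apply/integrableP; split; first exact: measurable_fun_insert.
  move/integrableP : gi => [_]; rewrite (integral_insert_pair i)//.
  exact: measurableT_comp.
rewrite /Rintegral; congr fine.
rewrite [LHS]integral_mkcond -/g [RHS]integral_mkcond.
transitivity (\int[image_measure (mu \x lam n)%E (@measurable_insert_pair R n i)]_x g x)%E.
  by apply: eq_measure_integral => X mX _; exact: lebesgue_rV_insert.
transitivity (\int[pushforward (mu \x lam n)%E (insert_pair i)]_x g x)%E => //.
rewrite (integral_pushforward (measurable_insert_pair i) mg)//=.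
rewrite -[LHS](integral21_prod_meas1 gpi).
apply: eq_integral => t _; rewrite /fubini_G patchE.
have [Et|Et] := pselect (E t); last first.
  rewrite memNset//; apply: integral0_eq => a _.
  by rewrite /g/= patchE memNset// => /hD[].
rewrite mem_set//=.
have ci : mu.-integrable `[0, l t] (EFin \o (fun a => f (insert_coord i a t))).
  apply: continuous_compact_integrable; first exact: segment_compact.
  apply: continuous_subspaceT => a.
  by apply: (@continuous_comp _ _ _ (fun a => insert_coord i a t) f);
    [exact: continuous_insert|exact: cf].
rewrite fineK; last by apply: integrable_fin_num.
rewrite [RHS]integral_mkcond; apply: eq_integral => a _.
rewrite /g/= !patchE; congr (if _ then _ else _).
apply/idP/idP; rewrite !inE /= in_itv/=; first by move=> /hD[].
by move=> h; apply/hD.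
Qed.

End coordinate_calculus.

(** * Calculus of C^1 functions of several variables *)

Section C1.
Variables (R : realType) (d : nat).
Implicit Types (f g : 'rV[R]_d -> R) (x v w : 'rV[R]_d).

Lemma Ck1P f : Ck 1 f <-> [/\ continuous f,
  forall x (i : 'I_d), derivable f x (delta_mx 0 i) & forall i, continuous (partial i f)].
Proof.
split => [[cf [df pf]]|[cf df pf]]; first by split => // i; have [] := pf i.
by split => //; split.
Qed.

Lemma C1_step f x (i : 'I_d) (s e c : R) :
  (forall y, derivable f y (delta_mx 0 i)) -> continuous f ->
  (forall r, `|r| <= `|s| -> `|partial i f (x + r *: delta_mx 0 i) - c| <= e) ->
  `|f (x + s *: delta_mx 0 i) - f x - s * c| <= e * `|s|.
Proof.
move=> df cf he.
pose h (r : R) := f (x + r *: delta_mx 0 i) - r * c.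
have dh (r : R) : is_derive r (1 : R) h (partial i f (x + r *: delta_mx 0 i) - c).
  have d1 : is_derive r (1 : R) (fun r : R => f (x + r *: delta_mx 0 i)) (partial i f (x + r *: delta_mx 0 i)).
    have E : (fun k : R => k^-1 *: (((fun r : R => f (x + r *: delta_mx 0 i)) \o shift r) (k *: 1) -
        f (x + r *: delta_mx 0 i))) =
      (fun k => k^-1 *: ((f \o shift (x + r *: delta_mx 0 i)) (k *: delta_mx 0 i) -
        f (x + r *: delta_mx 0 i))).
      apply/funext => k /=; congr (_ *: (f _ - _)).
      by rewrite scaler1 scalerDl addrCA.
    split; first by rewrite /derivable E; exact: df.
    by rewrite /derive E.
  have d2 : is_derive r (1 : R) (fun r : R => r * c) c.
    by apply: is_derive_eq; rewrite /GRing.scale/=; ring.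
  exact: is_deriveB.
have ch : continuous h by move=> r; apply: differentiable_continuous; apply/derivable1_diffP; have [] := dh r.
have key : `|h s - h 0| <= e * `|s|.
  have [s0|s0|->] := ltgtP s 0; last by rewrite subrr !normr0 mulr0.
  - have [r + hr] := MVT s0 (fun r _ => dh r) (continuous_subspaceT ch).
    rewrite in_itv/= => /andP[r1 r2].
    rewrite distrC hr sub0r normrM normrN; apply: ler_wpM2r => //.
    by apply: he; rewrite !ltr0_norm// lerN2 ltW.
  - have [r + hr] := MVT s0 (fun r _ => dh r) (continuous_subspaceT ch).
    rewrite in_itv/= => /andP[r1 r2].
    rewrite hr subr0 normrM; apply: ler_wpM2r => //.
    by apply: he; rewrite !gtr0_norm// ltW.
rewrite (_ : _ - _ = h s - h 0)//.
by rewrite /h scale0r addr0 mul0r subr0; ring.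
Qed.

(** The increment [h *: w] is split into moves along the axes. Each move is compared with its linear
    part by the mean value theorem, with one error bound for all, since near [x] every partial
    derivative is close to its value at [x]. *)
Lemma C1_is_derive f x w : Ck 1 f ->
  is_derive x w f (\sum_i w 0 i * partial i f x).
Proof.
move=> /Ck1P[cf df pf]; set L := \sum_i _.
suff H : (fun h : R => h^-1 *: ((f \o shift x) (h *: w) - f x)) @ 0^' --> L.
  by split; [apply/cvg_ex; exists L|exact: cvg_lim H].
apply/cvgrPdist_le => e e0.
pose C : R := \sum_i `|w 0 i| + 1; have C0 : 0 < C by rewrite ltr_wpDl// sumr_ge0.
have eC0 : 0 < e / C by rewrite divr_gt0.
have wC i : `|w 0 i| <= C.
  by rewrite /C (bigD1 i)//= -addrA lerDl addr_ge0// sumr_ge0.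
have [dl dl0 hdl] : exists2 dl : R, 0 < dl & forall y : 'rV[R]_d, (forall j : 'I_d, `|x 0 j - y 0 j| < dl) ->
    forall i : 'I_d, `|partial i f y - partial i f x| <= e / C.
  have : nbhs x [set y | forall i : 'I_d, `|partial i f y - partial i f x| <= e / C].
    apply: (@filter_forall _ 'I_d (fun i y => `|partial i f y - partial i f x| <= e / C) (nbhs x) _) => i.
    have /cvgrPdist_le h := pf i x; have := h _ eC0.
    by apply: filterS => y; rewrite distrC.
  move=> /nbhs_ballP[dl /= dl0 h]; exists dl => // y hy; apply: h; split => // i j.
  by rewrite ord1; exact: hy.
near=> h.
have h0 : h != 0 by near: h; exact: nbhs_dnbhs_neq.
have hC : `|h| * C < dl.
  rewrite -ltr_pdivlMr//; near: h; apply: dnbhs0_lt; exact: divr_gt0.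
(* [tr k] keeps the first [k] coordinates of [w], so consecutive truncations differ by a move along
   one axis. *)
pose tr k : 'rV[R]_d := \row_j (if (j < k)%N then w 0 j else 0).
have step k : (k <= d)%N ->
    `|f (x + h *: tr k) - f x - h * \sum_(i < d | (i < k)%N) w 0 i * partial i f x|
    <= e / C * `|h| * \sum_(i < d | (i < k)%N) `|w 0 i|.
  elim: k => [_|k IH kd].
    rewrite (_ : tr 0%N = 0) ?scaler0 ?addr0 ?subrr; last by apply/rowP => j; rewrite !mxE.
    by rewrite !big_pred0// !mulr0 subr0 normr0.
  have trE : tr k.+1 = tr k + w 0 (Ordinal kd) *: delta_mx 0 (Ordinal kd).
    apply/rowP => j; rewrite !mxE eqxx /= ltnS leq_eqVlt.
    have [jk|jk] := eqVneq j (Ordinal kd).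
      by rewrite jk/= eqxx ltnn /= mulr1 add0r.
    rewrite (_ : (nat_of_ord j == k) = false); last first.
      by apply/negbTE; apply: contra jk => /eqP jk; apply/eqP/val_inj.
    by rewrite mulr0 addr0.
  rewrite trE scalerDr addrA scalerA.
  have sumE (F : 'I_d -> R) : \sum_(i < d | (i < k.+1)%N) F i =
      \sum_(i < d | (i < k)%N) F i + F (Ordinal kd).
    rewrite (bigD1 (Ordinal kd))//= addrC; congr (_ + _); apply: eq_bigl => i.
    rewrite ltnS leq_eqVlt -(inj_eq val_inj) /=.
    by case: (ltngtP i k).
  rewrite !sumE.
  have st : `|f (x + h *: tr k + (h * w 0 (Ordinal kd)) *: delta_mx 0 (Ordinal kd)) -
      f (x + h *: tr k) - h * w 0 (Ordinal kd) * partial (Ordinal kd) f x|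
      <= e / C * `|h * w 0 (Ordinal kd)|.
    apply: C1_step => //.
    move=> r hr; apply: hdl => j; rewrite !mxE eqxx/=.
    rewrite (_ : forall a b c : R, a - (a + b + c) = - (b + c)); last by move=> *; ring.
    rewrite normrN; apply: le_lt_trans hC.
    have [jk|jk] := eqVneq j (Ordinal kd).
      by rewrite jk/= ltnn mulr0 add0r mulr1 (le_trans hr)// normrM ler_wpM2l.
    rewrite mulr0 addr0; case: ifP => _; first by rewrite normrM ler_wpM2l.
    by rewrite mulr0 normr0 mulr_ge0// ltW.
  have {}IH := IH (ltnW kd).
  have := le_trans (ler_normD _ _) (lerD IH st).
  rewrite [in X in _ <= _ + X -> _]normrM [X in _ <= _ + X -> _]mulrA -mulrDr.
  by congr (`|_| <= _); ring.
have := step d (leqnn d).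
have -> : tr d = w by apply/rowP => j; rewrite mxE ltn_ord.
under eq_bigl do rewrite ltn_ord.
under [X in _ <= _ * X]eq_bigl do rewrite ltn_ord.
rewrite -/L => H.
have -> : L - h^-1 *: ((f \o shift x) (h *: w) - f x) = - (h^-1 * (f (x + h *: w) - f x - h * L)).
  by rewrite /= [h *: w + x]addrC /GRing.scale/=; field.
rewrite normrN normrM normfV ler_pdivrMl ?normr_gt0//.
apply: (le_trans H); rewrite mulrAC [leRHS]mulrC ler_wpM2r//.
rewrite -mulrA ler_piMr ?(ltW e0)// ler_pdivrMl// mulr1.
by rewrite /C lerDl.
Unshelve. all: by end_near. Qed.

Lemma Ck1_continuous f : Ck 1 f -> continuous f. Proof. by case. Qed.

Lemma Ck1_partial f i : Ck 1 f -> continuous (partial i f).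
Proof. by move=> /Ck1P[_ _]; exact. Qed.

Lemma Ck1_intro f (df : 'I_d -> 'rV[R]_d -> R) : continuous f ->
  (forall i, continuous (df i)) ->
  (forall x (i : 'I_d), is_derive x (delta_mx 0 i : 'rV[R]_d) f (df i x)) ->
  Ck 1 f /\ forall i, partial i f = df i.
Proof.
move=> cf cdf hd.
have pE i : partial i f = df i.
  by apply/funext => x; rewrite /partial; by have [] := hd x i.
by split => //; apply/Ck1P; split => // i; rewrite pE.
Qed.

Lemma Ck1_is_derive f x i : Ck 1 f -> is_derive x (delta_mx 0 i : 'rV[R]_d) f (partial i f x).
Proof. by move=> /Ck1P[_ df _]; split. Qed.

Lemma Ck1_cst (c : R) : Ck 1 (cst c : 'rV[R]_d -> R) /\ forall i, partial i (cst c : 'rV[R]_d -> R) = cst 0.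
Proof. by apply: Ck1_intro => // *; exact: cst_continuous. Qed.

Lemma Ck1D f g : Ck 1 f -> Ck 1 g ->
  Ck 1 (fun x => f x + g x) /\
  forall i, partial i (fun x => f x + g x) = fun x => partial i f x + partial i g x.
Proof.
move=> cf cg; apply: (@Ck1_intro (fun x => f x + g x)).
- by move=> x; apply: (@continuousD _ _ _ f g); exact: Ck1_continuous.
- by move=> i x; apply: (@continuousD _ _ _ (partial i f) (partial i g)); exact: Ck1_partial.
- by move=> x i; apply: (@is_deriveD _ _ _ f g); exact: Ck1_is_derive.
Qed.

Lemma Ck1M f g : Ck 1 f -> Ck 1 g ->
  Ck 1 (fun x => f x * g x) /\
  forall i, partial i (fun x => f x * g x) = fun x => partial i f x * g x + f x * partial i g x.
Proof.
move=> cf cg; apply: (@Ck1_intro (fun x => f x * g x)).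
- by move=> x; apply: (@continuousM _ _ f g); exact: Ck1_continuous.
- move=> i x; apply: (@continuousD _ _ _ (fun x => partial i f x * g x) (fun x => f x * partial i g x)).
    by apply: (@continuousM _ _ (partial i f) g); [exact: Ck1_partial|exact: Ck1_continuous].
  by apply: (@continuousM _ _ f (partial i g)); [exact: Ck1_continuous|exact: Ck1_partial].
- move=> x i; have := @is_deriveM _ _ f g x (delta_mx 0 i) _ _ (Ck1_is_derive x i cf) (Ck1_is_derive x i cg).
  by rewrite /GRing.scale/= addrC (mulrC (g x)).
Qed.

Lemma coord_is_derive x v (j : 'I_d) : is_derive x v (fun y : 'rV[R]_d => y 0 j) (v 0 j).
Proof.
have E : forall h : R, h != 0 ->
    h^-1 *: (((fun y : 'rV[R]_d => y 0 j) \o shift x) (h *: v) - x 0 j) = v 0 j.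
  by move=> h h0 /=; rewrite !mxE addrK /GRing.scale/= mulKf.
have H : (fun h : R => h^-1 *: (((fun y : 'rV[R]_d => y 0 j) \o shift x) (h *: v) - x 0 j)) @ 0^'
    --> v 0 j.
  apply: cvg_near_cst; near=> h; apply: E; near: h; exact: nbhs_dnbhs_neq.
by split; [apply/cvg_ex; exists (v 0 j)|exact: cvg_lim H].
Unshelve. all: by end_near. Qed.

Lemma Ck1_coord (j : 'I_d) : Ck 1 (fun y : 'rV[R]_d => y 0 j) /\
  forall i, partial i (fun y : 'rV[R]_d => y 0 j) = cst ((j == i)%:R).
Proof.
apply: Ck1_intro.
- exact: coord_continuous.
- by move=> i; exact: cst_continuous.
- by move=> x i; have := coord_is_derive x (delta_mx 0 i) j; rewrite mxE eqxx /=.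
Qed.

End C1.

Section C1_affine.
Variable R : realType.
Local Notation mu := (@lebesgue_measure R).
Local Notation lam n := (lebesgue_rV R n).

Lemma Ck1_affine m n (f : 'rV[R]_n -> R) (A : 'M[R]_(m, n)) (b : 'rV[R]_n) : Ck 1 f ->
  Ck 1 (fun x : 'rV[R]_m => f (x *m A + b)) /\
  forall k, partial k (fun x : 'rV[R]_m => f (x *m A + b)) =
    fun x => \sum_i A k i * partial i f (x *m A + b).
Proof.
move=> cf; apply: (@Ck1_intro _ _ (fun x : 'rV[R]_m => f (x *m A + b)) (fun k x => \sum_i A k i * partial i f (x *m A + b))).
- move=> x; apply: (@continuous_comp _ _ _ (fun x : 'rV[R]_m => x *m A + b) f).
    exact: continuous_affine_map.
  exact: Ck1_continuous.
- move=> k; apply: continuous_big => [|i _ x]; first exact: add_continuous.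
  apply: (@continuousM _ _ (cst (A k i)) (fun x : 'rV[R]_m => partial i f (x *m A + b))).
    exact: cst_continuous.
  apply: (@continuous_comp _ _ _ (fun x : 'rV[R]_m => x *m A + b) (partial i f)).
    exact: continuous_affine_map.
  exact: Ck1_partial.
move=> x k; have := C1_is_derive (x *m A + b) (row k A) cf.
have E : (fun h : R => h^-1 *: ((f \o shift (x *m A + b)) (h *: row k A) - f (x *m A + b))) =
    (fun h : R => h^-1 *: (((fun x => f (x *m A + b)) \o shift x) (h *: delta_mx 0 k) -
      f (x *m A + b))).
  apply/funext => h /=; congr (_ *: (f _ - _)).
  by rewrite mulmxDl -scalemxAl -rowE addrA.
move=> [d1 d2]; under eq_bigr do rewrite -[A k _]/(A k _).
split; first by rewrite /derivable -E.
rewrite /derive -E -/(derive _ _ _) d2.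
by apply: eq_bigr => i _; rewrite mxE.
Qed.

Lemma C1_is_derive_insert n (i : 'I_n.+1) (f : 'rV[R]_n.+1 -> R) (t : 'rV[R]_n) (a : R) :
  Ck 1 f -> is_derive a (1 : R) (fun a => f (insert_coord i a t)) (partial i f (insert_coord i a t)).
Proof.
move=> cf; have := Ck1_is_derive (insert_coord i a t) i cf.
have E : (fun h : R => h^-1 *: ((f \o shift (insert_coord i a t)) (h *: delta_mx 0 i) -
      f (insert_coord i a t))) =
    (fun h : R => h^-1 *: (((fun a => f (insert_coord i a t)) \o shift a) (h *: 1) -
      f (insert_coord i a t))).
  apply/funext => h /=; congr (_ *: (f _ - _)); apply/rowP => j; rewrite !mxE eqxx /=.
  case: (unliftP i j) => [k|] ->; first by rewrite eq_sym (negbTE (neq_lift _ _)) mulr0 add0r.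
  by rewrite eqxx.
move=> [d1 d2]; split; first by rewrite /derivable -E.
by rewrite /derive -E -/(derive _ _ _) d2.
Qed.

Lemma C1_FTC n (i : 'I_n.+1) (f : 'rV[R]_n.+1 -> R) (t : 'rV[R]_n) (l : R) :
  Ck 1 f -> 0 <= l ->
  \int[mu]_(a in `[0, l]) partial i f (insert_coord i a t) =
  f (insert_coord i l t) - f (insert_coord i 0 t).
Proof.
move=> cf; rewrite le_eqVlt => /predU1P[<-|l0].
  by rewrite subrr set_itv1 Rintegral_set1.
have ci : continuous (fun a : R => f (insert_coord i a t)).
  move=> a; apply: (@continuous_comp _ _ _ (fun a => insert_coord i a t) f).
    exact: continuous_insert.
  exact: Ck1_continuous.
rewrite /Rintegral (continuous_FTC2 (F := fun a => f (insert_coord i a t)) l0)//.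
- apply: continuous_subspaceT => a.
  apply: (@continuous_comp _ _ _ (fun a => insert_coord i a t) (partial i f)).
    exact: continuous_insert.
  exact: Ck1_partial.
- split; last 2 first.
  + by apply: cvg_at_right_filter; exact: ci.
  + by apply: cvg_at_left_filter; exact: ci.
  by move=> a _; have [] := C1_is_derive_insert i t a cf.
- by move=> a _; rewrite derive1E; have [] := C1_is_derive_insert i t a cf.
Qed.

End C1_affine.

(** * Polynomial spaces and their stability under substitution *)

Section monomials.
Variable R : realType.

Definition mon d (m : 'I_d -> nat) (x : 'rV[R]_d) : R := \prod_i x 0 i ^+ m i.

(** Monomials form a list with possible repetitions, so sums are concatenations and products need no
    collection of coefficients. Leaving [D] arbitrary serves total degree and degree in each
    variable at once. *)
Definition spanned d (D : ('I_d -> nat) -> Prop) (v : 'rV[R]_d -> R) : Prop :=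
  exists2 s : seq (R * ('I_d -> nat)), (forall i, (i < size s)%N -> D (nth (0, fun=> 0%N) s i).2) &
    forall x, v x = \sum_(t <- s) t.1 * mon t.2 x.

Section one_space.
Variable d : nat.
Implicit Types (D : ('I_d -> nat) -> Prop) (v w : 'rV[R]_d -> R) (m : 'I_d -> nat).

Lemma spanned_ind D (P : ('rV[R]_d -> R) -> Prop) :
  P (fun=> 0) -> (forall a m v, D m -> spanned D v -> P v -> P (fun x => a * mon m x + v x)) ->
  forall v, spanned D v -> P v.
Proof.
move=> P0 Pc v [s hs vE]; have -> : v = fun x => \sum_(t <- s) t.1 * mon t.2 x by apply/funext.
elim: s hs {vE} => [|t s IH] hs.
  by rewrite (_ : (fun x => _) = fun=> 0)//; apply/funext => x; rewrite big_nil.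
rewrite (_ : (fun x => _) = fun x => t.1 * mon t.2 x + \sum_(t <- s) t.1 * mon t.2 x).
  have hs' i : (i < size s)%N -> D (nth (0, fun=> 0%N) s i).2 by exact: (hs i.+1).
  by apply: Pc; [exact: (hs 0%N)|exists s|exact: IH].
by apply/funext => x; rewrite big_cons.
Qed.

Lemma spanned_ext D v w : v =1 w -> spanned D v -> spanned D w.
Proof. by move=> /funext ->. Qed.

Lemma spanned0 D : spanned D (fun=> 0).
Proof. by exists [::] => // x; rewrite big_nil. Qed.

Lemma spanned_cons D a m v : D m -> spanned D v -> spanned D (fun x => a * mon m x + v x).
Proof.
move=> Dm [s hs vE]; exists ((a, m) :: s) => [[|i]//=|x]; first exact: hs.
by rewrite big_cons vE.
Qed.

Lemma spanned_mon D a m : D m -> spanned D (fun x => a * mon m x).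
Proof.
move=> Dm; apply: spanned_ext (spanned_cons a Dm (spanned0 D)) => x; exact: addr0.
Qed.

Lemma spannedD D v w : spanned D v -> spanned D w -> spanned D (fun x => v x + w x).
Proof.
move=> sv sw; move: v sv; apply: spanned_ind => [|a m v Dm _ IH].
  by apply: spanned_ext sw => x; rewrite add0r.
by apply: spanned_ext (spanned_cons a Dm IH) => x; rewrite addrA.
Qed.

Lemma spannedZ D a v : spanned D v -> spanned D (fun x => a * v x).
Proof.
move: v; apply: spanned_ind => [|b m v Dm _ IH].
  by apply: spanned_ext (spanned0 D) => x; rewrite mulr0.
by apply: spanned_ext (spanned_cons (a * b) Dm IH) => x; rewrite mulrDr mulrA.
Qed.

Lemma spanned_sum D (I : Type) (r : seq I) (P : pred I) (F : I -> 'rV[R]_d -> R) :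
  (forall i, P i -> spanned D (F i)) -> spanned D (fun x => \sum_(i <- r | P i) F i x).
Proof.
move=> h; elim: r => [|i r IH].
  by apply: spanned_ext (spanned0 D) => x; rewrite big_nil.
case: (boolP (P i)) => Pi.
  by apply: spanned_ext (spannedD (h _ Pi) IH) => x; rewrite big_cons Pi.
by apply: spanned_ext IH => x; rewrite big_cons (negbTE Pi).
Qed.

Lemma sub_spanned D D' v : (forall m, D m -> D' m) -> spanned D v -> spanned D' v.
Proof. by move=> DD' [s hs vE]; exists s => // i /hs/DD'. Qed.

Lemma monD m m' x : mon (fun i => (m i + m' i)%N) x = mon m x * mon m' x.
Proof. by rewrite /mon -big_split; apply: eq_bigr => i _; rewrite exprD. Qed.

Lemma spannedM D1 D2 D v w :
  (forall m m', D1 m -> D2 m' -> D (fun i => (m i + m' i)%N)) ->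
  spanned D1 v -> spanned D2 w -> spanned D (fun x => v x * w x).
Proof.
move=> h sv sw; move: v sv; apply: spanned_ind => [|a m v Dm _ IH].
  by apply: spanned_ext (spanned0 D) => x; rewrite mul0r.
have : spanned D (fun x => a * mon m x * w x).
  move: w sw {v IH}; apply: spanned_ind => [|b m' w Dm' _ IH].
    by apply: spanned_ext (spanned0 D) => x; rewrite mulr0.
  apply: spanned_ext (spanned_cons (a * b) (h _ _ Dm Dm') IH) => x.
  by rewrite monD; ring.
by move=> h'; apply: spanned_ext (spannedD h' IH) => x; rewrite mulrDl.
Qed.

End one_space.

(* The degree bound [D e] is indexed by [e] in a commutative monoid: a total   *)
(* degree in nat, or a tuple of partial degrees. *)
Lemma spanned_subst d d' (E : nmodType) (D : E -> ('I_d' -> nat) -> Prop)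
    (psi : 'rV[R]_d' -> 'rV[R]_d) (e : 'I_d -> E) (m : 'I_d -> nat) :
  D 0 (fun=> 0%N) -> (forall a b k l, D a k -> D b l -> D (a + b) (fun i => (k i + l i)%N)) ->
  (forall i, spanned (D (e i)) (fun x => psi x 0 i)) ->
  spanned (D (\sum_i e i *+ m i)) (fun x => mon m (psi x)).
Proof.
move=> D0 DD hpsi.
have s1 : spanned (D 0) (fun=> 1).
  by apply: spanned_ext (spanned_mon 1 D0) => x; rewrite /mon big1// mulr1.
have spow i k : spanned (D (e i *+ k)) (fun x => psi x 0 i ^+ k).
  elim: k => [|k IH]; first by apply: spanned_ext s1 => x.
  rewrite mulrS; apply: spanned_ext (spannedM (@DD _ _) (hpsi i) IH) => x.
  by rewrite exprS.
rewrite /mon; elim: (index_enum _) => [|i r IH].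
  by rewrite big_nil; apply: spanned_ext s1 => x; rewrite big_nil.
rewrite big_cons; apply: spanned_ext (spannedM (@DD _ _) (spow i (m i)) IH) => x.
by rewrite big_cons.
Qed.

End monomials.

Section ref_polynomials.
Variable R : realType.

Definition admissible d (K : ref_shape) (p : nat) (m : 'I_d -> nat) : Prop :=
  match K with Simplex => (\sum_i m i <= p)%N | Cube => forall i, (m i <= p)%N end.

Lemma admissible_le d K p (m : 'I_d -> nat) i : admissible K p m -> (m i <= p)%N.
Proof.
by case: K => /= [h|]; [apply: leq_trans h; rewrite (bigD1 i)//= leq_addr|exact].
Qed.

Lemma ref_polyP d K p (v : 'rV[R]_d -> R) : ref_poly K p v <-> spanned (admissible K p) v.
Proof.
split => [[c vE]|].
  apply: spanned_ext (fun x => esym (vE x)) _; apply: spanned_sum => m Pm.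
  apply: (@spanned_mon _ _ _ _ (fun i => m i)).
  by case: K Pm {vE} => //= _ i; rewrite -ltnS.
move: v; apply: spanned_ind.
  by exists (fun=> 0) => x; rewrite big1// => m _; rewrite mul0r.
move=> a m v Dm _ [c vE].
pose m' : {ffun 'I_d -> 'I_p.+1} := [ffun i => inord (m i)].
have m'E i : m' i = m i :> nat.
  by rewrite ffunE inordK// ltnS; exact: admissible_le Dm.
exists (fun k => c k + (if k == m' then a else 0)) => x.
under eq_bigr do rewrite mulrDl; rewrite big_split /= -vE addrC; congr (_ + _).
rewrite (bigD1 m')/=; last first.
  by case: K Dm {vE} => //= h; rewrite (eq_bigr m).
rewrite eqxx [X in _ = _ + X]big1 ?addr0; last by move=> k /andP[_ /negbTE ->]; rewrite mul0r.
by congr (_ * _); apply: eq_bigr => i _; rewrite m'E.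
Qed.

Lemma ref_poly_ext d K p (v w : 'rV[R]_d -> R) : v =1 w -> ref_poly K p v -> ref_poly K p w.
Proof. by move=> /funext ->. Qed.

Lemma ref_poly0 d K p : ref_poly K p (fun _ : 'rV[R]_d => 0).
Proof. by apply/ref_polyP; exact: spanned0. Qed.

Lemma ref_polyD d K p (v w : 'rV[R]_d -> R) :
  ref_poly K p v -> ref_poly K p w -> ref_poly K p (fun x => v x + w x).
Proof. by rewrite !ref_polyP; exact: spannedD. Qed.

Lemma ref_polyZ d K p a (v : 'rV[R]_d -> R) : ref_poly K p v -> ref_poly K p (fun x => a * v x).
Proof. by rewrite !ref_polyP; exact: spannedZ. Qed.

Lemma ref_polyN d K p (v : 'rV[R]_d -> R) : ref_poly K p v -> ref_poly K p (fun x => - v x).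
Proof. by move=> /(ref_polyZ (-1)); apply: ref_poly_ext => x; rewrite mulN1r. Qed.

Lemma ref_polyB d K p (v w : 'rV[R]_d -> R) :
  ref_poly K p v -> ref_poly K p w -> ref_poly K p (fun x => v x - w x).
Proof. by move=> hv /ref_polyN; exact: ref_polyD. Qed.

Lemma ref_poly_sum d K p (I : Type) (r : seq I) (P : pred I) (F : I -> 'rV[R]_d -> R) :
  (forall i, P i -> ref_poly K p (F i)) -> ref_poly K p (fun x => \sum_(i <- r | P i) F i x).
Proof. by move=> h; apply/ref_polyP; apply: spanned_sum => i /h/ref_polyP. Qed.

Lemma ref_polyM d K p q (v w : 'rV[R]_d -> R) :
  ref_poly K p v -> ref_poly K q w -> ref_poly K (p + q) (fun x => v x * w x).
Proof.
rewrite !ref_polyP; apply: spannedM => m m'; case: K => /= [h h'|h h' i].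
  by rewrite big_split leq_add.
by rewrite leq_add.
Qed.

Lemma ref_poly_le d K p q (v : 'rV[R]_d -> R) : (p <= q)%N -> ref_poly K p v -> ref_poly K q v.
Proof.
move=> pq; rewrite !ref_polyP; apply: sub_spanned => m; case: K => /= h.
  exact: leq_trans h pq.
by move=> i; exact: leq_trans (h i) pq.
Qed.

Lemma ref_poly_cst d K p (c : R) : ref_poly K p (fun _ : 'rV[R]_d => c).
Proof.
apply/ref_polyP; apply: (@spanned_ext _ _ _ (fun x => c * mon (fun=> 0%N) x)).
  by move=> x; rewrite /mon big1// mulr1.
by apply: spanned_mon; case: K => //=; rewrite sum_nat_const muln0.
Qed.

Lemma ref_poly_coord d K (j : 'I_d) : ref_poly K 1 (fun x : 'rV[R]_d => x 0 j).
Proof.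
apply/ref_polyP; apply: (@spanned_ext _ _ _ (fun x => 1 * mon (fun i => (i == j)%N) x)).
  move=> x; rewrite /mon (bigD1 j)//= eqxx expr1 big1 ?mul1r ?mulr1// => i /negbTE ->.
  by rewrite expr0.
apply: spanned_mon; case: K => /= [|i]; last by case: eqP.
rewrite (bigD1 j)//= eqxx big1// => i /negbTE -> //.
Qed.

(* Total degree is preserved by every affine substitution, degree in each      *)
(* variable only if each new coordinate depends on one old coordinate and      *)
(* different coordinates depend on different ones. *)
Lemma ref_poly_affine d d' p (B : 'M[R]_(d', d)) (b : 'rV[R]_d) (v : 'rV[R]_d -> R) :
  ref_poly Simplex p v -> ref_poly Simplex p (fun x : 'rV[R]_d' => v (x *m B + b)).
Proof.
rewrite [X in X -> _]ref_polyP; move: v; apply: spanned_ind => [|a m v Dm _ IH].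
  exact: ref_poly0.
apply: ref_polyD IH; apply: ref_polyZ; apply/ref_polyP.
have h i : spanned (fun k => (\sum_j k j <= 1)%N) (fun x : 'rV[R]_d' => (x *m B + b) 0 i).
  apply/(@ref_polyP _ Simplex 1).
  apply: (@ref_poly_ext _ _ _ (fun x : 'rV[R]_d' => \sum_j B j i * x 0 j + b 0 i)).
    by move=> x; rewrite !mxE; congr (_ + _); apply: eq_bigr => j _; rewrite mulrC.
  apply: ref_polyD; last exact: ref_poly_cst.
  by apply: ref_poly_sum => j _; apply: ref_polyZ; exact: ref_poly_coord.
apply: sub_spanned (@spanned_subst R d d' nat (fun q k => (\sum_j k j <= q)%N)
  (fun x => x *m B + b) (fun=> 1%N) m _ _ h) => /=.
- move=> k /leq_trans; apply; apply: leq_trans Dm.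
  rewrite leq_eqVlt; apply/orP; left; apply/eqP; apply: eq_bigr => i _.
  by elim: (m i) => // q IH; rewrite mulrS IH.
- by rewrite big1.
- by move=> q r k l hk hl; rewrite big_split leq_add.
Qed.

Lemma ref_poly_cube_subst d d' p (s : 'I_d -> option 'I_d') (a b : 'I_d -> R)
    (v : 'rV[R]_d -> R) :
  (forall i i' j, s i = Some j -> s i' = Some j -> i = i') ->
  ref_poly Cube p v ->
  ref_poly Cube p (fun x : 'rV[R]_d' =>
    v (\row_i ((if s i is Some j then a i * x 0 j else 0) + b i))).
Proof.
move=> s_inj; rewrite [X in X -> _]ref_polyP; move: v; apply: spanned_ind => [|c m v Dm _ IH].
  exact: ref_poly0.
apply: ref_polyD IH; apply: ref_polyZ; apply/ref_polyP.
pose psi (x : 'rV[R]_d') : 'rV[R]_d := \row_i ((if s i is Some j then a i * x 0 j else 0) + b i).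
(* Degree bounds are tuples of partial degrees here. Coordinate [i] contributes degree one in the
   single variable [s i], and injectivity of [s] keeps two coordinates from accumulating in one
   variable. *)
pose e i : {ffun 'I_d' -> nat} := [ffun j => (s i == Some j) : nat].
pose D (q : {ffun 'I_d' -> nat}) (k : 'I_d' -> nat) := forall j, (k j <= q j)%N.
have h i : spanned (D (e i)) (fun x : 'rV[R]_d' => psi x 0 i).
  have sb : spanned (D (e i)) (fun _ : 'rV[R]_d' => b i).
    apply: (@spanned_ext _ _ _ (fun x => b i * mon (fun=> 0%N) x)).
      by move=> x; rewrite /mon big1// mulr1.
    by apply: spanned_mon.
  case sE : (s i) => [j|]; last first.
    by apply: spanned_ext sb => x; rewrite mxE sE add0r.
  apply: (@spanned_ext _ _ _ (fun x => a i * mon (fun k => (k == j)%N) x + b i)).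
    move=> x; rewrite mxE sE; congr (_ * _ + _).
    rewrite /mon (bigD1 j)//= eqxx expr1 big1 ?mulr1// => k /negbTE ->.
    by rewrite expr0.
  apply: spannedD sb; apply: spanned_mon => k; rewrite ffunE sE.
  by rewrite (inj_eq (@Some_inj _)) eq_sym.
apply: sub_spanned (@spanned_subst R d d' {ffun 'I_d' -> nat} D psi e m _ _ h) => /=.
- move=> k hk j; apply: leq_trans (hk j) _.
  rewrite sum_ffunE.
  under eq_bigr do rewrite ffunMnE ffunE.
  have nE (x y : nat) : (x *+ y)%R = (x * y)%N by elim: y => [|y IHy]; rewrite ?muln0// mulrS IHy mulnS.
  under eq_bigr do rewrite nE.
  case: (pickP (fun i => s i == Some j)) => [i /eqP si|no]; last first.
    by rewrite big1// => i _; rewrite no mul0n.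
  rewrite (bigD1 i)//= si eqxx mul1n [X in _ + X]big1 ?addr0; first exact: Dm.
  move=> i' ii'; case: eqP => [si'|]; last by rewrite mul0n.
  by move: ii'; rewrite (s_inj _ _ _ si' si) eqxx.
- by [].
- by move=> q r k l hk hl j; rewrite ffunE leq_add.
Qed.

(** Reduces polynomial identities in several variables to a count of roots in one variable. *)
Lemma spanned_line d D (v : 'rV[R]_d -> R) (x w : 'rV[R]_d) : spanned D v ->
  exists q : {poly R}, forall t, v (x + t *: w) = q.[t].
Proof.
move: v; apply: spanned_ind => [|a m v _ _ [q hq]].
  by exists 0 => t; rewrite horner0.
exists (a%:P * (\prod_i ((x 0 i)%:P + w 0 i *: 'X) ^+ m i) + q) => t.
rewrite hq !hornerE; congr (_ * _ + _); rewrite horner_prod; apply: eq_bigr => i _.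
by rewrite !hornerE !mxE mulrC.
Qed.

Lemma spanned_Ck1 d D (v : 'rV[R]_d -> R) : spanned D v -> Ck 1 v.
Proof.
move: v; apply: spanned_ind => [|a m v _ _ IH].
  exact: (Ck1_cst _ 0).1.
apply: (Ck1D _ IH).1; apply: (Ck1M (Ck1_cst _ a).1 _).1.
rewrite /mon; elim: (index_enum _) => [|i r IHr].
  rewrite (_ : (fun x => _) = cst 1); first exact: (Ck1_cst _ 1).1.
  by apply/funext => x; rewrite big_nil.
rewrite (_ : (fun x => _) = fun x : 'rV[R]_d => x 0 i ^+ m i * \prod_(i <- r) x 0 i ^+ m i).
  apply: (Ck1M _ IHr).1; elim: (m i) => [|k IHk].
    rewrite (_ : (fun x => _) = cst 1); first exact: (Ck1_cst _ 1).1.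
    by apply/funext => x; rewrite expr0.
  rewrite (_ : (fun x => _) = fun x : 'rV[R]_d => x 0 i * x 0 i ^+ k).
    exact: (Ck1M (Ck1_coord R i).1 IHk).1.
  by apply/funext => x; rewrite exprS.
by apply/funext => x; rewrite big_cons.
Qed.

Lemma ref_poly_Ck1 d K p (v : 'rV[R]_d -> R) : ref_poly K p v -> Ck 1 v.
Proof. by move=> /ref_polyP; exact: spanned_Ck1. Qed.

Lemma ref_poly_continuous d K p (v : 'rV[R]_d -> R) : ref_poly K p v -> continuous v.
Proof. by move=> /ref_poly_Ck1; exact: Ck1_continuous. Qed.

Lemma partial_mon d (m : 'I_d -> nat) (i : 'I_d) (x : 'rV[R]_d) :
  partial i (mon m) x = (m i)%:R * mon (fun j => if j == i then (m i).-1 else m j) x.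
Proof.
pose rest (x : 'rV[R]_d) := \prod_(j | j != i) x 0 j ^+ m j.
have mE : mon m = fun x => x 0 i ^+ m i * rest x.
  by apply/funext => y; rewrite /mon (bigD1 i).
have dr : is_derive x (delta_mx 0 i : 'rV[R]_d) rest 0.
  have E : (fun h : R => h^-1 *: ((rest \o shift x) (h *: delta_mx 0 i) - rest x)) = cst 0.
    apply/funext => h; rewrite (_ : _ - _ = 0) ?scaler0//; apply/eqP; rewrite subr_eq0.
    apply/eqP; apply: eq_bigr => j ji; rewrite !mxE eqxx /=.
    by rewrite (negbTE ji) mulr0 add0r.
  split; first by rewrite /derivable E; exact: is_cvg_cst.
  by rewrite /derive E; exact: lim_cst.
have dc := coord_is_derive x (delta_mx 0 i) i.
have [_ hval] : is_derive x (delta_mx 0 i : 'rV[R]_d) (mon m) (x 0 i ^+ m i *: 0 +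
    rest x *: (((m i)%:R * x 0 i ^+ (m i).-1) *: (delta_mx 0 i : 'rV[R]_d) 0 i)).
  have XE k : (fun y : 'rV[R]_d => y 0 i : R) ^+ k = fun y => y 0 i ^+ k.
    elim: k => [|k IH]; apply/funext => y; rewrite ?expr0// exprS IH exprS //.
  have := is_deriveX (m i) dc; rewrite XE => dX.
  by rewrite mE; exact: (is_deriveM dX dr).
rewrite /partial hval.
rewrite scaler0 add0r mxE !eqxx /= /GRing.scale /= mulr1 mulrC -mulrA; congr (_ * _).
rewrite /mon (bigD1 i)//= eqxx; congr (_ * _).
by apply: eq_bigr => j /negbTE ->.
Qed.

(** On a monomial, differentiation lowers one exponent and multiplication by the same coordinate
    restores it. The second half is what places the bubble field in the Raviart-Thomas space. *)
Lemma ref_poly_partial d K p (v : 'rV[R]_d -> R) (i : 'I_d) :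
  ref_poly K p v -> ref_poly K p (partial i v) /\ ref_poly K p (fun x => x 0 i * partial i v x).
Proof.
rewrite ![X in X -> _]ref_polyP; move: v; apply: spanned_ind => [|a m v Dm sv [IH1 IH2]].
  rewrite (Ck1_cst _ 0).2; split; first exact: ref_poly0.
  by apply: ref_poly_ext (ref_poly0 _ _ _) => x; rewrite mulr0.
have sm : spanned (admissible K p) (@mon R d m).
  by apply: (@spanned_ext _ _ _ (fun x => 1 * mon m x)) => [x|]; [rewrite mul1r|exact: spanned_mon].
have cm := spanned_Ck1 sm.
have cv : Ck 1 v := spanned_Ck1 sv.
have pE : partial i (fun x => a * mon m x + v x) = fun x => a * partial i (mon m) x + partial i v x.
  rewrite (Ck1D (Ck1M (Ck1_cst _ a).1 cm).1 cv).2 (Ck1M (Ck1_cst _ a).1 cm).2 (Ck1_cst _ a).2.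
  by apply/funext => x; rewrite mul0r add0r.
split.
  rewrite pE; apply: ref_polyD IH1; apply: ref_polyZ; apply/ref_polyP.
  apply: (@spanned_ext _ _ _ (fun x => (m i)%:R * mon (fun j => if j == i then (m i).-1 else m j) x)).
    by move=> x; rewrite partial_mon.
  apply: spanned_mon; clear -Dm; case: K Dm => /= [Dm|Dm j].
    apply: leq_trans Dm; apply: leq_sum => j _; case: eqP => [->|//].
    exact: leq_pred.
  by case: eqP => _; [exact: leq_trans (leq_pred _) (Dm i)|exact: Dm].
apply: (@ref_poly_ext _ _ _ (fun x => a * (m i)%:R * mon m x + x 0 i * partial i v x)).
  move=> x; rewrite pE partial_mon mulrDr; congr (_ + _).
  rewrite mulrCA -mulrA; congr (_ * _); rewrite mulrCA.
  case mi : (m i) => [|k]; first by rewrite !mul0r.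
  congr (_ * _); rewrite /mon (bigD1 i)//= [in RHS](bigD1 i)//= eqxx mi /= exprS mulrA.
  by congr (_ * _); apply: eq_bigr => j /negbTE ->.
by apply: ref_polyD IH2; apply/ref_polyP; exact: spanned_mon.
Qed.

End ref_polynomials.

(** * Geometry of the reference cell *)

Section reference_geometry.
Variable R : realType.
Local Notation lam n := (lebesgue_rV R n).

Lemma open_pos_measure n (U : set 'rV[R]_n) : open U -> U !=set0 -> (0 < lam n U)%E.
Proof.
move=> oU [x Ux]; have : nbhs x U by exact: open_nbhs_nbhs.
move=> /nbhs_ballP[e /= e0 eU].
pose B i := `]x 0 i - e, x 0 i + e[%classic.
have [mB lB] := @lebesgue_rV_box R n B (fun i => measurable_itv _).
apply: (@lt_le_trans _ _ (lam n [set y : 'rV[R]_n | forall i, B i (y 0 i)])).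
  rewrite lB; elim/big_ind: _ => // [|i _].
    by move=> a b a0 b0; exact: mule_gt0.
  rewrite /B lebesgue_measure_itv/= lte_fin ifT; last by lra.
  by rewrite -EFinD lte_fin; lra.
apply: le_measure; rewrite ?inE//; first exact: open_measurable_rV.
move=> y By; apply: eU; split => // i j; rewrite ord1; have := By j.
by rewrite /B /= in_itv/= /ball/= distrC ltr_distl.
Qed.

Definition ref_interior d (K : ref_shape) : set 'rV[R]_d :=
  [set x | forall j : facet_ix d K, 0 < facet_form j x].

Lemma ref_poly_facet_form d K (j : facet_ix d K) : ref_poly Simplex 1 (@facet_form R d K j).
Proof.
case: K j => /= [[i|]|[i []]] /=; try exact: ref_poly_coord.
  apply: ref_polyB; first exact: ref_poly_cst.
  by apply: ref_poly_sum => i _; exact: ref_poly_coord.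
by apply: ref_polyB; [exact: ref_poly_cst|exact: ref_poly_coord].
Qed.

Lemma continuous_facet_form d K (j : facet_ix d K) : continuous (@facet_form R d K j).
Proof. exact: ref_poly_continuous (ref_poly_facet_form j). Qed.

Lemma closed_ref_cell d K : closed (@ref_cell R d K).
Proof.
rewrite (_ : ref_cell _ = \bigcap_(j in [set: facet_ix d K]) [set x | 0 <= facet_form j x]).
  apply: closed_bigI => j _.
  by apply: (continuous_closedP _).1 (@closed_ge _ 0); exact: continuous_facet_form.
by apply/seteqP; split => x h j => [_|]; apply: h.
Qed.

Lemma measurable_ref_cell d K : measurable (@ref_cell R d K).
Proof. by apply: closed_measurable_rV; exact: closed_ref_cell. Qed.

Lemma open_ref_interior d K : open (@ref_interior d K).
Proof.
rewrite openE => x hx.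
have : nbhs x [set y | forall j : facet_ix d K, 0 < facet_form j y].
  apply: (@filter_forall _ (facet_ix d K) (fun j y => 0 < facet_form j y) (nbhs x) _) => j.
  have : open [set y | 0 < @facet_form R d K j y].
    by apply: (continuousP _).1 (@open_gt _ 0); exact: continuous_facet_form.
  by rewrite openE; apply; exact: hx.
by [].
Qed.

Lemma ref_interior_sub d K : @ref_interior d K `<=` ref_cell K.
Proof. by move=> x h j; exact/ltW. Qed.

Lemma ref_interior_neq0 d K : @ref_interior d K !=set0.
Proof.
have d0 : 0 < d.+1%:R :> R by rewrite ltr0n.
have p0 : 0 < (d.+1%:R : R)^-1 by rewrite invr_gt0.
exists (const_mx d.+1%:R^-1) => j; case: K j => /= [[i|]|[i []]] /=; rewrite ?mxE//.
  under eq_bigr do rewrite mxE.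
  by rewrite sumr_const card_ord subr_gt0 -[_ *+ d]mulr_natl ltr_pdivrMr// mul1r ltr_nat.
by rewrite subr_gt0 invf_lt1// ltr1n ltnS; exact: leq_trans (ltn_ord i).
Qed.

Lemma ref_cell_inbox d K : @ref_cell R d K `<=` inbox 1.
Proof.
move=> x h i; case: K h => h; last first.
  have := h (i, true); have := h (i, false); rewrite /= subr_ge0 => x0 x1.
  by rewrite ger0_norm.
have h0 k : 0 <= x 0 k by exact: (h (Some k)).
rewrite ger0_norm//; have := h None; rewrite /= subr_ge0; apply: le_trans.
by rewrite (bigD1 i)//= lerDl sumr_ge0.
Qed.

Lemma ref_cell0 d K : @ref_cell R d K 0.
Proof.
move=> j; case: K j => /= [[i|]|[i []]] /=; rewrite ?mxE ?subr0//.
by rewrite big1 ?subr0// => i _; rewrite mxE.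
Qed.

Lemma ref_cell_delta d K (k : 'I_d) : @ref_cell R d K (delta_mx 0 k).
Proof.
move=> j; case: K j => /= [[i|]|[i []]] /=; rewrite ?mxE ?eqxx//=.
- rewrite (bigD1 k)//= mxE !eqxx /= big1 ?addr0 ?subrr// => i /negbTE ik.
  by rewrite mxE ik andbF.
- by rewrite subr_ge0; case: eqP => _; rewrite ?ler01 ?ler10.
Qed.

Lemma ref_cell_pos d K : (0 < lam d (@ref_cell R d K))%E.
Proof.
apply: lt_le_trans (open_pos_measure (@open_ref_interior d K) (@ref_interior_neq0 d K)) _.
apply: le_measure; rewrite ?inE; last exact: ref_interior_sub.
  by apply: open_measurable_rV; exact: open_ref_interior.
exact: measurable_ref_cell.
Qed.

Lemma ref_cell_fin d K : (lam d (@ref_cell R d K) < +oo)%E.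
Proof. exact: sub_inbox_fin (@measurable_ref_cell d K) (@ref_cell_inbox d K). Qed.

Lemma integrable_ref d K (f : 'rV[R]_d -> R) : continuous f ->
  (lam d).-integrable (ref_cell K) (EFin \o f).
Proof.
by move=> cf; exact: (continuous_integrable cf (@measurable_ref_cell d K) (@ref_cell_inbox d K)).
Qed.

Lemma vol_ref_gt0 d K : 0 < vol (@ref_cell R d K).
Proof. by rewrite /vol fine_gt0// ref_cell_pos ref_cell_fin. Qed.

(** The right inverses make both parametrizations injective, so the change of parameter is affine
    and maps the cell onto itself. It then preserves a set of finite positive measure, which forces
    a determinant of absolute value 1. *)
Lemma param_transition K m n (N N' : 'M[R]_(m, n)) (c c' : 'rV[R]_n) (H H' : 'M[R]_(n, m)) :
  N *m H = 1%:M -> N' *m H' = 1%:M ->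
  (fun t => t *m N + c) @` @ref_cell R m K = (fun t => t *m N' + c') @` @ref_cell R m K ->
  exists (B : 'M[R]_m) (b : 'rV[R]_m), [/\ `|\det B| = 1, B \in unitmx,
    N = B *m N', c = b *m N' + c' & forall t, ref_cell K t <-> ref_cell K (t *m B + b)].
Proof.
(* One inclusion of images determines the affine change of parameter: it is read off at 0 and at the
   unit vectors, which lie in the cell. *)
have key (P P' : 'M[R]_(m, n)) (e e' : 'rV[R]_n) (Q' : 'M[R]_(n, m)) : P' *m Q' = 1%:M ->
    (fun t => t *m P + e) @` @ref_cell R m K `<=` (fun t => t *m P' + e') @` @ref_cell R m K ->
    let B := P *m Q' in let b := (e - e') *m Q' in
    [/\ P = B *m P', e = b *m P' + e' & forall t, ref_cell K t -> ref_cell K (t *m B + b)].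
  move=> PQ sub B b.
  have h t : ref_cell K t -> ref_cell K (t *m B + b) /\
      t *m P + e = (t *m B + b) *m P' + e'.
    move=> rt; have [t' rt' E] : ((fun t => t *m P' + e') @` @ref_cell R m K) (t *m P + e).
      by apply: sub; exists t.
    suff -> : t *m B + b = t' by [].
    rewrite /B /b mulmxA -mulmxDl addrA -E addrK -mulmxA PQ mulmx1 //.
  have [_] := h 0 (@ref_cell0 m K); rewrite !mul0mx !add0r => eE.
  split => //; last by move=> t /h[].
  apply/row_matrixP => k; rewrite !rowE.
  have [_] := h _ (@ref_cell_delta m K k).
  rewrite {1}eE addrA => /addIr; rewrite mulmxDl => /addIr.
  by rewrite mulmxA.
move=> NH NH' FF.
have /seteqP[F1 F2] := FF.
have [E1 E2 E3] := @key N N' c c' H' NH' F1.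
have [E1' E2' E3'] := @key N' N c' c H NH F2.
set B := N *m H' in E1 E3; set b := (c - c') *m H' in E2 E3.
set B' := N' *m H in E1' E3'; set b' := (c' - c) *m H in E2' E3'.
have BB : B *m B' = 1%:M by rewrite /B' mulmxA -E1.
have uB : B \in unitmx by have [] := mulmx1_unit BB.
have tt t : (t *m B + b) *m B' + b' = t.
  rewrite mulmxDl -mulmxA BB mulmx1 -addrA.
  suff -> : b *m B' + b' = 0 by rewrite addr0.
  rewrite /B' mulmxA /b' -mulmxDl.
  suff -> : b *m N' + (c' - c) = 0 by rewrite mul0mx.
  by rewrite addrA -E2 subrr.
have iff t : ref_cell K t <-> ref_cell K (t *m B + b).
  by split => [|/E3']; [exact: E3|rewrite tt].
exists B, b; split => //.
have := lebesgue_rV_affine b uB (@measurable_ref_cell m K).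
rewrite (_ : _ @^-1` _ = ref_cell K); last by apply/seteqP; split => t; [exact: (iff t).2|exact: (iff t).1].
have := @ref_cell_pos m K; have := @ref_cell_fin m K.
case: (lam m (ref_cell K)) => // r _; rewrite lte_fin => r0 [].
by move=> /eqP; rewrite -subr_eq0 -{1}[r]mul1r -mulrBl mulf_eq0 (gt_eqF r0) orbF subr_eq0 => /eqP.
Qed.

Lemma Rintegral_ref_automorphism K m (B : 'M[R]_m) (b : 'rV[R]_m) (f : 'rV[R]_m -> R) :
  `|\det B| = 1 -> B \in unitmx -> (forall t, ref_cell K t <-> ref_cell K (t *m B + b)) ->
  continuous f ->
  \int[lam m]_(t in ref_cell K) f (t *m B + b) = \int[lam m]_(t in ref_cell K) f t.
Proof.
move=> dB uB iff cf.
rewrite [RHS](Rintegral_affine b uB)//; last 3 first.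
- exact: measurable_ref_cell.
- exact: continuous_measurable_rV.
- exact: integrable_ref.
rewrite dB mul1r (_ : _ @^-1` _ = ref_cell K)//.
by apply/seteqP; split => t; [exact: (iff t).2|exact: (iff t).1].
Qed.

End reference_geometry.

(** * Facets and the divergence theorem on the reference cell *)

Section facets_of_reference_cell.
Variables (R : realType) (m : nat).
Local Notation d := m.+1.
Local Notation lam n := (lebesgue_rV R n).

(** The coordinate that [facet_par] computes from the others; on the slanted facet it is the last
    one. *)
Definition dropi K : facet_ix d K -> 'I_d :=
  match K with
  | Simplex => fun j => if j is Some i then i else ord_max
  | Cube => fun j => j.1
  end.

(* the constant covector by which the outward normal flux through the j-th     *)
(* facet is measured in the parameters of [facet_par] *)
Definition nu K : facet_ix d K -> 'cV[R]_d :=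
  match K with
  | Simplex => fun j => if j is Some i then - delta_mx i 0 else const_mx 1
  | Cube => fun j => if j.2 then delta_mx j.1 0 else - delta_mx j.1 0
  end.

Definition fval K : facet_ix d K -> 'rV[R]_m -> R :=
  match K with
  | Simplex => fun j t => if j is Some i then 0 else 1 - \sum_k t 0 k
  | Cube => fun j t => (j.2)%:R
  end.

Lemma facet_par_insert K (j : facet_ix d K) (t : 'rV[R]_m) :
  facet_par j t = @insert_coord R d (dropi j) (fval j t) t.
Proof.
case: K j => [[i|]|[i b]] //=; apply/rowP => l; rewrite !mxE.
case: (unliftP ord_max l) => [k ->|->].
  by rewrite /= /bump leqNgt ltn_ord add0n valK.
by rewrite insubF// /= ltnn.
Qed.

Lemma insert_form K (j : facet_ix d K) (a : R) (t : 'rV[R]_m) :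
  facet_form j (@insert_coord R d (dropi j) a t) = (nu j (dropi j) 0) * (fval j t - a).
Proof.
case: K j => [[i|]|[i b]] /=.
- by rewrite !mxE !eqxx unlift_none sub0r mulN1r opprK.
- rewrite (bigD1_ord ord_max)//= !mxE unlift_none mul1r.
  under eq_bigr do rewrite mxE liftK.
  by rewrite opprD addrCA addrC.
case: b => /=; rewrite !mxE !eqxx unlift_none ?mul1r//.
by rewrite sub0r mulN1r opprK.
Qed.

Lemma nu_dropi K (j : facet_ix d K) : nu j (dropi j) 0 = 1 \/ nu j (dropi j) 0 = -1.
Proof.
case: K j => [[i|]|[i []]] /=; rewrite !mxE ?eqxx/=; by [right|left].
Qed.

Lemma facet_formE K (j : facet_ix d K) (x : 'rV[R]_d) :
  facet_form j x = facet_form j (0 : 'rV[R]_d) - (x *m nu j) 0 0.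
Proof.
have e (i : 'I_d) : (x *m delta_mx i 0 : 'M[R]_1) 0 0 = x 0 i.
  by rewrite -colE mxE.
have eN (i : 'I_d) : (x *m - delta_mx i 0 : 'M[R]_1) 0 0 = - x 0 i.
  by rewrite mulmxN mxE e.
case: K j => [[i|]|[i []]] /=; rewrite ?e ?eN ?[(0 : 'rV[R]_d) 0 i]mxE ?subr0 ?sub0r ?opprK//.
rewrite [X in _ = 1 - X - _]big1 ?subr0; last by move=> l _; rewrite mxE.
by congr (1 - _); rewrite mxE; apply: eq_bigr => l _; rewrite mxE mulr1.
Qed.

Definition drop_mx (i : 'I_d) : 'M[R]_(d, m) := \matrix_(l, k) (l == lift i k)%:R.

Lemma mul_drop_mx (i : 'I_d) (x : 'rV[R]_d) k : (x *m drop_mx i) 0 k = x 0 (lift i k).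
Proof.
rewrite mxE (bigD1 (lift i k))//= mxE eqxx mulr1 big1 ?addr0// => l lk.
by rewrite mxE (negbTE lk) mulr0.
Qed.

Lemma insert_drop (i : 'I_d) (x : 'rV[R]_d) : insert_coord i (x 0 i) (x *m drop_mx i) = x.
Proof.
apply/rowP => l; rewrite mxE; case: (unliftP i l) => [k|] ->//.
by rewrite mul_drop_mx.
Qed.

Lemma drop_insert (i : 'I_d) a (t : 'rV[R]_m) : @insert_coord R d i a t *m drop_mx i = t.
Proof. by apply/rowP => k; rewrite mul_drop_mx mxE liftK. Qed.

Lemma facet_par_drop K (j : facet_ix d K) (t : 'rV[R]_m) :
  facet_par j t *m drop_mx (dropi j) = t.
Proof. by rewrite facet_par_insert drop_insert. Qed.

Definition facet_mx K (j : facet_ix d K) : 'M[R]_(m, d) :=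
  \matrix_(k < m) (facet_par j (delta_mx 0 k) - facet_par j (0 : 'rV[R]_m)).

Lemma facet_parE K (j : facet_ix d K) (t : 'rV[R]_m) :
  facet_par j t = t *m facet_mx j + facet_par j (0 : 'rV[R]_m).
Proof.
have vE : fval j t = fval j 0 + \sum_k t 0 k * (fval j (delta_mx 0 k) - fval j 0).
  case: K j => [[i|]|[i b]] /=.
  - by rewrite big1 ?addr0// => k _; rewrite subr0 mulr0.
  - have z0 : \sum_k (0 : 'rV[R]_m) 0 k = 0 by rewrite big1// => k _; rewrite mxE.
    have dk k : \sum_l (delta_mx 0 k : 'rV[R]_m) 0 l = 1.
      rewrite (bigD1 k)//= mxE !eqxx big1 ?addr0// => l /negbTE lk.
      by rewrite mxE lk andbF.
    rewrite z0 subr0; congr (_ + _); rewrite -sumrN; apply: eq_bigr => k _.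
    by rewrite dk subrr sub0r mulrN1.
  - by rewrite big1 ?addr0// => k _; rewrite subrr mulr0.
apply/rowP => l; rewrite [RHS]mxE mxE.
under eq_bigr do rewrite mxE [X in _ * X]mxE [X in _ * (_ + X)]mxE !facet_par_insert.
rewrite !facet_par_insert; case: (unliftP (dropi j) l) => [k|] ->.
  under eq_bigr do rewrite ![insert_coord _ _ _ 0 _]mxE liftK !mxE.
  rewrite !mxE liftK mxE addr0 (bigD1 k)//= !eqxx subr0 mulr1 big1 ?addr0//.
  by move=> i /negbTE ik; rewrite ?eqxx (eq_sym k) ik /= subr0 mulr0.
rewrite !mxE unlift_none vE addrC; congr (_ + _).
by apply: eq_bigr => k _; rewrite !mxE unlift_none.
Qed.

Lemma facet_mxK K (j : facet_ix d K) : facet_mx j *m drop_mx (dropi j) = 1%:M.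
Proof.
apply/row_matrixP => k; rewrite row_mul rowK mulmxBl !facet_par_drop subr0.
by apply/rowP => l; rewrite !mxE eqxx eq_sym.
Qed.

Lemma facet_par_form K (j : facet_ix d K) (t : 'rV[R]_m) : facet_form j (facet_par j t) = 0.
Proof. by rewrite facet_par_insert insert_form subrr mulr0. Qed.

Lemma facet_par_of_form K (j : facet_ix d K) (x : 'rV[R]_d) :
  facet_form j x = 0 -> x = facet_par j (x *m drop_mx (dropi j)).
Proof.
rewrite -{1}(insert_drop (dropi j) x) insert_form facet_par_insert => /eqP.
rewrite mulf_eq0 => /orP[|].
  by case: (nu_dropi j) => ->; rewrite ?oppr_eq0 oner_eq0.
by rewrite subr_eq0 => /eqP ->; rewrite insert_drop.
Qed.

Lemma mulmx_facet_mx_nu K (j : facet_ix d K) : facet_mx j *m nu j = 0.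
Proof.
apply/row_matrixP => k; rewrite row_mul rowK row0.
have h (t : 'rV[R]_m) : facet_par j t *m nu j = (facet_form j (0 : 'rV[R]_d))%:M.
  apply/rowP => l; rewrite ord1 [RHS]mxE mulr1n; apply/eqP.
  by rewrite eq_sym -subr_eq0 -facet_formE facet_par_form.
by rewrite mulmxBl !h subrr.
Qed.

(** Length of the fibre of the cell over [t]. It is the same whichever coordinate is singled out,
    and the cell is the region under its graph. *)
Definition ref_len K : 'rV[R]_m -> R :=
  match K with Simplex => fun t => 1 - \sum_k t 0 k | Cube => fun=> 1 end.

Lemma ref_cell_insert K (i : 'I_d) (a : R) (t : 'rV[R]_m) :
  ref_cell K (@insert_coord R d i a t) <-> ref_cell K t /\ 0 <= a <= ref_len K t.
Proof.
have sE : \sum_l (@insert_coord R d i a t) 0 l = a + \sum_k t 0 k.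
  rewrite (bigD1_ord i)//= mxE unlift_none; congr (_ + _).
  by apply: eq_bigr => k _; rewrite mxE liftK.
split.
  case: K => h.
    have a0 : 0 <= a by have := h (Some i); rewrite /= mxE unlift_none.
    have t0 k : 0 <= t 0 k by have := h (Some (lift i k)); rewrite /= mxE liftK.
    have := h None; rewrite /= sE opprD addrCA addrC => h1.
    split; first by case=> [k|] //=; rewrite subr_ge0; lra.
    by rewrite a0 /=; lra.
  have t0 k b := h (lift i k, b).
  split; first by move=> [k b]; have := t0 k b; case: b => /=; rewrite mxE liftK.
  have := h (i, true); have := h (i, false); rewrite /= mxE unlift_none => -> /=.
  by rewrite subr_ge0.
case: K => /= -[h /andP[a0 a1]].
  case=> [l|] /=; last by rewrite sE; lra.
  by rewrite mxE; case: (unliftP i l) => [k|] _ //; exact: (h (Some k)).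
move=> [l b] /=; rewrite mxE; case: (unliftP i l) => [k|] _; last by case: b; rewrite ?subr_ge0.
exact: (h (k, b)).
Qed.

Lemma facet_par_cell K (j : facet_ix d K) (t : 'rV[R]_m) :
  ref_cell K t -> ref_cell K (facet_par j t).
Proof.
move=> rt; rewrite facet_par_insert; apply/ref_cell_insert; split => //.
case: K j rt => [[i|]|[i b]] rt /=; first by rewrite lexx; exact: (rt None).
  by rewrite lexx andbT; exact: (rt None).
by case: b; rewrite /= ?lexx ?ler01.
Qed.

Lemma facet_par_image K (j : facet_ix d K) :
  facet_par j @` ref_cell K = [set x : 'rV[R]_d | ref_cell K x /\ facet_form j x = 0].
Proof.
apply/seteqP; split => [_ [t rt <-]|x [rx fx]].
  by split; [exact: facet_par_cell|exact: facet_par_form].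
exists (x *m drop_mx (dropi j)); last by rewrite -facet_par_of_form.
by move: rx; rewrite -{1}(insert_drop (dropi j) x) => /ref_cell_insert[].
Qed.

Lemma continuous_facet_par K (j : facet_ix d K) : continuous (fun t : 'rV[R]_m => facet_par j t).
Proof.
rewrite (_ : (fun t => _) = fun t => t *m facet_mx j + facet_par j (0 : 'rV[R]_m)).
  exact: continuous_affine_map.
by apply/funext => t; exact: facet_parE.
Qed.

(** Integrating along axis [i] yields the slanted facet as a graph over the other coordinates,
    whereas [facet_par] always solves for the last coordinate. Both parametrize the same set, so
    they differ by a volume preserving automorphism of the simplex. *)
Lemma Rintegral_slanted (i : 'I_d) (w : 'rV[R]_d -> R) : continuous w ->
  \int[lam m]_(t in ref_cell Simplex) w (@insert_coord R d i (1 - \sum_k t 0 k) t) =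
  \int[lam m]_(t in ref_cell Simplex) w (@facet_par R d Simplex None t).
Proof.
move=> cw.
pose N (i : 'I_d) : 'M[R]_(m, d) := \matrix_(k, l) if unlift i l is Some k' then (k == k')%:R else -1.
pose c (i : 'I_d) : 'rV[R]_d := delta_mx 0 i.
have NE i' (t : 'rV[R]_m) : @insert_coord R d i' (1 - \sum_k t 0 k) t = t *m N i' + c i'.
  apply/rowP => l; rewrite !mxE eqxx /=; case: (unliftP i' l) => [k|] E.
    rewrite E eq_sym (negbTE (neq_lift _ _)) addr0 (bigD1 k)//= mxE liftK eqxx mulr1 big1 ?addr0//.
    by move=> k' /negbTE kk; rewrite mxE liftK kk mulr0.
  rewrite E eqxx addrC; congr (_ + _); rewrite -sumrN; apply: eq_bigr => k _.
  by rewrite mxE unlift_none mulrN1.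
have NH i' : N i' *m drop_mx i' = 1%:M.
  apply/row_matrixP => k; rewrite row_mul; apply/rowP => l.
  by rewrite mul_drop_mx !mxE liftK.
have img i' : (fun t => t *m N i' + c i') @` @ref_cell R m Simplex =
    [set x : 'rV[R]_d | ref_cell Simplex x /\ facet_form (None : facet_ix d Simplex) x = 0].
  have fE (t : 'rV[R]_m) : 1 - \sum_l (@insert_coord R d i' (1 - \sum_k t 0 k) t) 0 l = 0.
    rewrite (bigD1_ord i')//= mxE unlift_none.
    rewrite [X in 1 - (_ + X)](eq_bigr (fun k => t 0 k)); last by move=> k _; rewrite mxE liftK.
    by rewrite subrK subrr.
  apply/seteqP; split => [_ [t rt <-]|x [rx fx]].
    rewrite -NE; split; last exact: fE.
    apply: (ref_cell_insert Simplex i' _ t).2; split => //=.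
    by rewrite lexx andbT; exact: (rt None).
  exists (x *m drop_mx i').
    by move: rx; rewrite -{1}(insert_drop i' x) => /(ref_cell_insert Simplex)[].
  rewrite -NE -[RHS](insert_drop i' x); congr (insert_coord _ _ _).
  under eq_bigr do rewrite mul_drop_mx.
  have {}fx : 1 - \sum_l x 0 l = 0 by exact: fx.
  by move: fx; rewrite (bigD1_ord i')//= opprD addrA => /subr0_eq <-; ring.
have [B [b [dB uB NB cB iff]]] := param_transition (NH i) (NH ord_max) (etrans (img i) (esym (img ord_max))).
have pE (t : 'rV[R]_m) : @facet_par R d Simplex None t = t *m N ord_max + c ord_max.
  by rewrite -NE facet_par_insert.
rewrite -[RHS](Rintegral_ref_automorphism dB uB iff); last first.
  move=> t; apply: (@continuous_comp _ _ _ (fun t : 'rV[R]_m => @facet_par R d Simplex None t) w).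
    exact: continuous_facet_par.
  exact: cw.
apply: eq_Rintegral => t _; congr w.
by rewrite NE pE NB cB mulmxDl mulmxA addrA.
Qed.

(** The fundamental theorem of calculus on each fibre in direction [i] leaves the values at its two
    ends. These ends sweep out the two facets on which [nu] has a nonzero entry [i], with the signs
    of these entries. *)
Lemma ref_divergence K (w : 'rV[R]_d -> R) (i : 'I_d) : Ck 1 w ->
  \int[lam d]_(x in ref_cell K) partial i w x =
  \sum_j nu j i 0 * \int[lam m]_(t in ref_cell K) w (@facet_par R d K j t).
Proof.
move=> cw; have cw0 := Ck1_continuous cw.
have cins (g : 'rV[R]_m -> R) : continuous g ->
    continuous (fun t => w (@insert_coord R d i (g t) t)).
  move=> cg t; apply: (@continuous_comp _ _ _ (fun t => @insert_coord R d i (g t) t) w); last exact: cw0.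
  apply: continuous_to_rV => l s; case: (unliftP i l) => [k|] ->.
    rewrite (_ : (fun x => _) = fun x : 'rV[R]_m => x 0 k); first exact: coord_continuous.
    by apply/funext => b; rewrite mxE liftK.
  rewrite (_ : (fun x => _) = g); first exact: cg.
  by apply/funext => b; rewrite mxE unlift_none.
have clen : continuous (ref_len K).
  case: K => /=; last exact: cst_continuous.
  exact: (@continuous_facet_form R m Simplex None).
rewrite (Rintegral_insert (i := i) (E := ref_cell K) (l := ref_len K) (M := 1)); last 4 first.
- exact: Ck1_partial.
- exact: measurable_ref_cell.
- exact: ref_cell_inbox.
- by move=> a t; exact: ref_cell_insert.
transitivity (\int[lam m]_(t in ref_cell K)
    (w (@insert_coord R d i (ref_len K t) t) - w (@insert_coord R d i 0 t))).
  apply: eq_Rintegral => t; rewrite inE => rt; apply: C1_FTC => //.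
  by case: K rt {clen} => //= rt; exact: (rt None).
rewrite RintegralB; last 3 first.
- exact: measurable_ref_cell.
- by apply: integrable_ref; exact: cins.
- by apply: integrable_ref; apply: (cins (fun=> 0)); exact: cst_continuous.
case: K clen => clen.
  rewrite Rintegral_slanted//.
  transitivity (\sum_(j : option 'I_d) @nu Simplex j i 0 *
      \int[lam m]_(t in ref_cell Simplex) w (@facet_par R d Simplex j t)) => //.
  rewrite (bigD1 None)//= mxE mul1r; congr (_ + _).
  rewrite (bigD1 (Some i))//= !mxE !eqxx /= mulN1r big1 ?addr0//.
  move=> [k|]// /andP[_ ki]; rewrite !mxE eqxx andbT.
  have -> : (i == k) = false by apply/negbTE; apply: contra ki => /eqP ->.
  by rewrite oppr0 mul0r.
transitivity (\sum_(j : 'I_d * bool) @nu Cube j i 0 *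
      \int[lam m]_(t in ref_cell Cube) w (@facet_par R d Cube j t)) => //.
have nT : @nu Cube (i, true) i 0 = 1 by rewrite /nu /= mxE !eqxx.
have nF : @nu Cube (i, false) i 0 = -1 by rewrite /nu /= !mxE !eqxx.
have n0 k b : k != i -> @nu Cube (k, b) i 0 = 0.
  move=> ki; have {}ki : (i == k) = false by rewrite eq_sym (negbTE ki).
  by case: b; rewrite /nu /= !mxE ki /= ?oppr0.
rewrite (bigD1 (i, true))// nT mul1r; congr (_ + _).
rewrite (bigD1 (i, false)) ?xpair_eqE ?eqxx//= nF mulN1r big1; first by rewrite [RHS]addr0.
move=> [k b] /= /andP[k1 k2]; rewrite n0 ?mul0r//.
by apply/eqP => ki; move: k1 k2; rewrite ki; case: b; rewrite eqxx.
Qed.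

(** In [y] this determinant is the generalized cross product of the tangent rows. A row operation
    removes the tangential part of [y]; what remains is a multiple of one coordinate vector, whose
    minor is an identity matrix. The formula later shows that conormals belong to facets and not to
    their parametrizations. *)
Lemma det_col_facet_mx K (j : facet_ix d K) : exists2 k : R, k ^+ 2 = 1 &
  forall y : 'rV[R]_d, \det (col_mx y (facet_mx j) : 'M[R]_(1 + m)) = k * (y *m nu j) 0 0.
Proof.
set i := dropi j; pose c := nu j i 0.
have c2 : c ^+ 2 = 1 by case: (nu_dropi j); rewrite -/c => ->; rewrite ?sqrrN expr1n.
exists (c * (-1) ^+ i); first by rewrite exprMn c2 mul1r -exprM mulnC exprM sqrrN !expr1n.
move=> y; set s := (y *m nu j) 0 0.
pose t := (y - (s * c) *: delta_mx 0 i) *m drop_mx i.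
have yE : y = t *m facet_mx j + (s * c) *: delta_mx 0 i.
  pose x := y - (s * c) *: delta_mx 0 i.
  have x0 : (x *m nu j) 0 0 = 0.
    rewrite mulmxBl -scalemxAl -rowE [LHS]mxE -/s.
    by rewrite [X in _ + X]mxE [X in _ - X]mxE [X in _ - _ * X]mxE -/c -mulrA -expr2 c2 mulr1 subrr.
  have := facet_par_of_form (j := j) (x := x + facet_par j 0).
  rewrite facet_formE mulmxDl mxE x0 add0r -facet_formE facet_par_form => /(_ erefl).
  move=> E; rewrite [RHS]facet_parE in E; move/addIr: E.
  rewrite mulmxDl facet_par_drop -/i => E; rewrite -[LHS](subrK ((s * c) *: delta_mx 0 i)) -/x.
  congr (_ + _); rewrite {}E.
  by rewrite addr0.
transitivity (\det ((block_mx 1%:M t 0 1%:M : 'M[R]_(1 + m)) *m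
    (col_mx ((s * c) *: delta_mx 0 i) (facet_mx j) : 'M[R]_(1 + m)))).
  congr (\det _); rewrite mul_block_col !mul1mx mul0mx add0r.
  by congr col_mx; rewrite addrC.
rewrite det_mulmx det_ublock !det1 !mul1r.
rewrite (expand_det_row _ 0) (bigD1 i)//= big1 ?addr0; last first.
  move=> l li; rewrite (_ : (col_mx _ _ : 'M[R]_(1 + m)) 0 l = 0) ?mul0r//.
  have -> : (0 : 'I_(1 + m)) = lshift m (0 : 'I_1) by exact/val_inj.
  by rewrite col_mxEu !mxE (negbTE li) andbF mulr0.
rewrite (_ : (col_mx _ _ : 'M[R]_(1 + m)) 0 i = s * c); last first.
  have -> : (0 : 'I_(1 + m)) = lshift m (0 : 'I_1) by exact/val_inj.
  by rewrite col_mxEu !mxE !eqxx mulr1.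
rewrite /cofactor (_ : row' 0 (col' i _) = 1%:M).
  by rewrite det1 mulr1 add0n; ring.
apply/matrixP => k l; rewrite -(facet_mxK j) -/i.
rewrite [LHS]mxE [LHS]mxE.
have -> : lift (0 : 'I_(1 + m)) k = rshift 1 k by exact/val_inj.
transitivity (facet_mx j k (lift i l)); first exact: col_mxEd.
have := mul_drop_mx i (row k (facet_mx j)) l; rewrite -row_mul.
by rewrite [X in X = _ -> _]mxE [X in _ = X -> _]mxE => ->.
Qed.

End facets_of_reference_cell.

Lemma facet_form_line (R : realType) d K (j : facet_ix d K) (x y : 'rV[R]_d) (e : R) :
  facet_form j (x + e *: (y - x)) = (1 - e) * facet_form j x + e * facet_form j y.
Proof.
case: K j => [[i|]|[i []]] /=; rewrite ?mxE; try ring.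
under eq_bigr do rewrite !mxE; rewrite big_split -mulr_sumr sumrB /=; ring.
Qed.

Section facet_interior.
Variables (R : realType) (m : nat).
Local Notation d := m.+1.

Lemma facet_mx_decomp K (j : facet_ix d K) (y : 'rV[R]_d) : exists t : 'rV[R]_m,
  y = t *m facet_mx R j + ((y *m nu R j) 0 0 * nu R j (dropi j) 0) *: delta_mx 0 (dropi j).
Proof.
set i := dropi j; set c := nu R j i 0; set s := (y *m nu R j) 0 0.
have c2 : c * c = 1 by case: (nu_dropi R j); rewrite -/i -/c => ->; rewrite ?mulrNN mulr1.
pose x := y - (s * c) *: delta_mx 0 i.
exists (x *m drop_mx R i).
have x0 : (x *m nu R j) 0 0 = 0.
  rewrite mulmxBl -scalemxAl -rowE [LHS]mxE -/s.
  by rewrite [X in _ + X]mxE [X in _ - X]mxE [X in _ - _ * X]mxE -/c -mulrA c2 mulr1 subrr.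
have := facet_par_of_form (j := j) (x := x + facet_par j 0).
rewrite facet_formE mulmxDl mxE x0 add0r -facet_formE facet_par_form => /(_ erefl) E.
rewrite [RHS]facet_parE in E; move/addIr: E.
rewrite mulmxDl facet_par_drop -/i => E; rewrite -[LHS](subrK ((s * c) *: delta_mx 0 i)) -/x.
by congr (_ + _); rewrite {1}E addr0.
Qed.

(** The tangent rows together with one coordinate vector span the space, so a covector that
    annihilates the tangents is determined by a single entry. *)
Lemma facet_mx_kernel K (j : facet_ix d K) (v : 'cV[R]_d) : facet_mx R j *m v = 0 ->
  v = (nu R j (dropi j) 0 * v (dropi j) 0) *: nu R j.
Proof.
move=> Nv; apply/colP => k.
have [t E] := facet_mx_decomp j (delta_mx 0 k).
have nk : ((delta_mx 0 k : 'rV[R]_d) *m nu R j) 0 0 = nu R j k 0 by rewrite -rowE mxE.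
have vk : ((delta_mx 0 k : 'rV[R]_d) *m v) 0 0 = v k 0 by rewrite -rowE mxE.
rewrite nk in E; move: vk; rewrite {1}E mulmxDl -mulmxA Nv mulmx0 add0r -scalemxAl -rowE.
rewrite [X in X = _ -> _]mxE [X in _ * X = _ -> _]mxE => <-; rewrite [RHS]mxE; ring.
Qed.

Lemma facet_par_interior K (j k : facet_ix d K) (t : 'rV[R]_m) :
  ref_interior K t -> k != j -> 0 < facet_form k (facet_par j t).
Proof.
move=> rt kj; rewrite facet_par_insert.
have sE i a : \sum_l (@insert_coord R d i a t) 0 l = a + \sum_k t 0 k.
  rewrite (bigD1_ord i)//= mxE unlift_none; congr (_ + _).
  by apply: eq_bigr => l _; rewrite mxE liftK.
case: K j k rt kj => [j k|[i b] [l b']] rt kj.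
  have t0 : 0 < 1 - \sum_k t 0 k := rt None.
  have tk k' : 0 < t 0 k' := rt (Some k').
  case: j k kj => [i|] [l|]//= kj.
  - rewrite mxE; case: (unliftP i l) => [k _|E]; first by [].
    by move: kj; rewrite E eqxx.
  - by rewrite sE add0r.
  - by rewrite mxE; case: (unliftP ord_max l) => [k _|E].
have tk k' b0 : 0 < if b0 then 1 - t 0 k' else t 0 k' := rt (k', b0).
rewrite /= mxE; case: (unliftP i l) => [k E|E]; first exact: tk.
move: kj; rewrite E xpair_eqE eqxx /=; by case: b; case: b' => //= _; rewrite ?subr0.
Qed.

Lemma nu_neq0 K (j : facet_ix d K) : nu R j != 0.
Proof.
apply/eqP => h; case: (nu_dropi R j); rewrite h mxE => /eqP; rewrite eq_sym ?oppr_eq0 oner_eq0 //.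
Qed.

End facet_interior.

(** * Conormals and the pairing of mesh facets *)

Section mesh_cells.
Variables (R : realType) (m : nat) (K : ref_shape) (M : mesh R m.+1 K).
Local Notation d := m.+1.
Local Notation lam n := (lebesgue_rV R n).
Implicit Types (T : elt M) (s : side M).

Definition JT T : 'M[R]_d := (jac T)^T.

Lemma unit_JT T : JT T \in unitmx. Proof. by rewrite unitmx_tr jac_unit. Qed.

Lemma det_JT T : \det (JT T) = \det (jac T). Proof. exact: det_tr. Qed.

Lemma Phi_invE T (x : 'rV[R]_d) : Phi_inv T x = (x - offset T) *m invmx (JT T).
Proof. by rewrite /Phi_inv trmx_inv. Qed.

Lemma PhiK T (x : 'rV[R]_d) : Phi_inv T (Phi T x) = x.
Proof. by rewrite Phi_invE /Phi addrK mulmxK// unit_JT. Qed.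

Lemma Phi_invK T (x : 'rV[R]_d) : Phi T (Phi_inv T x) = x.
Proof. by rewrite Phi_invE /Phi -/(JT T) mulmxKV ?unit_JT// subrK. Qed.

Lemma Phi_inv_affine T (x : 'rV[R]_d) :
  Phi_inv T x = x *m invmx (JT T) + - (offset T *m invmx (JT T)).
Proof. by rewrite Phi_invE mulmxBl. Qed.

Lemma continuous_Phi T : continuous (Phi T).
Proof. exact: continuous_affine_map. Qed.

Lemma continuous_Phi_inv T : continuous (Phi_inv T).
Proof.
rewrite (_ : Phi_inv T = fun x => x *m invmx (JT T) + - (offset T *m invmx (JT T))).
  exact: continuous_affine_map.
by apply/funext => x; exact: Phi_inv_affine.
Qed.

Lemma cellP T (x : 'rV[R]_d) : cell T x <-> ref_cell K (Phi_inv T x).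
Proof.
split => [[y ry <-]|h]; first by rewrite PhiK.
by exists (Phi_inv T x) => //; rewrite Phi_invK.
Qed.

Definition cell_interior T : set 'rV[R]_d := Phi_inv T @^-1` ref_interior K.

Lemma closed_cell T : closed (cell T).
Proof.
rewrite (_ : cell T = Phi_inv T @^-1` ref_cell K).
  apply: (continuous_closedP _).1; first exact: continuous_Phi_inv.
  exact: closed_ref_cell.
by apply/seteqP; split => x /cellP.
Qed.

Lemma measurable_cell T : measurable (cell T).
Proof. by apply: closed_measurable_rV; exact: closed_cell. Qed.

Lemma open_cell_interior T : open (cell_interior T).
Proof.
apply: (continuousP _).1; first exact: continuous_Phi_inv.
exact: open_ref_interior.
Qed.

Lemma sub_cell_interior T : cell_interior T `<=` interior (cell T).
Proof.
move=> x hx; apply: (@filterS _ _ _ (cell_interior T)).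
  by move=> y /ref_interior_sub/cellP.
by apply: open_nbhs_nbhs; split => //; exact: open_cell_interior.
Qed.

Lemma cell_interior_neq0 T : cell_interior T !=set0.
Proof.
have [x hx] := @ref_interior_neq0 R d K; exists (Phi T x).
by rewrite /cell_interior /= PhiK.
Qed.

Lemma Phi_inv_line T (x y : 'rV[R]_d) (e : R) :
  Phi_inv T (x + e *: (y - x)) = Phi_inv T x + e *: (Phi_inv T y - Phi_inv T x).
Proof.
rewrite !Phi_inv_affine mulmxDl -scalemxAl mulmxBl.
by rewrite [in RHS]opprD addrACA subrr addr0 addrAC.
Qed.

Definition facet_map s (t : 'rV[R]_m) : 'rV[R]_d := Phi s.1 (facet_par s.2 t).

Definition facet_lin s : 'M[R]_(m, d) := facet_mx R s.2 *m JT s.1.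

Lemma facet_mapE s t : facet_map s t = t *m facet_lin s + facet_map s 0.
Proof. by rewrite /facet_map /Phi facet_parE mulmxDl -/(JT _) -mulmxA addrA. Qed.

Lemma continuous_facet_map s : continuous (facet_map s).
Proof.
rewrite (_ : facet_map s = fun t => t *m facet_lin s + facet_map s 0).
  exact: continuous_affine_map.
by apply/funext => t; exact: facet_mapE.
Qed.

Lemma facetE s : facet s = facet_map s @` ref_cell K.
Proof.
rewrite /facet /face; have := facet_par_image R s.2.
move=> /seteqP[h1 h2]; apply/seteqP; split => [_ [x [rx fx] <-]|_ [t rt <-]].
  have [t rt <-] : (facet_par s.2 @` ref_cell K) x.
    by apply: h2; split => //; apply: fx; rewrite finset.in_set1.
  by exists t.
exists (facet_par s.2 t) => //; have [] := h1 (facet_par s.2 t); first by exists t.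
by move=> rc fc; split => // j; rewrite finset.in_set1 => /eqP ->.
Qed.

Lemma facet_transition s s' : facet s = facet s' ->
  exists (B : 'M[R]_m) (b : 'rV[R]_m), [/\ `|\det B| = 1, B \in unitmx,
    facet_lin s = B *m facet_lin s',
    forall t, facet_map s t = facet_map s' (t *m B + b) &
    forall t : 'rV[R]_m, ref_cell K t <-> ref_cell K (t *m B + b)].
Proof.
move=> ss.
have NH s0 : facet_lin s0 *m (invmx (JT s0.1) *m drop_mx R (dropi s0.2)) = 1%:M.
  by rewrite mulmxA mulmxK ?unit_JT// facet_mxK.
have img s0 : (fun t => t *m facet_lin s0 + facet_map s0 0) @` ref_cell K = facet s0.
  by rewrite facetE; congr (_ @` _); apply/funext => t; rewrite -facet_mapE.
have [B [b [dB uB NB cB iff]]] := param_transition (NH s) (NH s')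
  (etrans (img s) (etrans ss (esym (img s')))).
exists B, b; split => // t.
by rewrite facet_mapE NB cB [RHS]facet_mapE mulmxDl mulmxA addrA.
Qed.

(* |det J| times the flux covector of the reference facet, pulled back to the  *)
(* element: it depends on the facet only, up to the sign given by the side *)
Definition conormal s : 'cV[R]_d := `|\det (JT s.1)| *: (invmx (JT s.1) *m nu R s.2).

Lemma det_JT_gt0 T : 0 < `|\det (JT T)|.
Proof. by rewrite normr_gt0 -unitfE -unitmxE unit_JT. Qed.

Lemma conormal_neq0 s : conormal s != 0.
Proof.
rewrite scaler_eq0 (gt_eqF (det_JT_gt0 _)) /=; apply/eqP => h.
have := congr1 (mulmx (JT s.1)) h; rewrite mulmxA mulmxV ?unit_JT// mul1mx mulmx0.
by move/eqP; rewrite (negbTE (nu_neq0 R s.2)).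
Qed.

(** The cross product formula of the reference facet transported by the element map. The sign of the
    Jacobian determinant is absorbed in [k], because [conormal] carries its absolute value. *)
Lemma det_facet_lin s : exists2 k : R, k ^+ 2 = 1 &
  forall y : 'rV[R]_d, \det (col_mx y (facet_lin s) : 'M[R]_(1 + m)) = k * (y *m conormal s) 0 0.
Proof.
have [k k2 kE] := det_col_facet_mx R s.2.
have [D0|D0] := ltP 0 (\det (JT s.1)); [exists k|exists (- k)]; rewrite ?sqrrN// => y.
all: have -> : \det (col_mx y (facet_lin s) : 'M[R]_(1 + m)) =
    \det ((col_mx (y *m invmx (JT s.1)) (facet_mx R s.2) : 'M[R]_(1 + m)) *m
      (JT s.1 : 'M[R]_(1 + m))).
1,3: by congr (\det _); rewrite mul_col_mx mulmxKV ?unit_JT.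
all: rewrite det_mulmx kE /conormal -scalemxAr [X in _ = _ * X]mxE mulmxA.
  by rewrite gtr0_norm//; ring.
by rewrite ler0_norm//; ring.
Qed.

(** Up to sign the conormal is the cross product of the tangent rows, and two parametrizations of
    one facet change this product by a determinant of absolute value 1. *)
Lemma conormal_same_facet s s' : facet s = facet s' ->
  exists2 k : R, k ^+ 2 = 1 & conormal s = k *: conormal s'.
Proof.
move=> /facet_transition[B [b [dB _ NB _ _]]].
have [k k2 kE] := det_facet_lin s; have [k' k2' kE'] := det_facet_lin s'.
have B2 : (\det B) ^+ 2 = 1 by rewrite -real_normK ?num_real// dB expr1n.
exists (k * \det B * k'); first by rewrite !exprMn k2 k2' B2 !mulr1.
apply/colP => l; rewrite [RHS]mxE.
have cE (v : 'cV[R]_d) : v l 0 = ((delta_mx 0 l : 'rV[R]_d) *m v) 0 0 by rewrite -rowE mxE.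
have h : k * ((delta_mx 0 l : 'rV[R]_d) *m conormal s) 0 0 =
    \det B * (k' * ((delta_mx 0 l : 'rV[R]_d) *m conormal s') 0 0).
  rewrite -kE -kE'.
  transitivity (\det ((block_mx 1%:M 0 0 B : 'M[R]_(1 + m)) *m
      (col_mx (delta_mx 0 l : 'rV[R]_d) (facet_lin s') : 'M[R]_(1 + m)))).
    by congr (\det _); rewrite mul_block_col !mul1mx !mul0mx addr0 add0r NB.
  by rewrite det_mulmx det_ublock det1 mul1r.
rewrite (cE (conormal s)) (cE (conormal s')) -!mulrA -h mulrA -expr2 k2 mul1r //.
Qed.

Lemma form_conormal s (x y : 'rV[R]_d) :
  facet_form s.2 (Phi_inv s.1 y) =
  facet_form s.2 (Phi_inv s.1 x) - `|\det (JT s.1)|^-1 * ((y - x) *m conormal s) 0 0.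
Proof.
rewrite facet_formE (facet_formE s.2 (Phi_inv s.1 x)) -addrA -opprD; congr (_ - _).
rewrite /conormal -scalemxAr [X in _ = _ + _ * X]mxE mulKf ?gt_eqF ?det_JT_gt0//.
rewrite !Phi_invE.
have -> : y - offset s.1 = (x - offset s.1) + (y - x) by rewrite [RHS]addrC addrA subrK.
by rewrite 2!mulmxDl [LHS]mxE -(mulmxA (y - x)).
Qed.

Lemma facet_map_form s t : facet_form s.2 (Phi_inv s.1 (facet_map s t)) = 0.
Proof. by rewrite /facet_map PhiK facet_par_form. Qed.

Section conforming.
Variable Om : set 'rV[R]_d.
Hypotheses (hconf : conforming_partition M Om) (oOm : open Om).

Lemma disjoint_cell_interior T T' x : cell_interior T x -> cell_interior T' x -> T = T'.
Proof.
case: hconf => _ dis _ h h'; apply/eqP; apply/negPn/negP => TT'.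
have : (interior (cell T) `&` interior (cell T')) x by split; exact: sub_cell_interior.
by rewrite dis.
Qed.

(** The two agree up to sign, and equality is excluded: both cells would lie on the same side of the
    facet, and a short segment from a relative interior point [x0] towards an interior point of the
    second cell would run inside both. If both sides belong to one element, a second facet of that
    cell would pass through [x0], where all other facet forms are positive. *)
Lemma conormal_opp s s' : s != s' -> facet s = facet s' -> conormal s' = - conormal s.
Proof.
move=> neq ff; have [t0 ht0] := @ref_interior_neq0 R m K.
pose x0 := facet_map s t0.
have [c0 hc0] := @ref_interior_neq0 R d K.
have x0s' : facet s' x0.
  by rewrite -ff facetE; exists t0 => //; exact: ref_interior_sub.
have [k k2 kE] := conormal_same_facet (esym ff).
have : (k == 1) || (k == -1).
  by rewrite -sqrf_eq1 k2.
case/orP => /eqP k1; last by rewrite kE k1 scaleN1r.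
exfalso; move: kE; rewrite k1 scale1r => cc {k k2 k1}.
have [x1 [rx1 fx1] x1E] := x0s'.
have px1 : Phi_inv s'.1 x0 = x1 by rewrite -x1E PhiK.
have fs' : facet_form s'.2 (Phi_inv s'.1 x0) = 0.
  by rewrite px1; apply: fx1; rewrite finset.in_set1.
have pos l : l != s.2 -> 0 < facet_form l (Phi_inv s.1 x0).
  by move=> ls; rewrite /x0 /facet_map PhiK; exact: facet_par_interior.
have [TT|TT] := eqVneq s.1 s'.1.
  have ls : s'.2 != s.2.
    by apply: contra neq => /eqP js; apply/eqP; case: s s' TT js {ff x0 x0s' cc x1E px1 fs' pos fx1 rx1} => [a b] [a' b'] /= -> ->.
  by have := pos _ ls; rewrite TT fs' ltxx.
pose y := Phi s'.1 c0.
have ys : 0 < facet_form s.2 (Phi_inv s.1 y).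
  rewrite (form_conormal s x0) facet_map_form sub0r -cc -mulrN.
  apply: mulr_gt0; first by rewrite invr_gt0 det_JT_gt0.
  have : 0 < facet_form s'.2 (Phi_inv s'.1 y) by rewrite PhiK.
  rewrite (form_conormal s' x0) fs' sub0r -mulrN pmulr_rgt0// invr_gt0 det_JT_gt0 //.
pose xe (e : R) := x0 + e *: (y - x0).
have in' e : 0 < e < 1 -> cell_interior s'.1 (xe e).
  move=> /andP[e0 e1] l; rewrite Phi_inv_line facet_form_line PhiK px1.
  by apply: ltr_wpDl; [rewrite mulr_ge0 ?subr_ge0 ?(ltW e1)//; exact: rx1|rewrite mulr_gt0].
have : \forall e \near (0 : R)^'+, cell_interior s.1 (xe e).
  apply: (@filter_forall _ (facet_ix d K) (fun l e => 0 < facet_form l (Phi_inv s.1 (xe e))) ((0 : R)^'+) _) => l.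
  have [->|ls] := eqVneq l s.2.
    near=> e; have e0 : 0 < e by near: e; exact: nbhs_right_gt.
    by rewrite Phi_inv_line facet_form_line facet_map_form mulr0 add0r mulr_gt0.
  have p := pos _ ls; set g := facet_form l (Phi_inv s.1 y).
  set q := facet_form l (Phi_inv s.1 x0) in p *.
  have g0 := normr_ge0 g; have den : 0 < q + `|g| + 1 by lra.
  have qd : 0 < q / (q + `|g| + 1) := divr_gt0 p den.
  near=> e; have e0 : 0 < e by near: e; exact: nbhs_right_gt.
  rewrite Phi_inv_line facet_form_line -/g -/q.
  have : e < q / (q + `|g| + 1) by near: e; exact: nbhs_right_lt.
  rewrite ltr_pdivlMr// => eq.
  have := ler_norm (- g); rewrite normrN => gg.
  have : e * (- g) <= e * `|g| by rewrite ler_pM2l.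
  nra.
move=> h; have : \forall e \near (0 : R)^'+, False.
  near=> e.
  have h1 : cell_interior s.1 (xe e) by near: e.
  have h2 : cell_interior s'.1 (xe e).
    apply: in'; apply/andP; split; first by near: e; exact: nbhs_right_gt.
    by near: e; exact: nbhs_right_lt.
  by move/eqP: TT; apply; exact: disjoint_cell_interior h1 h2.
by move=> /filter_ex[].
Unshelve. all: by end_near. Qed.


(** Three sides on one facet would have pairwise opposite conormals, so a nonzero vector would equal
    its own opposite. *)
Lemma same_facet_unique s s1 s2 : s1 != s -> s2 != s -> facet s1 = facet s ->
  facet s2 = facet s -> s1 = s2.
Proof.
move=> n1 n2 f1 f2; apply/eqP; apply: contraT => n12; exfalso.
have c1 : conormal s1 = - conormal s by apply: conormal_opp; rewrite 1?eq_sym.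
have c2 : conormal s2 = - conormal s by apply: conormal_opp; rewrite 1?eq_sym.
have c12 : conormal s2 = - conormal s1 by apply: conormal_opp => //; rewrite f1.
have h : conormal s = - conormal s by rewrite -{1}[conormal s]opprK -c1 -c12 c2.
have : conormal s *+ 2 == 0 by rewrite mulr2n {2}h subrr.
by rewrite -scaler_nat scaler_eq0 pnatr_eq0 /= (negbTE (conormal_neq0 s)).
Qed.

Lemma oppositeP s s' : opposite s = Some s' -> s' != s /\ facet s = facet s'.
Proof.
rewrite /opposite; case: pickP => // s0 /andP[n /asboolP f] [<-] //.
Qed.

Lemma opposite_sym s s' : opposite s = Some s' -> opposite s' = Some s.
Proof.
move=> /oppositeP[n f]; rewrite {1}/opposite; case: pickP => [s0 /andP[n0 /asboolP f0]|].
  have n' : s != s' by rewrite eq_sym.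
  have e := same_facet_unique n0 n' (esym f0) f. by rewrite e.
by move=> /(_ s); rewrite eq_sym n /same_facet /= asboolT.
Qed.

Lemma face_set0 T : face T finset.set0 = cell T.
Proof.
by apply/seteqP; split => [_ [x [rx _] <-]|_ [x rx <-]]; exists x => //; split => // j; rewrite finset.in_set0.
Qed.

Lemma face_subset T (S : {set facet_ix d K}) : face T S `<=` cell T.
Proof. by move=> _ [x [rx _] <-]; exists x. Qed.

Lemma cell_inclusion T T' : cell T `<=` cell T' -> T = T'.
Proof.
move=> sub; have [x hx] := cell_interior_neq0 T.
case: hconf => _ dis _; apply/eqP/negPn/negP => TT'.
have : (interior (cell T) `&` interior (cell T')) x.
  split; first exact: sub_cell_interior.
  by apply: filterS (sub_cell_interior hx); exact: sub.
by rewrite dis.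
Qed.

(** Crossing the facet at a point of the open domain stays in the domain, so a second cell contains
    the point. Conformity makes the intersection a face of both cells. The point lies on no other
    facet of the first cell, so this face is the given facet; it remains to see that a single facet
    of the second cell cuts it out. *)
Lemma unpaired_interior s (t0 : 'rV[R]_m) : ref_interior K t0 -> Om (facet_map s t0) ->
  opposite s <> None.
Proof.
move=> ht0 Omx op; set x0 := facet_map s t0 in Omx.
case: (hconf) => clO _ inter.
have pos l : l != s.2 -> 0 < facet_form l (Phi_inv s.1 x0).
  by move=> ls; rewrite /x0 /facet_map PhiK; exact: facet_par_interior.
(* Otherwise the finitely many other closed cells stay away from [x0]. Moving outwards along the
   conormal leaves the cell of [s] at once but remains in the domain, which the cells cover. *)
have [T' TT' x0T'] : exists2 T', T' != s.1 & cell T' x0.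
  apply: contrapT => no.
  pose w : 'rV[R]_d := (conormal s)^T.
  have ww : 0 < (w *m conormal s) 0 0.
    rewrite mxE; under eq_bigr do rewrite mxE -expr2.
    rewrite lt_neqAle sumr_ge0 ?andbT; last by move=> i _; exact: sqr_ge0.
    rewrite eq_sym psumr_neq0; last by move=> i _; exact: sqr_ge0.
    have /eqP h := conormal_neq0 s; apply/hasP; apply: contrapT => nh; apply: h.
    apply/colP => i; rewrite [RHS]mxE; apply: contrapT => /eqP ci; apply: nh.
    by exists i; rewrite ?mem_index_enum//= lt_neqAle sqr_ge0 andbT eq_sym sqrf_eq0.
  have nr (P : set R) : nbhs (0 : R) P -> \forall e \near (0 : R)^'+, P e.
    by move=> h; rewrite /at_right /within /=; apply: filterS h => e Pe _.
  have cl : continuous (fun e : R => x0 + e *: w).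
    move=> e; apply: (@continuousD _ _ _ (cst x0) (fun e : R => e *: w)).
      exact: cst_continuous.
    exact: scalel_continuous.
  have h T' : T' != s.1 -> \forall e \near (0 : R)^'+, ~ cell T' (x0 + e *: w).
    move=> TT'; apply: nr.
    have : nbhs (x0 + (0 : R) *: w) (~` cell T').
      rewrite scale0r addr0; apply: open_nbhs_nbhs; split; first exact/closed_openC/closed_cell.
      by move=> c; apply: no; exists T'.
    exact: cl.
  have hall : \forall e \near (0 : R)^'+, forall T', T' != s.1 -> ~ cell T' (x0 + e *: w).
    apply: (@filter_forall _ 'I_(nelt M) (fun T' e => T' != s.1 -> ~ cell T' (x0 + e *: w)) ((0 : R)^'+) _) => T'.
    have [->|TT'] := eqVneq T' s.1; first by near=> e.
    by apply: filterS (h _ TT') => e he _.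
  have hOm : \forall e \near (0 : R)^'+, Om (x0 + e *: w).
    apply: nr.
    have : nbhs (x0 + (0 : R) *: w) Om.
      by rewrite scale0r addr0; apply: open_nbhs_nbhs; split.
    exact: cl.
  have : \forall e \near (0 : R)^'+, False.
    near=> e.
    have e0 : 0 < e by near: e; exact: nbhs_right_gt.
    have : closure Om (x0 + e *: w) by apply: subset_closure; near: e.
    rewrite clO => -[T' _ cT'].
    have [TT'|TT'] := eqVneq T' s.1; last first.
      by move: cT'; apply: (near hall e) => //.
    move: cT'; rewrite TT' => /cellP/(_ s.2).
    rewrite (form_conormal s x0) facet_map_form sub0r oppr_ge0 leNgt => /negP; apply.
    rewrite mulr_gt0 ?invr_gt0 ?det_JT_gt0//.
    by rewrite addrAC subrr add0r -scalemxAl mxE mulr_gt0.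
  by move=> /filter_ex[].
have [S [S' [E E']]] := inter s.1 T'.
have x0S j : j \in S -> j = s.2.
  move=> jS; have : (cell s.1 `&` cell T') x0.
    split => //; apply/cellP; rewrite /x0 /facet_map PhiK; apply: facet_par_cell.
    exact: ref_interior_sub.
  rewrite E => -[x [rx fx] xE]; apply/eqP/negPn/negP => js.
  by have := pos _ js; rewrite -xE PhiK fx// ltxx.
have S1 : S = [set s.2]%SET.
  apply/setP => j; rewrite finset.in_set1; apply/idP/eqP => [/x0S//|->].
  apply: contraT => nS.
  have S0 : S = finset.set0.
    apply/setP => k; rewrite finset.in_set0; apply/negbTE/negP => kS.
    by move: nS; rewrite -(x0S _ kS) kS.
  have : cell s.1 `<=` cell T' by rewrite -(face_set0 s.1) -S0 -E => x [].
  by move=> /cell_inclusion TT; move: TT'; rewrite TT eqxx.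
have [j' j'S] : exists j', j' \in S'.
  apply/set0Pn; apply/eqP => S0.
  have : cell T' `<=` cell s.1 by rewrite -(face_set0 T') -S0 -E' => x [].
  by move=> /cell_inclusion TT; move: TT'; rewrite TT eqxx.
have FF : facet s = face T' S' by rewrite -E' E S1.
have fdiff (k : facet_ix d K) (a b : 'rV[R]_d) : facet_form k b = facet_form k a - ((b - a) *m nu R k) 0 0.
  by rewrite (facet_formE k b) (facet_formE k a) mulmxBl !mxE; ring.
have form0 k : k \in S' -> forall x, facet s x -> facet_form k (Phi_inv T' x) = 0.
  by move=> kS x; rewrite FF => -[y [_ fy] <-]; rewrite PhiK fy.
pose v (k : facet_ix d K) : 'cV[R]_d := invmx (JT T') *m nu R k.
have vE k : nu R k = JT T' *m v k by rewrite mulmxA mulmxV ?unit_JT// mul1mx.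
pose u : 'cV[R]_d := invmx (JT s.1) *m nu R s.2.
(* A facet form of the second cell that vanishes on the common face is constant along its tangents,
   so its covector is proportional to the one of [s]. *)
have key k : k \in S' -> exists2 c : R, c != 0 & v k = c *: u.
  move=> kS.
  have l0 : facet_lin s *m v k = 0.
    apply/row_matrixP => i; rewrite row_mul row0 rowE.
    have in_f (t : 'rV[R]_m) : ref_cell K t -> facet_form k (Phi_inv T' (facet_map s t)) = 0.
      by move=> rt; apply: form0 => //; rewrite facetE; exists t.
    have := fdiff k (Phi_inv T' (facet_map s 0)) (Phi_inv T' (facet_map s (delta_mx 0 i))).
    rewrite !in_f; [|exact: ref_cell0|exact: ref_cell_delta].
    rewrite sub0r !Phi_invE -mulmxBl facet_mapE opprB addrA subrK addrK -mulmxA => /eqP.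
    rewrite eq_sym oppr_eq0 => /eqP h.
    by apply/rowP => l; rewrite ord1 [RHS]mxE /v mulmxA (mulmxA _ (invmx _)); exact: h.
  have kE : facet_mx R s.2 *m (JT s.1 *m v k) = 0 by rewrite mulmxA.
  have Ek := facet_mx_kernel kE; set c := (X in X *: _) in Ek.
  have vc : v k = c *: u.
    by rewrite /u scalemxAr -Ek mulmxA mulVmx ?unit_JT// mul1mx.
  exists c => //; apply/eqP => c0; have := nu_neq0 R k.
  by rewrite vE vc c0 scale0r mulmx0 eqxx.
(* Two facets of one cell with proportional covectors and a common point would have forms vanishing
   on the same hyperplane, although one form is positive at a relative interior point of the other
   facet. *)
have uniq k : k \in S' -> k = j'.
  move=> kS; apply/eqP/negPn/negP => kj.
  have [c1 c10 e1] := key _ kS; have [c2 c20 e2] := key _ j'S.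
  have nE : nu R k = (c1 / c2) *: nu R j'.
    by rewrite vE e1 (vE j') e2 -!scalemxAr scalerA divfK.
  pose x := @facet_par R d K j' t0; pose z := Phi_inv T' x0.
  have fz l : l \in S' -> facet_form l z = 0.
    by move=> lS; apply: form0 => //; rewrite facetE; exists t0 => //; exact: ref_interior_sub.
  have : 0 < facet_form k x by exact: facet_par_interior.
  rewrite (fdiff k z) fz// sub0r nE -scalemxAr mxE.
  have := fdiff j' z x; rewrite fz// facet_par_form sub0r => /eqP.
  by rewrite eq_sym oppr_eq0 => /eqP ->; rewrite mulr0 oppr0 ltxx.
have S'1 : S' = [set j']%SET.
  by apply/setP => k; rewrite finset.in_set1; apply/idP/eqP => [/uniq|->].
move: op; rewrite /opposite; case: pickP => // /(_ (T', j')).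
rewrite /same_facet /= asboolT; last by rewrite FF S'1.
rewrite andbT => /eqP sE _; move: TT'; rewrite -sE /= eqxx //.
Unshelve. all: by end_near. Qed.

(** Any facet point is a limit of relative interior points, so openness of the domain reduces the
    claim to [unpaired_interior]. Test functions therefore vanish on unpaired facets. *)
Lemma unpaired_facet s x : opposite s = None -> facet s x -> ~ Om x.
Proof.
move=> op; rewrite facetE => -[t rt <-] Omx.
have [t0 ht0] := @ref_interior_neq0 R m K.
have ht (e : R) : 0 < e < 1 -> ref_interior K (t + e *: (t0 - t)).
  move=> /andP[e0 e1] l; rewrite facet_form_line; apply: ltr_wpDl; last by rewrite mulr_gt0.
  by rewrite mulr_ge0 ?subr_ge0 ?(ltW e1)//; exact: rt.
have : \forall e \near (0 : R)^'+, False.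
  have cl : continuous (fun e : R => facet_map s (t + e *: (t0 - t))).
    move=> e; apply: (@continuous_comp _ _ _ (fun e : R => t + e *: (t0 - t)) (facet_map s)).
      apply: (@continuousD _ _ _ (cst t) (fun e : R => e *: (t0 - t))).
        exact: cst_continuous.
      exact: scalel_continuous.
    exact: continuous_facet_map.
  have hOm : \forall e \near (0 : R)^'+, Om (facet_map s (t + e *: (t0 - t))).
    rewrite /at_right /within /=.
    suff : nbhs (0 : R) [set e | Om (facet_map s (t + e *: (t0 - t)))].
      by apply: filterS => e Pe _.
    have : nbhs (facet_map s (t + (0 : R) *: (t0 - t))) Om.
      by rewrite scale0r addr0; apply: open_nbhs_nbhs; split.
    exact: cl.
  near=> e; apply: (@unpaired_interior s (t + e *: (t0 - t))) op; last by near: e.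
  apply: ht; apply/andP; split; first by near: e; exact: nbhs_right_gt.
  by near: e; exact: nbhs_right_lt.
by move=> /filter_ex[].
Unshelve. all: by end_near. Qed.

End conforming.

End mesh_cells.

(** * Square integrable functions and integrals over a mesh *)

Section L2_functions.
Variables (R : realType) (d : nat) (Om : set 'rV[R]_d).
Hypothesis mOm : measurable Om.
Local Notation lam := (lebesgue_rV R d).
Implicit Types (u v w : 'rV[R]_d -> R).

Lemma L2P u : L2 Om u <->
  measurable_fun Om u /\ lam.-integrable Om (EFin \o (fun x => u x ^+ 2)).
Proof.
pose s x : R := u x ^+ 2.
have E : (\int[lam]_(x in Om) `|(EFin \o s) x| = \int[lam]_(x in Om) (s x)%:E)%E.
  by apply: eq_integral => x _; rewrite /= /s ger0_norm ?sqr_ge0.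
split => [[mu fin]|[mu /integrableP[_ fin]]]; split => //; last by rewrite -E.
apply/integrableP; split; last by rewrite E.
by apply/measurable_EFinP; exact: measurable_funX.
Qed.

Lemma L2_sqr_integrable u : L2 Om u -> lam.-integrable Om (EFin \o (fun x => u x ^+ 2)).
Proof. by move=> /L2P[]. Qed.

Lemma L2_integrableM u v : L2 Om u -> L2 Om v ->
  lam.-integrable Om (EFin \o (fun x => u x * v x)).
Proof.
move=> Lu Lv; have iu := L2_sqr_integrable Lu; have iv := L2_sqr_integrable Lv.
apply: (le_integrable mOm _ _ (integrableD mOm iu iv)).
  apply/measurable_EFinP; apply: measurable_realfun.measurable_funM; [exact: Lu.1|exact: Lv.1].
move=> x _ /=; rewrite lee_fin [leRHS]ger0_norm; last by rewrite addr_ge0 ?sqr_ge0.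
rewrite normrM -(real_normK (num_real (u x))) -(real_normK (num_real (v x))).
have := sqr_ge0 (`|u x| - `|v x|); have := normr_ge0 (u x); have := normr_ge0 (v x).
nra.
Qed.

Lemma L2D u v : L2 Om u -> L2 Om v -> L2 Om (fun x => u x + v x).
Proof.
move=> Lu Lv; apply/L2P; split.
  by apply: measurable_realfun.measurable_funD; [exact: Lu.1|exact: Lv.1].
have -> : EFin \o (fun x => (u x + v x) ^+ 2) =
    (EFin \o (fun x => u x ^+ 2)) \+ ((fun x => 2%:E * (EFin \o (fun x => (u x * v x)%R)) x)%E
      \+ (EFin \o (fun x => v x ^+ 2))).
  by apply/funext => x /=; rewrite -EFinM -!EFinD; congr EFin; ring.
apply: integrableD => //; first exact: L2_sqr_integrable.
apply: integrableD => //; last exact: L2_sqr_integrable.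
by apply: integrableZl => //; exact: L2_integrableM.
Qed.

Lemma L2Z a u : L2 Om u -> L2 Om (fun x => a * u x).
Proof.
move=> Lu; apply/L2P; split.
  by apply: measurable_realfun.measurable_funM => //; exact: Lu.1.
have -> : EFin \o (fun x => (a * u x) ^+ 2) =
    (fun x => (a ^+ 2)%:E * (EFin \o (fun x => (u x ^+ 2)%R)) x)%E.
  by apply/funext => x /=; rewrite exprMn.
by apply: integrableZl => //; exact: L2_sqr_integrable.
Qed.

Lemma L2N u : L2 Om u -> L2 Om (fun x => - u x).
Proof.
by move=> /(L2Z (-1)); congr L2; apply/funext => x; rewrite mulN1r.
Qed.

Lemma L2B u v : L2 Om u -> L2 Om v -> L2 Om (fun x => u x - v x).
Proof. by move=> Lu /L2N; exact: L2D. Qed.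

Lemma L2_sum (I : Type) (r : seq I) (P : pred I) (F : I -> 'rV[R]_d -> R) :
  (forall i, P i -> L2 Om (F i)) -> L2 Om (fun x => \sum_(i <- r | P i) F i x).
Proof.
move=> h; elim: r => [|i r IH].
  rewrite (_ : (fun x => _) = fun=> 0); last by apply/funext => x; rewrite big_nil.
  apply/L2P; split => //; rewrite (_ : EFin \o _ = cst 0%E); first exact: integrable0.
  by apply/funext => x; rewrite /= expr0n.
case: (boolP (P i)) => Pi.
  rewrite (_ : (fun x => _) = fun x => F i x + \sum_(i <- r | P i) F i x).
    by apply: L2D => //; exact: h.
  by apply/funext => x; rewrite big_cons Pi.
rewrite (_ : (fun x => _) = fun x => \sum_(i <- r | P i) F i x) //.
by apply/funext => x; rewrite big_cons (negbTE Pi).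
Qed.

Lemma L2_bounded u (C : R) : (lam Om < +oo)%E -> measurable_fun Om u ->
  (forall x, Om x -> `|u x| <= C) -> L2 Om u.
Proof.
move=> fin mu hC; apply/L2P; split => //.
apply: measurable_bounded_integrable => //; first exact: measurable_funX.
exists (C ^+ 2); split; rewrite ?num_real// => y Cy x Ox.
rewrite /= normrX (le_trans _ (ltW Cy))// lerXn2r ?nnegrE//; last exact: hC.
by apply: le_trans (hC _ Ox).
Qed.

Lemma L2M_bounded u v (C : R) : measurable_fun Om u ->
  {ae lam, forall x, Om x -> `|u x| <= C} -> L2 Om v -> L2 Om (fun x => u x * v x).
Proof.
move=> mu hC Lv.
have mM : measurable_fun Om (fun x => u x * v x).
  by apply: measurable_realfun.measurable_funM => //; exact: Lv.1.
split => //; apply: (@le_lt_trans _ _ (\int[lam]_(x in Om) ((C ^+ 2)%:E * ((v x) ^+ 2)%:E))%E).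
  apply: ae_ge0_le_integral => //.
  - by move=> x _; rewrite lee_fin sqr_ge0.
  - by apply/measurable_EFinP; exact: measurable_funX.
  - by move=> x _; rewrite -EFinM lee_fin mulr_ge0// sqr_ge0.
  - apply/measurable_EFinP; apply: measurable_realfun.measurable_funM => //.
    by apply: measurable_funX; exact: Lv.1.
  apply: filterS hC => x hx Ox; rewrite -EFinM lee_fin exprMn ler_wpM2r ?sqr_ge0//.
  rewrite -(real_normK (num_real (u x))) lerXn2r ?nnegrE//; last exact: hx.
  by apply: le_trans (hx Ox).
have : lam.-integrable Om (fun x => (C ^+ 2)%:E * (EFin \o (fun x => (v x ^+ 2)%R)) x)%E.
  by apply: integrableZl => //; exact: L2_sqr_integrable.
move=> /integrableP[_]; congr (_ < _)%E.
apply: eq_integral => x _ /=; rewrite ger0_norm //.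
by rewrite mulr_ge0 ?sqr_ge0.
Qed.

Lemma ipC u v : ip Om u v = ip Om v u.
Proof. by apply: eq_Rintegral => x _; rewrite mulrC. Qed.

Lemma ipDl u v w : L2 Om u -> L2 Om v -> L2 Om w ->
  ip Om (fun x => u x + v x) w = ip Om u w + ip Om v w.
Proof.
move=> Lu Lv Lw; rewrite /ip -RintegralD//; try exact: L2_integrableM.
by apply: eq_Rintegral => x _; rewrite mulrDl.
Qed.

Lemma ipZl a u w : L2 Om u -> L2 Om w -> ip Om (fun x => a * u x) w = a * ip Om u w.
Proof.
move=> Lu Lw; rewrite /ip -RintegralZl//; try exact: L2_integrableM.
by apply: eq_Rintegral => x _; rewrite mulrA.
Qed.

Lemma ipBl u v w : L2 Om u -> L2 Om v -> L2 Om w ->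
  ip Om (fun x => u x - v x) w = ip Om u w - ip Om v w.
Proof.
move=> Lu Lv Lw; rewrite /ip -RintegralB//; try exact: L2_integrableM.
by apply: eq_Rintegral => x _; rewrite mulrBl.
Qed.

Lemma ip_ge0 u : 0 <= ip Om u u.
Proof. by apply: Rintegral_ge0 => x _; rewrite -expr2 sqr_ge0. Qed.

Lemma ip_ae u v w : L2 Om u -> L2 Om v -> L2 Om w ->
  {ae lam, forall x, Om x -> u x = v x} -> ip Om u w = ip Om v w.
Proof.
move=> Lu Lv Lw h; rewrite /ip /Rintegral; congr fine; apply: ae_eq_integral => //.
- by apply/measurable_EFinP/measurable_realfun.measurable_funM; [exact: Lu.1|exact: Lw.1].
- by apply/measurable_EFinP/measurable_realfun.measurable_funM; [exact: Lv.1|exact: Lw.1].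
- by apply: filterS h => x hx Ox; rewrite hx.
Qed.

End L2_functions.

Section mesh_integrals.
Variables (R : realType) (m : nat) (K : ref_shape) (M : mesh R m.+1 K).
Local Notation d := m.+1.
Local Notation lam := (lebesgue_rV R d).
Variable Om : set 'rV[R]_d.
Hypotheses (hconf : conforming_partition M Om) (oOm : open Om).
Hypothesis regOm : interior (closure Om) = Om.
Implicit Types (T : elt M).

Lemma mesh_inbox : exists2 B : R, 0 <= B & forall T, cell T `<=` inbox B.
Proof.
have h T : exists2 B : R, 0 <= B & cell T `<=` inbox B.
  exists (\sum_j \sum_i `|(JT T) j i| + \sum_i `|offset T 0 i|).
    by rewrite addr_ge0 ?sumr_ge0// => j _; rewrite sumr_ge0.
  move=> _ [x /ref_cell_inbox rx <-] i; rewrite /Phi mxE.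
  apply: (le_trans (ler_normD _ _)); apply: lerD; last first.
    by rewrite (bigD1 i)//= lerDl sumr_ge0.
  rewrite mxE; apply: (le_trans (ler_norm_sum _ _ _)); apply: ler_sum => j _.
  rewrite normrM; apply: (@le_trans _ _ `|(JT T) j i|).
    by rewrite ler_piMl.
  by rewrite (bigD1 i)//= lerDl sumr_ge0.
have [B hB] := choice (fun T => let: ex_intro2 B B0 h := h T in ex_intro (fun B => 0 <= B /\ cell T `<=` inbox B) B (conj B0 h)).
exists (\sum_T B T) => [|T x cx i]; first by rewrite sumr_ge0// => T _; have [] := hB T.
have [B0 /(_ x cx i) hx] := hB T; apply: (le_trans hx).
by rewrite (bigD1 T)//= lerDl sumr_ge0// => T' _; have [] := hB T'.
Qed.

(** The cells cover the closure of the domain; the absence of slits, [interior (closure Om) = Om],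
    brings their interiors back into the domain. *)
Lemma sub_interior_cell T : interior (cell T) `<=` Om.
Proof.
rewrite -regOm; apply: interiorS; case: hconf => -> _ _ x cx.
by exists T.
Qed.

Lemma cell_interior_sub T : cell_interior T `<=` Om.
Proof. by move=> x /sub_cell_interior/sub_interior_cell. Qed.

Lemma Om_inbox : exists2 B : R, 0 <= B & Om `<=` inbox B.
Proof.
have [B B0 hB] := mesh_inbox; exists B => // x Ox.
have : closure Om x by exact: subset_closure.
by case: hconf => -> _ _ [T _ /hB].
Qed.

Lemma measurable_Om : measurable Om. Proof. exact: open_measurable_rV. Qed.

Lemma Om_fin : (lam Om < +oo)%E.
Proof. by have [B _ hB] := Om_inbox; exact: sub_inbox_fin measurable_Om hB. Qed.

(** Whole hyperplanes are taken instead of facets: they are null sets by [null_hyperplane], and a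
    point of a cell off all of them satisfies every facet inequality of that cell strictly. *)
Definition skeleton : set 'rV[R]_d :=
  \bigcup_(s in [set: side M]) [set x | facet_form s.2 (Phi_inv s.1 x) = 0].

Lemma skeleton_null : measurable skeleton /\ lam skeleton = 0%E.
Proof.
have h (s : side M) : measurable [set x | facet_form s.2 (Phi_inv s.1 x) = 0] /\
    lam [set x | facet_form s.2 (Phi_inv s.1 x) = 0] = 0%E.
  pose a : 'cV[R]_d := invmx (JT s.1) *m nu R s.2.
  have a0 : a != 0.
    apply/eqP => h; have := congr1 (mulmx (JT s.1)) h.
    rewrite mulmxA mulmxV ?unit_JT// mul1mx mulmx0 => /eqP.
    by rewrite (negbTE (nu_neq0 R s.2)).
  pose c := facet_form s.2 (0 : 'rV[R]_d) + (offset s.1 *m a) 0 0.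
  have -> : [set x | facet_form s.2 (Phi_inv s.1 x) = 0] = [set x : 'rV[R]_d | (x *m a) 0 0 = c].
    have E x : facet_form s.2 (Phi_inv s.1 x) = c - (x *m a) 0 0.
      by rewrite facet_formE Phi_invE -mulmxA -/a mulmxBl [X in _ - X]mxE [X in _ - (_ + X)]mxE /c; ring.
    apply/seteqP; split => x /=; rewrite E; first by move=> /subr0_eq.
    by move=> ->; rewrite subrr.
  split; last exact: null_hyperplane.
  apply: closed_measurable_rV.
  by apply: (continuous_closedP _).1 (@closed_eq _ c); exact: continuous_linear_form.
have -> : skeleton = \big[setU/set0]_(s : side M) [set x | facet_form s.2 (Phi_inv s.1 x) = 0].
  rewrite -bigcup_seq; apply/seteqP; split => x [s _ sx]; exists s => //=.
  by rewrite mem_index_enum.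
elim: (index_enum _) => [|s r [IH1 IH2]]; first by rewrite big_nil measure0.
have [ms ls] := h s; rewrite big_cons; split; first exact: measurableU.
by rewrite measureU0.
Qed.

Lemma off_skeleton T x : cell T x -> ~ skeleton x -> cell_interior T x.
Proof.
move=> /cellP cx nsk j; rewrite lt_neqAle cx andbT; apply/eqP => E; apply: nsk.
by exists (T, j) => //=; rewrite -E.
Qed.

Lemma Rintegral_off_skeleton (D : set 'rV[R]_d) (F : 'rV[R]_d -> R) :
  measurable D -> lam.-integrable D (EFin \o F) ->
  \int[lam]_(x in D) F x = \int[lam]_(x in D `\` skeleton) F x.
Proof.
move=> mD iF; have [mS nS] := skeleton_null.
by rewrite /Rintegral (negligible_integral mS mD iF nS).
Qed.

Lemma measurable_cell_interior T : measurable (cell_interior T).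
Proof. by apply: open_measurable_rV; exact: open_cell_interior. Qed.

Lemma integrable_cell T (G : 'rV[R]_d -> R) : continuous G ->
  lam.-integrable (cell T) (EFin \o G).
Proof.
move=> cG; have [B _ hB] := mesh_inbox.
exact: (continuous_integrable cG (measurable_cell T) (hB T)).
Qed.

Lemma Rintegral_cell T (G : 'rV[R]_d -> R) : continuous G ->
  \int[lam]_(x in cell T) G x = `|\det (JT T)| * \int[lam]_(x in ref_cell K) G (Phi T x).
Proof.
move=> cG; rewrite (Rintegral_affine (offset T) (unit_JT T)); last 3 first.
- exact: measurable_cell.
- exact: continuous_measurable_rV.
- exact: integrable_cell.
congr (_ * _); rewrite (_ : _ @^-1` _ = ref_cell K)//.
apply/seteqP; split => x; rewrite /= -[_ *m _ + _]/(Phi T x).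
  by move=> /cellP; rewrite PhiK.
by move=> rx; apply/cellP; rewrite PhiK.
Qed.

Lemma Rintegral_cell_interior T (D : set 'rV[R]_d) (F G : 'rV[R]_d -> R) : continuous G ->
  measurable D -> cell_interior T `<=` D -> D `<=` cell T ->
  lam.-integrable D (EFin \o F) ->
  (forall x, cell_interior T x -> F x = G x) ->
  \int[lam]_(x in D) F x = \int[lam]_(x in cell T) G x.
Proof.
move=> cG mD iD Dc iF FG.
rewrite (Rintegral_off_skeleton mD iF) (Rintegral_off_skeleton (measurable_cell T) (integrable_cell T cG)).
have -> : D `\` skeleton = cell T `\` skeleton.
  apply/seteqP; split => x [h nsk]; split => //; first exact: Dc.
  by apply: iD; exact: off_skeleton.
by apply: eq_Rintegral => x; rewrite inE => -[cx nsk]; apply: FG; exact: off_skeleton.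
Qed.

(** Off the null skeleton the domain is the disjoint union of the open cells, so only the values of
    [F] inside the cells matter. *)
Lemma Rintegral_mesh (F : 'rV[R]_d -> R) (G : elt M -> 'rV[R]_d -> R) :
  (forall T, continuous (G T)) -> lam.-integrable Om (EFin \o F) ->
  (forall T x, cell_interior T x -> F x = G T x) ->
  \int[lam]_(x in Om) F x = \sum_T \int[lam]_(x in cell T) G T x.
Proof.
move=> cG iF FG.
pose U := \big[setU/set0]_(T : elt M) cell_interior T.
have UE : U = \bigcup_(T in [set: elt M]) cell_interior T.
  rewrite /U -bigcup_seq; apply/seteqP; split => x [T _ Tx]; exists T => //=.
  by rewrite mem_index_enum.
have UOm : U `<=` Om by rewrite UE => x [T _]; exact: cell_interior_sub.
have mU : measurable U by apply: bigsetU_measurable => T _; exact: measurable_cell_interior.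
have iU := integrableS measurable_Om mU UOm iF.
transitivity (\int[lam]_(x in U) F x).
  rewrite (Rintegral_off_skeleton measurable_Om iF) (Rintegral_off_skeleton mU iU).
  suff -> : Om `\` skeleton = U `\` skeleton by [].
  apply/seteqP; split => x [h nsk]; split => //; last exact: UOm.
  have : closure Om x by exact: subset_closure.
  case: hconf => -> _ _ [T _ cx]; rewrite UE; exists T => //; exact: off_skeleton.
transitivity (\sum_(T : elt M) \int[lam]_(x in cell_interior T) F x).
  rewrite /Rintegral /U integral_bigsetU_EFin.
  - rewrite (eq_bigr (fun T => (\int[lam]_(x in cell_interior T) F x)%:E)) ?sumEFin// => T _.
    rewrite /Rintegral fineK//; apply: integrable_fin_num; first exact: measurable_cell_interior.
    apply: integrableS iU => //; first exact: measurable_cell_interior.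
    by rewrite UE => x hx; exists T.
  - by move=> T; exact: measurable_cell_interior.
  - exact: index_enum_uniq.
  - move=> T T' _ _ [x [h h']]; exact: (disjoint_cell_interior hconf h h').
  - exact: measurable_int iU.
apply: eq_bigr => T _; apply: Rintegral_cell_interior => //.
- exact: measurable_cell_interior.
- by move=> x /ref_interior_sub/cellP.
- apply: integrableS iF => //; [exact: measurable_Om|exact: measurable_cell_interior|exact: cell_interior_sub].
- exact: FG.
Qed.

Lemma assembleE (V : nmodType) (v : elt M -> 'rV[R]_d -> V) T x :
  interior (cell T) x -> assemble v x = v T x.
Proof.
move=> h; rewrite /assemble (bigD1 T) ?asboolT//= big1 ?addr0// => T' /andP[/asboolP h' TT].
case: hconf => _ dis _; have : (interior (cell T') `&` interior (cell T)) x by [].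
by rewrite dis.
Qed.

Lemma assemble_interior (V : nmodType) (v : elt M -> 'rV[R]_d -> V) T x :
  cell_interior T x -> assemble v x = v T x.
Proof. by move=> h; apply: assembleE; exact: sub_cell_interior. Qed.

Lemma assemble_L2 (v : elt M -> 'rV[R]_d -> R) : (forall T, continuous (v T)) ->
  L2 Om (assemble v).
Proof.
move=> cv; have [B B0 hB] := Om_inbox.
have E : assemble v = fun x => \sum_T (\1_(interior (cell T)) x : R) * v T x.
  apply/funext => x; rewrite /assemble big_mkcond; apply: eq_bigr => T _.
  rewrite indicE; case: asboolP => h; first by rewrite mem_set// mul1r.
  by rewrite memNset// mul0r.
have mv : measurable_fun setT (assemble v).
  rewrite E; apply: measurable_sum => T; apply: measurable_realfun.measurable_funM.
    by apply: measurable_indic; apply: open_measurable_rV; exact: open_interior.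
  exact: continuous_measurable_rV.
have h T : exists C : R, 0 <= C /\ forall x, inbox B x -> `|v T x| <= C.
  by have [C C0 hC] := continuous_bounded_on B (cv T); exists C.
have [C hC] := choice h.
apply: (@L2_bounded _ _ _ measurable_Om _ (\sum_T C T)).
- exact: Om_fin.
- exact: measurable_funTS.
move=> x Ox; rewrite E; apply: (le_trans (ler_norm_sum _ _ _)); apply: ler_sum => T _.
have [C0 hT] := hC T; rewrite normrM; apply: (@le_trans _ _ (1 * `|v T x|)).
  by apply: ler_wpM2r => //; rewrite indicE; case: (x \in _); rewrite ?normr1 ?normr0.
by rewrite mul1r; exact/hT/hB.
Qed.

Lemma ip_mesh (u v : elt M -> 'rV[R]_d -> R) (F G : 'rV[R]_d -> R) :
  (forall T, continuous (u T)) -> (forall T, continuous (v T)) -> L2 Om F -> L2 Om G ->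
  (forall T x, cell_interior T x -> F x = u T x) ->
  (forall T x, cell_interior T x -> G x = v T x) ->
  ip Om F G = \sum_T `|\det (JT T)| * \int[lam]_(x in ref_cell K) (u T (Phi T x) * v T (Phi T x)).
Proof.
move=> cu cv LF LG Fu Gv.
have cuv T : continuous (fun x => u T x * v T x).
  by move=> x; apply: (@continuousM _ _ (u T) (v T)); [exact: cu|exact: cv].
rewrite /ip (Rintegral_mesh cuv).
- by apply: eq_bigr => T _; exact: Rintegral_cell.
- exact: (L2_integrableM measurable_Om LF LG).
- by move=> T x h; rewrite (Fu T)// (Gv T).
Qed.

Lemma ip_assemble (u v : elt M -> 'rV[R]_d -> R) :
  (forall T, continuous (u T)) -> (forall T, continuous (v T)) ->
  ip Om (assemble u) (assemble v) =
  \sum_T `|\det (JT T)| * \int[lam]_(x in ref_cell K) (u T (Phi T x) * v T (Phi T x)).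
Proof.
move=> cu cv; apply: ip_mesh => //; try exact: assemble_L2.
- by move=> T x; exact: assemble_interior.
- by move=> T x; exact: assemble_interior.
Qed.

Lemma vol_cell T : vol (cell T) = `|\det (JT T)| * vol (@ref_cell R d K).
Proof.
rewrite /vol (lebesgue_rV_affine (offset T) (unit_JT T) (measurable_cell T)).
rewrite (_ : _ @^-1` cell T = ref_cell K); last first.
  apply/seteqP; split => x; rewrite /= -[_ *m _ + _]/(Phi T x).
    by move=> /cellP; rewrite PhiK.
  by move=> rx; apply/cellP; rewrite PhiK.
have f : lam (@ref_cell R d K) \is a fin_num by rewrite ge0_fin_numE ?measure_ge0//; exact: ref_cell_fin.
by rewrite (@fineM _ _ (lam (@ref_cell R d K))).
Qed.

End mesh_integrals.

(** * Smooth bumps and the fundamental lemma of the calculus of variations *)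

Section smooth_bump.
Variable R : realType.

Definition bump (P : {poly R}) (x : R) : R :=
  if 0 < x then P.[x^-1] * expR (- x^-1) else 0.

Lemma bump_le0 (P : {poly R}) x : x <= 0 -> bump P x = 0.
Proof. by move=> x0; rewrite /bump ltNge x0. Qed.

Lemma poly_le_expR (P : {poly R}) :
  exists2 C, 0 <= C & forall y, 0 <= y -> `|P.[y]| <= C * expR y.
Proof.
exists (\sum_(i < size P) `|P`_i| * i`!%:R) => [|y y0].
  by rewrite sumr_ge0// => i _; rewrite mulr_ge0.
rewrite horner_coef mulr_suml; apply: (le_trans (ler_norm_sum _ _ _)).
apply: ler_sum => i _; rewrite normrM -mulrA ler_wpM2l//.
have fi : (0 : R) < i`!%:R by rewrite ltr0n fact_gt0.
rewrite ger0_norm ?exprn_ge0// mulrC -ler_pdivrMr//.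
case: (i : nat) fi => [|k] fi; last first.
  by apply: le_trans (expR_ge1Dxn k y0); rewrite lerDr.
by rewrite expr0 fact0 divr1; apply: le_trans (expR_ge1Dx y); rewrite lerDl.
Qed.

(** The exponential dominates the polynomial [P * 'X^2] at 1/x. A quadratic bound is what gives
    derivative zero at the origin. *)
Lemma bump_sqr (P : {poly R}) : exists2 C, 0 <= C & forall x, `|bump P x| <= C * x ^+ 2.
Proof.
have [C C0 hC] := poly_le_expR (P * 'X^2).
exists C => // x; rewrite /bump; case: ifPn => [x0|_]; last first.
  by rewrite normr0 mulr_ge0// sqr_ge0.
have y0 : 0 < x^-1 by rewrite invr_gt0.
have := hC _ (ltW y0); rewrite hornerM hornerXn normrM (normrM P.[_]).
rewrite (gtr0_norm (exprn_gt0 2 y0)) (gtr0_norm (expR_gt0 _)) expRN.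
rewrite exprVn ler_pdivrMr ?exprn_gt0// => h.
rewrite ler_pdivrMr ?expR_gt0//; apply: (le_trans h).
by rewrite le_eqVlt; apply/orP; left; apply/eqP; ring.
Qed.

Lemma bump_is_derive (P : {poly R}) (x : R) :
  is_derive x (1 : R) (bump P) (bump ('X^2 * (P - P^`())) x).
Proof.
have [x0|x0|x0] := ltgtP x 0.
- have -> : bump ('X^2 * (P - P^`())) x = 0 by rewrite /bump ltNge (ltW x0).
  apply: (@near_eq_is_derive _ R R (cst 0)).
  near=> y; rewrite /bump ltNge (_ : y <= 0)//.
  by apply/ltW; near: y; exact: lt_nbhsl.
- have -> : bump ('X^2 * (P - P^`())) x =
      ('X^2 * (P - P^`())).[x^-1] * expR (- x^-1) by rewrite /bump x0.
  apply: (@near_eq_is_derive _ R R (fun x : R => P.[x^-1] * expR (- x^-1))).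
    by near=> y; rewrite /bump (_ : 0 < y)//; near: y; exact: lt_nbhsr.
  have xn : x != 0 by rewrite gt_eqF.
  have dv : is_derive x (1 : R) (fun y : R => y^-1) (- x ^- 2 *: 1) :> Prop.
    by apply: (@is_deriveV R id).
  have dp := is_derive1_comp (is_derive_poly P x^-1) dv.
  have dn := is_deriveN dv.
  have de := @is_derive1_comp _ expR (fun y : R => - y^-1) _ _ _ (is_derive_expR (- x^-1)) dn.
  have [h1 h2] := is_deriveM dp de; split; first exact: h1.
  apply: (etrans h2); rewrite /= !hornerE /GRing.scale /=; field.
  exact: xn.
- rewrite x0; have -> : bump ('X^2 * (P - P^`())) 0 = 0 by rewrite /bump ltxx.
  have [C C0 hC] := bump_sqr P.
  have L : (fun h : R => h^-1 *: ((bump P \o shift (0 : R)) (h *: 1) - bump P 0)) @ 0^' --> (0 : R).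
    apply/cvgr0Pnorm_le => e e0.
    near=> h; rewrite /= addr0 {2}/bump ltxx subr0 /GRing.scale /= mulr1 normrM normfV.
    have hn : h != 0 by near: h; exact: nbhs_dnbhs_neq.
    rewrite mulrC ler_pdivrMr ?normr_gt0//; apply: (le_trans (hC _)).
    rewrite -real_normK ?num_real// expr2 mulrA ler_wpM2r//.
    rewrite -[leRHS]mulr1 -(@mulVf _ (C + 1)); last by rewrite gt_eqF// ltr_wpDl.
    rewrite mulrA (@le_trans _ _ ((C + 1) * `|h|))//.
      by rewrite ler_wpM2r// lerDl.
    rewrite mulrC ler_wpM2r ?addr_ge0//.
    near: h; apply: dnbhs0_le; rewrite divr_gt0// ltr_wpDl//.
  split; first by apply/cvg_ex; exists 0; exact: L.
  exact: cvg_lim L.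
Unshelve. all: by end_near. Qed.

Lemma bump_continuous P : continuous (bump P).
Proof.
move=> x; apply: differentiable_continuous; apply/derivable1_diffP.
by have [] := bump_is_derive P x.
Qed.

Lemma is_derive_coord_comp d (g : R -> R) (x : 'rV[R]_d) (i j : 'I_d) (dg : R) :
  is_derive (x 0 j) (1 : R) g dg ->
  is_derive x (delta_mx 0 i : 'rV[R]_d) (fun y : 'rV[R]_d => g (y 0 j)) ((j == i)%:R * dg).
Proof.
have [->|ji] := eqVneq j i; rewrite ?mul1r ?mul0r => -[d1 d2].
  have E : (fun h : R => h^-1 *: (((fun y : 'rV[R]_d => g (y 0 i)) \o shift x) (h *: delta_mx 0 i) -
      g (x 0 i))) = (fun h : R => h^-1 *: ((g \o shift (x 0 i)) (h *: 1) - g (x 0 i))).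
    by apply/funext => h /=; rewrite !mxE !eqxx /=.
  split; first by rewrite /derivable E.
  by rewrite /derive E -/(derive _ _ _) d2.
have E : (fun h : R => h^-1 *: (((fun y : 'rV[R]_d => g (y 0 j)) \o shift x) (h *: delta_mx 0 i) -
      g (x 0 j))) = cst 0.
  by apply/funext => h /=; rewrite !mxE (negbTE ji) mulr0 add0r subrr scaler0.
split; first by rewrite /derivable E; exact: is_cvg_cst.
by rewrite /derive E; exact: lim_cst.
Qed.

Variable d : nat.

(** A class containing the bumps of one coordinate and stable under partial derivatives, so that all
    its members are C^k for every k by one induction. *)
Inductive bumpy : ('rV[R]_d -> R) -> Prop :=
| bumpy_cst c : bumpy (fun=> c)
| bumpy_coord P a b j : bumpy (fun x => bump P (a * x 0 j + b))
| bumpyD f g : bumpy f -> bumpy g -> bumpy (fun x => f x + g x)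
| bumpyM f g : bumpy f -> bumpy g -> bumpy (fun x => f x * g x).

Lemma bumpy_continuous f : bumpy f -> continuous f.
Proof.
elim=> [c|P a b j|{}f g _ cf _ cg|{}f g _ cf _ cg] x.
- exact: cst_continuous.
- apply: (@continuous_comp _ _ _ (fun x : 'rV[R]_d => a * x 0 j + b) (bump P)); last first.
    exact: bump_continuous.
  apply: (@continuousD _ _ _ (fun x : 'rV[R]_d => a * x 0 j)); last exact: cst_continuous.
  apply: (@continuousM _ _ (fun=> a) (fun x : 'rV[R]_d => x 0 j)); first exact: cst_continuous.
  exact: coord_continuous.
- by apply: (@continuousD _ _ _ f g); [exact: cf|exact: cg].
- by apply: (@continuousM _ _ f g); [exact: cf|exact: cg].
Qed.

Lemma bumpy_derive f i : bumpy f -> exists2 g, bumpy g &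
  forall x, is_derive x (delta_mx 0 i : 'rV[R]_d) f (g x).
Proof.
elim=> [c|P a b j|{}f g bf [f' bf' df] bg [g' bg' dg]|{}f g bf [f' bf' df] bg [g' bg' dg]].
- by exists (fun=> 0) => [|x]; [exact: bumpy_cst|exact: is_derive_cst].
- exists (fun x => ((j == i)%:R * a) * bump ('X^2 * (P - P^`())) (a * x 0 j + b)).
    by apply: (@bumpyM (fun=> _)); [exact: bumpy_cst|exact: bumpy_coord].
  move=> x; rewrite -mulrA.
  apply: (@is_derive_coord_comp d (fun y => bump P (a * y + b))).
  have da : is_derive (x 0 j) (1 : R) (fun y : R => a * y + b) (a *: 1 + 0).
    by apply: is_deriveD.
  have [h1 h2] := @is_derive1_comp _ (bump P) (fun y : R => a * y + b) _ _ _ (bump_is_derive P (a * x 0 j + b)) da.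
  split; first exact: h1.
  by apply: (etrans h2); rewrite /GRing.scale /= mulr1 addr0 mulrC.
- exists (fun x => f' x + g' x); first exact: bumpyD.
  by move=> x; apply: (@is_deriveD _ _ _ f g).
- exists (fun x => f x * g' x + g x * f' x) => [|x].
    by apply: bumpyD; apply: bumpyM.
  by have := @is_deriveM _ _ f g x (delta_mx 0 i) _ _ (df x) (dg x).
Qed.

Lemma bumpy_Ck f k : bumpy f -> Ck k f.
Proof.
elim: k f => [|k IH] f bf; first by split => //; exact: bumpy_continuous.
split; first exact: bumpy_continuous.
split => [x i|i]; have [g bg df] := bumpy_derive i bf.
  by have [] := df x.
rewrite (_ : partial i f = g); first exact: IH.
by apply/funext => x; have [_] := df x.
Qed.

Lemma bumpy_prod (I : Type) (r : seq I) (F : I -> 'rV[R]_d -> R) :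
  (forall i, bumpy (F i)) -> bumpy (fun x => \prod_(i <- r) F i x).
Proof.
move=> bF; elim: r => [|i r IH].
  under eq_fun do rewrite big_nil.
  exact: bumpy_cst.
under eq_fun do rewrite big_cons.
exact: bumpyM.
Qed.

End smooth_bump.

Section fundamental_lemma.
Variables (R : realType) (d : nat).
Local Notation lam := (lebesgue_rV R d).

Lemma integral_limit0 (D : set 'rV[R]_d) (w : 'rV[R]_d -> R) (phi_ : nat -> 'rV[R]_d -> R)
    (phi : 'rV[R]_d -> R) : measurable D -> lam.-integrable D (EFin \o w) ->
  (forall k, measurable_fun setT (phi_ k)) -> measurable_fun setT phi ->
  (forall k x, `|phi_ k x| <= 1) -> (forall x, phi_ k x @[k --> \oo] --> phi x) ->
  (forall k, \int[lam]_(x in D) (w x * phi_ k x)%:E = 0)%E ->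
  (\int[lam]_(x in D) (w x * phi x)%:E = 0)%E.
Proof.
move=> mD iw mphi mph b1 cv z.
have mw : measurable_fun D w by case/integrableP: iw => /measurable_EFinP.
have mf k : measurable_fun D (EFin \o (fun x => w x * phi_ k x)).
  apply/measurable_EFinP; apply: measurable_realfun.measurable_funM => //.
  exact: measurable_funTS.
have [] := @dominated_convergence _ _ _ lam D mD
  (fun k x => (w x * phi_ k x)%:E) (fun x => (w x * phi x)%:E) (fun x => `|w x|%:E) mf.
- apply/measurable_EFinP; apply: measurable_realfun.measurable_funM => //.
  exact: measurable_funTS.
- apply: aeW => x _; apply: cvg_EFin; first exact: nearW.
  by apply: cvgM; [exact: cvg_cst|exact: cv].
- exact: (integrable_norm iw).
- apply: aeW => x k _; rewrite lee_fin normrM -[leRHS]mulr1.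
  by rewrite ler_wpM2l.
move=> _ _ h; have := cvg_lim (@ereal_hausdorff R) h => <-.
by rewrite (_ : (fun k => _) = cst 0%E) ?lim_cst//; apply/funext => k; rewrite /= z.
Qed.

Definition box (a b : 'I_d -> R) : set 'rV[R]_d := [set x | forall i, a i < x 0 i < b i].
Definition cbox (a b : 'I_d -> R) : set 'rV[R]_d := [set x | forall i, a i <= x 0 i <= b i].

Lemma measurable_box a b : measurable (box a b).
Proof.
rewrite (_ : box a b = [set x : 'rV[R]_d | forall i, `]a i, b i[%classic (x 0 i)]).
  by apply: (lebesgue_rV_box (A := fun i => `]a i, b i[%classic) _).1.
by apply/seteqP; split => x h i; have := h i; rewrite /= ?in_itv/=.
Qed.

Lemma compact_cbox a b : compact (cbox a b).
Proof.
have := @rV_compact R d (fun i => `[a i, b i]%classic) (fun i => @segment_compact R (a i) (b i)).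
congr compact; apply/seteqP; split => x h i; have := h i; rewrite /= ?in_itv//=.
Qed.

(** Each factor vanishes on the wrong side of a face of the box. Inside, the scaling by [k.+1] sends
    it to exp(0) = 1, so these test functions converge boundedly to the indicator of the open
    box. *)
Definition box_bump (a b : 'I_d -> R) (k : nat) (x : 'rV[R]_d) : R :=
  \prod_i (bump 1 (k.+1%:R * x 0 i + - (k.+1%:R * a i)) *
           bump 1 (- k.+1%:R * x 0 i + k.+1%:R * b i)).

Lemma bump1_itv (x : R) : 0 <= bump 1 x <= 1.
Proof.
rewrite /bump hornerC mul1r; case: ifP => [x0|_]; last by rewrite lexx ler01.
by rewrite expR_ge0 -expR0 ler_expR oppr_le0 invr_ge0 ltW.
Qed.

Lemma bumpy_box_bump a b k : bumpy (box_bump a b k).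
Proof. by apply: bumpy_prod => i; apply: bumpyM; exact: bumpy_coord. Qed.

Lemma box_bump_test U a b k : cbox a b `<=` U -> test_function U (box_bump a b k).
Proof.
move=> abU; split; first by move=> l; exact: bumpy_Ck (bumpy_box_bump a b k).
exists (cbox a b); split => //; first exact: compact_cbox.
move=> x /existsNP[i /negP hi]; rewrite /box_bump (bigD1 i)//=.
rewrite (_ : bump 1 _ * bump 1 _ = 0) ?mul0r//; rewrite negb_and -!ltNge in hi.
have n0 : 0 <= k.+1%:R :> R by [].
case/orP: hi => hi; [rewrite bump_le0 ?mul0r//|rewrite [X in _ * X]bump_le0 ?mulr0//].
  by rewrite -mulrBr mulr_ge0_le0// subr_le0 ltW.
by rewrite addrC mulNr -mulrBr mulr_ge0_le0// subr_le0 ltW.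
Qed.

Lemma box_bump_norm a b k x : `|box_bump a b k x| <= 1.
Proof.
rewrite /box_bump normr_prod prodr_ile1// => i _.
rewrite normr_ge0 normrM.
have [/andP[h1 h2] /andP[h3 h4]] := (bump1_itv (k.+1%:R * x 0 i + - (k.+1%:R * a i)),
  bump1_itv (- k.+1%:R * x 0 i + k.+1%:R * b i)).
by rewrite !ger0_norm// mulr_ile1.
Qed.

Lemma box_bump_cvg a b x : box_bump a b k x @[k --> \oo] --> (\1_(box a b) x : R).
Proof.
rewrite indicE; case: (asboolP (box a b x)) => hx; last first.
  rewrite memNset//=; apply: cvg_near_cst; apply: nearW => k.
  move/existsNP: hx => [i /negP hi]; rewrite /box_bump (bigD1 i)//=.
  rewrite (_ : bump 1 _ * bump 1 _ = 0) ?mul0r//; rewrite negb_and -!leNgt in hi.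
  have n0 : 0 <= k.+1%:R :> R by [].
  case/orP: hi => hi; [rewrite bump_le0 ?mul0r//|rewrite [X in _ * X]bump_le0 ?mulr0//].
    by rewrite -mulrBr mulr_ge0_le0// subr_le0.
  by rewrite addrC mulNr -mulrBr mulr_ge0_le0// subr_le0.
rewrite mem_set//=.
have one (c : R) : 0 < c -> bump 1 (k.+1%:R * c) @[k --> \oo] --> (1 : R).
  move=> c0; rewrite (_ : (fun k => _) = fun k => expR (- (c^-1 * k.+1%:R^-1))); last first.
    apply/funext => k; rewrite /bump mulr_gt0 ?ltr0Sn// hornerC mul1r invfM.
    by rewrite mulrC.
  rewrite -[X in _ --> X]expR0; apply: (@continuous_cvg _ _ _ _ _ _ expR).
    exact: continuous_expR.
  rewrite -oppr0; apply: cvgN; rewrite -[X in _ --> X](mulr0 c^-1).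
  by apply: cvgM; [exact: cvg_cst|exact: cvg_harmonic].
have cvp : forall r : seq 'I_d, \prod_(i <- r) (bump 1 (k.+1%:R * x 0 i + - (k.+1%:R * a i)) *
    bump 1 (- k.+1%:R * x 0 i + k.+1%:R * b i)) @[k --> \oo] --> \prod_(i <- r) (1 : R).
  elim=> [|i r IH].
    by under eq_fun do rewrite big_nil; rewrite big_nil; exact: cvg_cst.
  under eq_fun do rewrite big_cons; rewrite big_cons.
  apply: cvgM => //; rewrite -[X in _ --> X](mulr1 (1 : R)).
  have /andP[h1 h2] := hx i.
  apply: cvgM.
    by under eq_fun do rewrite -mulrBr; apply: one; rewrite subr_gt0.
  by under eq_fun do rewrite mulNr addrC -mulrBr; apply: one; rewrite subr_gt0.
rewrite [X in _ --> X](_ : _ = \prod_(i <- index_enum 'I_d) (1 : R)); first exact: cvp.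
by rewrite big1_eq.
Qed.

Lemma boxI a b a' b' : box a b `&` box a' b' =
  box (fun i => Num.max (a i) (a' i)) (fun i => Num.min (b i) (b' i)).
Proof.
apply/seteqP; split => x.
  by move=> [h h'] i; rewrite gt_max lt_min; have /andP[-> ->] := h i; have /andP[-> ->] := h' i.
move=> h; split => i; have := h i; rewrite gt_max lt_min.
  by move=> /andP[/andP[-> _] /andP[-> _]].
by move=> /andP[/andP[_ ->] /andP[_ ->]].
Qed.

End fundamental_lemma.

Lemma measurable_boxes (R : realType) (d : nat) : (@measurable _ 'rV[R]_d) `<=`
  <<s [set B | exists a b : 'I_d -> R, B = box a b] >>.
Proof.
set G := [set B | _].
apply: smallest_sub; first exact: smallest_sigma_algebra.
case: d @G => [|n] G; first by rewrite big_ord0.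
rewrite -bigcup_mkord_ord => B [i _ [C mC <-]]; rewrite setTI.
pose S : set (set R) := [set C | <<s G >> ((fun x : 'rV[R]_n.+1 => x 0 (inord i)) @^-1` C)].
suff : (@measurable _ (measurableTypeR R)) `<=` S by apply.
move=> Y mY; have {mY} : (RGenOInfty.G (R:=R)).-sigma.-measurable Y.
  by rewrite -RGenOInfty.measurableE.
move: Y; apply: smallest_sub.
  split; rewrite /S/=.
  - rewrite preimage_set0; apply: sigma_algebra0.
  - by move=> D hD; rewrite setTD preimage_setC; apply: sigma_algebraC.
  - by move=> F hF; rewrite preimage_bigcup; apply: sigma_algebra_bigcup.
move=> D [c ->]; rewrite /S/=.
rewrite (_ : _ @^-1` _ = \bigcup_k box
  (fun j : 'I_n.+1 => if j == inord i then c else - k%:R) (fun=> k%:R)).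
  by apply: sigma_algebra_bigcup => k; apply: sub_sigma_algebra; eexists; eexists.
apply/seteqP; split => x /=.
  rewrite in_itv/= andbT => cx.
  have h j : exists k : nat, `|x 0 j| < k%:R.
    by exists (Num.truncn `|x 0 j|).+1; exact: truncnS_gt.
  have [k hk] := choice h; exists (\max_j k j) => // j.
  have := lt_le_trans (hk j) (_ : _ <= (\max_j k j)%:R).
  rewrite ler_nat leq_bigmax// => /(_ isT); rewrite ltr_norml => /andP[h1 ->].
  by case: eqP => [->|_]; rewrite ?cx ?h1.
by move=> [k _ /(_ (inord i))]; rewrite eqxx in_itv/= => /andP[->].
Qed.

Section fundamental_lemma2.
Variables (R : realType) (d : nat) (Om : set 'rV[R]_d).
Local Notation lam := (lebesgue_rV R d).
Hypotheses (mOm : measurable Om) (fOm : (lam Om < +oo)%E).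

Lemma indic_setD (A B Q : set 'rV[R]_d) x : B `<=` A ->
  \1_((A `\` B) `&` Q) x = \1_(A `&` Q) x - \1_(B `&` Q) x :> R.
Proof.
move=> BA; rewrite !indicE; have [hB|hB] := pselect (B x).
  rewrite memNset; last by case=> -[].
  rewrite (_ : (x \in B `&` Q) = (x \in A `&` Q)) ?subrr//.
  by apply/idP/idP => /set_mem[h1 h2]; apply/mem_set; split => //; exact: BA.
rewrite (@memNset _ (B `&` Q)) ?subr0; last by case.
rewrite (_ : (x \in (A `\` B) `&` Q) = (x \in A `&` Q))//.
by apply/idP/idP => /set_mem[h1 h2]; apply/mem_set; split => //; case: h1.
Qed.

(** The measurable sets on whose trace in the box [w] has integral zero form a lambda-system. It
    contains the boxes, which are stable under intersection and generate, so [w] has integral zero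
    on every measurable subset of the box. *)
Lemma test_functions_separate_box (w : 'rV[R]_d -> R) (a b : 'I_d -> R) :
  lam.-integrable Om (EFin \o w) -> box a b `<=` Om ->
  (forall a' b', box a' b' `<=` box a b -> (\int[lam]_(x in Om) (w x * \1_(box a' b') x)%:E = 0)%E) ->
  {ae lam, forall x, box a b x -> w x = 0}.
Proof.
move=> iw abO z.
have mw : measurable_fun Om w by case/integrableP: iw => /measurable_EFinP.
have mI (A : set 'rV[R]_d) : measurable A -> measurable_fun Om (fun x => w x * \1_A x).
  by move=> mA; apply: measurable_realfun.measurable_funM.
have iI (A : set 'rV[R]_d) : measurable A -> lam.-integrable Om (fun x => (w x * \1_A x)%:E).
  move=> mA; apply: (le_integrable mOm _ _ iw); first by apply/measurable_EFinP; exact: mI.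
  move=> x _; rewrite lee_fin normrM -[leRHS]mulr1 ler_wpM2l//.
  by rewrite indicE; case: (_ \in _); rewrite ?normr1 ?normr0.
have mB := measurable_box a b.
pose H : set (set 'rV[R]_d) := [set A | measurable A /\
  (\int[lam]_(x in Om) (w x * \1_(A `&` box a b) x)%:E = 0)%E].
pose G : set (set 'rV[R]_d) := [set B | exists a' b' : 'I_d -> R, B = box a' b'].
have sub : <<s G>> `<=` H.
  apply: lambda_system_subset => //.
  - by move=> _ _ [a1 [b1 ->]] [a2 [b2 ->]]; rewrite boxI; eexists; eexists.
  - split => //.
    + by split => //; rewrite setTI; apply: z.
    + move=> A B BA [mA hA] [mB' hB]; split; first exact: measurableD.
      have E x : (w x * \1_((A `\` B) `&` box a b) x)%:E =
          ((w x * \1_(A `&` box a b) x)%:E - (w x * \1_(B `&` box a b) x)%:E)%E.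
        rewrite -EFinB -mulrBr; congr (_ * _)%:E; exact: indic_setD.
      under eq_integral do rewrite E.
      by rewrite integralB// ?hA ?hB ?sube0//; apply: iI; apply: measurableI.
    + move=> F ndF hF; have mF : measurable (\bigcup_i F i).
        by apply: bigcupT_measurable => k; have [] := hF k.
      split => //.
      apply: (@integral_limit0 R d Om w (fun k => \1_(F k `&` box a b))) => //.
      * move=> k; apply: measurable_indic; apply: measurableI => //; by have [] := hF k.
      * by apply: measurable_indic; exact: measurableI.
      * by move=> k x; rewrite indicE; case: (_ \in _); rewrite ?normr1 ?normr0.
      * move=> x; rewrite setI_bigcupl.
        case: (pselect ((\bigcup_i (F i `&` box a b)) x)) => hx.
          rewrite [X in _ --> X]indicE mem_set//=.
          have [k0 _ [Fk bx]] := hx.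
          apply: cvg_near_cst; exists k0 => // k /= k0k; rewrite indicE mem_set//.
          by split => //; move: Fk; apply/subsetPset/ndF.
        rewrite [X in _ --> X]indicE memNset//=.
        apply: cvg_near_cst; apply: nearW => k; rewrite indicE memNset// => h.
        by apply: hx; exists k.
      * by move=> k; have [] := hF k.
  - move=> _ [a' [b' ->]]; split; first exact: measurable_box.
    rewrite boxI; apply: z; rewrite -boxI; exact: subIsetr.
have iwB : lam.-integrable (box a b) (EFin \o w) by exact: (integrableS mOm).
have := @integral_ae_eq _ _ _ lam _ mB (cst 0%E) _ iwB (@measurable_cst _ _ _ _ _ _).
move=> /(_ _)/wrap[|h].
  move=> E Eab mE; rewrite integral0.
  have [_] := sub _ (measurable_boxes mE).
  rewrite (setIidl Eab) => <-.
  rewrite -{1}(setIidr (subset_trans Eab abO)) integral_mkcondr.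
  apply: eq_integral => x _; rewrite /patch indicE.
  by case: ifP; rewrite ?mulr1 ?mulr0.
by apply: filterS h => x h /h [].
Qed.

(** Bumps converge to indicators of boxes whose closure lies in [U], so dominated convergence
    reduces to the case of one box. Countably many rational boxes of this kind cover [U], and their
    exceptional null sets are collected. *)
Theorem test_functions_separate (U : set 'rV[R]_d) (w : 'rV[R]_d -> R) : open U -> U `<=` Om ->
  L2 Om w -> (forall phi, test_function U phi -> ip Om w phi = 0) ->
  {ae lam, forall x, U x -> w x = 0}.
Proof.
move=> oU UO Lw z.
have Lone : L2 Om (fun=> 1).
  by apply: (L2_bounded mOm fOm (C := 1)) => // x _; rewrite normr1.
have iw : lam.-integrable Om (EFin \o w).
  by have := L2_integrableM mOm Lw Lone; congr (_.-integrable _ _); apply/funext => x /=; rewrite mulr1.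
have zbox a b : cbox a b `<=` U -> (\int[lam]_(x in Om) (w x * \1_(box a b) x)%:E = 0)%E.
  move=> abU; have mb k : measurable_fun setT (box_bump a b k).
    by apply: continuous_measurable_rV; apply: bumpy_continuous; exact: bumpy_box_bump.
  apply: (@integral_limit0 R d Om w (fun k => box_bump a b k)) => //.
  - by apply: measurable_indic; exact: measurable_box.
  - by move=> k x; exact: box_bump_norm.
  - by move=> x; exact: box_bump_cvg.
  - move=> k; have := z _ (box_bump_test k abU); rewrite /ip /Rintegral => h.
    have Lb : L2 Om (box_bump a b k).
      apply: (L2_bounded mOm fOm (C := 1)) => //; first exact: measurable_funTS.
      by move=> x _; exact: box_bump_norm.
    rewrite -[LHS]fineK ?h//; exact: integrable_fin_num (L2_integrableM mOm Lw Lb).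
pose Q (q : {ffun 'I_d -> rat * rat}) : set 'rV[R]_d :=
  box (fun i => ratr (q i).1) (fun i => ratr (q i).2).
pose cQ (q : {ffun 'I_d -> rat * rat}) : set 'rV[R]_d :=
  cbox (fun i => ratr (q i).1) (fun i => ratr (q i).2).
have boxc (a b : 'I_d -> R) : box a b `<=` cbox a b.
  by move=> x h i; have /andP[/ltW -> /ltW ->] := h i.
have aeQ q : cQ q `<=` U -> {ae lam, forall x, Q q x -> w x = 0}.
  move=> qU; apply: test_functions_separate_box => //.
    by move=> x /boxc/qU/UO.
  (* A nonempty open box inside [Q q] has its closure in [cQ q], hence in [U], so [zbox] applies; an
     empty box contributes nothing. *)
  move=> a' b' sub; case: (pselect (box a' b' !=set0)) => [[y hy]|e]; last first.
    rewrite (_ : box a' b' = set0); last first.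
      by apply/seteqP; split => // x hx; apply: e; exists x.
    under eq_integral do rewrite indic0 mulr0.
    by rewrite integral0.
  apply: zbox => x hx; apply: qU => i.
  have cv (e : R) : 0 < e < 1 -> box a' b' (x + e *: (y - x)).
    move=> /andP[e0 e1] j; rewrite !mxE.
    have /andP[x1 x2] := hx j; have /andP[y1 y2] := hy j.
    by apply/andP; split; nra.
  have /andP[y1 y2] := sub _ hy i; have /andP[x1 x2] := hx i.
  apply/andP; split; rewrite leNgt; apply/negP => xq.
    pose e := (ratr (q i).1 - x 0 i) / (y 0 i - x 0 i).
    have yx : 0 < y 0 i - x 0 i by lra.
    have /cv/sub/(_ i) : 0 < e < 1.
      by rewrite /e ltr_pdivrMr// mul1r divr_gt0//=; lra.
    by rewrite !mxE /e divfK ?gt_eqF// => /andP[+ _]; lra.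
  pose e := (ratr (q i).2 - x 0 i) / (y 0 i - x 0 i).
  have yx : 0 < x 0 i - y 0 i by lra.
  have yx0 : y 0 i - x 0 i != 0 by rewrite lt_eqF//; lra.
  have /cv/sub/(_ i) : 0 < e < 1.
    rewrite /e -mulrNN -invrN !opprB.
    by rewrite ltr_pdivrMr// mul1r divr_gt0//=; lra.
  by rewrite !mxE /e divfK// => /andP[_]; lra.
pose F k : set 'rV[R]_d := if unpickle k is Some q then
  (if `[< cQ q `<=` U >] then [set x | Q q x /\ w x != 0] else set0) else set0.
have nF k : lam.-negligible (F k).
  rewrite /F; case: (unpickle k) => [q|]; last exact: negligible_set0.
  case: asboolP => [/aeQ h|_]; last exact: negligible_set0.
  apply: negligibleS h => x [Qx wx] h; move/eqP: wx; apply; exact: h.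
apply: negligibleS (negligible_bigcup nF) => x /= /not_implyP[Ux wx].
have : nbhs x U by exact: open_nbhs_nbhs.
move=> /nbhs_ballP[e /= e0 eU].
have h i : exists q : rat * rat,
    [/\ x 0 i - e < ratr q.1, ratr q.1 < x 0 i, x 0 i < ratr q.2 & ratr q.2 < x 0 i + e].
  have /rat_in_itvoo[q1] : x 0 i - e < x 0 i by rewrite ltrBlDr ltrDl.
  have /rat_in_itvoo[q2] : x 0 i < x 0 i + e by rewrite ltrDl.
  rewrite !in_itv/= => /andP[? ?] /andP[? ?].
  by exists (q1, q2).
have [q hq] := choice h; pose q' : {ffun 'I_d -> rat * rat} := [ffun i => q i].
exists (pickle q') => //; rewrite /F pickleK; case: asboolP => [_|].
  by split; [move=> i; rewrite ffunE; have [_ -> -> _] := hq i|exact/eqP].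
case=> y Fy; apply: eU; split => // i j; rewrite ord1.
have := Fy j; rewrite ffunE => /andP[y1 y2].
have [h1 h2 h3 h4] := hq j.
rewrite /ball/= distrC ltr_distl; apply/andP; split; first exact: lt_le_trans h1 y1.
exact: le_lt_trans y2 h4.
Qed.

End fundamental_lemma2.

Lemma cts_comp (S T U : topologicalType) (f : S -> T) (g : T -> U) :
  continuous f -> continuous g -> continuous (fun x => g (f x)).
Proof. by move=> cf cg x; apply: (@continuous_comp _ _ _ f g); [exact: cf|exact: cg]. Qed.

Section continuous_functions.
Variables (R : realType) (T : topologicalType).
Implicit Types (f g : T -> R).

Lemma cts_mul f g : continuous f -> continuous g -> continuous (fun x => f x * g x).
Proof. by move=> cf cg x; apply: (@continuousM _ _ f g); [exact: cf|exact: cg]. Qed.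

Lemma cts_add f g : continuous f -> continuous g -> continuous (fun x => f x + g x).
Proof. by move=> cf cg x; apply: (@continuousD _ _ _ f g); [exact: cf|exact: cg]. Qed.

Lemma cts_scale (a : R) f : continuous f -> continuous (fun x => a * f x).
Proof. by apply: cts_mul => x; exact: cst_continuous. Qed.

Lemma cts_sum (I : Type) (r : seq I) (P : pred I) (F : I -> T -> R) :
  (forall i, continuous (F i)) -> continuous (fun x => \sum_(i <- r | P i) F i x).
Proof.
move=> cF; elim: r => [|i r IH].
  by under eq_fun do rewrite big_nil; move=> x; exact: cst_continuous.
under eq_fun do rewrite big_cons.
by case: (P i) => //; exact: cts_add.
Qed.

Lemma cts_sqr f : continuous f -> continuous (fun x => f x ^+ 2).
Proof. by move=> cf; under eq_fun do rewrite expr2; exact: cts_mul. Qed.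

End continuous_functions.

Section reference_integral.
Variables (R : realType) (d : nat) (K : ref_shape).
Local Notation lam := (lebesgue_rV R d).
Implicit Types (f g : 'rV[R]_d -> R).

Lemma ref_intD f g : continuous f -> continuous g ->
  \int[lam]_(x in ref_cell K) (f x + g x) =
  \int[lam]_(x in ref_cell K) f x + \int[lam]_(x in ref_cell K) g x.
Proof.
by move=> cf cg; rewrite RintegralD//; [exact: measurable_ref_cell|exact: integrable_ref|exact: integrable_ref].
Qed.

Lemma ref_intZ (a : R) f : continuous f ->
  \int[lam]_(x in ref_cell K) (a * f x) = a * \int[lam]_(x in ref_cell K) f x.
Proof. by move=> cf; rewrite RintegralZl//; [exact: measurable_ref_cell|exact: integrable_ref]. Qed.

Lemma ref_int_sum (I : Type) (r : seq I) (P : pred I) (F : I -> 'rV[R]_d -> R) :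
  (forall i, continuous (F i)) ->
  \int[lam]_(x in ref_cell K) (\sum_(i <- r | P i) F i x) =
  \sum_(i <- r | P i) \int[lam]_(x in ref_cell K) F i x.
Proof.
move=> cF; elim: r => [|i r IH].
  by under eq_Rintegral do rewrite big_nil; rewrite big_nil /Rintegral integral0.
rewrite big_cons -IH; under eq_Rintegral do rewrite big_cons.
by case: (P i) => //; rewrite ref_intD//; exact: cts_sum.
Qed.

Lemma ref_int_ge0 f : (forall x, ref_cell K x -> 0 <= f x) ->
  0 <= \int[lam]_(x in ref_cell K) f x.
Proof. by move=> f0; apply: Rintegral_ge0. Qed.

End reference_integral.

(** * Integration by parts and piecewise Piola fields *)

Section reference_fields.
Variables (R : realType) (m : nat).
Local Notation d := m.+1.
Local Notation lam n := (lebesgue_rV R n).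
Implicit Types (rh : 'rV[R]_d -> 'rV[R]_d) (w : 'rV[R]_d -> R).

Definition C1_field rh := forall i, Ck 1 (fun x => rh x 0 i).

Definition divergence rh x := \sum_i partial i (fun y => rh y 0 i) x.

Definition flux K rh (j : facet_ix d K) (t : 'rV[R]_m) := (rh (facet_par j t) *m nu R j) 0 0.

Lemma continuous_divergence rh : C1_field rh -> continuous (divergence rh).
Proof.
by move=> Crh; apply: cts_sum => i; apply: Ck1_partial; exact: Crh.
Qed.

Lemma continuous_field rh : C1_field rh -> continuous rh.
Proof. by move=> Crh; apply: continuous_to_rV => j; exact: Ck1_continuous (Crh j). Qed.

Lemma continuous_flux K rh (j : facet_ix d K) : continuous rh -> continuous (flux rh j).
Proof.
move=> crh; apply: (@cts_comp _ _ _ (fun t : 'rV[R]_m => rh (facet_par j t)) (fun x : 'rV[R]_d => (x *m nu R j) 0 0)).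
  by apply: (@cts_comp _ _ _ _ rh) => //; exact: continuous_facet_par.
exact: continuous_linear_form.
Qed.

Lemma RT_C1 K p rh : RT K p rh -> C1_field rh.
Proof.
have H q r (a b : 'rV[R]_d -> R) i : ref_poly K q a -> ref_poly K r b -> Ck 1 (fun x : 'rV[R]_d => a x + b x * x 0 i).
  move=> ha hb; apply: (Ck1D _ _).1; first exact: ref_poly_Ck1 ha.
  by apply: (Ck1M _ _).1; [exact: ref_poly_Ck1 hb|exact: (Ck1_coord R i).1].
case: K H => H [a [b [ha hb E]]] i.
  under eq_fun do rewrite E !mxE.
  exact: (H p p (fun x => a x 0 i) b).
under eq_fun do rewrite E.
exact: (H p p (fun x => a x 0 i) (fun x => b x 0 i)).
Qed.

Lemma ref_IBP K rh w : C1_field rh -> Ck 1 w ->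
  \int[lam d]_(x in ref_cell K) (\sum_k rh x 0 k * partial k w x + divergence rh x * w x) =
  \sum_(j : facet_ix d K) \int[lam m]_(t in ref_cell K) (w (facet_par j t) * flux rh j t).
Proof.
move=> Crh cw.
have E x : \sum_k rh x 0 k * partial k w x + divergence rh x * w x =
    \sum_k partial k (fun y => w y * rh y 0 k) x.
  rewrite /divergence mulr_suml -big_split; apply: eq_bigr => k _ /=.
  by rewrite (Ck1M cw (Crh k)).2; ring.
under eq_Rintegral do rewrite E.
rewrite (@ref_int_sum _ _ _ _ _ _ (fun k => partial k (fun y => w y * rh y 0 k))); last first.
  by move=> k; apply: Ck1_partial; exact: (Ck1M cw (Crh k)).1.
rewrite (eq_bigr _ (fun k _ => @ref_divergence R m K (fun y => w y * rh y 0 k) k (Ck1M cw (Crh k)).1)).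
rewrite exchange_big/=; apply: eq_bigr => j _.
have cf : continuous (@facet_par R d K j) by exact: continuous_facet_par.
have cr (k : 'I_d) : continuous (fun t : 'rV[R]_m => rh (facet_par j t) 0 k).
  apply: (@cts_comp _ _ _ (facet_par j) (fun x => rh x 0 k)); first exact: cf.
  exact: Ck1_continuous (Crh k).
have cwf : continuous (fun t : 'rV[R]_m => w (facet_par j t)).
  by apply: (@cts_comp _ _ _ (facet_par j) w); [exact: cf|exact: Ck1_continuous cw].
under [RHS]eq_Rintegral do rewrite /flux mxE mulr_sumr.
rewrite (@ref_int_sum _ _ _ _ _ _ (fun k t => w (facet_par j t) * (rh (facet_par j t) 0 k * nu R j k 0))).
  apply: eq_bigr => k _; rewrite -ref_intZ//; last exact: cts_mul.
  by apply: eq_Rintegral => t _; ring.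
move=> k; apply: cts_mul => //; apply: cts_mul => // t; exact: cst_continuous.
Qed.
End reference_fields.

Section mesh_fields.
Variables (R : realType) (m : nat) (K : ref_shape) (M : mesh R m.+1 K).
Local Notation d := m.+1.
Local Notation lam n := (lebesgue_rV R n).
Variable Om : set 'rV[R]_d.
Hypotheses (hconf : conforming_partition M Om) (oOm : open Om).
Hypothesis regOm : interior (closure Om) = Om.
Implicit Types (T : elt M) (s : side M).

Definition piola T (rh : 'rV[R]_d -> 'rV[R]_d) (x : 'rV[R]_d) : 'rV[R]_d :=
  (\det (jac T))^-1 *: (rh (Phi_inv T x) *m (jac T)^T).

Definition piola_div T (rh : 'rV[R]_d -> 'rV[R]_d) (x : 'rV[R]_d) : R :=
  (\det (jac T))^-1 * divergence rh (Phi_inv T x).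

(** The sign of the Jacobian. It appears because the Piola map divides by the signed determinant
    whereas integrals scale with its absolute value. *)
Definition orient T : R := `|\det (JT T)| * (\det (JT T))^-1.

Lemma orient_sqr T : orient T ^+ 2 = 1.
Proof.
have d0 : \det (JT T) != 0 by rewrite -unitfE -unitmxE unit_JT.
by rewrite /orient exprMn real_normK ?num_real// exprVn mulfV// expf_neq0.
Qed.

Lemma continuous_piola T rh i : continuous rh -> continuous (fun x => piola T rh x 0 i).
Proof.
move=> crh; under eq_fun do rewrite /piola mxE.
apply: cts_scale; apply: (@cts_comp _ _ _ (fun x => rh (Phi_inv T x)) (fun x : 'rV[R]_d => (x *m (jac T)^T) 0 i)).
  by apply: (@cts_comp _ _ _ _ rh) => //; exact: continuous_Phi_inv.
exact: continuous_linear_form.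
Qed.

Lemma continuous_pdiv T rh : C1_field rh -> continuous (piola_div T rh).
Proof.
move=> crh; apply: cts_scale; apply: (@cts_comp _ _ _ (Phi_inv T)); first exact: continuous_Phi_inv.
exact: continuous_divergence.
Qed.

(** The Piola map is made for this: in the pairing with a gradient the two Jacobian matrices cancel,
    and the divergence scales like a density, so reference integration by parts carries over with
    only the sign [orient T] left. *)
Lemma cell_IBP T rh (w : 'rV[R]_d -> R) : C1_field rh -> Ck 1 w ->
  `|\det (JT T)| * \int[lam d]_(y in ref_cell K)
    (\sum_i piola T rh (Phi T y) 0 i * partial i w (Phi T y) + piola_div T rh (Phi T y) * w (Phi T y)) =
  orient T * \sum_(j : facet_ix d K)
    \int[lam m]_(t in ref_cell K) (w (facet_map (T, j) t) * flux rh j t).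
Proof.
move=> Crh cw; have [cwp dwp] := Ck1_affine (JT T) (offset T) cw.
rewrite -(ref_IBP K Crh cwp) -mulrA; congr (_ * _).
rewrite -ref_intZ; last first.
  apply: cts_add; last first.
    by apply: cts_mul; [exact: continuous_divergence|exact: Ck1_continuous cwp].
  apply: cts_sum => i; apply: cts_mul; first exact: Ck1_continuous (Crh i).
  exact: Ck1_partial.
apply: eq_Rintegral => y _; rewrite mulrDr; congr (_ + _); last first.
  by rewrite /piola_div PhiK det_JT mulrA.
rewrite mulr_sumr; under [RHS]eq_bigr do rewrite dwp mulr_sumr mulr_sumr.
rewrite exchange_big/=; apply: eq_bigr => i _.
rewrite /piola PhiK !mxE mulr_sumr mulr_suml; apply: eq_bigr => k _.
rewrite det_JT /JT /Phi; ring.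
Qed.

Lemma ipvE (r q : 'rV[R]_d -> 'rV[R]_d) : L2v Om r -> L2v Om q ->
  ipv Om r q = \sum_i ip Om (fun x => r x 0 i) (fun x => q x 0 i).
Proof.
have mO := measurable_Om oOm.
move=> Lr Lq; rewrite /ipv /ip /dot.
suff h (l : seq 'I_d) : (lam d).-integrable Om (EFin \o (fun x => \sum_(i <- l) r x 0 i * q x 0 i)) /\
    \int[lam d]_(x in Om) (\sum_(i <- l) r x 0 i * q x 0 i) =
    \sum_(i <- l) \int[lam d]_(x in Om) (r x 0 i * q x 0 i) by have [] := h (index_enum 'I_d).
elim: l => [|i l [IH1 IH2]].
  split; last by rewrite big_nil /Rintegral; under eq_integral do rewrite big_nil; rewrite integral0.
  rewrite (_ : EFin \o _ = cst 0%E); first exact: integrable0.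
  by apply/funext => x /=; rewrite big_nil.
have ii := L2_integrableM mO (Lr i) (Lq i).
split.
  have := integrableD mO ii IH1; congr (_.-integrable _ _).
  by apply/funext => x /=; rewrite big_cons EFinD.
rewrite big_cons -IH2; under eq_Rintegral do rewrite big_cons.
by rewrite RintegralD.
Qed.

Lemma assemble_coord (r : elt M -> 'rV[R]_d -> 'rV[R]_d) i :
  (fun x => assemble r x 0 i) = assemble (fun T x => r T x 0 i).
Proof. by apply/funext => x; rewrite /assemble summxE. Qed.

Lemma assemble_L2v (r : elt M -> 'rV[R]_d -> 'rV[R]_d) :
  (forall T i, continuous (fun x => r T x 0 i)) -> L2v Om (assemble r).
Proof. by move=> cr i; rewrite assemble_coord; apply: (assemble_L2 hconf oOm). Qed.

Lemma continuous_L2 (w : 'rV[R]_d -> R) : continuous w -> L2 Om w.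
Proof.
move=> cw; have [B B0 OB] := Om_inbox hconf.
have [C C0 hC] := continuous_bounded_on B cw.
apply: (L2_bounded (measurable_Om oOm) (Om_fin hconf oOm) (C := C)).
  by apply: measurable_funTS; exact: continuous_measurable_rV.
by move=> x /OB/hC.
Qed.

Section one_field.
Variable rh : elt M -> 'rV[R]_d -> 'rV[R]_d.
Hypothesis Crh : forall T, C1_field (rh T).

Local Notation r := (fun T => piola T (rh T)).
Local Notation divr := (fun T => piola_div T (rh T)).

Lemma piola_L2v : L2v Om (assemble r).
Proof. by apply: assemble_L2v => T i; apply: continuous_piola; exact: continuous_field. Qed.

Lemma pdiv_L2 : L2 Om (assemble divr).
Proof. by apply: (assemble_L2 hconf oOm) => // T; exact: continuous_pdiv. Qed.

Lemma mesh_IBP (w : 'rV[R]_d -> R) : Ck 1 w ->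
  ipv Om (assemble r) (grad w) + ip Om (assemble divr) w =
  \sum_s orient s.1 * \int[lam m]_(t in ref_cell K) (w (facet_map s t) * flux (rh s.1) s.2 t).
Proof.
move=> cw.
have cpw i := Ck1_partial (i := i) cw.
have cPhi T (g : 'rV[R]_d -> R) : continuous g -> continuous (fun y => g (Phi T y)).
  by apply: cts_comp; exact: continuous_Phi.
have Lg : L2v Om (grad w).
  by move=> i; rewrite (_ : (fun x => _) = partial i w); [exact: continuous_L2|apply/funext => x; rewrite mxE].
have cp T i : continuous (fun x => piola T (rh T) x 0 i).
  by apply: continuous_piola; exact: continuous_field.
have cd T : continuous (piola_div T (rh T)) by exact: continuous_pdiv.
rewrite ipvE//; last exact: piola_L2v.
have E i : ip Om (fun x => assemble r x 0 i) (fun x => grad w x 0 i) =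
    \sum_T `|\det (JT T)| * \int[lam d]_(y in ref_cell K) (piola T (rh T) (Phi T y) 0 i * partial i w (Phi T y)).
  rewrite assemble_coord (_ : (fun x => grad w x 0 i) = partial i w); last by apply/funext => x; rewrite mxE.
  apply: (ip_mesh hconf oOm regOm (u := fun T x => piola T (rh T) x 0 i) (v := fun=> partial i w)) => //.
  - exact: (assemble_L2 hconf oOm).
  - exact: continuous_L2.
  - by move=> T x; exact: (assemble_interior hconf).
under eq_bigr do rewrite E.
rewrite (ip_mesh hconf oOm regOm (u := divr) (v := fun=> w)) //; first last.
- by move=> T x; exact: (assemble_interior hconf).
- by apply: continuous_L2; exact: Ck1_continuous.
- exact: pdiv_L2.
- by move=> _; exact: Ck1_continuous.
rewrite exchange_big -big_split /=.
rewrite -(pair_bigA _ (fun T j => orient T * \int[lam m]_(t in ref_cell K) (w (facet_map (T, j) t) * flux (rh T) j t))) /=.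
apply: eq_bigr => T _; rewrite -[RHS]mulr_sumr -cell_IBP//.
rewrite -mulr_sumr -mulrDr; congr (_ * _).
rewrite -ref_int_sum; last by move=> i; apply: cts_mul; [exact: (cPhi T _ (cp T i))|exact: (cPhi T _ (cpw i))].
rewrite -ref_intD//; first by apply: cts_sum => i; apply: cts_mul; [exact: (cPhi T _ (cp T i))|exact: (cPhi T _ (cpw i))].
by apply: cts_mul; [exact: (cPhi T _ (cd T))|apply: (cPhi T w); exact: Ck1_continuous].
Qed.

(** A segment from [x] to an interior point of [T] is in the interior of [T] right after its start;
    if [x] were interior to [T'], the two interiors would meet. *)
Lemma cell_avoids_interior T T' x : T != T' -> cell T x -> ~ cell_interior T' x.
Proof.
move=> TT' Tx T'x.
have [y Ty] := cell_interior_neq0 T.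
have nr (P : set R) : nbhs (0 : R) P -> \forall e \near (0 : R)^'+, P e.
  by move=> h; rewrite /at_right /within /=; apply: filterS h => e Pe _.
have cl : continuous (fun e : R => x + e *: (y - x)).
  move=> e; apply: (@continuousD _ _ _ (cst x) (fun e : R => e *: (y - x))).
    exact: cst_continuous.
  exact: scalel_continuous.
have h1 : \forall e \near (0 : R)^'+, cell_interior T' (x + e *: (y - x)).
  apply: nr; have : nbhs (x + (0 : R) *: (y - x)) (cell_interior T').
    by rewrite scale0r addr0; apply: open_nbhs_nbhs; split => //; exact: open_cell_interior.
  exact: cl.
have : \forall e \near (0 : R)^'+, False.
  near=> e; move/eqP: TT'; apply.
  apply: (disjoint_cell_interior hconf (x := x + e *: (y - x))); last by near: e.
  have e0 : 0 < e by near: e; exact: nbhs_right_gt.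
  have e1 : e < 1 by near: e; exact: nbhs_right_lt.
  move=> k; rewrite Phi_inv_line facet_form_line.
  apply: ltr_wpDl; last by apply: mulr_gt0 => //; exact: Ty.
  by rewrite mulr_ge0 ?subr_ge0 ?(ltW e1)//; move/cellP: Tx; apply.
by move=> /filter_ex[].
Unshelve. all: by end_near. Qed.

Lemma facet_avoids_interior s T t : ref_cell K t -> ~ cell_interior T (facet_map s t).
Proof.
move=> rt; have [->|TT] := eqVneq T s.1.
  by move=> /(_ s.2); rewrite facet_map_form ltxx.
apply: (@cell_avoids_interior s.1); first by rewrite eq_sym.
by apply/cellP; rewrite /facet_map PhiK; exact: facet_par_cell.
Qed.

Lemma test_function_Ck1 U (w : 'rV[R]_d -> R) : test_function U w -> Ck 1 w.
Proof. by case=> h _; exact: h. Qed.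

Lemma test_function_out U (w : 'rV[R]_d -> R) x : test_function U w -> ~ U x -> w x = 0.
Proof. by case=> _ [S [_ SU h]] Ux; apply: h => /SU. Qed.

Lemma ref_int_eq0 n (g : 'rV[R]_n -> R) : (forall t, ref_cell K t -> g t = 0) ->
  \int[lam n]_(t in ref_cell K) g t = 0.
Proof.
move=> h; transitivity (\int[lam n]_(t in @ref_cell R n K) (0 : R)).
  by apply: eq_Rintegral => t /set_mem/h.
by rewrite /Rintegral integral0.
Qed.

(** A test function supported in one open cell vanishes on all facets, so [mesh_IBP] identifies the
    weak divergence with the elementwise one in that cell. The cells exhaust the domain up to the
    null skeleton. *)
Lemma weak_div_assemble : Hdiv Om (assemble r) ->
  L2 Om (weak_div Om (assemble r)) /\
  {ae lam d, forall x, Om x -> weak_div Om (assemble r) x = assemble divr x}.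
Proof.
have mO := measurable_Om oOm; have fO := Om_fin hconf oOm.
move=> [_ [u0 hu0]]; have [Lu hu] : is_weak_div Om (assemble r) (weak_div Om (assemble r)).
  exact: (xgetPex (fun=> 0) (ex_intro _ u0 hu0)).
split => //; set u := weak_div _ _ in Lu hu *.
have Ld := pdiv_L2.
have h T : {ae lam d, forall x, cell_interior T x -> u x - assemble divr x = 0}.
  apply: (@test_functions_separate R d Om mO fO (cell_interior T)).
  - exact: open_cell_interior.
  - exact: (cell_interior_sub hconf regOm).
  - exact: L2B.
  move=> w tw; have tO : test_function Om w.
    case: tw => h [S [cS SU S0]]; split => //; exists S; split => //.
    by move=> x /SU; exact: (cell_interior_sub hconf regOm).
  have cw := test_function_Ck1 tw.
  have Lw : L2 Om w by apply: continuous_L2; exact: Ck1_continuous.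
  rewrite ipBl//; have := mesh_IBP cw; rewrite hu// big1 => [/eqP|s _].
    by rewrite addrC subr_eq0 => /eqP ->; rewrite subrr.
  rewrite ref_int_eq0 ?mulr0// => t rt; rewrite (test_function_out tw) ?mul0r//.
  exact: facet_avoids_interior.
have [mS nS] := @skeleton_null R m K M.
have nsk : {ae lam d, forall x, ~ skeleton M x}.
  exists (skeleton M); split => // x /= /contrapT; exact.
have hall : {ae lam d, forall x, forall T, cell_interior T x -> u x - assemble divr x = 0}.
  apply: (@filter_forall _ 'I_(nelt M) (fun T x => cell_interior T x -> u x - assemble divr x = 0) (almost_everywhere (lam d)) _) => T.
  exact: h.
apply: filterS2 nsk hall => x sx hx Ox.
have [T _ Tx] : (\bigcup_(T in [set: elt M]) cell T) x.
  by case: hconf => <- _ _; exact: subset_closure.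
by apply/eqP; rewrite -subr_eq0; apply/eqP; apply: (hx T); exact: off_skeleton.
Qed.

Hypothesis matched : forall s s' t t', opposite s = Some s' ->
  facet_map s t = facet_map s' t' ->
  orient s.1 * flux (rh s.1) s.2 t = - (orient s'.1 * flux (rh s'.1) s'.2 t').

(** In [mesh_IBP] the two contributions of a paired facet cancel by [matched], after the transition
    between the two parametrizations, and an unpaired facet lies outside the domain, where test
    functions vanish. *)
Lemma matched_Hdiv : Hdiv Om (assemble r).
Proof.
split; first exact: piola_L2v.
exists (assemble divr); split; first exact: pdiv_L2.
move=> w tw; have cw := test_function_Ck1 tw.
apply/eqP; rewrite -addr_eq0 mesh_IBP//; apply/eqP.
pose X s := orient s.1 * \int[lam m]_(t in ref_cell K) (w (facet_map s t) * flux (rh s.1) s.2 t).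
have X0 s : opposite s = None -> X s = 0.
  move=> os; rewrite /X ref_int_eq0 ?mulr0// => t rt.
  rewrite (test_function_out tw) ?mul0r//; apply: (unpaired_facet hconf oOm os).
  by rewrite facetE; exists t.
have cX s' : continuous (fun t : 'rV[R]_m => w (facet_map s' t) * flux (rh s'.1) s'.2 t).
  apply: cts_mul; last by apply: continuous_flux; exact: continuous_field.
  by apply: (@cts_comp _ _ _ (facet_map s') w); [exact: continuous_facet_map|exact: Ck1_continuous].
have Xopp s s' : opposite s = Some s' -> X s = - X s'.
  move=> ss'; have [_ /facet_transition[B [b [dB uB _ tr iff]]]] := oppositeP ss'.
  rewrite /X -(Rintegral_ref_automorphism dB uB iff (cX s')) -mulNr.
  have cX' : continuous (fun t : 'rV[R]_m => w (facet_map s' (t *m B + b)) * flux (rh s'.1) s'.2 (t *m B + b)).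
    by apply: (cts_comp _ (cX s')); exact: continuous_affine_map.
  rewrite -!ref_intZ//; apply: eq_Rintegral => t _.
  rewrite mulrCA (matched ss' (tr t)) tr; ring.
(* Exchanging the two sides of every facet reverses the sign of the total, which is therefore
   zero. *)
pose sig s := if opposite s is Some s' then s' else s.
have sigK : involutive sig.
  move=> s; rewrite /sig; case E: (opposite s) => [s'|]; last by rewrite E.
  by rewrite (opposite_sym hconf E).
have E : \sum_s X s = - \sum_s X s.
  rewrite {1}(reindex_inj (inv_inj sigK)) -sumrN; apply: eq_bigr => s _.
  rewrite /sig; case E: (opposite s) => [s'|]; last by rewrite X0// oppr0.
  by rewrite (Xopp s' s)//; exact: (opposite_sym hconf E).
by move: E; rewrite -/(X _); lra.
Qed.

End one_field.
End mesh_fields.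

(** * Semidefinite forms on finitely generated subspaces *)

Section semidefinite_forms.
Variables (R : realType) (V : lmodType R).
Implicit Types (S : V -> Prop) (L : V -> R) (B : V -> V -> R).

Definition linear_subspace S := S 0 /\ forall a x y, S x -> S y -> S (a *: x + y).

Definition linear_on S L := forall a x y, S x -> S y -> L (a *: x + y) = a * L x + L y.

Definition psd_form S B := [/\ forall y, S y -> linear_on S (fun x => B x y),
  forall x y, S x -> S y -> B x y = B y x & forall x, S x -> 0 <= B x x].

Definition comb N (b : 'I_N -> V) (c : 'rV[R]_N) : V := \sum_i c 0 i *: b i.

(** Discrete spaces are predicates on an ambient function space, and finite dimension is a finite
    generating family. No independence is asked, so Gram matrices may be singular. *)
Definition generates S N (b : 'I_N -> V) :=
  (forall i, S (b i)) /\ forall x, S x -> exists c, x = comb b c.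

Section in_subspace.
Variable S : V -> Prop.
Hypothesis sS : linear_subspace S.

Lemma subspaceZ a x : S x -> S (a *: x).
Proof. by case: sS => S0 h Sx; rewrite -[_ *: _]addr0; exact: h. Qed.

Lemma subspaceD x y : S x -> S y -> S (x + y).
Proof. by case: sS => _ h Sx Sy; have := h 1 x y Sx Sy; rewrite scale1r. Qed.

Lemma subspaceB x y : S x -> S y -> S (x - y).
Proof. by move=> Sx Sy; rewrite -scaleN1r addrC; case: sS => _; apply. Qed.

Lemma subspace_sum (I : Type) (r : seq I) (P : pred I) (F : I -> V) :
  (forall i, P i -> S (F i)) -> S (\sum_(i <- r | P i) F i).
Proof. by move=> h; elim/big_ind: _ => //; [case: sS|exact: subspaceD]. Qed.

Lemma subspace_comb N (b : 'I_N -> V) c : (forall i, S (b i)) -> S (comb b c).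
Proof. by move=> h; apply: subspace_sum => i _; exact: subspaceZ. Qed.

Lemma linear_on0 L : linear_on S L -> L 0 = 0.
Proof.
case: sS => S0 _ h; have := h 1 0 0 S0 S0; rewrite scaler0 addr0 mul1r => /eqP.
by rewrite -subr_eq0 opprD addrA subrr sub0r oppr_eq0 => /eqP.
Qed.

Lemma linear_onD L x y : linear_on S L -> S x -> S y -> L (x + y) = L x + L y.
Proof. by move=> h Sx Sy; have := h 1 x y Sx Sy; rewrite scale1r mul1r. Qed.

Lemma linear_onZ L a x : linear_on S L -> S x -> L (a *: x) = a * L x.
Proof.
move=> h Sx; have := h a x 0 Sx sS.1; rewrite addr0 => ->.
by rewrite linear_on0// addr0.
Qed.

Lemma linear_onB L x y : linear_on S L -> S x -> S y -> L (x - y) = L x - L y.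
Proof.
move=> h Sx Sy; rewrite linear_onD//; last by rewrite -scaleN1r; exact: subspaceZ.
by rewrite -scaleN1r linear_onZ// mulN1r.
Qed.

Lemma linear_on_sum L (I : Type) (r : seq I) (F : I -> V) : linear_on S L ->
  (forall i, S (F i)) -> L (\sum_(i <- r) F i) = \sum_(i <- r) L (F i).
Proof.
move=> h SF; elim: r => [|i r IH]; first by rewrite !big_nil linear_on0.
by rewrite !big_cons linear_onD ?IH//; apply: subspace_sum.
Qed.

Lemma linear_on_comb L N (b : 'I_N -> V) c : linear_on S L -> (forall i, S (b i)) ->
  L (comb b c) = \sum_i c 0 i * L (b i).
Proof.
move=> h Sb; rewrite linear_on_sum//; last by move=> i; exact: subspaceZ.
by apply: eq_bigr => i _; rewrite linear_onZ.
Qed.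

Section one_form.
Variable B : V -> V -> R.
Hypothesis pB : psd_form S B.

Lemma psdl y : S y -> linear_on S (fun x => B x y). Proof. by case: pB => h _ _; exact: h. Qed.
Lemma psdC x y : S x -> S y -> B x y = B y x. Proof. by case: pB => _ + _; apply. Qed.
Lemma psd_ge0 x : S x -> 0 <= B x x. Proof. by case: pB => _ _; apply. Qed.

Lemma psdr x : S x -> linear_on S (B x).
Proof.
move=> Sx a y z Sy Sz; rewrite psdC//; last by case: sS => _; apply.
by rewrite psdl// (psdC Sy)// (psdC Sz).
Qed.

Lemma psd_square t x y : S x -> S y ->
  B (t *: x + y) (t *: x + y) = t ^+ 2 * B x x + t * (B x y *+ 2) + B y y.
Proof.
move=> Sx Sy; have Sxy : S (t *: x + y) by case: sS => _; apply.
by rewrite psdl// !psdr// (psdC Sy Sx); ring.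
Qed.

Lemma psd_cauchy x y : S x -> S y -> B x y ^+ 2 <= B x x * B y y.
Proof.
move=> Sx Sy; have h t : 0 <= t ^+ 2 * B x x + t * (B x y *+ 2) + B y y.
  by rewrite -psd_square//; apply: psd_ge0; case: sS => _; apply.
have [x0|xn] := eqVneq (B x x) 0.
  rewrite x0 mul0r; have [->|yn] := eqVneq (B x y) 0; first by rewrite expr0n.
  (* When [B x x] is zero the quadratic in [t] is affine, and this value of [t] makes it equal to
     -1. *)
  have := h (- (B y y + 1) / (B x y *+ 2)); rewrite x0 mulr0 add0r divfK; last first.
    by rewrite mulrn_eq0.
  have := psd_ge0 Sy; lra.
have xp : 0 < B x x by rewrite lt_neqAle eq_sym xn psd_ge0.
have := h (- B x y / B x x).
rewrite (_ : _ + B y y = (B x x * B y y - B x y ^+ 2) / B x x); last by field.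
by rewrite pmulr_lge0 ?invr_gt0// subr_ge0.
Qed.

Lemma psd_null x y : S x -> S y -> B x x = 0 -> B x y = 0.
Proof.
move=> Sx Sy x0; have := psd_cauchy Sx Sy; rewrite x0 mul0r => h.
by apply/eqP; rewrite -sqrf_eq0 eq_le h sqr_ge0.
Qed.

Lemma psd_comb N (b : 'I_N -> V) c c' : (forall i, S (b i)) ->
  B (comb b c) (comb b c') = (c *m (\matrix_(i, j) B (b i) (b j)) *m c'^T) 0 0.
Proof.
move=> Sb; rewrite (linear_on_comb _ (psdl _))//; last exact: subspace_comb.
rewrite -mulmxA mxE; apply: eq_bigr => i _; congr (_ * _).
rewrite (linear_on_comb _ (psdr _))// mxE; apply: eq_bigr => j _.
by rewrite !mxE mulrC.
Qed.

(** A coefficient vector in the kernel of the Gram matrix represents a null vector of the form, on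
    which [L] vanishes. Hence the row of values of [L] lies in the row space of the Gram matrix, and
    a pseudo-inverse solves the system. *)
Lemma riesz N (b : 'I_N -> V) L : generates S b -> linear_on S L ->
  (forall x, S x -> B x x = 0 -> L x = 0) ->
  exists2 q, S q & forall x, S x -> B q x = L x.
Proof.
move=> [Sb gen] lL ker; pose G := \matrix_(i, j) B (b i) (b j).
pose l : 'rV[R]_N := \row_i L (b i).
have lG : (l <= G)%MS.
  rewrite submxE; apply/eqP/row_matrixP => i0; rewrite ord1 {i0} row0.
  apply/rowP => k; pose y := (col k (cokermx G))^T.
  have Gy : G *m y^T = 0 by rewrite trmxK colE mulmxA mulmx_coker mul0mx.
  have : L (comb b y) = 0.
    apply: ker; first exact: subspace_comb.
    by rewrite psd_comb// -mulmxA Gy mulmx0 mxE.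
  rewrite (linear_on_comb _ lL)// => h; rewrite [RHS]mxE -h !mxE; apply: eq_bigr => i _.
  by rewrite /y !mxE mulrC.
exists (comb b (l *m pinvmx G)); first exact: subspace_comb.
move=> _ /gen[c ->]; rewrite psd_comb// mulmxKpV//.
by rewrite (linear_on_comb _ lL)// mxE; apply: eq_bigr => i _; rewrite !mxE mulrC.
Qed.

End one_form.
End in_subspace.

(** Among the coefficient matrices whose rows represent elements of [S], one of maximal rank already
    spans: adding the coefficients of a further element cannot raise the rank. *)
Lemma sub_generates S0 S N (b : 'I_N -> V) : linear_subspace S -> generates S0 b ->
  (forall x, S x -> S0 x) -> exists N' (b' : 'I_N' -> V), generates S b'.
Proof.
move=> sS [Sb gen] SS0.
pose P (k : nat) := `[< exists A : 'M[R]_N, (\rank A = k) /\ forall i, S (comb b (row i A)) >].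
have P0 : exists k, P k.
  exists 0%N; apply/asboolP; exists 0; split; first exact: mxrank0.
  move=> i; rewrite row0 /comb big1; first by case: sS.
  by move=> j _; rewrite mxE scale0r.
have Pb k : P k -> (k <= N)%N by move=> /asboolP[A [<- _]]; exact: rank_leq_row.
have [k /asboolP[A [rA SA]] kmax] := ex_maxnP P0 Pb.
exists N, (fun i => comb b (row i A)); split => // x Sx.
have [c xc] := gen x (SS0 x Sx).
have cA : (c <= A)%MS.
  have combM (y : 'rV[R]_N) : comb b (y *m A) = \sum_i y 0 i *: comb b (row i A).
    rewrite /comb; under [RHS]eq_bigr do rewrite scaler_sumr.
    rewrite exchange_big/=; apply: eq_bigr => j _; rewrite mxE scaler_suml.
    by apply: eq_bigr => i _; rewrite mxE scalerA.
  have Srow (y : 'rV[R]_N) : (y <= A + c)%MS -> S (comb b y).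
    move=> /sub_addsmxP[[u1 u2] /= ->].
    have -> : comb b (u1 *m A + u2 *m c) = (u2 0 0) *: x + comb b (u1 *m A).
      rewrite xc /comb scaler_sumr -big_split; apply: eq_bigr => i _ /=.
      by rewrite [in LHS]mxE [X in (_ + X) *: _]mxE big_ord1 scalerDl addrC scalerA.
    have [_ cl] := sS; apply: cl => //; rewrite combM; apply: (subspace_sum sS) => i _.
    exact: (subspaceZ sS).
  have : (\rank (A + c)%MS <= k)%N.
    apply: kmax; apply/asboolP; exists (A + c)%MS; split => // i.
    by apply: Srow; exact: row_sub.
  rewrite -rA => h; have := mxrank_leqif_sup (addsmxSl A c) => -[h1 h2].
  have : \rank A == \rank (A + c)%MS by rewrite eqn_leq h1 h.
  by rewrite h2; apply: submx_trans; exact: addsmxSr.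
exists (c *m pinvmx A); rewrite xc -{1}(mulmxKpV cA).
rewrite /comb; under [RHS]eq_bigr do rewrite scaler_sumr.
rewrite exchange_big/=; apply: eq_bigr => j _; rewrite mxE scaler_suml.
by apply: eq_bigr => i _; rewrite [X in _ = _ *: (X *: _)]mxE scalerA.
Qed.

End semidefinite_forms.

(** * Quadratic forms: coercivity, minimization and spectral bounds *)

Section matrix_forms.
Variable R : realType.

Definition mform N (G : 'M[R]_N) (x y : 'rV[R]_N) : R := (x *m G *m y^T) 0 0.

Definition sqnorm N (x : 'rV[R]_N) : R := \sum_i x 0 i ^+ 2.

Lemma sqnorm_ge0 N (x : 'rV[R]_N) : 0 <= sqnorm x.
Proof. by apply: sumr_ge0 => i _; exact: sqr_ge0. Qed.

Lemma sqnorm_eq0 N (x : 'rV[R]_N) : sqnorm x = 0 -> x = 0.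
Proof.
move=> h; apply/rowP => i; rewrite [RHS]mxE; apply/eqP; rewrite -sqrf_eq0; apply/eqP.
by apply: (psumr_eq0P (P := xpredT) (F := fun i => x 0 i ^+ 2) _ h) => // j _; exact: sqr_ge0.
Qed.

Lemma mformE N (G : 'M[R]_N) x y : mform G x y = \sum_i \sum_j x 0 i * G i j * y 0 j.
Proof.
rewrite /mform mxE exchange_big; apply: eq_bigr => j _ /=.
by rewrite !mxE mulr_suml.
Qed.

Lemma continuous_mform N (G : 'M[R]_N) (f g : 'rV[R]_N -> 'rV[R]_N) :
  continuous f -> continuous g -> continuous (fun x => mform G (f x) (g x)).
Proof.
move=> cf cg; under eq_fun do rewrite mformE.
have cc (h : 'rV[R]_N -> 'rV[R]_N) i : continuous h -> continuous (fun x => h x 0 i).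
  by move=> ch; apply: (@cts_comp _ _ _ h (fun y : 'rV[R]_N => y 0 i)) => // y; exact: coord_continuous.
apply: cts_sum => i; apply: cts_sum => j; apply: cts_mul; last exact: cc.
by apply: cts_mul; [exact: cc|move=> x; exact: cst_continuous].
Qed.

Lemma mformZ N (G : 'M[R]_N) a x : mform G (a *: x) (a *: x) = a ^+ 2 * mform G x x.
Proof.
rewrite !mformE mulr_sumr; apply: eq_bigr => i _; rewrite mulr_sumr.
by apply: eq_bigr => j _; rewrite !mxE; ring.
Qed.

Lemma mform0 N (G : 'M[R]_N) : mform G 0 0 = 0.
Proof. by rewrite -(scale0r (0 : 'rV[R]_N)) mformZ expr0n mul0r. Qed.

Lemma sqnorm0 N : sqnorm (0 : 'rV[R]_N) = 0.
Proof. by rewrite /sqnorm big1// => i _; rewrite mxE expr0n. Qed.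

Lemma continuous_sqnorm N : continuous (@sqnorm N).
Proof. by apply: cts_sum => i; apply: cts_sqr => y; exact: coord_continuous. Qed.

Lemma compact_sphere N k (W : 'M[R]_(N, k)) : compact [set x : 'rV[R]_N | x *m W = 0 /\ sqnorm x = 1].
Proof.
apply: (@subclosed_compact _ _ (inbox 1)); last 2 first.
- exact: compact_inbox.
- move=> x /= [_ h] i; rewrite -ler_sqr ?nnegrE// expr1n real_normK ?num_real//.
  by rewrite -h /sqnorm (bigD1 i)//= lerDl sumr_ge0// => j _; exact: sqr_ge0.
rewrite (_ : [set x | _] = (\bigcap_(j in [set: 'I_k]) [set x : 'rV[R]_N | (x *m W) 0 j = 0]) `&`
  [set x : 'rV[R]_N | sqnorm x = 1]).
  apply: closedI.
    apply: closed_bigI => j _; apply: (@closed_comp _ _ (fun x : 'rV[R]_N => (x *m W) 0 j) [set y | y = 0]).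
      by move=> x _; exact: continuous_linear_form.
    exact: closed_eq.
  apply: (@closed_comp _ _ (@sqnorm N) [set y | y = 1]); first by move=> x _; exact: continuous_sqnorm.
  exact: closed_eq.
apply/seteqP; split => x /= [h ->]; split => //.
  by move=> j _ /=; rewrite h mxE.
by apply/rowP => j; have /= -> := h j I; rewrite mxE.
Qed.

(** The constant is the minimum of the form on the unit sphere of the subspace [x *m W = 0], which
    is compact. A zero matrix [W] imposes no constraint. *)
Lemma coercive_on N k (W : 'M[R]_(N, k)) (G : 'M[R]_N) :
  (forall x, x *m W = 0 -> x != 0 -> 0 < mform G x x) ->
  exists2 c, 0 < c & forall x, x *m W = 0 -> c * sqnorm x <= mform G x x.
Proof.
move=> pos; set D := [set x : 'rV[R]_N | x *m W = 0 /\ sqnorm x = 1].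
have norm1 x : x *m W = 0 -> x != 0 -> D ((Num.sqrt (sqnorm x))^-1 *: x).
  move=> xW x0; split; first by rewrite -scalemxAl xW scaler0.
  have s0 : 0 < sqnorm x.
    by rewrite lt_neqAle sqnorm_ge0 eq_sym andbT; apply: contra_neq x0; exact: sqnorm_eq0.
  rewrite /sqnorm; under eq_bigr do rewrite mxE exprMn.
  by rewrite -mulr_sumr exprVn sqr_sqrtr ?mulVf ?gt_eqF// ltW.
have [D0|nD] := pselect (D !=set0); last first.
  exists 1 => // x xW; have [->|x0] := eqVneq x 0.
    by rewrite sqnorm0 mform0 mulr0.
  by exfalso; apply: nD; eexists; exact: norm1 xW x0.
have cid : continuous (fun x : 'rV[R]_N => x) by move=> x; exact: cvg_id.
have [y /set_mem[yW y1] ymin] := EVT_min_rV D0 (@compact_sphere N k W)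
  (continuous_subspaceT (@continuous_mform N G _ _ cid cid)).
have yp : 0 < mform G y y.
  apply: pos => //; apply/eqP => y0; move: y1; rewrite y0 sqnorm0 => /eqP.
  by rewrite eq_sym oner_eq0.
exists (mform G y y) => // x xW; have [->|x0] := eqVneq x 0.
  by rewrite sqnorm0 mform0 mulr0.
have h := norm1 _ xW x0; have := ymin _ (mem_set h).
have s0 : 0 < sqnorm x.
  by rewrite lt_neqAle sqnorm_ge0 eq_sym andbT; apply: contra_neq x0; exact: sqnorm_eq0.
rewrite mformZ exprVn (sqr_sqrtr (ltW s0)) => h2.
by rewrite -ler_pdivlMr// mulrC.
Qed.

Lemma mform_bound N (G : 'M[R]_N) : exists2 C, 0 <= C & forall x, mform G x x <= C * sqnorm x.
Proof.
exists (\sum_i \sum_j `|G i j|) => [|x].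
  by apply: sumr_ge0 => i _; exact: sumr_ge0.
rewrite mformE mulr_suml; apply: ler_sum => i _; rewrite mulr_suml; apply: ler_sum => j _.
apply: (le_trans (ler_norm _)); rewrite !normrM mulrAC -mulrA mulrC -mulrA mulrC -mulrA.
rewrite ler_wpM2l//.
have h k : `|x 0 k| ^+ 2 <= sqnorm x.
  rewrite real_normK ?num_real// /sqnorm (bigD1 k)//= lerDl sumr_ge0// => l _.
  exact: sqr_ge0.
have := h i; have := h j; have := sqr_ge0 (`|x 0 i| - `|x 0 j|); nra.
Qed.

Lemma mformDl N (G : 'M[R]_N) x y z : mform G (x + y) z = mform G x z + mform G y z.
Proof. by rewrite /mform !mulmxDl mxE. Qed.

Lemma mformDr N (G : 'M[R]_N) x y z : mform G z (x + y) = mform G z x + mform G z y.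
Proof. by rewrite /mform linearD mulmxDr mxE. Qed.

(* modulo the kernel of G1, which lies in the kernel of G2, every vector has a *)
(* representative in the row space of G1, where G1 is coercive *)
Lemma mform_dominated N (G1 G2 : 'M[R]_N) : G1^T = G1 -> G2^T = G2 ->
  (forall x y, mform G1 x x = 0 -> mform G1 x y = 0) ->
  (forall x y, mform G2 x x = 0 -> mform G2 x y = 0) ->
  (forall x, 0 <= mform G1 x x) -> (forall x, mform G1 x x = 0 -> mform G2 x x = 0) ->
  exists2 C, 0 <= C & forall x, mform G2 x x <= C * mform G1 x x.
Proof.
move=> s1 s2 n1 n2 p1 ker.
have mformC G x y : G^T = G -> mform G x y = mform G y x.
  move=> s; rewrite !mformE exchange_big; apply: eq_bigr => i _; apply: eq_bigr => j _ /=.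
  have -> : G j i = G i j by move/matrixP: s => /(_ i j); rewrite mxE.
  ring.
have dot0 (x : 'rV[R]_N) : (x *m x^T) 0 0 = 0 -> x = 0.
  rewrite mxE => h; apply: sqnorm_eq0; rewrite -h; apply: eq_bigr => i _.
  by rewrite mxE expr2.
have [c c0 hc] : exists2 c, 0 < c & forall z, z *m cokermx G1 = 0 -> c * sqnorm z <= mform G1 z z.
  apply: coercive_on => z zc z0; rewrite lt_neqAle p1 andbT eq_sym; apply: contra_neq z0 => zz.
  have /submxP[w zw] : (z <= G1)%MS by rewrite submxE zc.
  apply: dot0; rewrite {1}zw -mulmxA.
  have := n1 z w zz; rewrite mformC// /mform => <-.
  by rewrite -!mulmxA.
have [C C0 hC] := mform_bound G2.
exists (C / c) => [|x]; first by rewrite divr_ge0// ltW.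
(* For symmetric [G1] the matrix and its square have the same kernel, because the squared norm of
   [u *m G1] is the form of [G1 *m G1] at [u]; hence they have the same row space. *)
have xG : (x *m G1 <= G1 *m G1)%MS.
  rewrite submxE -mulmxA; apply/eqP; rewrite (_ : G1 *m cokermx _ = 0) ?mulmx0//.
  set Y := cokermx _; have h : G1 *m G1 *m Y = 0 by exact: mulmx_coker.
  apply/matrixP => i j; rewrite [RHS]mxE; pose u := (col j Y)^T.
  have u0 : u *m G1 = 0.
    apply: dot0; rewrite trmx_mul s1 /u trmxK colE -mulmxA [G1 *m (G1 *m _)]mulmxA mulmxA.
    by rewrite -mulmxA (mulmxA _ Y) h mul0mx mulmx0 mxE.
  have : G1 *m col j Y = 0 by rewrite -[col j Y]trmxK -/u -s1 -trmx_mul u0 trmx0.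
  by rewrite colE mulmxA -colE => /colP/(_ i); rewrite [LHS]mxE [RHS]mxE.
have [w xw] := submxP xG.
pose z := w *m G1.
have [k [kG xE]] : exists k, k *m G1 = 0 /\ x = k + z.
  by exists (x - z); rewrite mulmxBl xw mulmxA subrr subrK.
have k0 : mform G1 k k = 0 by rewrite /mform kG mul0mx mxE.
have e1 : mform G1 x x = mform G1 z z.
  by rewrite xE mformDl !mformDr k0 (n1 k z)// (mformC _ G1 z)// (n1 k z)// !add0r.
have e2 : mform G2 x x = mform G2 z z.
  have k2 := ker _ k0.
  by rewrite xE mformDl !mformDr k2 (n2 k z)// (mformC _ G2 z)// (n2 k z)// !add0r.
rewrite e1 e2; apply: (le_trans (hC z)); rewrite -mulrA ler_wpM2l//.
rewrite mulrC ler_pdivlMr// mulrC; apply: hc.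
by rewrite /z -mulmxA mulmx_coker mulmx0.
Qed.

End matrix_forms.

Section dominated_forms.
Variables (R : realType) (V : lmodType R) (S : V -> Prop) (N : nat) (b : 'I_N -> V).
Hypotheses (sS : linear_subspace S) (gS : generates S b).

(** Equivalence of norms in finite dimension, for seminorms. It is used on reference polynomials,
    where the constant is independent of the mesh, and on the flux space of one mesh, where it is
    not. *)
Lemma psd_dominated (B1 B2 : V -> V -> R) : psd_form S B1 -> psd_form S B2 ->
  (forall x, S x -> B1 x x = 0 -> B2 x x = 0) ->
  exists2 C, 0 <= C & forall x, S x -> B2 x x <= C * B1 x x.
Proof.
have [Sb gen] := gS; move=> p1 p2 ker.
pose G (B : V -> V -> R) := \matrix_(i, j) B (b i) (b j).
have E B x y : psd_form S B -> mform (G B) x y = B (comb b x) (comb b y).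
  by move=> pB; rewrite (psd_comb sS pB).
have Sc x : S (comb b x) by exact: subspace_comb.
have sym B : psd_form S B -> (G B)^T = G B.
  by move=> pB; apply/matrixP => i j; rewrite !mxE (psdC pB).
have [||||C C0 hC] := @mform_dominated _ _ (G B1) (G B2) (sym _ p1) (sym _ p2).
- by move=> x y; rewrite !E//; exact: (psd_null sS p1).
- by move=> x y; rewrite !E//; exact: (psd_null sS p2).
- by move=> x; rewrite E//; exact: (psd_ge0 p1).
- by move=> x; rewrite !E//; exact: ker.
by exists C => // _ /gen[c ->]; rewrite -!E.
Qed.

End dominated_forms.

Lemma le_sqr1D (R : realDomainType) (q : R) : 0 <= q -> q <= (1 + q) ^+ 2.
Proof. by move=> q0; have := sqr_ge0 q; rewrite sqrrD expr1n mul1r; lra. Qed.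

Section convex_minimization.
Variables (R : realType) (N : nat) (G : 'M[R]_N) (l : 'cV[R]_N) (D : set 'rV[R]_N).
Hypotheses (sG : G^T = G) (pG : forall x : 'rV[R]_N, x != 0 -> 0 < mform G x x).
Hypotheses (cD : closed D) (D0 : D !=set0).
Hypothesis convD : forall (x y : 'rV[R]_N) (t : R), D x -> D y -> 0 <= t <= 1 -> D (x + t *: (y - x)).

(** The solution minimizes the energy [J], whose sublevel sets are compact by coercivity. Convexity
    of [D] allows short moves towards any [z], and the first-order term of [J] along them cannot be
    negative. *)
Lemma quadratic_vi : exists2 y, D y &
  forall z, D z -> ((z - y) *m l) 0 0 <= mform G y (z - y).
Proof.
pose J x := mform G x x / 2 - (x *m l) 0 0.
have [x0 Dx0] := D0.
have cid : continuous (fun x : 'rV[R]_N => x) by move=> x; exact: cvg_id.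
have cJ : continuous J.
  apply: cts_add; last first.
    by under eq_fun do rewrite -mulN1r; apply: cts_scale; exact: continuous_linear_form.
  under eq_fun do rewrite mulrC.
  by apply: cts_scale; exact: (@continuous_mform R N G _ _ cid cid).
have [c c0 hc] : exists2 c, 0 < c & forall x, x *m (0 : 'M[R]_(N, 0)) = 0 -> c * sqnorm x <= mform G x x.
  by apply: coercive_on => x _; exact: pG.
(* The constant term of Young's inequality, weighted so that the linear part takes only a quarter of
   the coercivity constant. *)
pose L := \sum_i (l i 0) ^+ 2 / c.
have lin_bound x : (x *m l) 0 0 <= L + c / 4 * sqnorm x.
  rewrite mxE /L /sqnorm mulr_sumr -big_split; apply: ler_sum => i _ /=.
  have := sqr_ge0 (l i 0 - c / 2 * x 0 i) => h.
  rewrite -(ler_pM2l c0) -subr_ge0 (_ : _ - _ = (l i 0 - c / 2 * x 0 i) ^+ 2)//.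
  by field; rewrite gt_eqF.
pose E := D `&` [set x | J x <= J x0].
have cE : compact E.
  pose M := 1 + 4 * (J x0 + L) / c.
  apply: (@subclosed_compact _ _ (inbox M)); last 2 first.
  - exact: compact_inbox.
  - move=> x [_ /= h] i.
    have hx : c / 4 * sqnorm x <= J x0 + L.
      have := lin_bound x; have := hc x (mulmx0 _ _); move: h; rewrite {1}/J; lra.
    have hx2 : sqnorm x <= 4 * (J x0 + L) / c.
      by rewrite ler_pdivlMr//; lra.
    have M0 : 0 <= 4 * (J x0 + L) / c by apply: le_trans (sqnorm_ge0 x) hx2.
    rewrite -ler_sqr ?nnegrE//; last by rewrite /M addr_ge0.
    rewrite real_normK ?num_real//.
    have xi : x 0 i ^+ 2 <= sqnorm x.
      by rewrite /sqnorm (bigD1 i)//= lerDl sumr_ge0// => j _; exact: sqr_ge0.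
    apply: (le_trans xi); apply: (le_trans hx2); exact: le_sqr1D.
  apply: closedI => //.
  apply: (@closed_comp _ _ J [set y | y <= J x0]); first by move=> x _; exact: cJ.
  exact: closed_le.
have E0 : E !=set0 by exists x0; split => /=.
have [y /set_mem[Dy Jy] ymin] := EVT_min_rV E0 cE (continuous_subspaceT cJ).
have yD z : D z -> J y <= J z.
  move=> Dz; have [h|h] := leP (J z) (J x0); first by apply: ymin; apply: mem_set.
  by apply: ltW; exact: le_lt_trans Jy h.
exists y => // z Dz; have [w wE] : exists w, w = z - y by exists (z - y).
rewrite -wE.
have Gsym x x' : mform G x x' = mform G x' x.
  rewrite !mformE exchange_big; apply: eq_bigr => i _; apply: eq_bigr => j _ /=.
  have -> : G j i = G i j by move/matrixP: sG => /(_ i j); rewrite mxE.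
  ring.
have key t : 0 < t <= 1 -> (w *m l) 0 0 - mform G y w <= t * (mform G w w / 2).
  move=> /andP[t0 t1]; have t01 : 0 <= t <= 1 by rewrite (ltW t0).
  have := yD _ (convD Dy Dz t01); rewrite -wE.
  have E1 : mform G y (t *: w) = t * mform G y w.
    rewrite !mformE mulr_sumr; apply: eq_bigr => i _; rewrite mulr_sumr.
    by apply: eq_bigr => j _; rewrite !mxE; ring.
  have E2 : ((y + t *: w) *m l) 0 0 = (y *m l) 0 0 + t * (w *m l) 0 0.
    by rewrite mulmxDl -scalemxAl mxE [X in _ + X]mxE.
  have -> : J (y + t *: w) = J y + t * (mform G y w - (w *m l) 0 0 + t * (mform G w w / 2)).
    by rewrite /J E2 mformDl !mformDr mformZ (Gsym (t *: w) y) E1; field.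
  rewrite -subr_ge0 [X in 0 <= X]addrAC subrr add0r pmulr_rge0// => h; rewrite -subr_ge0; apply: le_trans h _.
  by rewrite le_eqVlt; apply/orP; left; apply/eqP; ring.
rewrite leNgt; apply/negP => lt; pose e := (w *m l) 0 0 - mform G y w.
have e0 : 0 < e by rewrite subr_gt0.
(* A violation of size [e] contradicts [key] at the step [e / g], or at the full step 1 if [e / g]
   is at least 1. *)
pose g := `|mform G w w| + 1; have g0 : 0 < g by rewrite ltr_wpDl.
have [h|h] := leP 1 (e / g).
  have := key 1; rewrite ltr01 lexx => /(_ isT); rewrite mul1r -/e.
  have : g <= e by rewrite -[leLHS]mul1r -ler_pdivlMr.
  have := ler_norm (mform G w w); rewrite /g; lra.
have := key (e / g); rewrite divr_gt0// (ltW h) => /(_ isT); rewrite -/e.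
rewrite mulrAC ler_pdivlMr// (ler_pM2l e0).
by have := ler_norm (mform G w w); have := normr_ge0 (mform G w w); rewrite /g; lra.
Qed.

End convex_minimization.

Section rayleigh.
Variables (R : realType) (m : nat) (A : 'M[R]_m.+1) (a0 a1 : R).
Hypotheses (sA : A^T = A) (a0p : 0 < a0).
Hypothesis spec : forall lam, eigenvalue A lam -> a0 <= lam <= a1.

Lemma mform_sym (G : 'M[R]_m.+1) x y : G^T = G -> mform G x y = mform G y x.
Proof.
move=> sG; rewrite !mformE exchange_big; apply: eq_bigr => i _; apply: eq_bigr => j _ /=.
have -> : G j i = G i j by move/matrixP: sG => /(_ i j); rewrite mxE.
ring.
Qed.

Lemma mform_scalar (lam : R) (x y : 'rV[R]_m.+1) : mform lam%:M x y = lam * \sum_i x 0 i * y 0 i.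
Proof.
by rewrite /mform mul_mx_scalar -scalemxAl !mxE; congr (_ * _); apply: eq_bigr => i _; rewrite mxE.
Qed.

Lemma mform_psd (G : 'M[R]_m.+1) : G^T = G -> (forall x, 0 <= mform G x x) ->
  psd_form (fun _ : 'rV[R]_m.+1 => True) (mform G).
Proof.
move=> sG pG; split => //; last by move=> x y _ _; exact: mform_sym.
by move=> y _ a x z _ _; rewrite /mform !mulmxDl -!scalemxAl mxE; congr (_ + _); rewrite mxE.
Qed.

(* the minimum of the Rayleigh quotient is attained at an eigenvector *)
Lemma rayleigh_min (G : 'M[R]_m.+1) : G^T = G ->
  exists2 lam, eigenvalue G lam & forall x, lam * sqnorm x <= mform G x x.
Proof.
move=> sG; have cid : continuous (fun x : 'rV[R]_m.+1 => x) by move=> x; exact: cvg_id.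
set D := [set x : 'rV[R]_m.+1 | x *m (0 : 'M[R]_(m.+1, 0)) = 0 /\ sqnorm x = 1].
have D0 : D !=set0.
  exists (delta_mx 0 0); split; first by rewrite mulmx0.
  rewrite /sqnorm (bigD1 0)//= big1 => [|i i0]; rewrite !mxE !eqxx ?expr1n ?addr0//.
  by rewrite (negbTE i0) expr0n.
have [y /set_mem[_ y1] ymin] := EVT_min_rV D0 (@compact_sphere R m.+1 0 0)
  (continuous_subspaceT (@continuous_mform R m.+1 G _ _ cid cid)).
pose lam := mform G y y.
have bnd x : lam * sqnorm x <= mform G x x.
  have [->|x0] := eqVneq x 0; first by rewrite sqnorm0 mform0 mulr0.
  have s0 : 0 < sqnorm x.
    by rewrite lt_neqAle sqnorm_ge0 eq_sym andbT; apply: contra_neq x0; exact: sqnorm_eq0.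
  have h : D ((Num.sqrt (sqnorm x))^-1 *: x).
    split; first by rewrite mulmx0.
    rewrite /sqnorm; under eq_bigr do rewrite mxE exprMn.
    by rewrite -mulr_sumr exprVn sqr_sqrtr ?mulVf ?gt_eqF// ltW.
  have := ymin _ (mem_set h); rewrite mformZ exprVn (sqr_sqrtr (ltW s0)) => h2.
  by rewrite -ler_pdivlMr// mulrC.
(* [H] is positive semidefinite and the minimizer [y] is a null vector of its form, so by
   Cauchy-Schwarz [y] lies in its kernel: it is an eigenvector. *)
exists lam => //; pose H := G - lam%:M.
have HE (x z : 'rV[R]_m.+1) : mform H x z = mform G x z - lam * \sum_i x 0 i * z 0 i.
  by rewrite -mform_scalar /H /mform mulmxBr mulmxBl !mxE.
have sH : H^T = H by rewrite /H linearB/= tr_scalar_mx sG.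
have sqE (x : 'rV[R]_m.+1) : \sum_i x 0 i * x 0 i = sqnorm x by apply: eq_bigr => i _; rewrite expr2.
have pH : psd_form (fun _ : 'rV[R]_m.+1 => True) (mform H).
  by apply: (mform_psd sH) => x; rewrite HE sqE subr_ge0.
have sT : linear_subspace (fun _ : 'rV[R]_m.+1 => True) by split.
apply/eigenvalueP; exists y; last first.
  by apply/eqP => y0; move: y1; rewrite y0 sqnorm0 => /eqP; rewrite eq_sym oner_eq0.
apply/eqP; rewrite -subr_eq0 -mul_mx_scalar -mulmxBr -/H; apply/eqP/rowP => j.
have h0 := @psd_null _ _ _ sT _ pH y (delta_mx 0 j) I I.
move: h0; rewrite HE sqE y1 mulr1 subrr => /(_ erefl).
rewrite /mform trmx_delta -colE mxE => h; rewrite [RHS]mxE -h.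
by rewrite mxE; apply: eq_bigr => i _; rewrite !mxE.
Qed.

(** The extreme values of the Rayleigh quotient are eigenvalues; the upper bound is the minimum for
    the opposite matrix. *)
Lemma spectral_bounds x : a0 * sqnorm x <= mform A x x /\ mform A x x <= a1 * sqnorm x.
Proof.
split.
  have [lam /spec/andP[h _] hl] := rayleigh_min sA.
  by apply: le_trans (hl x); rewrite ler_wpM2r// sqnorm_ge0.
have sN : (- A)^T = - A by rewrite linearN/= sA.
have [lam ev hl] := rayleigh_min sN.
have /spec/andP[_ h] : eigenvalue A (- lam).
  move/eigenvalueP: ev => [v vA v0]; apply/eigenvalueP; exists v => //.
  by rewrite scaleNr -vA mulmxN opprK.
have := hl x; rewrite (_ : mform (- A) x x = - mform A x x); last first.
  by rewrite /mform mulmxN mulNmx mxE.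
have := sqnorm_ge0 x; nra.
Qed.

Lemma spectral_unit : A \in unitmx.
Proof.
rewrite -row_free_unit -kermx_eq0; apply/eqP/row_matrixP => i; rewrite row0.
set k := row i _; have kA : k *m A = 0 by rewrite -row_mul mulmx_ker row0.
apply: sqnorm_eq0; apply/eqP; rewrite eq_le sqnorm_ge0 andbT.
have [h _] := spectral_bounds k; move: h; rewrite /mform kA mul0mx mxE.
by rewrite pmulr_rle0.
Qed.

(** With [r = z *m A], the pairing of [z] and [r] is the form of [A] at [z]. Cauchy-Schwarz for the
    identity gives the upper bound and Cauchy-Schwarz for [A] the lower one. *)
Lemma spectral_inverse (r : 'rV[R]_m.+1) (z := r *m (invmx A)^T) :
  [/\ \sum_i z 0 i * r 0 i <= a0^-1 * sqnorm r, sqnorm r <= a1 * \sum_i z 0 i * r 0 i &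
  sqnorm z <= a0^-1 ^+ 2 * sqnorm r].
Proof.
have uA := spectral_unit.
have rE : r = z *m A by rewrite /z trmx_inv sA mulmxKV.
have sE : \sum_i z 0 i * r 0 i = mform A z z.
  by rewrite /mform -rE mxE; apply: eq_bigr => i _; rewrite [in RHS]mxE mulrC.
have id_psd : psd_form (fun _ : 'rV[R]_m.+1 => True) (mform 1%:M).
  by apply: (mform_psd (tr_scalar_mx _ _)) => x; rewrite mform_scalar mul1r sumr_ge0// => i _; rewrite -expr2 sqr_ge0.
have sT : linear_subspace (fun _ : 'rV[R]_m.+1 => True) by split.
have cs := @psd_cauchy _ _ _ sT _ id_psd z r I I.
have n1 (x : 'rV[R]_m.+1) : mform 1%:M x x = sqnorm x.
  by rewrite mform_scalar mul1r; apply: eq_bigr => i _; rewrite expr2.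
rewrite !n1 mform_scalar mul1r in cs.
have A_psd : psd_form (fun _ : 'rV[R]_m.+1 => True) (mform A).
  apply: (mform_psd sA) => x; have [h _] := spectral_bounds x.
  by apply: le_trans h; rewrite mulr_ge0 ?sqnorm_ge0// ltW.
have cs2 := @psd_cauchy _ _ _ sT _ A_psd z r I I.
have zr : mform A z r = sqnorm r.
  by rewrite /mform -rE mxE; apply: eq_bigr => i _; rewrite mxE expr2.
rewrite zr -sE in cs2.
have [hz _] := spectral_bounds z; have [_ hr] := spectral_bounds r.
rewrite -sE in hz; set s := \sum_i _ in cs cs2 hz *.
have z0 := sqnorm_ge0 z; have r0 := sqnorm_ge0 r.
have s0 : 0 <= s by apply: le_trans hz; rewrite mulr_ge0// ltW.
have i0 : 0 < a0^-1 by rewrite invr_gt0.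
have zs : sqnorm z <= a0^-1 * s by rewrite mulrC ler_pdivlMr// mulrC.
have h1 : s <= a0^-1 * sqnorm r.
  have [->|sn] := eqVneq s 0; first by rewrite mulr_ge0// ltW.
  have sp : 0 < s by rewrite lt_neqAle eq_sym sn.
  rewrite -(ler_pM2l sp) -expr2; apply: (le_trans cs).
  by rewrite mulrCA mulrA ler_wpM2r.
split => //.
  have [->|rn] := eqVneq (sqnorm r) 0.
    rewrite mulr_ge0//; have [lam /spec/andP[h3 h4] _] := rayleigh_min sA.
    by apply: le_trans (ltW a0p) (le_trans h3 h4).
  have rp : 0 < sqnorm r by rewrite lt_neqAle eq_sym rn.
  rewrite -(ler_pM2l rp) -expr2; apply: (le_trans cs2).
  by rewrite mulrC mulrA ler_wpM2r// mulrC.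
by apply: (le_trans zs); rewrite expr2 -mulrA ler_wpM2l// ltW.
Qed.

End rayleigh.

(** * Polynomial identities and bubble fields *)

Section polynomial_identity.
Variable R : realType.

Lemma horner_zero_near0 (q : {poly R}) e : 0 < e -> (forall t, 0 < t < e -> q.[t] = 0) -> q = 0.
Proof.
move=> e0 h; apply/eqP/negPn/negP => q0.
pose rs := [seq e / i.+2%:R | i <- iota 0 (size q)].
have : (size rs < size q)%N.
  apply: max_poly_roots => //.
    apply/allP => _ /mapP[i _ ->]; apply/eqP; apply: h.
    have i0 : (0 : R) < i.+2%:R by rewrite ltr0n.
    by rewrite divr_gt0// ltr_pdivrMr// ltr_pMr// ltr1n.
  rewrite map_inj_uniq ?iota_uniq// => i j /(mulfI (lt0r_neq0 e0))/invr_inj/eqP.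
  by rewrite eqr_nat => /eqP[].
by rewrite size_map size_iota ltnn.
Qed.

Lemma interior_ray d (U : set 'rV[R]_d) (x w : 'rV[R]_d) : open U -> U x ->
  exists2 e : R, 0 < e & forall t, 0 < t < e -> U (x + t *: w).
Proof.
move=> oU Ux; have cl : continuous (fun t : R => x + t *: w).
  move=> t; apply: (@continuousD _ _ _ (cst x) (fun t : R => t *: w)).
    exact: cst_continuous.
  exact: scalel_continuous.
have : nbhs (x + (0 : R) *: w) U by rewrite scale0r addr0; apply: open_nbhs_nbhs; split.
move=> /(cl 0)/nbhs_ballP[e /= e0 he]; exists e => // t /andP[t0 te].
by apply: he; rewrite /ball/= sub0r normrN gtr0_norm.
Qed.

(** On the line from an interior point to [x] the polynomial has more roots than its size, since a
    short initial piece stays in the interior. *)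
Lemma ref_poly_zero d K p (v : 'rV[R]_d -> R) : ref_poly K p v ->
  (forall x, ref_interior K x -> v x = 0) -> forall x, v x = 0.
Proof.
move=> /ref_polyP hv v0 x; have [y iy] := @ref_interior_neq0 R d K.
have [q hq] := spanned_line y (x - y) hv.
have [e e0 he] := interior_ray (x - y) (@open_ref_interior R d K) iy.
have q0 : q = 0 by apply: (horner_zero_near0 e0) => t /he/v0; rewrite hq.
by rewrite -(subrK y x) addrC -[x - y]scale1r hq q0 horner0.
Qed.

Lemma C1_constant d (v : 'rV[R]_d -> R) : Ck 1 v -> (forall i x, partial i v x = 0) ->
  forall x y, v x = v y.
Proof.
move=> cv v0 x y; pose w := y - x.
have dv (t : R) : is_derive t (1 : R) (fun t : R => v (x + t *: w)) 0.
  have [d1 d2] := C1_is_derive (x + t *: w) w cv.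
  have E : (fun h : R => h^-1 *: ((v \o shift (x + t *: w)) (h *: w) - v (x + t *: w))) =
    (fun h : R => h^-1 *: (((fun t : R => v (x + t *: w)) \o shift t) (h *: 1) - v (x + t *: w))).
    apply/funext => h /=; congr (_ *: (v _ - _)); rewrite scalerDl addrCA.
    by rewrite [h *: 1]mulr1.
  split; first by rewrite /derivable -E; exact: d1.
  rewrite /derive -E; apply: (etrans d2); rewrite big1// => i _.
  by rewrite v0 mulr0.
have := is_derive_0_is_cst 0 1 dv; rewrite scale0r addr0 scale1r => ->.
by rewrite /w addrC subrK.
Qed.

Lemma ref_int0 d K (f : 'rV[R]_d -> R) : continuous f -> (forall x, ref_cell K x -> 0 <= f x) ->
  \int[lebesgue_rV R d]_(x in ref_cell K) f x = 0 -> forall x, ref_interior K x -> f x = 0.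
Proof.
move=> cf f0 h x ix; apply: contrapT => fx.
have mC := @measurable_ref_cell R d K.
have if0 := integrable_ref K cf.
have e0 : (\int[lebesgue_rV R d]_(x in ref_cell K) `|(f x)%:E| = 0)%E.
  rewrite -[RHS](_ : (\int[lebesgue_rV R d]_(x in ref_cell K) (f x)%:E)%E = 0%E).
    by apply: eq_integral => y /set_mem/f0 fy; rewrite gee0_abs// lee_fin.
  by rewrite -[LHS]fineK ?(integrable_fin_num mC if0)//; rewrite /Rintegral in h; rewrite h.
have mf : measurable_fun (ref_cell K) (EFin \o f) by case/integrableP: if0.
have [N [mN N0 sN]] := (ae_eq_integral_abs (lebesgue_rV R d) mC mf).1 e0.
pose U := ref_interior K `&` [set y | f y != 0].
have oU : open U.
  apply: openI; first exact: open_ref_interior.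
  apply: (@open_comp _ _ f [set y | y != 0]); first by move=> y _; exact: cf.
  exact: open_neq.
have UN : U `<=` N.
  move=> y [iy /eqP fy]; apply: sN => /= /(_ (ref_interior_sub iy)) []; exact: fy.
have U0 : U !=set0 by exists x; split => //; apply/eqP.
have := open_pos_measure oU U0; rewrite ltNge => /negP; apply.
by rewrite -N0; apply: le_measure => //; rewrite inE//; exact: open_measurable_rV.
Qed.

Lemma generates_fin (V : lmodType R) (S : V -> Prop) (I : finType) (b : I -> V) :
  (forall i, S (b i)) -> (forall x, S x -> exists c : I -> R, x = \sum_i c i *: b i) ->
  exists N (b' : 'I_N -> V), generates S b'.
Proof.
move=> Sb gen; exists #|I|, (fun k => b (enum_val k)); split => // x /gen[c ->].
exists (\row_k c (enum_val k)); rewrite /comb.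
rewrite (reindex_onto enum_val enum_rank) /=; last by move=> i _; rewrite enum_rankK.
rewrite (eq_bigl xpredT); last by move=> k; rewrite enum_valK eqxx.
by apply: eq_bigr => k _; rewrite mxE.
Qed.

Lemma subspace_ref_poly d K p : linear_subspace (@ref_poly R d K p).
Proof.
rewrite /linear_subspace; split; first exact: ref_poly0.
by move=> a x y hx hy; apply: (ref_polyD (v := fun t => a * x t)) => //; exact: ref_polyZ.
Qed.

Lemma generates_ref_poly d K p : exists N b, @generates R _ (@ref_poly R d K p) N b.
Proof.
pose adm (m : {ffun 'I_d -> 'I_p.+1}) : bool := if K is Simplex then (\sum_i m i <= p)%N else true.
apply: (@generates_fin _ _ _ (fun m : {ffun 'I_d -> 'I_p.+1} => fun x => (adm m)%:R * mon (fun i => m i : nat) x)).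
  move=> m; case a : (adm m); last by apply: (ref_poly_ext (v := fun=> 0)) (ref_poly0 _ _ _ _) => x; rewrite mul0r.
  exists (fun m' => (m' == m)%:R) => x.
  rewrite (bigD1 m)//= eqxx !mul1r big1 ?addr0// => m' /andP[_ /negbTE ->].
  by rewrite mul0r.
move=> v [c hc]; exists c; apply/funext => x; rewrite hc fct_sumE.
rewrite big_mkcond; apply: eq_bigr => m _; rewrite -/(adm m) /mon.
transitivity (c m * ((adm m)%:R * \prod_i x 0 i ^+ m i)); last by [].
by case: (adm m) => /=; rewrite ?mulr1n ?mulr0n ?mul1r ?mul0r ?mulr0.
Qed.

End polynomial_identity.

Section bubble.
Variables (R : realType) (m : nat).
Local Notation d := m.+1.
Local Notation lam n := (lebesgue_rV R n).
Implicit Types (K : ref_shape) (v w : 'rV[R]_d -> R).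

Lemma sum_delta n (F : 'I_n -> R) k : \sum_l (k == l)%:R * F l = F k.
Proof.
rewrite (bigD1 k)//= eqxx mul1r big1 ?addr0// => l /negbTE lk.
by rewrite eq_sym lk mul0r.
Qed.

(** The matrix diag(x) - x^T x on the simplex and diag(x_k (1 - x_k)) on the cube. It is positive
    definite inside the cell and annihilates the normal of each facet on that facet; its entries are
    of the degree that [RT] allows for a multiple of the gradient. *)
Definition weight K (k l : 'I_d) (x : 'rV[R]_d) : R :=
  if K is Simplex then x 0 k * (k == l)%:R - x 0 k * x 0 l else x 0 k * (1 - x 0 k) * (k == l)%:R.

Lemma continuous_weight K k l : continuous (weight K k l).
Proof.
have cc i : continuous (fun x : 'rV[R]_d => x 0 i : R) by move=> x; exact: coord_continuous.
have c1 (c : R) : continuous (fun x : 'rV[R]_d => c) by move=> x; exact: cst_continuous.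
have cN (f : 'rV[R]_d -> R) : continuous f -> continuous (fun x => - f x).
  by move=> cf; under eq_fun do rewrite -mulN1r; exact: cts_scale.
case: K.
  apply: (@cts_add _ _ (fun x : 'rV[R]_d => x 0 k * (k == l)%:R) (fun x => - (x 0 k * x 0 l))).
    exact: cts_mul.
  by apply: cN; exact: cts_mul.
apply: cts_mul => //; apply: cts_mul => //.
by apply: (@cts_add _ _ (fun=> 1)) => //; exact: cN.
Qed.

Lemma weightC K k l x : weight K k l x = weight K l k x.
Proof.
rewrite /weight; case: K; have [->|kl] := eqVneq k l => //.
  by rewrite /= !mulr0n !mulr0 mulrC.
by rewrite /= !mulr0n !mulr0.
Qed.

Definition wquad K (x xi : 'rV[R]_d) : R := \sum_k \sum_l weight K k l x * xi 0 k * xi 0 l.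

(** A variance: the barycentric coordinates are probabilities of the values [xi 0 k], the last
    vertex carries the value 0, and [mu] is the mean. Positivity on the cell is visible in this
    form. *)
Lemma wquad_simplex (x xi : 'rV[R]_d) (mu := \sum_k x 0 k * xi 0 k) : wquad Simplex x xi =
  \sum_k x 0 k * (xi 0 k - mu) ^+ 2 + (1 - \sum_k x 0 k) * mu ^+ 2.
Proof.
have -> : wquad Simplex x xi = \sum_k x 0 k * xi 0 k ^+ 2 - mu ^+ 2.
  rewrite /wquad expr2 {1}/mu mulr_suml -sumrB; apply: eq_bigr => k _.
  rewrite /mu mulr_sumr; under eq_bigr do rewrite /weight mulrBl mulrBl.
  rewrite sumrB; congr (_ - _); last by apply: eq_bigr => l _; ring.
  transitivity (\sum_l (k == l)%:R * (x 0 k * xi 0 k * xi 0 l)).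
    by apply: eq_bigr => l _; ring.
  by rewrite sum_delta; ring.
have -> : \sum_k x 0 k * (xi 0 k - mu) ^+ 2 =
    \sum_k x 0 k * xi 0 k ^+ 2 - 2 * mu * mu + mu ^+ 2 * \sum_k x 0 k.
  have -> : 2 * mu * mu = \sum_k 2 * mu * (x 0 k * xi 0 k) by rewrite -mulr_sumr.
  rewrite [mu ^+ 2 * _]mulr_sumr -sumrB -big_split.
  by apply: eq_bigr => k _ /=; ring.
ring.
Qed.

Lemma wquad_cube (x xi : 'rV[R]_d) : wquad Cube x xi = \sum_k x 0 k * (1 - x 0 k) * xi 0 k ^+ 2.
Proof.
apply: eq_bigr => k _; transitivity (\sum_l (k == l)%:R * (x 0 k * (1 - x 0 k) * xi 0 k * xi 0 l)).
  by apply: eq_bigr => l _; rewrite /weight; ring.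
by rewrite sum_delta; ring.
Qed.

Lemma wquad_ge0 K x xi : ref_cell K x -> 0 <= wquad K x xi.
Proof.
case: K => rx.
  rewrite wquad_simplex addr_ge0//.
    by apply: sumr_ge0 => k _; rewrite mulr_ge0 ?sqr_ge0//; exact: (rx (Some k)).
  by rewrite mulr_ge0 ?sqr_ge0//; exact: (rx None).
rewrite wquad_cube; apply: sumr_ge0 => k _; rewrite mulr_ge0 ?sqr_ge0// mulr_ge0//.
  exact: (rx (k, false)).
exact: (rx (k, true)).
Qed.

Lemma wquad_eq0 K x xi : ref_interior K x -> wquad K x xi = 0 -> xi = 0.
Proof.
case: K => rx.
  pose mu := \sum_k x 0 k * xi 0 k; rewrite wquad_simplex -/mu => /eqP.
  have s0 : 0 < 1 - \sum_k x 0 k by exact: (rx None).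
  have x0 k : 0 < x 0 k by exact: (rx (Some k)).
  rewrite paddr_eq0; first last.
  - by rewrite mulr_ge0 ?sqr_ge0// ltW.
  - by apply: sumr_ge0 => k _; rewrite mulr_ge0 ?sqr_ge0// ltW.
  move=> /andP[/eqP h1]; rewrite mulf_eq0 (gt_eqF s0) /= sqrf_eq0 => /eqP mu0.
  apply/rowP => k; rewrite [RHS]mxE; apply/eqP.
  have /eqP : x 0 k * (xi 0 k - mu) ^+ 2 = 0.
    apply: (psumr_eq0P (P := xpredT) (F := fun k => x 0 k * (xi 0 k - mu) ^+ 2) _ h1) => // i _.
    by rewrite mulr_ge0 ?sqr_ge0// ltW.
  by rewrite mulf_eq0 (gt_eqF (x0 k)) /= sqrf_eq0 mu0 subr0.
have x0 k : 0 < x 0 k by exact: (rx (k, false)).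
have x1 k : 0 < 1 - x 0 k by exact: (rx (k, true)).
rewrite wquad_cube => h; apply/rowP => k; rewrite [RHS]mxE; apply/eqP.
have /eqP : x 0 k * (1 - x 0 k) * xi 0 k ^+ 2 = 0.
  apply: (psumr_eq0P (P := xpredT) (F := fun k => x 0 k * (1 - x 0 k) * xi 0 k ^+ 2) _ h) => // i _.
  by rewrite mulr_ge0 ?sqr_ge0// mulr_ge0// ltW.
by rewrite mulf_eq0 sqrf_eq0 mulf_eq0 (gt_eqF (x0 k)) (gt_eqF (x1 k)).
Qed.

Definition grad_form K (W : 'I_d -> 'I_d -> 'rV[R]_d -> R) v w : R :=
  \int[lam d]_(x in ref_cell K) \sum_k \sum_l W k l x * partial k v x * partial l w x.

Lemma continuous_grad_form (W : 'I_d -> 'I_d -> 'rV[R]_d -> R) v w :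
  (forall k l, continuous (W k l)) -> Ck 1 v -> Ck 1 w ->
  continuous (fun x => \sum_k \sum_l W k l x * partial k v x * partial l w x).
Proof.
move=> cW cv cw; apply: cts_sum => k; apply: cts_sum => l; apply: cts_mul; last exact: Ck1_partial.
by apply: cts_mul => //; exact: Ck1_partial.
Qed.

Lemma partial_lin (a : R) v w k x : Ck 1 v -> Ck 1 w ->
  partial k (a *: v + w) x = a * partial k v x + partial k w x.
Proof.
move=> cv cw; have [ca pa] := Ck1_cst d a; have [c1 p1] := Ck1M ca cv.
have E : a *: v + w = fun x => cst a x * v x + w x by [].
by rewrite E (Ck1D c1 cw).2 p1 pa /cst mul0r add0r.
Qed.

Lemma grad_form_psd K p (W : 'I_d -> 'I_d -> 'rV[R]_d -> R) : (forall k l, continuous (W k l)) ->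
  (forall k l x, W k l x = W l k x) ->
  (forall x xi : 'rV[R]_d, ref_cell K x -> 0 <= \sum_k \sum_l W k l x * xi 0 k * xi 0 l) ->
  psd_form (ref_poly K p) (grad_form K W).
Proof.
move=> cW sW pW; split.
- move=> y hy a u w hu hw; have [cy cu cw] := And3 (ref_poly_Ck1 hy) (ref_poly_Ck1 hu) (ref_poly_Ck1 hw).
  rewrite /grad_form -ref_intZ; last exact: continuous_grad_form.
  rewrite -ref_intD; [|by apply: cts_scale; exact: continuous_grad_form|exact: continuous_grad_form].
  apply: eq_Rintegral => x _; rewrite mulr_sumr -big_split; apply: eq_bigr => k _ /=.
  rewrite mulr_sumr -big_split; apply: eq_bigr => l _ /=; rewrite partial_lin//; ring.
- move=> x y _ _; apply: eq_Rintegral => z _; rewrite exchange_big; apply: eq_bigr => k _ /=.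
  by apply: eq_bigr => l _; rewrite sW; ring.
- move=> v _; apply: ref_int_ge0 => x rx; have := pW x (grad v x) rx; rewrite /grad.
  by under eq_bigr do under eq_bigr do rewrite !mxE.
Qed.

Definition idw (k l : 'I_d) (x : 'rV[R]_d) : R := (k == l)%:R.

Lemma idw_sum (xi : 'rV[R]_d) (x : 'rV[R]_d) : \sum_k \sum_l idw k l x * xi 0 k * xi 0 l = sqnorm xi.
Proof.
apply: eq_bigr => k _; transitivity (\sum_l (k == l)%:R * (xi 0 k * xi 0 l)).
  by apply: eq_bigr => l _; rewrite /idw; ring.
by rewrite sum_delta expr2.
Qed.

Lemma grad_form_idw K v : grad_form K idw v v = \int[lam d]_(x in ref_cell K) sqnorm (grad v x).
Proof.
apply: eq_Rintegral => x _; rewrite -(idw_sum _ x).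
by apply: eq_bigr => k _; apply: eq_bigr => l _; rewrite !mxE.
Qed.

Lemma grad_form_weight K v : grad_form K (weight K) v v =
  \int[lam d]_(x in ref_cell K) wquad K x (grad v x).
Proof.
apply: eq_Rintegral => x _.
by apply: eq_bigr => k _; apply: eq_bigr => l _; rewrite !mxE.
Qed.

Lemma grad_zero K p v : ref_poly K p v -> \int[lam d]_(x in ref_cell K) sqnorm (grad v x) = 0 ->
  forall k x, partial k v x = 0.
Proof.
move=> hv h k; have cv := ref_poly_Ck1 hv.
apply: (ref_poly_zero (ref_poly_partial k hv).1) => x ix.
have c : continuous (fun x => sqnorm (grad v x)).
  by apply: cts_sum => i; under eq_fun do rewrite mxE; apply: cts_sqr; exact: Ck1_partial.
have := ref_int0 c (fun x _ => sqnorm_ge0 _) h ix => /sqnorm_eq0/rowP/(_ k).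
by rewrite !mxE.
Qed.

(** The weight degenerates on the boundary, so there is no pointwise comparison. If the weighted
    integral vanishes, the gradient vanishes inside the cell and hence everywhere, being polynomial;
    [psd_dominated] then gives a constant that depends on the cell and [p] only. *)
Lemma bubble_dominates K p : exists2 C, 0 <= C & forall v, ref_poly K p v ->
  \int[lam d]_(x in ref_cell K) sqnorm (grad v x) <= C * grad_form K (weight K) v v.
Proof.
have [N [b gb]] := generates_ref_poly R d K p.
have p1 : psd_form (ref_poly K p) (grad_form K (weight K)).
  apply: grad_form_psd => //; [exact: continuous_weight|exact: weightC|].
  by move=> x xi rx; exact: wquad_ge0.
have p2 : psd_form (ref_poly K p) (grad_form K idw).
  apply: grad_form_psd => //.
  - by move=> k l x; exact: cst_continuous.
  - by move=> k l x; rewrite /idw eq_sym.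
  - by move=> x xi _; rewrite idw_sum sqnorm_ge0.
have [|C C0 hC] := psd_dominated (@subspace_ref_poly R d K p) gb p1 p2; last first.
  by exists C => // v hv; rewrite -grad_form_idw; exact: hC.
move=> v hv; rewrite grad_form_weight grad_form_idw => h.
have cv := ref_poly_Ck1 hv.
have cg : continuous (fun x => wquad K x (grad v x)).
  rewrite (_ : (fun x => _) = fun x => \sum_k \sum_l weight K k l x * partial k v x * partial l v x).
    by apply: continuous_grad_form => // k l; exact: continuous_weight.
  by apply/funext => x; apply: eq_bigr => k _; apply: eq_bigr => l _; rewrite !mxE.
have z : forall x, ref_interior K x -> grad v x = 0.
  move=> x ix; apply: (wquad_eq0 ix); apply: (ref_int0 cg _ h ix) => y ry.
  exact: wquad_ge0.
apply: ref_int_eq0 => x rx; suff -> : grad v x = 0 by rewrite sqnorm0.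
apply/rowP => k; rewrite !mxE; apply: (ref_poly_zero (ref_poly_partial k hv).1) => y /z/rowP/(_ k).
by rewrite !mxE.
Qed.

Definition bubble K v (x : 'rV[R]_d) : 'rV[R]_d := \row_k \sum_l weight K k l x * partial l v x.

Lemma bubble_simplex v x k : bubble Simplex v x 0 k =
  x 0 k * partial k v x - (\sum_l x 0 l * partial l v x) * x 0 k.
Proof.
rewrite mxE; under eq_bigr do rewrite /weight mulrBl; rewrite sumrB; congr (_ - _).
  rewrite (bigD1 k)//= eqxx big1 ?addr0 ?mulr1// => l /negbTE lk.
  by rewrite eq_sym lk mulr0 mul0r.
by rewrite mulr_suml; apply: eq_bigr => l _; ring.
Qed.

Lemma bubble_cube v x k : bubble Cube v x 0 k = x 0 k * (1 - x 0 k) * partial k v x.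
Proof.
rewrite mxE (bigD1 k)//= /weight eqxx big1 ?addr0 ?mulr1// => l /negbTE lk.
by rewrite eq_sym lk mulr0 mul0r.
Qed.

(** The weight splits into a part linear in the point and a quadratic part. The products
    [x 0 k * partial k v x] stay in P_p, and the remaining coordinate factor is the one that the
    Raviart-Thomas space supplies. *)
Lemma bubble_RT K p v : ref_poly K p v -> RT K p (bubble K v).
Proof.
move=> hv; have hp k := (ref_poly_partial k hv).2.
case: K hv hp => hv hp.
  exists (fun x : 'rV[R]_d => \row_k (x 0 k * partial k v x)), (fun x : 'rV[R]_d => - \sum_l x 0 l * partial l v x); split.
  - by move=> k; apply: ref_poly_ext (hp k) => x; rewrite mxE.
  - by apply: ref_polyN; apply: ref_poly_sum => l _; exact: hp.
  - by move=> x; apply/rowP => k; rewrite bubble_simplex !mxE mulNr.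
exists (fun x : 'rV[R]_d => \row_k (x 0 k * partial k v x)), (fun x : 'rV[R]_d => \row_k (- (x 0 k * partial k v x))); split.
- by move=> k; apply: ref_poly_ext (hp k) => x; rewrite mxE.
- by move=> k; apply: ref_poly_ext (ref_polyN (hp k)) => x; rewrite mxE.
- by move=> x k; rewrite bubble_cube !mxE; ring.
Qed.

Lemma bubble_flux K v j t : flux (K := K) (bubble K v) j t = 0.
Proof.
have := @facet_par_form R m K j t; rewrite /flux; set x := facet_par j t => fx.
rewrite mxE; case: K j x fx => [[i|]|[i []]] x /= fx.
- rewrite (bigD1 i)//= big1 ?addr0 => [|k /negbTE ki]; rewrite !mxE ?eqxx ?andbT.
    have -> : \sum_l weight Simplex i l x * partial l v x = bubble Simplex v x 0 i by rewrite [RHS]mxE.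
    by rewrite bubble_simplex fx mul0r mulr0 subrr mul0r.
  by rewrite ki oppr0 mulr0.
- under eq_bigr do rewrite [in X in _ * X]mxE mulr1 bubble_simplex.
  rewrite sumrB -mulr_sumr; have -> : \sum_k x 0 k = 1 by move: fx; lra.
  by rewrite mulr1 subrr.
- rewrite (bigD1 i)//= big1 ?addr0 => [|k /negbTE ki].
    by rewrite bubble_cube; have -> : 1 - x 0 i = 0 by []; ring.
  by rewrite !mxE ki mulr0.
- rewrite (bigD1 i)//= big1 ?addr0 => [|k /negbTE ki].
    by rewrite bubble_cube fx; ring.
  by rewrite !mxE ki oppr0 mulr0.
Qed.

Lemma bubble_form K v : \int[lam d]_(x in ref_cell K) (\sum_k bubble K v x 0 k * partial k v x) =
  grad_form K (weight K) v v.
Proof.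
apply: eq_Rintegral => x _; apply: eq_bigr => k _; rewrite mxE mulr_suml.
by apply: eq_bigr => l _; ring.
Qed.

Lemma weight_bound K k l (x : 'rV[R]_d) : ref_cell K x -> `|weight K k l x| <= 2.
Proof.
move=> rx; have bx i : `|x 0 i| <= 1 by exact: ref_cell_inbox rx i.
have h i : -1 <= x 0 i <= 1 by have := bx i; rewrite ler_norml.
have b01 : 0 <= (k == l)%:R :> R /\ (k == l)%:R <= 1 :> R by case: (k == l).
have /andP[k1 k2] := h k; have /andP[l1 l2] := h l; case: b01; set c : R := (k == l)%:R => c0 c1.
rewrite /weight -/c; case: K rx => rx.
  apply: (le_trans (ler_normB _ _)); rewrite !normrM (ger0_norm c0).
  have := bx k; have := bx l; have := normr_ge0 (x 0 k); have := normr_ge0 (x 0 l); nra.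
have xk0 : 0 <= x 0 k by exact: (rx (k, false)).
by rewrite ler_norml; apply/andP; split; nra.
Qed.

Lemma bubble_bound K v x : ref_cell K x -> sqnorm (bubble K v x) <= (4 * d%:R ^+ 2) * sqnorm (grad v x).
Proof.
move=> rx; have hk k : bubble K v x 0 k ^+ 2 <= 4 * d%:R * sqnorm (grad v x).
  have cs : (\sum_l weight K k l x * partial l v x) ^+ 2 <=
      (\sum_l weight K k l x ^+ 2) * \sum_l partial l v x ^+ 2.
    have p1 : psd_form (fun _ : 'rV[R]_d => True) (mform 1%:M).
      apply: (mform_psd (tr_scalar_mx _ _)) => y.
      by rewrite mform_scalar mul1r sumr_ge0// => i _; rewrite -expr2 sqr_ge0.
    have sT : linear_subspace (fun _ : 'rV[R]_d => True) by split.
    have := @psd_cauchy _ _ _ sT _ p1 (\row_l weight K k l x) (grad v x) I I.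
    rewrite !mform_scalar !mul1r; under eq_bigr do rewrite !mxE.
    under [X in _ <= X * _ -> _]eq_bigr do rewrite !mxE -expr2.
    by under [X in _ <= _ * X -> _]eq_bigr do rewrite !mxE -expr2.
  rewrite mxE; apply: (le_trans cs).
  have -> : sqnorm (grad v x) = \sum_l partial l v x ^+ 2 by apply: eq_bigr => l _; rewrite mxE.
  apply: ler_wpM2r; first by apply: sumr_ge0 => l _; exact: sqr_ge0.
  rewrite (_ : 4 * d%:R = \sum_(l < d) (2 : R) ^+ 2).
    apply: ler_sum => l _; rewrite -real_normK ?num_real// lerXn2r ?nnegrE//.
    exact: weight_bound.
  by rewrite sumr_const card_ord -mulr_natr; ring.
rewrite {1}/sqnorm; apply: (le_trans (ler_sum _ (fun k _ => hk k))).
by rewrite sumr_const card_ord -mulr_natr le_eqVlt; apply/orP; left; apply/eqP; ring.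
Qed.

End bubble.

(** * Automorphisms of the reference cell and facet fields *)

Section cube_automorphisms.
Variable R : realType.

Lemma cube_cellP n (x : 'rV[R]_n) : ref_cell Cube x <-> forall i, 0 <= x 0 i <= 1.
Proof.
split => [rx i|h [i []] /=].
- have := rx (i, false); have := rx (i, true); rewrite /= subr_ge0 => -> ->; exact: isT.
- by rewrite subr_ge0; have /andP[] := h i.
- by have /andP[] := h i.
Qed.

(** Evaluate at the vertices that select the positive and the negative entries of the column: both
    values lie in [0, 1], and their difference is the sum of absolute values. *)
Lemma cube_column_norm n (B : 'M[R]_n) (b : 'rV[R]_n) :
  (forall t, ref_cell Cube t -> ref_cell Cube (t *m B + b)) -> forall i, \sum_k `|B k i| <= 1.
Proof.
move=> h i; pose tp : 'rV[R]_n := \row_k (0 < B k i)%R%:R; pose tn : 'rV[R]_n := \row_k (B k i < 0)%R%:R.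
have bb (c : bool) : 0 <= c%:R :> R /\ c%:R <= 1 :> R by case: c.
have /h/cube_cellP/(_ i) : ref_cell Cube tp.
  by apply/cube_cellP => k; rewrite mxE; have [-> ->] := bb (0 < B k i)%R.
have /h/cube_cellP/(_ i) : ref_cell Cube tn.
  by apply/cube_cellP => k; rewrite mxE; have [-> ->] := bb (B k i < 0)%R.
have E t : (t *m B + b) 0 i = (t *m B) 0 i + b 0 i by rewrite mxE.
rewrite !E => /andP[h1 h2] /andP[h3 h4].
have -> : \sum_k `|B k i| = (tp *m B) 0 i - (tn *m B) 0 i.
  rewrite !mxE -sumrB; apply: eq_bigr => k _; rewrite !mxE -mulrBl.
  have [B0|B0|B0] := ltgtP (B k i) 0; last by rewrite B0 normr0 mulr0.
    by rewrite (ltr0_norm B0) /= ?mulr0n ?mulr1n; ring.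
  by rewrite (gtr0_norm B0) /= ?mulr0n ?mulr1n; ring.
move: h1 h2 h3 h4; lra.
Qed.

(** The columns of [B] and of its inverse have sum of absolute values at most 1. A diagonal entry of
    their product is 1, so equality holds throughout and each row of [B] has an entry of absolute
    value 1, which exhausts its column. *)
Lemma cube_automorphism n (B : 'M[R]_n) (b : 'rV[R]_n) : B \in unitmx ->
  (forall t, ref_cell Cube t <-> ref_cell Cube (t *m B + b)) ->
  exists2 pi : 'I_n -> 'I_n, injective pi & forall i k, B k i != 0 -> k = pi i.
Proof.
move=> uB iff; pose C := invmx B.
have nB := cube_column_norm (fun t => (iff t).1).
have nC : forall i, \sum_k `|C k i| <= 1.
  apply: (@cube_column_norm n C (- (b *m C))) => t rt; apply/iff.
  by rewrite mulmxDl mulNmx -!mulmxA mulVmx// !mulmx1 subrK.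
have B1 k i : `|B k i| <= 1.
  by apply: le_trans (nB i); rewrite (bigD1 k)//= lerDl sumr_ge0.
have ex i : exists k, `|B i k| = 1.
  have BC : \sum_k B i k * C k i = 1.
    by have := mulmxV uB => /matrixP/(_ i i); rewrite !mxE eqxx.
  have [k] : exists k, B i k * C k i != 0.
    apply: contrapT => no; have : \sum_k B i k * C k i = 0.
      by apply: big1 => k _; apply: contrapT => /eqP h; apply: no; exists k.
    by rewrite BC => /eqP; rewrite oner_eq0.
  rewrite mulf_eq0 negb_or => /andP[_ Ck]; exists k.
  have z : \sum_k (1 - `|B i k|) * `|C k i| = 0.
    apply/eqP; rewrite eq_le sumr_ge0 ?andbT; last first.
      by move=> l _; rewrite mulr_ge0// subr_ge0.
    under eq_bigr do rewrite mulrBl mul1r; rewrite sumrB subr_le0.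
    apply: (le_trans (nC i)); rewrite -BC.
    apply: le_trans (ler_norm _) _; apply: le_trans (ler_norm_sum _ _ _) _.
    by apply: ler_sum => l _; rewrite normrM.
  have /eqP : (1 - `|B i k|) * `|C k i| = 0.
    apply: (psumr_eq0P (P := xpredT) (F := fun k => (1 - `|B i k|) * `|C k i|) _ z) => // l _.
    by rewrite mulr_ge0// subr_ge0.
  by rewrite mulf_eq0 normr_eq0 (negbTE Ck) orbF subr_eq0 => /eqP.
have [rho hrho] := choice ex.
have col i k : B k (rho i) != 0 -> k = i.
  move=> Bk; apply/eqP/negPn/negP => ki; have := nB (rho i).
  rewrite (bigD1 i)//= hrho (bigD1 k)//= => h.
  have : 0 < `|B k (rho i)| by rewrite normr_gt0.
  have : 0 <= \sum_(l < n | (l != i) && (l != k)) `|B l (rho i)| by exact: sumr_ge0.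
  move: h; lra.
have rho_inj : injective rho.
  move=> i i' e; apply: (col i'); rewrite -e -normr_eq0 hrho; exact: oner_neq0.
exists (invF rho_inj); first exact: can_inj (f_invF rho_inj).
by move=> i k Bk; apply: col; rewrite f_invF.
Qed.

(** Needed to see that the neighbour's trace, and with it the jump, is a polynomial of the right
    kind in the parameters of either side. For cubes this rests on [cube_automorphism]. *)
Lemma transition_poly K p n (v : 'rV[R]_n -> R) (B : 'M[R]_n) (b : 'rV[R]_n) : B \in unitmx ->
  (forall t : 'rV[R]_n, ref_cell K t <-> ref_cell K (t *m B + b)) ->
  ref_poly K p v -> ref_poly K p (fun t => v (t *m B + b)).
Proof.
case: K => uB iff hv; first exact: ref_poly_affine.
have [pi ipi hpi] := cube_automorphism uB iff.
have := ref_poly_cube_subst (d' := n) (s := fun i => Some (pi i)) (fun i => B (pi i) i) (fun i => b 0 i) _ hv.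
move=> /(_ _)/wrap[|]; first by move=> i i' j [<-] [/ipi].
apply: ref_poly_ext => t; congr v; apply/rowP => i; rewrite !mxE; congr (_ + _).
rewrite (bigD1 (pi i))//= big1 ?addr0; first by rewrite mulrC.
move=> k kp; have [->|/hpi ke] := eqVneq (B k i) 0; first by rewrite mulr0.
by rewrite ke eqxx in kp.
Qed.

End cube_automorphisms.

Section facet_fields.
Variables (R : realType) (m : nat).
Local Notation d := m.+1.
Local Notation lam n := (lebesgue_rV R n).

Lemma facet_pullback K p (v : 'rV[R]_d -> R) (j : facet_ix d K) :
  ref_poly K p v -> ref_poly K p (fun t : 'rV[R]_m => v (facet_par j t)).
Proof.
case: K j => j hv.
  apply: (ref_poly_ext (v := fun t => v (t *m facet_mx R j + facet_par j 0))).
    by move=> t; rewrite -facet_parE.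
  exact: ref_poly_affine.
pose s (i : 'I_d) := unlift j.1 i.
have := ref_poly_cube_subst (d' := m) (s := s) (fun=> 1) (fun i => if s i is Some _ then 0 else (j.2)%:R) _ hv.
move=> /(_ _)/wrap[|].
  move=> i i' k; rewrite /s; case: unliftP => // k1 -> [->]; case: unliftP => // k2 -> [->].
  by [].
apply: ref_poly_ext => t; congr v; apply/rowP => i; rewrite !mxE /s.
by case: unliftP => [k|] _; rewrite ?mul1r ?addr0 ?add0r.
Qed.

Lemma drop_pullback K p (g : 'rV[R]_m -> R) (i : 'I_d) :
  ref_poly K p g -> ref_poly K p (fun x : 'rV[R]_d => g (x *m drop_mx R i)).
Proof.
case: K => hg.
  apply: (ref_poly_ext (v := fun x => g (x *m drop_mx R i + 0))); first by move=> x; rewrite addr0.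
  exact: ref_poly_affine.
have := ref_poly_cube_subst (d' := d) (s := fun k => Some (lift i k)) (fun=> 1) (fun=> 0) _ hg.
move=> /(_ _)/wrap[|]; first by move=> k k' l <- h; apply/esym/(@lift_inj _ i); move: h; move: (lift i k) (lift i k') => a c [->].
by apply: ref_poly_ext => x; congr g; apply/rowP => k; rewrite mul_drop_mx !mxE mul1r addr0.
Qed.

Lemma RTD K p (r q : 'rV[R]_d -> 'rV[R]_d) : RT K p r -> RT K p q -> RT K p (fun x => r x + q x).
Proof.
case: K => [[a [b [ha hb E]]] [a' [b' [ha' hb' E']]]|[a [b [ha hb E]]] [a' [b' [ha' hb' E']]]].
  exists (fun x => a x + a' x), (fun x => b x + b' x); split.
  - by move=> i; apply: ref_poly_ext (ref_polyD (ha i) (ha' i)) => x; rewrite mxE.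
  - exact: ref_polyD.
  - by move=> x; rewrite E E' scalerDl addrACA.
exists (fun x => a x + a' x), (fun x => b x + b' x); split.
- by move=> i; apply: ref_poly_ext (ref_polyD (ha i) (ha' i)) => x; rewrite mxE.
- by move=> i; apply: ref_poly_ext (ref_polyD (hb i) (hb' i)) => x; rewrite mxE.
- by move=> x i; rewrite mxE E E' !mxE; ring.
Qed.

Lemma RTZ K p c (r : 'rV[R]_d -> 'rV[R]_d) : RT K p r -> RT K p (fun x => c *: r x).
Proof.
case: K => [[a [b [ha hb E]]]|[a [b [ha hb E]]]].
  exists (fun x => c *: a x), (fun x => c * b x); split.
  - by move=> i; apply: ref_poly_ext (ref_polyZ c (ha i)) => x; rewrite mxE.
  - exact: ref_polyZ.
  - by move=> x; rewrite E scalerDr scalerA.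
exists (fun x => c *: a x), (fun x => c *: b x); split.
- by move=> i; apply: ref_poly_ext (ref_polyZ c (ha i)) => x; rewrite mxE.
- by move=> i; apply: ref_poly_ext (ref_polyZ c (hb i)) => x; rewrite mxE.
- by move=> x i; rewrite mxE E !mxE; ring.
Qed.

Lemma RT0 K p : RT K p (fun _ : 'rV[R]_d => 0).
Proof.
have z i : ref_poly K p (fun x : 'rV[R]_d => (0 : 'rV[R]_d) 0 i).
  by apply: ref_poly_ext (ref_poly0 _ _ _ _) => x; rewrite mxE.
case: K z => z; exists (fun=> 0).
  by exists (fun=> 0); split => // [|x]; [exact: ref_poly0|rewrite scale0r addr0].
by exists (fun=> 0); split => // x i; rewrite !mxE mul0r addr0.
Qed.

Lemma RT_sum K p (I : Type) (l : seq I) (F : I -> 'rV[R]_d -> 'rV[R]_d) :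
  (forall i, RT K p (F i)) -> RT K p (fun x => \sum_(i <- l) F i x).
Proof.
move=> h; elim: l => [|i l IH].
  by under eq_fun do rewrite big_nil; exact: RT0.
by under eq_fun do rewrite big_cons; exact: RTD.
Qed.

(** The lowest-order Raviart-Thomas shape functions. On the simplex this is the position relative to
    the vertex opposite to the facet; the flux is 1 through the own facet and 0 through the
    others. *)
Definition facet_shape K : facet_ix d K -> 'rV[R]_d -> 'rV[R]_d :=
  match K with
  | Simplex => fun j x => if j is Some i then x - delta_mx 0 i else x
  | Cube => fun j x => (x 0 j.1 - (~~ j.2)%:R) *: delta_mx 0 j.1
  end.

Lemma mul_nu K (j : facet_ix d K) (x : 'rV[R]_d) : (x *m nu R j) 0 0 =
  facet_form j (0 : 'rV[R]_d) - facet_form j x.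
Proof. by rewrite (facet_formE j x) opprB addrC subrK. Qed.

Lemma facet_shape_flux K (j l : facet_ix d K) (t : 'rV[R]_m) :
  (facet_shape j (facet_par l t) *m nu R l) 0 0 = (j == l)%:R.
Proof.
have := @facet_par_form R m K l t; rewrite mul_nu; set x := facet_par l t.
have z0 : \sum_k (0 : 'rV[R]_d) 0 k = 0 by rewrite big1// => k _; rewrite mxE.
case: K j l x => [[i|] [k|]|[i bi] [k bk]] x /= fx; rewrite ?z0.
- by rewrite !mxE fx eqxx /= !sub0r opprK eq_sym.
- have -> : \sum_k (x - delta_mx 0 i) 0 k = \sum_k x 0 k - 1.
    under eq_bigr do rewrite !mxE eqxx /= ; rewrite sumrB; congr (_ - _).
    rewrite (bigD1 i)//= eqxx big1 ?addr0// => l /negbTE ->.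
    by [].
  have -> : (Some i == None)%:R = 0 :> R by [].
  by move: fx; lra.
- by rewrite mxE fx subrr.
- have -> : (None == None :> option 'I_d)%:R = 1 :> R by [].
  by move: fx; lra.
- have -> : ((i, bi) == (k, bk)) = (k == i) && (bi == bk) by rewrite xpair_eqE eq_sym.
  set c := x 0 i - _.
  have E : (c *: delta_mx 0 i : 'rV[R]_d) 0 k = c * (k == i)%:R by rewrite !mxE.
  have z : (0 : 'rV[R]_d) 0 k = 0 by rewrite mxE.
  rewrite /c {c} in E *.
  case: bk fx => /= fx; rewrite E z; have [ki|ki] := eqVneq k i; rewrite /= ?mulr1n ?mulr0n ?mulr1 ?mulr0 ?subrr//.
  - have -> : x 0 i = 1 by rewrite -ki; move: fx; lra.
    by case: bi {E} => /=; rewrite ?mulr1n ?mulr0n; lra.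
  - have -> : x 0 i = 0 by rewrite -ki.
    by case: bi {E} => /=; rewrite ?mulr1n ?mulr0n; lra.
Qed.

(** Facet data are extended into the cell, constant in the dropped coordinate, and multiplied by the
    shape function. This lifts arbitrary P_p fluxes on all facets into RT_p at once. *)
Definition facet_field K (g : facet_ix d K -> 'rV[R]_m -> R) (x : 'rV[R]_d) : 'rV[R]_d :=
  \sum_j g j (x *m drop_mx R (dropi j)) *: facet_shape j x.

Lemma facet_field_flux K g j (t : 'rV[R]_m) : flux (K := K) (facet_field g) j t = g j t.
Proof.
rewrite /flux /facet_field mulmx_suml summxE (bigD1 j)//= big1 => [|l lj].
  by rewrite -scalemxAl mxE facet_shape_flux facet_par_drop eqxx mulr1 addr0.
by rewrite -scalemxAl mxE facet_shape_flux (negbTE lj) mulr0.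
Qed.

Lemma scaled_shape_RT K p (G : 'rV[R]_d -> R) (j : facet_ix d K) : ref_poly K p G ->
  RT K p (fun x => G x *: facet_shape j x).
Proof.
move=> hG; have z (c : R) (i k : 'I_d) : ref_poly K p (fun x => (c * G x) * (delta_mx 0 i : 'rV[R]_d) 0 k).
  by apply: ref_poly_ext (ref_polyZ (c * (delta_mx 0 i : 'rV[R]_d) 0 k) hG) => x; rewrite mulrAC.
case: K j hG z => j hG z.
  exists (fun x => (((if j is Some _ then -1 else 0) * G x) *: delta_mx 0 (odflt ord0 j))), G; split => //.
  - by move=> k; apply: ref_poly_ext (z (if j is Some _ then -1 else 0) (odflt ord0 j) k) => x; rewrite !mxE.
  - move=> x; case: j z => [i|] z /=; last by rewrite mul0r scale0r add0r.
    by rewrite mulN1r scaleNr scalerBr addrC.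
exists (fun x => ((- (~~ j.2)%:R) * G x) *: delta_mx 0 j.1), (fun x => (1 * G x) *: delta_mx 0 j.1); split.
- by move=> k; apply: ref_poly_ext (z (- (~~ j.2)%:R) j.1 k) => x; rewrite !mxE.
- by move=> k; apply: ref_poly_ext (z 1 j.1 k) => x; rewrite !mxE.
- move=> x k; rewrite !mxE; have [->|kj] := eqVneq k j.1; first by rewrite eqxx; ring.
  by rewrite andbF !mulr0n !mulr0 mul0r addr0.
Qed.

Lemma facet_field_RT K p (g : facet_ix d K -> 'rV[R]_m -> R) :
  (forall j, ref_poly K p (g j)) -> RT K p (facet_field g).
Proof.
move=> hg; apply: RT_sum => j.
exact: (scaled_shape_RT j (drop_pullback (dropi j) (hg j))).
Qed.

Lemma sum_sqr (I : finType) (a : I -> R) : (\sum_i a i) ^+ 2 <= #|I|%:R * \sum_i a i ^+ 2.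
Proof.
rewrite expr2 mulr_suml; apply: (@le_trans _ _ (\sum_i \sum_j (a i ^+ 2 / 2 + a j ^+ 2 / 2))).
  apply: ler_sum => i _; rewrite mulr_sumr; apply: ler_sum => j _.
  by have := sqr_ge0 (a i - a j); rewrite sqrrB; lra.
pose S := \sum_i a i ^+ 2.
have -> : \sum_i \sum_j (a i ^+ 2 / 2 + a j ^+ 2 / 2) = \sum_i (#|I|%:R * (a i ^+ 2 / 2) + S / 2).
  by apply: eq_bigr => i _; rewrite big_split /= sumr_const mulr_natl -mulr_suml.
rewrite big_split /= -mulr_sumr sumr_const -mulr_suml -/S -[X in _ + X]mulr_natl.
by rewrite -mulrDr le_eqVlt; apply/orP; left; apply/eqP; congr (_ * _); field.
Qed.

Lemma le_ref_int n K (f g : 'rV[R]_n -> R) : continuous f -> continuous g ->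
  (forall x, ref_cell K x -> f x <= g x) ->
  \int[lam n]_(x in ref_cell K) f x <= \int[lam n]_(x in ref_cell K) g x.
Proof.
move=> cf cg fg; have : 0 <= \int[lam n]_(x in ref_cell K) (g x + -1 * f x).
  by apply: ref_int_ge0 => x /fg; lra.
by rewrite ref_intD ?ref_intZ//; [lra|exact: cts_scale].
Qed.

Lemma facet_shape_bound K (j : facet_ix d K) (x : 'rV[R]_d) k : ref_cell K x ->
  facet_shape j x 0 k ^+ 2 <= 4.
Proof.
move=> rx; have b i : `|x 0 i| <= 1 by exact: ref_cell_inbox rx i.
have d01 i : 0 <= (delta_mx 0 i : 'rV[R]_d) 0 k <= 1.
  by rewrite mxE eqxx /=; case: (k == i); rewrite /= ?mulr1n ?mulr0n ?lexx ?ler01.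
suff : `|facet_shape j x 0 k| <= 2.
  move=> h; rewrite -real_normK ?num_real//; have -> : 4 = 2 ^+ 2 :> R by ring.
  by rewrite lerXn2r ?nnegrE.
case: K j rx => [[i|]|[i bi]] rx /=.
- rewrite mxE [X in _ + X]mxE; apply: (le_trans (ler_normB _ _)).
  by have := b k; have /andP[h1 h2] := d01 i; rewrite (ger0_norm h1); lra.
- by have := b k; lra.
- rewrite mxE; have /andP[h1 h2] := d01 i; rewrite normrM (ger0_norm h1).
  have : `|x 0 i - (~~ bi)%:R| <= 2.
    apply: (le_trans (ler_normB _ _)); have := b i.
    by case: bi => /=; rewrite ?mulr1n ?mulr0n ?normr0 ?normr1; lra.
  have := normr_ge0 (x 0 i - (~~ bi)%:R); nra.
Qed.

(** The extension is constant along fibres, and these have length at most 1. *)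
Lemma drop_int K i (g : 'rV[R]_m -> R) : continuous g ->
  \int[lam d]_(x in ref_cell K) (g (x *m drop_mx R i)) ^+ 2 <=
  \int[lam m]_(t in ref_cell K) g t ^+ 2.
Proof.
move=> cg; have cgd : continuous (fun x : 'rV[R]_d => g (x *m drop_mx R i) ^+ 2).
  apply: cts_sqr; apply: (@cts_comp _ _ _ (fun x : 'rV[R]_d => x *m drop_mx R i) g) => //.
  by apply: continuous_to_rV => k; exact: continuous_linear_form.
rewrite (@Rintegral_insert R m i _ (ref_cell K) (ref_cell K) (@ref_len R m K) 1)//; first last.
- by move=> a t; exact: ref_cell_insert.
- exact: ref_cell_inbox.
- exact: measurable_ref_cell.
have len01 t : ref_cell K t -> 0 <= @ref_len R m K t <= 1.
  case: K {cgd} => rt; last by rewrite /= ler01 lexx.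
  have := rt None; rewrite /= => -> /=; rewrite gerBl; apply: sumr_ge0 => k _; exact: (rt (Some k)).
have cl : continuous (@ref_len R m K).
  case: K {cgd len01} => [|t]; last exact: cst_continuous.
  exact: (@continuous_facet_form R m Simplex None).
have -> : \int[lam m]_(t in ref_cell K) \int[lebesgue_measure]_(a in `[0, @ref_len R m K t]) (g (@insert_coord R d i a t *m drop_mx R i)) ^+ 2
    = \int[lam m]_(t in ref_cell K) (@ref_len R m K t * g t ^+ 2).
  apply: eq_Rintegral => t /set_mem/len01/andP[l0 _].
  under eq_Rintegral do rewrite drop_insert.
  rewrite Rintegral_cst//= lebesgue_measure_itv /= lte_fin.
  case: ltgtP l0 => // [l0|<-] _; last by rewrite mulr0 mul0r.
  by rewrite oppr0 addr0 mulrC.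
apply: le_ref_int.
- by apply: cts_mul => //; exact: cts_sqr.
- exact: cts_sqr.
- by move=> t /len01/andP[l0 l1]; rewrite -[leRHS]mul1r ler_wpM2r// sqr_ge0.
Qed.

End facet_fields.

(** * Scaling estimates under shape regularity *)

Section mesh_geometry.
Variables (R : realType) (m : nat) (K : ref_shape) (M : mesh R m.+1 K).
Local Notation d := m.+1.
Local Notation lam n := (lebesgue_rV R n).
Implicit Types (T : elt M) (s : side M).

Lemma enorm_ge0 n (x : 'rV[R]_n) : 0 <= enorm x. Proof. exact: sqrtr_ge0. Qed.

Lemma enorm_sqr n (x : 'rV[R]_n) : enorm x ^+ 2 = sqnorm x.
Proof.
rewrite /enorm sqr_sqrtr; first by apply: eq_bigr => i _; rewrite expr2.
by apply: sumr_ge0 => i _; rewrite -expr2 sqr_ge0.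
Qed.

Lemma coord_enorm n (x : 'rV[R]_n) i : `|x 0 i| <= enorm x.
Proof.
rewrite -ler_sqr ?nnegrE ?enorm_ge0// enorm_sqr real_normK ?num_real//.
by rewrite /sqnorm (bigD1 i)//= lerDl sumr_ge0// => j _; exact: sqr_ge0.
Qed.

Lemma enorm_diam n (D : set 'rV[R]_n) B x y : D `<=` inbox B -> D x -> D y -> enorm (x - y) <= diam D.
Proof.
move=> DB Dx Dy; apply: ub_le_sup; last by exists (x, y).
exists (1 + \sum_(i < n) (2 * B) ^+ 2) => _ [[a b] [/= Da Db] <-].
have s0 : 0 <= \sum_(i < n) (2 * B) ^+ 2 by apply: sumr_ge0 => i _; exact: sqr_ge0.
rewrite -ler_sqr ?nnegrE ?enorm_ge0 ?addr_ge0// enorm_sqr.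
apply: le_trans (le_sqr1D s0); apply: ler_sum => i _.
have := DB _ Da i; have := DB _ Db i; rewrite !mxE !ler_norml => /andP[h1 h2] /andP[h3 h4].
rewrite -real_normK ?num_real// lerXn2r ?nnegrE//; first by lra.
by rewrite ler_norml; apply/andP; split; lra.
Qed.

Local Notation h T := (diam (cell T)).

Lemma cell_diam T x y : cell T x -> cell T y -> enorm (x - y) <= h T.
Proof. by have [B _ hB] := @mesh_inbox R m K M; apply: enorm_diam; exact: hB. Qed.

Lemma JT_bound T k i : `|JT T k i| <= h T.
Proof.
have -> : JT T k i = (Phi T (delta_mx 0 k) - Phi T 0) 0 i.
  by rewrite /Phi mul0mx add0r addrK -rowE [RHS]mxE.
apply: (le_trans (coord_enorm _ _)); apply: cell_diam.
  by exists (delta_mx 0 k) => //; exact: ref_cell_delta.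
by exists 0 => //; exact: ref_cell0.
Qed.

Lemma h_gt0 T : 0 < h T.
Proof.
rewrite ltNge; apply/negP => h0; have J0 : JT T = 0.
  apply/matrixP => k i; rewrite [RHS]mxE; apply/eqP; rewrite -normr_eq0 eq_le normr_ge0 andbT.
  exact: le_trans (JT_bound T k i) h0.
have := mulmxV (unit_JT T); rewrite J0 mul0mx => /matrixP/(_ 0 0) /eqP.
by rewrite !mxE eqxx eq_sym oner_eq0.
Qed.

Definition regular_at sigma T := exists (c : 'rV[R]_d) (rho : R),
  [/\ 0 < rho, ball2 c rho `<=` cell T & diam (cell T) <= sigma * rho].

Variables (sigma : R) (sigma0 : 0 < sigma).
Hypothesis reg : forall T, regular_at sigma T.

(** The centre of the inscribed ball and its translate by [rho] along an axis are mapped into the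
    reference cell, whose coordinates are at most 1 in absolute value; this gives the 2, and
    [h T <= sigma * rho] does the rest. *)
Lemma invJT_bound T k i : `|invmx (JT T) k i| <= 2 * sigma / h T.
Proof.
have [c [rho [r0 cT hr]]] := reg T.
have c1 : cell T c by apply: cT; rewrite /ball2/= subrr /enorm /dot big1 ?sqrtr0 ?ltW// => j _; rewrite mxE mul0r.
have c2 : cell T (c + rho *: delta_mx 0 k).
  apply: cT; rewrite /ball2/= addrAC subrr add0r /enorm.
  rewrite (_ : dot _ _ = rho ^+ 2) ?sqrtr_sqr ?gtr0_norm//.
  rewrite /dot (bigD1 k)//= big1 => [|j jk]; rewrite !mxE !eqxx ?(negbTE jk) ?mulr0// mulr1 addr0.
  by rewrite expr2.
have E : (Phi_inv T (c + rho *: delta_mx 0 k) - Phi_inv T c) 0 i = rho * invmx (JT T) k i.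
  rewrite !Phi_invE -mulmxBl opprB addrA subrK addrAC subrr add0r -scalemxAl -rowE !mxE.
  by [].
have b1 := ref_cell_inbox ((cellP _ _).1 c1) i; have b2 := ref_cell_inbox ((cellP _ _).1 c2) i.
have : rho * `|invmx (JT T) k i| <= 2.
  rewrite -{1}(gtr0_norm r0) -normrM -E mxE [X in _ + X]mxE.
  apply: (le_trans (ler_normB _ _)); move: b1 b2; lra.
rewrite ler_pdivlMr ?h_gt0// => h2; apply: (le_trans (ler_wpM2l (normr_ge0 _) hr)).
by rewrite mulrCA (mulrC 2) ler_pM2l// mulrC.
Qed.

Lemma det_bound n (A : 'M[R]_n) (c : R) : 0 <= c -> (forall i j, `|A i j| <= c) ->
  `|\det A| <= n`!%:R * c ^+ n.
Proof.
move=> c0 hA; rewrite /determinant; apply: (le_trans (ler_norm_sum _ _ _)).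
apply: (@le_trans _ _ (\sum_(s : 'S_n) c ^+ n)).
  apply: ler_sum => s _; rewrite normrM normrX normrN1 expr1n mul1r normr_prod.
  rewrite -[X in c ^+ X](card_ord n) -prodr_const; apply: ler_prod => i _.
  by rewrite normr_ge0 hA.
by rewrite sumr_const card_Sn mulr_natl.
Qed.

Definition cdet : R := d`!%:R * (2 * sigma) ^+ d.

(** The Leibniz bound for the determinant of the inverse Jacobian, read backwards; this is where
    [cdet] comes from. *)
Lemma h_det T : h T ^+ d <= cdet * `|\det (JT T)|.
Proof.
have h0 := h_gt0 T; have s2 : 0 <= 2 * sigma / h T by rewrite divr_ge0 ?mulr_ge0 ?ltW.
have := det_bound s2 (invJT_bound T).
rewrite det_inv normfV expr_div_n mulrA -/cdet ler_pdivlMr ?exprn_gt0//.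
by rewrite mulrC ler_pdivrMr ?det_JT_gt0.
Qed.

Definition gam s : R := Num.sqrt (\det (facet_lin s *m (facet_lin s)^T)).

(** The weight of the jump term of the DG norm once the facet integral is pulled back to the
    reference facet; [gam] is the surface element. *)
Definition mu s : R := (diam (facet s))^-1 * gam s.

Lemma facet_integralE s w :
  facet_integral s w = gam s * \int[lam m]_(t in @ref_cell R m K) w (facet_map s t).
Proof.
rewrite /facet_integral /gam; congr (Num.sqrt (\det (_ *m _^T)) * _).
  apply/row_matrixP => k; rewrite rowK -/(facet_map s _) -/(facet_map s 0).
  by rewrite facet_mapE addrK rowE.
apply/row_matrixP => k; rewrite rowK -/(facet_map s _) -/(facet_map s 0).
by rewrite facet_mapE addrK rowE.
Qed.

Lemma facet_map_cell s t : ref_cell K t -> cell s.1 (facet_map s t).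
Proof. by move=> rt; apply/cellP; rewrite /facet_map PhiK; exact: facet_par_cell. Qed.

Lemma facet_lin_row s k : row k (facet_lin s) = facet_map s (delta_mx 0 k) - facet_map s 0.
Proof. by rewrite facet_mapE addrK rowE. Qed.

Lemma facet_lin_bound s k i : `|facet_lin s k i| <= h s.1.
Proof.
have -> : facet_lin s k i = row k (facet_lin s) 0 i by rewrite [RHS]mxE.
rewrite facet_lin_row; apply: (le_trans (coord_enorm _ _)); apply: cell_diam.
  by apply: facet_map_cell; exact: ref_cell_delta.
by apply: facet_map_cell; exact: ref_cell0.
Qed.

Definition cgam : R := Num.sqrt (m`!%:R * d%:R ^+ m).

Lemma gam_bound s : gam s <= cgam * h s.1 ^+ m.
Proof.
have h0 := ltW (h_gt0 s.1); have dh0 : 0 <= d%:R * h s.1 ^+ 2 by rewrite mulr_ge0// exprn_ge0.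
have hb (i j : 'I_m) : `|(facet_lin s *m (facet_lin s)^T) i j| <= d%:R * h s.1 ^+ 2.
  rewrite mxE; apply: (le_trans (ler_norm_sum _ _ _)).
  apply: (@le_trans _ _ (\sum_(l < d) h s.1 ^+ 2)); last by rewrite sumr_const card_ord mulr_natl.
  apply: ler_sum => l _; rewrite normrM expr2 [X in _ * `|X|]mxE.
  by apply: ler_pM => //; exact: facet_lin_bound.
have mh0 : 0 <= m`!%:R * d%:R ^+ m :> R by rewrite mulr_ge0// exprn_ge0.
rewrite /cgam -(ger0_norm (exprn_ge0 m h0)) -sqrtr_sqr -sqrtrM//; apply: ler_wsqrtr.
apply: le_trans (ler_norm _) _; apply: (le_trans (det_bound dh0 hb)).
by rewrite exprMn mulrA -!exprM mulnC.
Qed.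

(** A row of [facet_mx] has an entry 1 and equals an edge vector of the facet times the inverse
    Jacobian. The edge is bounded by the facet diameter and the inverse by [invJT_bound]. In
    dimension one a facet is a point, so [m] must be positive. *)
Lemma facet_diam s : (0 < m)%N -> h s.1 <= 2 * sigma * d%:R * diam (facet s).
Proof.
move=> m0; pose k := Ordinal m0; pose i0 := dropi s.2; pose i := lift i0 k.
have e1 : facet_mx R s.2 k i = 1.
  have H : \sum_l facet_mx R s.2 k l * drop_mx R i0 l k = 1.
    by have := facet_mxK R s.2 => /matrixP/(_ k k); rewrite mxE [in RHS]mxE eqxx.
  have dE l : drop_mx R i0 l k = (l == i)%:R by rewrite mxE.
  rewrite -H (bigD1 i)//= dE eqxx mulr1 big1 ?addr0// => l /negbTE li.
  by rewrite dE li mulr0.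
have E : facet_mx R s.2 = facet_lin s *m invmx (JT s.1) by rewrite /facet_lin mulmxK ?unit_JT.
have Fk l : `|facet_lin s k l| <= diam (facet s).
  have -> : facet_lin s k l = row k (facet_lin s) 0 l by rewrite [RHS]mxE.
  rewrite facet_lin_row; apply: (le_trans (coord_enorm _ _)).
  have [B _ hB] := @mesh_inbox R m K M.
  apply: (@enorm_diam _ _ B).
  - by apply: subset_trans (hB s.1); exact: face_subset.
  - by rewrite facetE; exists (delta_mx 0 k) => //; exact: ref_cell_delta.
  - by rewrite facetE; exists 0 => //; exact: ref_cell0.
have h0 := h_gt0 s.1.
have h1 : `|facet_mx R s.2 k i| <= \sum_(l < d) (diam (facet s) * (2 * sigma / h s.1)).
  rewrite E mxE; apply: le_trans (ler_norm_sum _ _ _) _.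
  apply: ler_sum => l _; rewrite normrM; apply: ler_pM => //; exact: invJT_bound.
move: h1; rewrite e1 normr1 sumr_const card_ord -[X in 1 <= X]mulr_natl => h1.
rewrite (_ : 2 * sigma * d%:R * _ = d%:R * (diam (facet s) * (2 * sigma / h s.1)) * h s.1); last first.
  by field; exact: lt0r_neq0.
by rewrite -[leLHS]mul1r ler_pM2r.
Qed.

Definition cmu : R := cgam * (2 * sigma * d%:R) * cdet.

Lemma cmu_ge0 : 0 <= cmu.
Proof.
by rewrite /cmu /cdet mulr_ge0 ?mulr_ge0 ?sqrtr_ge0 ?exprn_ge0 ?mulr_ge0 ?(ltW sigma0).
Qed.

(** The relation that balances the two parts of the broken norm: facet weights are at most a
    multiple of the volume weight, uniformly in the mesh size. *)
Lemma mu_bound s : (0 < m)%N ->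
  0 <= mu s /\ mu s * h s.1 ^+ 2 <= cmu * `|\det (JT s.1)|.
Proof.
move=> m0; have h0 := h_gt0 s.1; have hd := facet_diam s m0.
have c0 : 0 < 2 * sigma * d%:R by rewrite mulr_gt0 ?mulr_gt0 ?ltr0n.
have dF : 0 < diam (facet s).
  by have := lt_le_trans h0 hd; rewrite pmulr_rgt0.
split; first by rewrite /mu mulr_ge0 ?sqrtr_ge0// invr_ge0 ltW.
have hdiv : h s.1 / diam (facet s) <= 2 * sigma * d%:R by rewrite ler_pdivrMr.
have g0 : 0 <= cgam by exact: sqrtr_ge0.
have -> : mu s * h s.1 ^+ 2 = gam s * h s.1 * (h s.1 / diam (facet s)).
  by rewrite /mu; field; exact: lt0r_neq0.
apply: (@le_trans _ _ (cgam * h s.1 ^+ m * h s.1 * (2 * sigma * d%:R))).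
  apply: ler_pM => //; first by rewrite mulr_ge0 ?sqrtr_ge0// ltW.
    by rewrite divr_ge0// ltW.
  by rewrite ler_wpM2r ?gam_bound// ltW.
rewrite /cmu -!mulrA ler_wpM2l// [h s.1 ^+ m * _]mulrA -exprSr [_ ^+ _ * _]mulrC -!mulrA.
rewrite ler_pM2l ?ltr0n// ler_pM2l// ler_pM2l ?ltr0n// mulrA; exact: h_det.
Qed.

Lemma diam_ge0 n (D : set 'rV[R]_n) : 0 <= diam D.
Proof.
rewrite /diam; set E := [set _ | _ in _]; have [[[e Ee] ub]|ns] := pselect (has_sup E); last by rewrite sup_out.
by apply: (@le_trans _ _ e); [case: Ee => z _ <-; exact: enorm_ge0|exact: ub_le_sup].
Qed.

(** With the conormal [y] as an additional row, orthogonal to the tangents, the full Gram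
    determinant is the squared length of [y] times that of the facet; by the cross product formula
    it is also the square of this squared length. *)
Lemma gam_gt0 s : 0 < gam s.
Proof.
pose y : 'rV[R]_d := (conormal s)^T; pose F := facet_lin s.
have Fy : F *m y^T = 0.
  rewrite trmxK /F /facet_lin /conormal -scalemxAr -mulmxA (mulmxA (JT s.1)) mulmxV ?unit_JT//.
  by rewrite mul1mx mulmx_facet_mx_nu scaler0.
have yy : (y *m y^T) 0 0 = sqnorm y.
  by rewrite mxE; apply: eq_bigr => i _; rewrite [y^T _ _]mxE expr2.
have y0 : 0 < sqnorm y.
  rewrite lt_neqAle sqnorm_ge0 eq_sym andbT; apply/eqP => /sqnorm_eq0 h.
  by have := conormal_neq0 s; rewrite -[conormal s]trmxK -/y h trmx0 eqxx.
have [k k2 hk] := det_facet_lin s.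
have E : \det ((col_mx y F : 'M[R]_(1 + m)) *m (col_mx y F : 'M[R]_(1 + m))^T) =
    sqnorm y * \det (F *m F^T).
  rewrite [X in \det (_ *m X)](_ : _ = row_mx y^T F^T); last exact: tr_col_mx.
  rewrite [X in \det X](_ : _ = block_mx (y *m y^T) (y *m F^T) (F *m y^T) (F *m F^T)); last exact: mul_col_row.
  by rewrite Fy det_ublock det_mx11 yy.
have e2 : sqnorm y * \det (F *m F^T) = sqnorm y ^+ 2.
  rewrite -E det_mulmx det_tr -expr2 hk -yy.
  have -> : (y *m conormal s) 0 0 = (y *m y^T) 0 0 by rewrite trmxK.
  by rewrite exprMn k2 mul1r.
rewrite /gam sqrtr_gt0 -/F -(pmulr_rgt0 _ y0) e2 exprn_gt0//.
Qed.

Lemma mu_gt0 s : (0 < m)%N -> 0 < mu s.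
Proof.
move=> m0; rewrite mulr_gt0 ?gam_gt0// invr_gt0.
have := lt_le_trans (h_gt0 s.1) (facet_diam s m0).
by rewrite pmulr_rgt0// mulr_gt0 ?mulr_gt0 ?ltr0n.
Qed.

Lemma mu_same s s' : facet s = facet s' -> mu s = mu s'.
Proof.
move=> ss; rewrite /mu ss; congr (_ * Num.sqrt _).
have [B [b [dB _ -> _ _]]] := facet_transition ss.
rewrite trmx_mul mulmxA -(mulmxA B) !det_mulmx det_tr mulrAC -expr2.
by rewrite -real_normK ?num_real// dB expr1n mul1r.
Qed.

End mesh_geometry.

Lemma sum_involution (R : realType) (I : finType) (f : I -> R) (sig : I -> I) : involutive sig ->
  2 * \sum_s f s = \sum_s (f s + f (sig s)).
Proof.
move=> sigK; have E : \sum_s f (sig s) = \sum_s f s by rewrite [RHS](reindex_inj (inv_inj sigK)).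
rewrite big_split /= E.
by move: (\sum_s f s) => z; ring.
Qed.

(** * The inf-sup estimate in the broken norm *)

Section inf_sup.
Variables (R : realType) (m : nat) (K : ref_shape) (M : mesh R m.+1 K).
Local Notation d := m.+1.
Local Notation lam n := (lebesgue_rV R n).
Variable Om : set 'rV[R]_d.
Hypotheses (hconf : conforming_partition M Om) (oOm : open Om).
Hypothesis regOm : interior (closure Om) = Om.
Implicit Types (T : elt M) (s : side M).
Variables (p : nat) (vh : elt M -> 'rV[R]_d -> R).
Hypothesis hvh : forall T, ref_poly K p (vh T).

Definition pull T (x : 'rV[R]_d) : R := vh T (Phi_inv T x).

Definition gjump s (t : 'rV[R]_m) : R := jump pull s (facet_map s t).

Lemma pull_facet s t : pull s.1 (facet_map s t) = vh s.1 (facet_par s.2 t).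
Proof. by rewrite /pull /facet_map PhiK. Qed.

Lemma gjump_poly s : ref_poly K p (gjump s).
Proof.
rewrite /gjump /jump; case E: (opposite s) => [s'|]; last first.
  apply: (ref_poly_ext (v := fun t => vh s.1 (facet_par s.2 t))).
    by move=> t; rewrite pull_facet subr0.
  exact: facet_pullback.
have [_ /facet_transition[B [b [_ uB _ tr iff]]]] := oppositeP E.
apply: (ref_poly_ext (v := fun t => vh s.1 (facet_par s.2 t) - vh s'.1 (facet_par s'.2 (t *m B + b)))).
  by move=> t; rewrite pull_facet tr pull_facet.
apply: ref_polyB; first exact: facet_pullback.
exact: (transition_poly uB iff (facet_pullback s'.2 (hvh s'.1))).
Qed.

Lemma gjump_opp s s' t t' : opposite s = Some s' -> facet_map s t = facet_map s' t' ->
  gjump s t = - gjump s' t'.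
Proof.
by move=> ss tt; rewrite /gjump /jump ss (opposite_sym hconf ss) -tt opprB.
Qed.

Let X T := \int[lam d]_(x in ref_cell K) sqnorm (grad (vh T) x).
Let Y s := \int[lam m]_(t in ref_cell K) gjump s t ^+ 2.
Let hT T := diam (cell T).
Let dT T := `|\det (JT T)|.
Let la T := dT T / hT T ^+ 2.

(** A squared norm written on the reference cell: [la T] is the scaling of the gradient term. The
    facet sum runs over sides, so an interior facet counts twice. *)
Definition broken_norm : R := \sum_T la T * X T + \sum_s mu s * Y s.

Lemma Y_ge0 s : 0 <= Y s.
Proof. by apply: ref_int_ge0 => x _; exact: sqr_ge0. Qed.

Variable beta : R.

(** The facet part makes the fluxes equal to weighted jumps, and the bubble part adds control of the
    gradient without changing them. The prefactor [orient T] cancels the sign left by the Piola map;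
    the factor [la T] gives both parts the same scaling. *)
Definition test_ref T (x : 'rV[R]_d) : 'rV[R]_d :=
  orient T *: (facet_field (fun j => fun t => mu (T, j) * gjump (T, j) t) x +
               (- (beta * la T)) *: bubble K (vh T) x).

Local Notation ff T := (facet_field (fun j => fun t => mu (T, j) * gjump (T, j) t)).

Lemma ff_RT T : RT K p (ff T).
Proof. by apply: facet_field_RT => j; apply: ref_polyZ; exact: gjump_poly. Qed.

Lemma test_ref_RT T : RT K p (test_ref T).
Proof.
by apply: RTZ; apply: RTD; [exact: ff_RT|apply: RTZ; exact: bubble_RT].
Qed.

Lemma test_ref_flux s t : orient s.1 * flux (test_ref s.1) s.2 t = mu s * gjump s t.
Proof.
have E : flux (test_ref s.1) s.2 t = orient s.1 *
    (flux (ff s.1) s.2 t + (- (beta * la s.1)) * flux (bubble K (vh s.1)) s.2 t).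
  rewrite /flux /test_ref -scalemxAl mxE mulmxDl mxE -scalemxAl.
  by congr (_ * (_ + _)); rewrite mxE.
by rewrite E facet_field_flux bubble_flux mulr0 addr0 mulrA -expr2 orient_sqr mul1r -surjective_pairing.
Qed.

Definition test_field T : 'rV[R]_d -> 'rV[R]_d := piola T (test_ref T).

Lemma test_C1 T : C1_field (test_ref T).
Proof. exact: RT_C1 (test_ref_RT T). Qed.

Lemma test_Hdiv : Hdiv Om (assemble test_field).
Proof.
apply: (matched_Hdiv hconf oOm regOm test_C1) => s s' t t' ss tt.
rewrite !test_ref_flux (gjump_opp ss tt) mulrN.
by have [_ /mu_same ->] := oppositeP ss.
Qed.

Lemma test_Sigmah : Sigmah Om p test_field.
Proof. by split; [exact: test_Hdiv|move=> T; exists (test_ref T) => //; exact: test_ref_RT]. Qed.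

Lemma cvh T : Ck 1 (vh T). Proof. exact: ref_poly_Ck1 (hvh T). Qed.

Lemma continuous_pull T : continuous (pull T).
Proof. by apply: (@cts_comp _ _ _ (Phi_inv T) (vh T)); [exact: continuous_Phi_inv|exact: Ck1_continuous (cvh T)]. Qed.

Lemma RT_coord q (r : 'rV[R]_d -> 'rV[R]_d) i : RT K q r -> continuous (fun x => r x 0 i).
Proof. by move=> hr; exact: Ck1_continuous (RT_C1 hr i). Qed.

Let P s := mu s * \int[lam m]_(t in ref_cell K) (vh s.1 (facet_par s.2 t) * gjump s t).
Let F T := \int[lam d]_(x in ref_cell K) sqnorm (ff T x).
Let Q T := \int[lam d]_(x in ref_cell K) (\sum_k ff T x 0 k * partial k (vh T) x).
Let Bb T := grad_form K (weight K) (vh T) (vh T).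

Lemma continuous_gjump s : continuous (gjump s).
Proof. exact: ref_poly_continuous (gjump_poly s). Qed.

Lemma continuous_vpar s : continuous (fun t : 'rV[R]_m => vh s.1 (facet_par s.2 t)).
Proof. exact: ref_poly_continuous (facet_pullback s.2 (hvh s.1)). Qed.

(** Elementwise integration by parts. Facet terms see only the prescribed flux, since the bubble has
    none; volume terms change sign, which makes the bubble contribution positive and leaves the
    cross term [Q] to be absorbed. *)
Lemma div_test : ip Om (weak_div Om (assemble test_field)) (assemble pull) =
  \sum_s P s - \sum_T Q T + \sum_T beta * la T * Bb T.
Proof.
have mO := measurable_Om oOm.
have [Lw wE] := weak_div_assemble hconf oOm regOm test_C1 test_Hdiv.
have Lp := pdiv_L2 hconf oOm test_C1.
have Lv : L2 Om (assemble pull) by apply: (assemble_L2 hconf oOm) => T; exact: continuous_pull.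
rewrite (ip_ae mO Lw Lp Lv wE) (ip_assemble hconf oOm regOm) //; first last.
- by move=> T; exact: continuous_pull.
- by move=> T; apply: continuous_pdiv; exact: test_C1.
rewrite -(pair_bigA _ (fun T j => P (T, j))) /= -sumrB -big_split; apply: eq_bigr => T _ /=.
have c1 : continuous (fun x => \sum_k test_ref T x 0 k * partial k (vh T) x).
  apply: cts_sum => k; apply: cts_mul; first exact: RT_coord (test_ref_RT T).
  by apply: Ck1_partial; exact: cvh.
have c2 : continuous (fun x => divergence (test_ref T) x * vh T x).
  by apply: cts_mul; [apply: continuous_divergence; exact: test_C1|exact: Ck1_continuous (cvh T)].
have IBP := ref_IBP K (test_C1 T) (cvh T); rewrite ref_intD// in IBP.
have -> : \int[lam d]_(x in ref_cell K) (piola_div T (test_ref T) (Phi T x) * pull T (Phi T x)) =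
    (\det (JT T))^-1 * \int[lam d]_(x in ref_cell K) (divergence (test_ref T) x * vh T x).
  rewrite -ref_intZ//; apply: eq_Rintegral => x _; rewrite /piola_div /pull PhiK det_JT; ring.
rewrite mulrA -/(orient T).
move/(canRL (addKr _)): IBP => ->.
rewrite [X in orient T * X]addrC mulrBr mulr_sumr -addrA; congr (_ + _).
  apply: eq_bigr => j _; rewrite /P -!ref_intZ; first last.
  - by apply: cts_mul; [exact: (@continuous_vpar (T, j))|exact: continuous_gjump].
  - by apply: cts_mul; [exact: (@continuous_vpar (T, j))|apply: continuous_flux; apply: continuous_field; exact: test_C1].
  apply: eq_Rintegral => t _; have := test_ref_flux (T, j) t => /= e.
  by rewrite mulrCA e; ring.
have cf : continuous (fun x => \sum_k ff T x 0 k * partial k (vh T) x).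
  apply: cts_sum => k; apply: cts_mul; first exact: RT_coord (ff_RT T).
  by apply: Ck1_partial; exact: cvh.
have cb : continuous (fun x => \sum_k bubble K (vh T) x 0 k * partial k (vh T) x).
  apply: cts_sum => k; apply: cts_mul; first exact: RT_coord (bubble_RT (hvh T)).
  by apply: Ck1_partial; exact: cvh.
rewrite /Q /Bb -bubble_form -mulNr -ref_intZ// -[- (\int[_]_(x in _) _)]mulN1r -!ref_intZ// -ref_intD; first last.
- exact: cts_scale.
- exact: cts_scale.
apply: eq_Rintegral => x _; rewrite !mulr_sumr -big_split; apply: eq_bigr => k _ /=.
have o2 := orient_sqr T; rewrite /test_ref !mxE.
transitivity (- orient T ^+ 2 * ((ff T x 0 k + - (beta * la T) * bubble K (vh T) x 0 k) * partial k (vh T) x)).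
  by rewrite [in RHS]mxE; ring.
have -> : \sum_l weight K k l x * partial l (vh T) x = bubble K (vh T) x 0 k.
    by rewrite [RHS]mxE.
  by rewrite o2; ring.
Qed.

(** The two sides of an interior facet contribute one trace minus the other, times the jump:
    together the square of the jump, for each side. A boundary side gives the square by itself, so
    the factor 2 leaves slack there. *)
Lemma P_pair : \sum_s mu s * Y s <= 2 * \sum_s P s.
Proof.
pose sig s := if opposite s is Some s' then s' else s.
have sigK : involutive sig.
  move=> s; rewrite /sig; case E: (opposite s) => [s'|]; last by rewrite E.
  by rewrite (opposite_sym hconf E).
rewrite (sum_involution P sigK).
apply: ler_sum => s _; rewrite /sig; case E: (opposite s) => [s'|]; last first.
  have -> : P s = mu s * Y s.
    congr (_ * _); apply: eq_Rintegral => t _; rewrite -pull_facet.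
    by rewrite [in RHS]/gjump /jump E subr0 /gjump /jump E subr0 expr2.
  have m0 : 0 <= mu s * Y s.
    rewrite mulr_ge0 ?Y_ge0// /mu mulr_ge0 ?sqrtr_ge0// invr_ge0.
    exact: diam_ge0.
  by rewrite lerDl.
have [_ ff] := oppositeP E; have [B [b [dB uB _ tr iff]]] := facet_transition ff.
have c1 s1 : continuous (fun t : 'rV[R]_m => vh s1.1 (facet_par s1.2 t) * gjump s1 t).
  by apply: cts_mul; [exact: continuous_vpar|exact: continuous_gjump].
have -> : P s' = mu s * \int[lam m]_(t in ref_cell K) (-1 * (pull s'.1 (facet_map s t) * gjump s t)).
  rewrite /P (mu_same ff) -(Rintegral_ref_automorphism dB uB iff (c1 s')); congr (_ * _).
  apply: eq_Rintegral => t _; rewrite -pull_facet -tr (gjump_opp E (tr t)); ring.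
rewrite /P -mulrDr -ref_intD//; last first.
  apply: cts_scale; apply: cts_mul; last exact: continuous_gjump.
  by apply: (@cts_comp _ _ _ (facet_map s)); [exact: continuous_facet_map|exact: continuous_pull].
rewrite le_eqVlt; apply/orP; left; apply/eqP; congr (_ * _); apply: eq_Rintegral => t _.
rewrite -pull_facet expr2 {1}/gjump /jump E; ring.
Qed.

Lemma F_bound T : F T <= (4 * d%:R * #|facet_ix d K|%:R) * \sum_j mu (T, j) ^+ 2 * Y (T, j).
Proof.
pose n := #|facet_ix d K|; pose g j (x : 'rV[R]_d) := gjump (T, j) (x *m drop_mx R (dropi j)) : R.
have cg j : continuous (g j).
  apply: (@cts_comp _ _ _ (fun x : 'rV[R]_d => x *m drop_mx R (dropi j)) (gjump (T, j))); last exact: continuous_gjump.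
  by apply: continuous_to_rV => k; exact: continuous_linear_form.
have cS : continuous (fun x => \sum_j mu (T, j) ^+ 2 * g j x ^+ 2).
  by apply: cts_sum => j; apply: cts_scale; apply: cts_sqr.
have cF : continuous (fun x => sqnorm (ff T x)).
  by apply: cts_sum => k; apply: cts_sqr; exact: RT_coord (ff_RT T).
apply: (@le_trans _ _ (\int[lam d]_(x in ref_cell K) ((4 * d%:R * n%:R) * \sum_j mu (T, j) ^+ 2 * g j x ^+ 2))).
  apply: le_ref_int => //; first exact: cts_scale.
  move=> x rx; rewrite /sqnorm.
  apply: (@le_trans _ _ (\sum_(k < d) n%:R * (4 * \sum_j mu (T, j) ^+ 2 * g j x ^+ 2))).
    apply: ler_sum => k _; rewrite /facet_field summxE; apply: (le_trans (sum_sqr _)).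
    rewrite ler_wpM2l// mulr_sumr; apply: ler_sum => j _; rewrite mxE exprMn exprMn mulrC.
    by rewrite ler_wpM2r ?facet_shape_bound// mulr_ge0// sqr_ge0.
  rewrite sumr_const card_ord -mulr_natl le_eqVlt; apply/orP; left; apply/eqP; ring.
rewrite ref_intZ//; apply: ler_wpM2l; first by rewrite !mulr_ge0.
rewrite ref_int_sum; last by move=> j; apply: cts_scale; apply: cts_sqr.
apply: ler_sum => j _; rewrite ref_intZ; last exact: cts_sqr.
by rewrite ler_wpM2l ?sqr_ge0//; apply: drop_int; exact: continuous_gjump.
Qed.

(** Young's inequality with a free parameter, later chosen proportional to [la T]. *)
Lemma Q_bound T (a : R) : 0 < a -> Q T <= a / 2 * X T + (2 * a)^-1 * F T.
Proof.
move=> a0; have cX : continuous (fun x => sqnorm (grad (vh T) x)).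
  by apply: cts_sum => i; under eq_fun do rewrite mxE; apply: cts_sqr; apply: Ck1_partial; exact: cvh.
have cF : continuous (fun x => sqnorm (ff T x)).
  by apply: cts_sum => k; apply: cts_sqr; exact: RT_coord (ff_RT T).
rewrite /X /F -!ref_intZ// -ref_intD; [|exact: cts_scale|exact: cts_scale].
apply: le_ref_int.
- apply: cts_sum => k; apply: cts_mul; first exact: RT_coord (ff_RT T).
  by apply: Ck1_partial; exact: cvh.
- by apply: cts_add; exact: cts_scale.
- move=> x _; rewrite /sqnorm !mulr_sumr -big_split; apply: ler_sum => k _ /=.
  rewrite [grad _ _ _ _]mxE; set y := partial k _ x; set z := ff T x 0 k.
  have := sqr_ge0 (a * y - z) => h.
  have a20 : 0 < 2 * a by rewrite mulr_gt0.
  rewrite -subr_ge0 (_ : _ - _ = (2 * a)^-1 * (a * y - z) ^+ 2); last by field; exact: lt0r_neq0.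
  by rewrite mulr_ge0// invr_ge0 ltW.
Qed.

End inf_sup.

Section inf_sup_bounds.
Variables (R : realType) (m : nat) (K : ref_shape) (M : mesh R m.+1 K).
Local Notation d := m.+1.
Local Notation lam n := (lebesgue_rV R n).
Variable Om : set 'rV[R]_d.
Hypotheses (hconf : conforming_partition M Om) (oOm : open Om).
Hypothesis regOm : interior (closure Om) = Om.
Implicit Types (T : elt M) (s : side M).
Variables (sigma : R) (sigma0 : 0 < sigma) (m0 : (0 < m)%N).
Hypothesis reg : forall T, regular_at sigma T.
Variables (p : nat) (vh : elt M -> 'rV[R]_d -> R).
Hypothesis hvh : forall T, ref_poly K p (vh T).
Variables (Cb : R) (Cb0 : 0 <= Cb).
Hypothesis hCb : forall v, ref_poly K p v ->
  \int[lam d]_(x in ref_cell K) sqnorm (grad v x) <= Cb * grad_form K (weight K) v v.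

Let cf : R := 4 * d%:R * #|facet_ix d K|%:R.
(** Large enough that Young's inequality with parameter [theta * la T] leaves at most a quarter of
    the jump term from the lifted jumps; the 1 also covers the gradient part. *)
Let theta : R := 2 * cf * cmu m sigma + 1.
Let beta : R := theta * Cb.

Let X T := \int[lam d]_(x in ref_cell K) sqnorm (grad (vh T) x).
Let Y s := \int[lam m]_(t in ref_cell K) gjump vh s t ^+ 2.
Let hT T := diam (cell T).
Let dT T := `|\det (JT T)|.
Let la T := dT T / hT T ^+ 2.
Let YT T := \sum_j mu (T, j) * Y (T, j).
Let F T := \int[lam d]_(x in ref_cell K)
  sqnorm (facet_field (fun j => fun t => mu (T, j) * gjump vh (T, j) t) x).

Let cf0 : 0 <= cf. Proof. by rewrite !mulr_ge0. Qed.
Let cm0 : 0 <= cmu m sigma. Proof. exact: cmu_ge0. Qed.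
Let th1 : 1 <= theta. Proof. by rewrite lerDr; apply: mulr_ge0 cm0; apply: mulr_ge0 cf0. Qed.
Let la0 T : 0 < la T. Proof. by rewrite divr_gt0 ?det_JT_gt0// exprn_gt0// h_gt0. Qed.
Let X0 T : 0 <= X T. Proof. by apply: ref_int_ge0 => x _; exact: sqnorm_ge0. Qed.
Let Y0 s : 0 <= Y s. Proof. by apply: ref_int_ge0 => x _; exact: sqr_ge0. Qed.
Let mu0 s : 0 <= mu s. Proof. by have [] := mu_bound sigma0 reg s m0. Qed.
Let YT0 T : 0 <= YT T. Proof. by apply: sumr_ge0 => j _; exact: mulr_ge0 (mu0 _) (Y0 _). Qed.

Let mu_la s : mu s <= cmu m sigma * la s.1.
Proof.
have [_ h] := mu_bound sigma0 reg s m0.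
by rewrite /la mulrA ler_pdivlMr ?exprn_gt0 ?h_gt0.
Qed.

Let F_la T : F T <= cf * cmu m sigma * la T * YT T.
Proof.
apply: (@le_trans _ _ (cf * \sum_j mu (T, j) ^+ 2 * Y (T, j))); first by apply: F_bound.
have -> : cf * cmu m sigma * la T * YT T = cf * (cmu m sigma * la T * YT T) by ring.
apply: (ler_wpM2l cf0); rewrite /YT mulr_sumr.
apply: ler_sum => j _.
have -> : mu (T, j) ^+ 2 * Y (T, j) = mu (T, j) * (mu (T, j) * Y (T, j)) by ring.
apply: ler_wpM2r; last exact: (mu_la (T, j)).
exact: mulr_ge0 (mu0 _) (Y0 _).
Qed.

Lemma broken_normE : broken_norm vh = \sum_T (la T * X T + YT T).
Proof. by rewrite big_split /= pair_bigA /=; congr (_ + _); apply: eq_bigr => -[T j] _. Qed.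

Lemma broken_norm_ge0 : 0 <= broken_norm vh.
Proof. by rewrite broken_normE; apply: sumr_ge0 => T _; apply: addr_ge0 (YT0 T); exact: mulr_ge0 (ltW (la0 T)) (X0 T). Qed.

(** With SX and SY the gradient and jump sums, the facet terms are at least SY/2, the cross term at
    most theta SX/2 + SY/4, and the bubble term at least theta SX. The remainder theta SX/2 + SY/4
    is at least a quarter of the norm. *)
Lemma inf_sup_coercive : broken_norm vh <=
  4 * ip Om (weak_div Om (assemble (test_field vh beta))) (assemble (pull vh)).
Proof.
have -> := div_test hconf oOm regOm hvh beta.
have hP : \sum_s mu s * Y s <= 2 * \sum_s (mu s *
    \int[lam m]_(t in ref_cell K) (vh s.1 (@facet_par R d K s.2 t) * gjump vh s t)).
  first [exact: (P_pair hconf hvh) | exact: (P_pair hvh hconf) | exact: (P_pair hconf oOm hvh) | exact: (P_pair hconf oOm regOm hvh) | exact: (P_pair hconf (p := p) hvh)].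
have hQ T : \int[lam d]_(x in ref_cell K) (\sum_k
    facet_field (fun j => fun t => mu (T, j) * gjump vh (T, j) t) x 0 k * partial k (vh T) x) <=
    theta * la T / 2 * X T + YT T / 4.
  have a0 : 0 < theta * la T by rewrite mulr_gt0// (lt_le_trans ltr01).
  apply: le_trans; first by apply: (Q_bound (p := p)) a0.
  rewrite lerD2l -/(F T).
  have a2 : 0 < 2 * (theta * la T) by rewrite mulr_gt0.
  rewrite mulrC ler_pdivrMr//; apply: (le_trans (F_la T)).
  have := YT0 T; have := la0 T; rewrite /theta; have := cf0; have := cm0.
  set a := cmu _ _; set c := cf; set l := la T; set y := YT T => a0' c0' l0' y0'.
  have ly : 0 <= l * y by rewrite mulr_ge0// ltW.
  have : 0 <= c * a by rewrite mulr_ge0.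
  move: a0'; set u := c * a; set w := l * y => _ u0.
  have -> : c * a * l * y = u * w by rewrite /u /w; ring.
  have -> : y / 4 * (2 * ((2 * c * a + 1) * l)) = (u + 2^-1) * w by rewrite /u /w; field.
  by rewrite ler_wpM2r// lerDl invr_ge0.
have hB T : theta * la T * X T <= beta * la T * grad_form K (weight K) (vh T) (vh T).
  have -> : beta * la T * grad_form K (weight K) (vh T) (vh T) =
    theta * la T * (Cb * grad_form K (weight K) (vh T) (vh T)) by rewrite /beta; ring.
  apply: ler_wpM2l; last exact: hCb.
  exact: mulr_ge0 (le_trans ler01 th1) (ltW (la0 T)).
have sQ := ler_sum (index_enum (elt M)) (P := xpredT) (fun T _ => hQ T).
have sB := ler_sum (index_enum (elt M)) (P := xpredT) (fun T _ => hB T).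
have SYE : \sum_s mu s * Y s = \sum_T YT T.
  by rewrite /YT pair_bigA /=; apply: eq_bigr => -[T j] _.
rewrite SYE in hP.
rewrite broken_normE big_split /=; set SX := \sum_T la T * X T; set SY := \sum_T YT T in hP *.
have SX0 : 0 <= SX by apply: sumr_ge0 => T _; exact: mulr_ge0 (ltW (la0 T)) (X0 T).
have e1 : \sum_T (theta * la T / 2 * X T + YT T / 4) = theta / 2 * SX + SY / 4.
  rewrite big_split /= -mulr_suml /SX mulr_sumr; congr (_ + _).
  by apply: eq_bigr => T _; ring.
have e2 : \sum_T theta * la T * X T = theta * SX.
  by rewrite /SX mulr_sumr; apply: eq_bigr => T _; ring.
have tS : SX <= theta * SX by rewrite ler_peMl.
have e3 : theta / 2 * SX = theta * SX / 2 by ring.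
rewrite e1 e3 in sQ; rewrite e2 in sB; clear e1 e2 e3 SYE; move: hP sQ sB tS SX0.
move: (theta * SX) => tSX; clearbody SX SY.
move: (\sum_s _) (\sum_T \int[_]_(x in _) _) (\sum_T beta * _ * _) => zP zQ zB; lra.
Qed.

(** The Piola map costs a factor of order 1 / [la T]. The lifted jumps carry one factor [la T] by
    [mu_bound] and the bubble part carries two, one of which is the weight of the gradient term, so
    all mesh sizes cancel. *)
Lemma test_field_bound : ipv Om (assemble (test_field vh beta)) (assemble (test_field vh beta)) <=
  (d%:R ^+ 2 * (2 * cf * cmu m sigma + 8 * d%:R ^+ 2 * beta ^+ 2)) * broken_norm vh.
Proof.
have cr T i : continuous (fun x => test_ref vh beta T x 0 i).
  by apply: (@RT_coord _ _ K p); apply: test_ref_RT.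
have cp T i : continuous (fun x => test_field vh beta T x 0 i).
  apply: continuous_piola; apply: continuous_field; by apply: (test_C1 (p := p)).
have Lr : L2v Om (assemble (test_field vh beta)) by apply: (assemble_L2v hconf oOm) => T i; exact: cp.
rewrite (ipvE oOm) //.
under eq_bigr do rewrite assemble_coord (ip_assemble hconf oOm regOm (fun T => cp T _) (fun T => cp T _)).
rewrite exchange_big broken_normE mulr_sumr /=; apply: ler_sum => T _.
set I := \int[lam d]_(x in ref_cell K) sqnorm (test_ref vh beta T x).
have cI : continuous (fun x => sqnorm (test_ref vh beta T x)).
  by apply: cts_sum => k; apply: cts_sqr; exact: cr.
have d0 := det_JT_gt0 T; have h0 := h_gt0 T.
have per i : `|\det (JT T)| * \int[lam d]_(x in ref_cell K)
    (test_field vh beta T (Phi T x) 0 i * test_field vh beta T (Phi T x) 0 i) <= d%:R / la T * I.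
  have -> : d%:R / la T * I = dT T * ((d%:R * hT T ^+ 2 / dT T ^+ 2) * I).
    by rewrite /la; field; rewrite !gt_eqF.
  apply: (ler_wpM2l (ltW d0)); rewrite -ref_intZ//; apply: le_ref_int.
  - apply: cts_mul; apply: (@cts_comp _ _ _ (Phi T) (fun x => test_field vh beta T x 0 i)) => //; exact: continuous_Phi.
  - exact: cts_scale.
  - move=> x rx; rewrite -expr2 /test_field /piola PhiK mxE exprMn exprVn -det_JT.
    rewrite -[(\det _) ^+ 2]real_normK ?num_real// mulrC.
    rewrite [leRHS]mulrAC ler_wpM2r ?invr_ge0 ?exprn_ge0//.
    rewrite mxE; apply: (le_trans (sum_sqr _)); rewrite card_ord -mulrA ler_wpM2l//.
    rewrite /sqnorm mulr_sumr; apply: ler_sum => k _; rewrite exprMn mulrC ler_wpM2r ?sqr_ge0//.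
    by rewrite -real_normK ?num_real// lerXn2r ?nnegrE ?(ltW h0)//; exact: JT_bound.
apply: (le_trans (ler_sum _ (fun i _ => per i))); rewrite sumr_const card_ord -[leLHS]mulr_natl.
have hI : I <= 2 * F T + 2 * (beta * la T) ^+ 2 * (4 * d%:R ^+ 2) * X T.
  have cF : continuous (fun x => sqnorm (facet_field (fun j => fun t => mu (T, j) * gjump vh (T, j) t) x)).
    by apply: cts_sum => k; apply: cts_sqr; by apply: (@RT_coord _ _ K p); apply: ff_RT.
  have cX : continuous (fun x => sqnorm (grad (vh T) x)).
    by apply: cts_sum => i; under eq_fun do rewrite mxE; apply: cts_sqr; apply: Ck1_partial; exact: ref_poly_Ck1 (hvh T).
  rewrite /F /X -!ref_intZ// -ref_intD; [|exact: cts_scale|exact: cts_scale].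
  apply: le_ref_int => //; first by apply: cts_add; exact: cts_scale.
  move=> x rx; have hb := bubble_bound (vh T) rx.
  apply: (@le_trans _ _ (2 * sqnorm (facet_field (fun j => fun t => mu (T, j) * gjump vh (T, j) t) x) +
     2 * (beta * la T) ^+ 2 * sqnorm (bubble K (vh T) x))).
    rewrite /sqnorm !mulr_sumr -big_split; apply: ler_sum => k _ /=.
    rewrite /test_ref mxE exprMn orient_sqr mul1r mxE [X in (_ + X) ^+ 2]mxE.
    set u := facet_field _ _ _ _; set w := bubble _ _ _ _ _; set c := beta * la T.
    by have := sqr_ge0 (u + c * w); rewrite !sqrrD; move=> h; nra.
  by rewrite lerD2l -[leRHS]mulrA ler_wpM2l// mulr_ge0// sqr_ge0.
rewrite mulrA; have -> : d%:R * (d%:R / la T) = d%:R ^+ 2 / la T by rewrite mulrA expr2.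
have dl : 0 <= d%:R ^+ 2 / la T by rewrite divr_ge0 ?exprn_ge0// ltW.
apply: (le_trans (ler_wpM2l dl hI)).
apply: (@le_trans _ _ (d%:R ^+ 2 / la T * (2 * (cf * cmu m sigma * la T * YT T) +
    2 * (beta * la T) ^+ 2 * (4 * d%:R ^+ 2) * X T))).
  by rewrite ler_wpM2l// lerD2r ler_wpM2l// F_la.
have -> : d%:R ^+ 2 / la T * (2 * (cf * cmu m sigma * la T * YT T) +
    2 * (beta * la T) ^+ 2 * (4 * d%:R ^+ 2) * X T) =
    d%:R ^+ 2 * (2 * cf * cmu m sigma * YT T + 8 * d%:R ^+ 2 * beta ^+ 2 * (la T * X T)).
  by field; rewrite gt_eqF.
rewrite -[leRHS]mulrA ler_wpM2l ?exprn_ge0//.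
have a0 : 0 <= 2 * cf * cmu m sigma by apply: mulr_ge0 cm0; apply: mulr_ge0 cf0.
have b0 : 0 <= 8 * d%:R ^+ 2 * beta ^+ 2 by rewrite mulr_ge0 ?sqr_ge0// mulr_ge0// exprn_ge0.
have lx : 0 <= la T * X T by exact: mulr_ge0 (ltW (la0 T)) (X0 T).
rewrite mulrDr !mulrDl; have := mulr_ge0 a0 lx; have := mulr_ge0 b0 (YT0 T); lra.
Qed.

Lemma pull_grad T x k : partial k (pull vh T) x =
  \sum_i invmx (JT T) k i * partial i (vh T) (Phi_inv T x).
Proof.
have := (Ck1_affine (invmx (JT T)) (- (offset T *m invmx (JT T))) (ref_poly_Ck1 (hvh T))).2 k.
have -> : (fun x : 'rV[R]_d => vh T (x *m invmx (JT T) + - (offset T *m invmx (JT T)))) = pull vh T.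
  by apply/funext => y; rewrite /pull Phi_inv_affine.
by move=> ->; apply: eq_bigr => i _; rewrite -Phi_inv_affine.
Qed.

Lemma pull_Ck1 T : Ck 1 (pull vh T).
Proof.
have := (Ck1_affine (invmx (JT T)) (- (offset T *m invmx (JT T))) (ref_poly_Ck1 (hvh T))).1.
by have -> : (fun x : 'rV[R]_d => vh T (x *m invmx (JT T) + - (offset T *m invmx (JT T)))) = pull vh T
  by apply/funext => y; rewrite /pull Phi_inv_affine.
Qed.

Lemma gradient_bound T : \int[lam d]_(x in cell T) sqnorm (grad (pull vh T) x) <=
  4 * d%:R ^+ 2 * sigma ^+ 2 * (la T * X T).
Proof.
have cg : continuous (fun x => sqnorm (grad (pull vh T) x)).
  by apply: cts_sum => i; under eq_fun do rewrite mxE; apply: cts_sqr; apply: Ck1_partial; exact: pull_Ck1.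
have cX : continuous (fun x => sqnorm (grad (vh T) x)).
  by apply: cts_sum => i; under eq_fun do rewrite mxE; apply: cts_sqr; apply: Ck1_partial; exact: ref_poly_Ck1 (hvh T).
have h0 := h_gt0 T.
rewrite Rintegral_cell//.
have -> : 4 * d%:R ^+ 2 * sigma ^+ 2 * (la T * X T) = dT T * ((d%:R ^+ 2 * (2 * sigma / hT T) ^+ 2) * X T).
  by rewrite /la; field; rewrite gt_eqF.
rewrite ler_wpM2l ?normr_ge0// /X -ref_intZ//; apply: le_ref_int.
- by apply: (@cts_comp _ _ _ (Phi T) (fun x => sqnorm (grad (pull vh T) x))) => //; exact: continuous_Phi.
- exact: cts_scale.
move=> x rx.
apply: (@le_trans _ _ (\sum_(k < d) d%:R * ((2 * sigma / hT T) ^+ 2 * sqnorm (grad (vh T) x)))).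
  apply: ler_sum => k _; rewrite mxE pull_grad PhiK; apply: (le_trans (sum_sqr _)).
  rewrite card_ord ler_wpM2l// /sqnorm mulr_sumr; apply: ler_sum => i _; rewrite exprMn [grad _ _ _ _]mxE.
  have b0 : 0 <= 2 * sigma / hT T by exact: divr_ge0 (mulr_ge0 (ler0n _ 2) (ltW sigma0)) (ltW h0).
  apply: ler_wpM2r; first exact: sqr_ge0.
  by rewrite -real_normK ?num_real// lerXn2r ?nnegrE//; exact: invJT_bound.
by rewrite sumr_const card_ord -[leLHS]mulr_natl le_eqVlt; apply/orP; left; apply/eqP; ring.
Qed.

(** The DG norm selects one side per facet, whereas the broken norm sums nonnegative terms over all
    sides. *)
Lemma jump_bound : \sum_(s in facets M) (diam (facet s))^-1 *
    facet_integral s (fun x => jump (pull vh) s x ^+ 2) <= \sum_T YT T.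
Proof.
rewrite /YT pair_bigA /= [leRHS](bigID (mem (facets M))) /= .
apply: (@le_trans _ _ (\sum_(s in facets M) mu s * Y s)).
  by apply: ler_sum => s _; rewrite facet_integralE mulrA -/(mu s).
rewrite (eq_bigr (fun s => mu (s.1, s.2) * Y (s.1, s.2))); last by move=> [T j] _.
by rewrite lerDl; apply: sumr_ge0 => -[T j] _; exact: mulr_ge0 (mu0 _) (Y0 _).
Qed.

Lemma pair_sum0 (Z : side M -> R) : (forall s, opposite s = None -> Z s = 0) ->
  (forall s s', opposite s = Some s' -> Z s = - Z s') -> \sum_s Z s = 0.
Proof.
move=> Z0 Z1; pose sig s := if opposite s is Some s' then s' else s.
have sigK : involutive sig.
  move=> s; rewrite /sig; case E: (opposite s) => [s'|]; last by rewrite E.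
  by rewrite (opposite_sym hconf E).
have E : \sum_s Z s = - \sum_s Z s.
  rewrite {1}(reindex_inj (inv_inj sigK)) -sumrN; apply: eq_bigr => s _.
  rewrite /sig; case E: (opposite s) => [s'|]; last by rewrite Z0// oppr0.
  by rewrite (Z1 s' s)//; exact: (opposite_sym hconf E).
by move: E; lra.
Qed.

(** Such a function is constant on each cell, equal across paired facets and zero next to unpaired
    ones. Instead of following chains of neighbours, the divergence theorem is applied to its
    square: the weighted volumes of the cells sum to facet terms that cancel or vanish. *)
Lemma broken_norm_eq0 : broken_norm vh = 0 -> forall T x, vh T x = 0.
Proof.
move=> h; have lx T : 0 <= la T * X T by exact: mulr_ge0 (ltW (la0 T)) (X0 T).
have hT0 T : la T * X T + YT T = 0.
  move: h; rewrite broken_normE => h.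
  by apply: (psumr_eq0P (P := xpredT) (F := fun T => la T * X T + YT T) _ h) => // T' _; exact: addr_ge0 (lx T') (YT0 T').
have XT T : X T = 0.
  have /eqP := hT0 T; rewrite (paddr_eq0 (lx T) (YT0 T)) => /andP[+ _].
  by rewrite mulf_eq0 (gt_eqF (la0 T)) => /eqP.
have Ys s : Y s = 0.
  have /eqP := hT0 s.1; rewrite (paddr_eq0 (lx _) (YT0 _)) => /andP[_ /eqP y].
  have := psumr_eq0P (P := xpredT) (F := fun j => mu (s.1, j) * Y (s.1, j)) _ y => /(_ _ s.2)/wrap[|].
    by move=> j _; exact: mulr_ge0 (mu0 _) (Y0 _).
  move=> /(_ isT) /eqP; rewrite -surjective_pairing mulf_eq0.
  by rewrite (gt_eqF (mu_gt0 sigma0 reg s m0)) => /eqP.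
have cst T x y : vh T x = vh T y.
  by apply: C1_constant; [exact: ref_poly_Ck1 (hvh T)|exact: grad_zero (hvh T) (XT T)].
have g0 s t : gjump vh s t = 0.
  apply: (ref_poly_zero (gjump_poly hvh s)) => {}t it.
  have cg : continuous (fun t => gjump vh s t ^+ 2) by apply: cts_sqr; exact: continuous_gjump.
  have := ref_int0 cg (fun t _ => sqr_ge0 _) (Ys s) it => /eqP.
  by rewrite sqrf_eq0 => /eqP.
pose c T := vh T 0.
have cP s t : pull vh s.1 (facet_map s t) = c s.1 by rewrite /pull; exact: cst.
have c_none s : opposite s = None -> c s.1 = 0.
  by move=> os; have := g0 s 0; rewrite /gjump /jump os subr0 cP.
have c_some s s' : opposite s = Some s' -> c s.1 = c s'.1.
  move=> os; have := g0 s 0; rewrite /gjump /jump os cP /pull.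
  by rewrite (cst s'.1 _ 0) -/(c _) => /eqP; rewrite subr_eq0 => /eqP.
(* The Piola preimage of the constant field with first component [c T ^+ 2]. Paired with the
   gradient of the first coordinate [w] it gives [c T ^+ 2] times the volume, and its divergence is
   zero. *)
pose rh T (_ : 'rV[R]_d) : 'rV[R]_d := (c T ^+ 2 * \det (JT T)) *: (delta_mx 0 0 *m invmx (JT T)).
have Crh T : C1_field (rh T) by move=> i; exact: (Ck1_cst _ _).1.
have dJ0 T : \det (JT T) != 0 by rewrite -unitfE -unitmxE unit_JT.
pose w (x : 'rV[R]_d) := x 0 0.
have [cw dw] := Ck1_coord R (0 : 'I_d).
pose Z s := \int[lam m]_(t in ref_cell K) (w (facet_map s t) * (c s.1 ^+ 2 * conormal s 0 0)).
have key T : dT T * \int[lam d]_(x in @ref_cell R d K) (c T ^+ 2) = \sum_j Z (T, j).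
  have := cell_IBP T (Crh T) cw.
  have -> : \int[lam d]_(y in ref_cell K) (\sum_i piola T (rh T) (Phi T y) 0 i * partial i w (Phi T y) +
      piola_div T (rh T) (Phi T y) * w (Phi T y)) = \int[lam d]_(x in @ref_cell R d K) (c T ^+ 2).
    apply: eq_Rintegral => y _; have -> : piola_div T (rh T) (Phi T y) = 0.
      rewrite /piola_div /divergence big1 ?mulr0// => i _.
      by rewrite (Ck1_cst d (rh T 0 0 i)).2.
    rewrite mul0r addr0 (bigD1 0)//= big1 ?addr0 => [|i i0].
      rewrite dw eqxx mulr1 /piola /rh -scalemxAl mulmxKV ?unit_JT// !mxE !eqxx -det_JT mulr1.
      by rewrite mulrCA mulVf ?mulr1.
    by rewrite dw /cst eq_sym (negbTE i0) mulr0.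
  move=> ->; rewrite mulr_sumr; apply: eq_bigr => j _; rewrite /Z -ref_intZ; last first.
    apply: cts_mul; last by move=> t; exact: cst_continuous.
    apply: (@cts_comp _ _ _ (facet_map (T, j)) w); first exact: continuous_facet_map.
    exact: Ck1_continuous cw.
  apply: eq_Rintegral => t _; rewrite mulrCA; congr (_ * _).
  rewrite /flux /rh -scalemxAl mxE -mulmxA -rowE /conormal !mxE /orient.
  by rewrite /=; move: (\sum_j0 _) => S; field; exact: dJ0.
have Z0 : \sum_s Z s = 0.
  apply: pair_sum0 => [s /c_none c0|s s' ss].
    by rewrite /Z ref_int_eq0// => t _; rewrite c0 expr0n mul0r mulr0.
  have [ne ff] := oppositeP ss; have [B [b [dB uB _ tr iff]]] := facet_transition ff.
  have cZ (s1 : side M) (e : R) : continuous (fun t : 'rV[R]_m => w (facet_map s1 t) * e).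
    apply: cts_mul; last by move=> t; exact: cst_continuous.
    apply: (@cts_comp _ _ _ (facet_map s1) w); first exact: continuous_facet_map.
    exact: Ck1_continuous cw.
  rewrite /Z -[in RHS](Rintegral_ref_automorphism dB uB iff (cZ s' _)) -mulN1r -ref_intZ; last first.
    apply: (@cts_comp _ _ _ (fun t : 'rV[R]_m => t *m B + b) (fun t => w (facet_map s' t) * _)); first exact: continuous_affine_map.
    exact: cZ.
  apply: eq_Rintegral => t _; rewrite -tr (c_some _ _ ss).
  have -> : conormal s' = - conormal s by apply: (conormal_opp hconf) => //; rewrite eq_sym.
  by rewrite [X in _ = -1 * (_ * (_ * X))]mxE; ring.
have cz T : c T = 0.
  have V0 : 0 < \int[lam d]_(x in @ref_cell R d K) (1 : R).
    rewrite Rintegral_cst ?mul1r; [exact: vol_ref_gt0|exact: measurable_ref_cell].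
  have := Z0; rewrite -(pair_bigA _ (fun T j => Z (T, j))) /=.
  under eq_bigr do rewrite -key.
  move=> z; have := psumr_eq0P (P := xpredT) (F := fun T => dT T * \int[lam d]_(x in @ref_cell R d K) (c T ^+ 2)) _ z.
  move=> /(_ _)/wrap[|].
    by move=> T' _; rewrite mulr_ge0 ?normr_ge0//; apply: ref_int_ge0 => x _; exact: sqr_ge0.
  move=> /(_ T isT)/eqP; rewrite mulf_eq0 (gt_eqF (det_JT_gt0 T)) /=.
  have -> : \int[lam d]_(x in @ref_cell R d K) (c T ^+ 2) = c T ^+ 2 * \int[lam d]_(x in @ref_cell R d K) (1 : R).
    rewrite -ref_intZ; last by move=> x; exact: cst_continuous.
    by apply: eq_Rintegral => x _; rewrite mulr1.
  by rewrite mulf_eq0 (gt_eqF V0) orbF sqrf_eq0 => /eqP.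
by move=> T x; rewrite (cst T x 0) -/(c T) cz.
Qed.

End inf_sup_bounds.

(** * Bilinear forms of the mixed problem *)

Section measurable_inverse.
Variables (R : realType) (dT : measure_display) (X : measurableType dT) (D : set X).
Hypothesis mD : measurable D.

Lemma measurable_invr : measurable_fun setT (fun t : measurableTypeR R => t^-1 : measurableTypeR R).
Proof.
have cU : closed [set (0 : R)] by exact: accessible_closed_set1 (hausdorff_accessible (@norm_hausdorff _ R)) 0.
rewrite -(setUv [set (0 : R)]); apply/measurable_funU => //; first exact: measurableC.
split; first exact: measurable_fun_set1.
apply: open_continuous_measurable_fun; first by rewrite openC.
by move=> x; rewrite inE => x0; apply: inv_continuous; apply/eqP.
Qed.

Lemma measurable_det n (f : X -> 'M[R]_n) : (forall i j, measurable_fun D (fun x => f x i j)) ->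
  measurable_fun D (fun x => \det (f x)).
Proof.
move=> mf; rewrite /determinant; apply: measurable_sum => s.
apply: measurable_realfun.measurable_funM; first exact: measurable_cst.
by apply: measurable_prod => i _; exact: mf.
Qed.

(** [invmx] returns its argument on singular matrices. With the inverse of 0 being 0, the second
    summand of the formula is active on singular matrices and the adjugate term on regular ones, so
    no case split on a measurable set is needed. *)
Lemma measurable_invmx n (f : X -> 'M[R]_n) i j : (forall i j, measurable_fun D (fun x => f x i j)) ->
  measurable_fun D (fun x => invmx (f x) i j).
Proof.
move=> mf; rewrite (_ : (fun x => _) = fun x => (\det (f x))^-1 * \adj (f x) i j +
    (1 - \det (f x) * (\det (f x))^-1) * f x i j); last first.
  apply/funext => x; rewrite /invmx unitmxE unitfE.
  have [->|d0] /= := eqVneq (\det (f x)) 0; first by rewrite invr0 !mul0r subr0 mul1r add0r.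
  by rewrite mulfV// subrr mul0r addr0 mxE.
have md := measurable_det mf.
have mi : measurable_fun D (fun x => (\det (f x))^-1) by exact: (measurableT_comp measurable_invr md).
apply: measurable_realfun.measurable_funD; apply: measurable_realfun.measurable_funM => //.
  rewrite (_ : (fun x => _) = fun x => (-1) ^+ (j + i) * \det (row' j (col' i (f x)))); last first.
    by apply/funext => x; rewrite mxE.
  apply: measurable_realfun.measurable_funM; first exact: measurable_cst.
  apply: measurable_det => k l; rewrite (_ : (fun x => _) = fun x => f x (lift j k) (lift i l))//.
  by apply/funext => x; rewrite !mxE.
apply: measurable_realfun.measurable_funB; first exact: measurable_cst.
exact: measurable_realfun.measurable_funM.
Qed.

End measurable_inverse.

Lemma ae_le_Rintegral (R : realType) d (X : measurableType d) (mu : {measure set X -> \bar R})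
    (D : set X) (f g : X -> R) : measurable D ->
  mu.-integrable D (EFin \o f) -> mu.-integrable D (EFin \o g) ->
  {ae mu, forall x, D x -> f x <= g x} ->
  \int[mu]_(x in D) f x <= \int[mu]_(x in D) g x.
Proof.
move=> mD fi gi [N [mN N0 sN]].
rewrite /Rintegral (negligible_integral mN mD fi N0) (negligible_integral mN mD gi N0).
apply: le_Rintegral.
- exact: measurableD.
- by apply: integrableS fi => //; exact: measurableD.
- by apply: integrableS gi => //; exact: measurableD.
- by move=> x [Dx Nx]; apply: contrapT => h; apply: Nx; apply: sN => /= /(_ Dx).
Qed.

Section coefficient_forms.
Variables (R : realType) (m : nat) (K : ref_shape) (M : mesh R m.+1 K).
Local Notation d := m.+1.
Local Notation lam := (lebesgue_rV R d).
Variable Om : set 'rV[R]_d.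
Hypotheses (hconf : conforming_partition M Om) (oOm : open Om).
Hypothesis regOm : interior (closure Om) = Om.
Variables (A : 'rV[R]_d -> 'M[R]_d) (a0 a1 : R).
Hypotheses (a00 : 0 < a0) (a10 : 0 < a1).
Hypothesis mA : forall i j, measurable_fun Om (fun x => A x i j).
Hypothesis sA : {ae lam, forall x, Om x -> (A x)^T = A x}.
Hypothesis eA : {ae lam, forall x, Om x -> forall l, eigenvalue (A x) l -> a0 <= l <= a1}.

Let mO : measurable Om. Proof. exact: measurable_Om oOm. Qed.

Let c i j x := invmx (A x) i j.

Let goodA : {ae lam, forall x, Om x -> (A x)^T = A x /\ forall l, eigenvalue (A x) l -> a0 <= l <= a1}.
Proof. by apply: filterS2 sA eA => x h1 h2 Ox; split; [exact: h1|exact: h2]. Qed.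

Let mc i j : measurable_fun Om (c i j). Proof. exact: measurable_invmx. Qed.

Let bc i j : {ae lam, forall x, Om x -> `|c i j x| <= a0^-1}.
Proof.
apply: filterS goodA => x h Ox; have [s e] := h Ox.
have [_ _ h3] := spectral_inverse s a00 e (delta_mx 0 j).
have i0 : 0 <= a0^-1 by rewrite invr_ge0 ltW.
rewrite -ler_sqr ?nnegrE// real_normK ?num_real//.
have n1 : sqnorm (delta_mx 0 j : 'rV[R]_d) = 1.
  rewrite /sqnorm (bigD1 j)//= big1 => [|k kj]; rewrite !mxE !eqxx ?expr1n ?addr0//.
  by rewrite (negbTE kj) expr0n.
rewrite n1 mulr1 in h3; apply: le_trans h3.
rewrite /sqnorm (bigD1 i)//= -rowE !mxE lerDl sumr_ge0// => k _; exact: sqr_ge0.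
Qed.

Lemma applyAinvE r i : (fun x => applyAinv A r x 0 i) = fun x => \sum_j c i j x * r x 0 j.
Proof. by apply/funext => x; rewrite mxE; apply: eq_bigr => j _; rewrite mxE mulrC. Qed.

Lemma L2v_applyAinv r : L2v Om r -> L2v Om (applyAinv A r).
Proof.
move=> Lr i; rewrite applyAinvE; apply: (L2_sum mO) => j _.
exact: (L2M_bounded mO (mc i j) (bc i j) (Lr j)).
Qed.

Lemma ipv_linear (a : R) r q s : L2v Om r -> L2v Om q -> L2v Om s ->
  ipv Om (fun x => a *: r x + q x) s = a * ipv Om r s + ipv Om q s.
Proof.
move=> Lr Lq Ls; have Lc : L2v Om (fun x => a *: r x + q x).
  move=> i; have := L2D mO (L2Z mO a (Lr i)) (Lq i); congr L2; by apply/funext => x; rewrite !mxE.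
rewrite !(ipvE oOm)// mulr_sumr -big_split; apply: eq_bigr => i _ /=.
rewrite -(ipZl mO) // -(ipDl mO)//; last exact: L2Z.
by congr ip; apply/funext => x; rewrite !mxE.
Qed.

Lemma ipvC r s : ipv Om r s = ipv Om s r.
Proof. by apply: eq_Rintegral => x _; apply: eq_bigr => i _; rewrite mulrC. Qed.

Definition aform r s := ipv Om (applyAinv A r) s.

Lemma aform_linear (a : R) r q s : L2v Om r -> L2v Om q -> L2v Om s ->
  aform (fun x => a *: r x + q x) s = a * aform r s + aform q s.
Proof.
move=> Lr Lq Ls; rewrite /aform -ipv_linear//; try exact: L2v_applyAinv.
by congr ipv; apply/funext => x; rewrite /applyAinv mulmxDl scalemxAl.
Qed.

Lemma dot_integrable r s : L2v Om r -> L2v Om s -> lam.-integrable Om (EFin \o (fun x => dot (r x) (s x))).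
Proof.
move=> Lr Ls; rewrite /dot.
suff h (l : seq 'I_d) : lam.-integrable Om (EFin \o (fun x => \sum_(i <- l) r x 0 i * s x 0 i)) by exact: h.
elim: l => [|i l IH].
  rewrite (_ : EFin \o _ = cst 0%E); first exact: integrable0.
  by apply/funext => x /=; rewrite big_nil.
have := integrableD mO (L2_integrableM mO (Lr i) (Ls i)) IH; congr (_.-integrable _ _).
by apply/funext => x /=; rewrite big_cons EFinD.
Qed.

Lemma aformC r s : L2v Om r -> L2v Om s -> aform r s = aform s r.
Proof.
move=> Lr Ls.
have h : {ae lam, forall x, Om x -> dot (applyAinv A r x) (s x) = dot (applyAinv A s x) (r x)}.
  apply: filterS sA => x hs Ox; rewrite /dot /applyAinv.
  have e : (invmx (A x))^T = invmx (A x) by rewrite trmx_inv (hs Ox).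
  have dm (v w : 'rV[R]_d) : \sum_i v 0 i * w 0 i = (v *m w^T) 0 0.
    by rewrite mxE; apply: eq_bigr => i _; rewrite mxE.
  rewrite e !dm; transitivity ((r x *m invmx (A x) *m (s x)^T)^T 0 0); first by rewrite [RHS]mxE.
  by rewrite !trmx_mul trmxK e mulmxA.
have L1 := dot_integrable (L2v_applyAinv Lr) Ls; have L2' := dot_integrable (L2v_applyAinv Ls) Lr.
apply/eqP; rewrite eq_le; apply/andP; split; apply: ae_le_Rintegral => //.
  by apply: filterS h => x hx Ox; rewrite hx.
by apply: filterS h => x hx Ox; rewrite hx.
Qed.

Lemma dotxx (x : 'rV[R]_d) : dot x x = sqnorm x.
Proof. by apply: eq_bigr => i _; rewrite expr2. Qed.

Lemma ipv_ge0 r : 0 <= ipv Om r r.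
Proof. by apply: Rintegral_ge0 => x _; rewrite dotxx; exact: sqnorm_ge0. Qed.

Lemma aform_lower r : L2v Om r -> ipv Om r r <= a1 * aform r r.
Proof.
move=> Lr; have La := L2v_applyAinv Lr; rewrite /aform /ipv -RintegralZl//; last exact: dot_integrable.
apply: ae_le_Rintegral => //; first exact: dot_integrable.
  have := integrableZl mO a1 (dot_integrable La Lr); congr (_.-integrable _ _).
apply: filterS goodA => x h Ox; have [s e] := h Ox.
by have [_ h2 _] := spectral_inverse s a00 e (r x); rewrite dotxx.
Qed.

Lemma aform_upper r : L2v Om r -> aform r r <= a0^-1 * ipv Om r r.
Proof.
move=> Lr; have La := L2v_applyAinv Lr; rewrite /aform /ipv -RintegralZl//; last exact: dot_integrable.
apply: ae_le_Rintegral => //; first exact: dot_integrable.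
  have := integrableZl mO a0^-1 (dot_integrable Lr Lr); congr (_.-integrable _ _).
apply: filterS goodA => x h Ox; have [s e] := h Ox.
by have [h1 _ _] := spectral_inverse s a00 e (r x); rewrite dotxx.
Qed.

Lemma aform_ge0 r : L2v Om r -> 0 <= aform r r.
Proof. by move=> /aform_lower h; have := le_trans (ipv_ge0 r) h; rewrite pmulr_rge0. Qed.

(** [weak_div] is a choice among representatives, so its linearity can only be used almost
    everywhere, through this uniqueness. *)
Lemma is_weak_div_unique r u1 u2 : is_weak_div Om r u1 -> is_weak_div Om r u2 ->
  {ae lam, forall x, Om x -> u1 x = u2 x}.
Proof.
move=> [L1 h1] [L2' h2].
have := @test_functions_separate R d Om mO (Om_fin hconf oOm) Om (fun x => u1 x - u2 x) oOm (@subset_refl _ _) (L2B mO L1 L2').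
move=> /(_ _)/wrap[|h].
  move=> phi tphi; have Lp : L2 Om phi.
    by apply: (continuous_L2 hconf oOm); apply: Ck1_continuous; exact: test_function_Ck1 tphi.
  by rewrite (ipBl mO)// -[ip Om u1 phi]opprK -h1// h2// opprK subrr.
by apply: filterS h => x h Ox; apply/eqP; rewrite -subr_eq0 h.
Qed.

Lemma weak_divP r : Hdiv Om r -> is_weak_div Om r (weak_div Om r).
Proof. by move=> [_ [u hu]]; exact: (xgetPex (fun=> 0) (ex_intro _ u hu)). Qed.

Lemma test_grad_L2v phi : test_function Om phi -> L2v Om (grad phi).
Proof.
move=> tp i; rewrite (_ : (fun x => _) = partial i phi); last by apply/funext => x; rewrite mxE.
by apply: (continuous_L2 hconf oOm); apply: Ck1_partial; exact: test_function_Ck1 tp.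
Qed.

Lemma weak_div_linear (a : R) r q : Hdiv Om r -> Hdiv Om q ->
  is_weak_div Om (fun x => a *: r x + q x) (fun x => a * weak_div Om r x + weak_div Om q x).
Proof.
move=> hr hq; have [Lr e1] := weak_divP hr; have [Lq e2] := weak_divP hq.
split; first exact: (L2D mO (L2Z mO a Lr) Lq).
move=> phi tp; have Lp : L2 Om phi.
  by apply: (continuous_L2 hconf oOm); apply: Ck1_continuous; exact: test_function_Ck1 tp.
rewrite (ipv_linear _ hr.1 hq.1 (test_grad_L2v tp)) e1// e2//.
rewrite mulrN -opprD; congr (- _); apply/esym.
transitivity (ip Om (fun x => a * weak_div Om r x) phi + ip Om (weak_div Om q) phi).
  exact: (ipDl mO (L2Z mO a Lr) Lq Lp).
by congr (_ + _); exact: (ipZl mO a Lr Lp).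
Qed.

Lemma Hdiv_linear (a : R) r q : Hdiv Om r -> Hdiv Om q -> Hdiv Om (fun x => a *: r x + q x).
Proof.
move=> hr hq; split; last by eexists; exact: weak_div_linear.
by move=> i; have := L2D mO (L2Z mO a (hr.1 i)) (hq.1 i); congr L2; apply/funext => x; rewrite !mxE.
Qed.

Definition bform r v := ip Om (weak_div Om r) v.

Lemma bform_linear (a : R) r q v : Hdiv Om r -> Hdiv Om q -> L2 Om v ->
  bform (fun x => a *: r x + q x) v = a * bform r v + bform q v.
Proof.
move=> hr hq Lv; have hc := weak_divP (Hdiv_linear a hr hq).
have [Lr _] := weak_divP hr; have [Lq _] := weak_divP hq.
rewrite /bform (ip_ae mO hc.1 _ Lv (is_weak_div_unique hc (weak_div_linear a hr hq))).
  by rewrite (ipDl mO)// ?(ipZl mO)//; exact: L2Z.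
exact: (L2D mO (L2Z mO a Lr) Lq).
Qed.

Variable G : 'rV[R]_d -> R.
Hypothesis hG : H1 Om G.

Lemma weak_gradP : is_weak_grad Om G (weak_grad Om G).
Proof. by case: hG => _ [r hr]; exact: (xgetPex (fun=> 0) (ex_intro _ r hr)). Qed.

Lemma pairing_linear (a : R) r q : Hdiv Om r -> Hdiv Om q ->
  boundary_pairing Om G (fun x => a *: r x + q x) = a * boundary_pairing Om G r + boundary_pairing Om G q.
Proof.
move=> hr hq; have [Lg _] := weak_gradP; have LG := hG.1.
have bpE s : boundary_pairing Om G s = ipv Om s (weak_grad Om G) + bform s G.
  by congr (_ + _); [exact: ipvC|exact: ipC].
by rewrite !bpE (ipv_linear a hr.1 hq.1 Lg) (bform_linear a hr hq LG) mulrDr addrACA.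
Qed.

End coefficient_forms.

(** * Scalar Bregman inequalities *)

Section entropy_bounds.
Variable R : realType.

(** The tangent inequality of convex functions, from chord bounds at one base point. If it failed, a
    difference quotient with small step [t * w] would stay further from the derivative than the
    limit allows. *)
Lemma derive_le_chord (g : R -> R) (y s w c : R) : is_derive y (1 : R) g s -> w != 0 ->
  (forall t, 0 < t < 1 -> g (t * w + y) - g y <= t * c) -> s * w <= c.
Proof.
move=> [dv <-] w0 h; rewrite leNgt; apply/negP; set s' := 'D_1 g y => cs.
have w1 : 0 < `|w| by rewrite normr_gt0.
have e0 : 0 < (s' * w - c) / `|w| by rewrite divr_gt0 ?subr_gt0.
have /nbhs_ballP[e /= ep he] : \forall t \near (0 : R), t != 0 ->
    `|s' - t^-1 *: (g (t *: (1 : R) + y) - g y)| < (s' * w - c) / `|w|.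
  by have /cvgrPdist_lt/(_ _ e0) := dv.
(* [t] is below 1 for the chord bound, and the step [t * w] is within the radius [e] where the
   quotient is close to the derivative. *)
pose t := Num.min (1 / 2) (e / (2 * `|w|)).
have t0 : 0 < t by rewrite /t lt_min divr_gt0//= divr_gt0// mulr_gt0.
have t1 : t < 1 by rewrite /t gt_min; apply/orP; left; lra.
have te : t * `|w| < e.
  have : t <= e / (2 * `|w|) by rewrite /t ge_min lexx orbT.
  rewrite ler_pdivlMr ?mulr_gt0// => h1; have h2 := mulr_gt0 t0 w1; lra.
have tw0 : t * w != 0 by rewrite mulf_neq0// gt_eqF.
have Hb : ball (0 : R) e (t * w).
  by rewrite /ball /= sub0r normrN normrM (gtr0_norm t0).
have H : `|s' - (t * w)^-1 * (g (t * w * 1 + y) - g y)| < (s' * w - c) / `|w| := he (t * w) Hb tw0.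
have hq : g (t * w + y) - g y <= t * c by apply: h; rewrite t0.
move: H hq; rewrite mulr1; set Q := g _ - g _ => H hq.
move: H; rewrite ltr_pdivlMr// -normrM => /(le_lt_trans (ler_norm _)).
have -> : (s' - (t * w)^-1 * Q) * w = s' * w - Q / t by field; rewrite w0 gt_eqF.
have : Q / t <= c by rewrite ler_pdivrMr// mulrC.
lra.
Qed.

Variables (lo : R) (hi : \bar R) (rho : R -> \bar R) (ups : R -> R).
Hypothesis H : entropy_at lo hi rho ups.

Definition node_bregman (x y : R) : R :=
  fine (rho x) - fine (rho y) - derive1 (fine \o rho) y * (x - y).

(** [ups s] is interior to the effective domain, so the entropy has the slope [s] there and lies
    above its tangent. The point [x] may be an end of the domain, where the entropy is merely
    finite. *)
Lemma node_bregman_ge0 (x s : R) : lo <= x -> (x%:E <= hi)%E -> 0 <= node_bregman x (ups s).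
Proof.
move=> lx xh; rewrite /node_bregman (upsilonK H); set y := ups s.
have [ly yh] := upsilon_range H s.
have fx : (rho x < +oo)%E by apply/(entropy_domain H); rewrite lee_fin.
have fy : (rho y < +oo)%E by apply/(entropy_domain H); rewrite lee_fin; split; exact: ltW.
have [->|xy] := eqVneq x y; first by rewrite !subrr mulr0 subrr.
have fin z : (rho z < +oo)%E -> rho z = (fine (rho z))%:E.
  by move=> hz; rewrite fineK// fin_numE (entropy_ninfty H) /= lt_eqF.
have dg : is_derive y (1 : R) (fine \o rho) s.
  have e : 'D_1 (fine \o rho) y = s by rewrite -derive1E; exact: upsilonK H s.
  by rewrite -[X in is_derive _ _ _ X]e; exact/derivableP/(entropy_differentiable H).
rewrite subr_ge0; apply: (derive_le_chord dg); first by rewrite subr_eq0.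
move=> t t01 /=.
have sc := entropy_strictly_convex H fx fy xy t01.
have e : t * (x - y) + y = t * x + (1 - t) * y by ring.
have [t0 t1] := andP t01.
have fz : (rho (t * x + (1 - t) * y) < +oo)%E.
  apply: lt_trans sc _; rewrite (fin _ fx) (fin _ fy) -!EFinM -EFinD; exact: ltry.
move: sc; rewrite e (fin _ fx) (fin _ fy) (fin _ fz) /= -!EFinM -EFinD lte_fin => sc.
lra.
Qed.

Lemma upsilon_monotone s t : 0 <= (s - t) * (ups s - ups t).
Proof.
have [st|ts|->] := ltgtP s t; last by rewrite !subrr mulr0.
  by apply: mulr_le0; rewrite subr_le0 ltW// (upsilon_increasing H).
by apply: mulr_ge0; rewrite subr_ge0 ltW// (upsilon_increasing H).
Qed.

(** The derivative of the entropy at [ups s] is [s], so the entropy values cancel and the linear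
    terms remain. *)
Lemma three_point (x s t : R) :
  node_bregman x (ups s) - node_bregman x (ups t) - node_bregman (ups t) (ups s) =
  (s - t) * (ups t - x).
Proof. by rewrite /node_bregman !(upsilonK H); ring. Qed.

End entropy_bounds.

(** * The abstract obstacle problem and its proximal iteration *)

Section saddle_point_obstacle.
Variables (R : realType) (V U : lmodType R) (Sg : V -> Prop) (SU : U -> Prop) (N : nat).
Variables (a : V -> V -> R) (B : V -> U -> R) (ipU : U -> U -> R) (L : V -> R) (F : U -> R).
Variables (nrm : U -> R) (Ca : R) (e : 'I_N -> U) (ev : 'I_N -> U -> R) (w : 'I_N -> R).
Variables (lo : 'I_N -> R) (hi : 'I_N -> \bar R).
Hypotheses (sSg : linear_subspace Sg) (sSU : linear_subspace SU).
Hypothesis gSg : exists N' (b : 'I_N' -> V), generates Sg b.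
Hypothesis pa : psd_form Sg a.
Hypothesis da : forall q, Sg q -> a q q = 0 -> q = 0.
Hypothesis Bl : forall v, SU v -> linear_on Sg (fun r => B r v).
Hypothesis Br : forall r, Sg r -> linear_on SU (B r).
Hypotheses (LL : linear_on Sg L) (LF : linear_on SU F).
Hypothesis evl : forall i, linear_on SU (ev i).
Hypothesis eS : forall i, SU (e i).
Hypothesis eE : forall v, SU v -> v = \sum_i ev i v *: e i.
Hypothesis ee : forall i j, ev j (e i) = (i == j)%:R.
Hypothesis ipE : forall u v, SU u -> SU v -> ipU u v = \sum_i w i * (ev i u * ev i v).
Hypothesis w0 : forall i, 0 < w i.
Hypothesis nrm0 : forall v, SU v -> 0 <= nrm v.
Hypothesis nrmz : forall v, SU v -> nrm v = 0 -> v = 0.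
Hypothesis Ca0 : 0 <= Ca.
Hypothesis infsup : forall v, SU v ->
  exists2 r, Sg r & nrm v <= 4 * B r v /\ a r r <= Ca * nrm v.

Definition feasible u := forall i, lo i <= ev i u /\ ((ev i u)%:E <= hi i)%E.

Definition obstacle_solution q u := [/\ Sg q, SU u, feasible u,
  (forall r, Sg r -> a q r - B r u = - L r) &
  forall v, SU v -> feasible v -> 0 <= B q (v - u) - F (v - u)].

Lemma aBl q q' r : Sg q -> Sg q' -> Sg r -> a (q - q') r = a q r - a q' r.
Proof. by move=> Sq Sq' Sr; exact: (linear_onB sSg (psdl pa Sr) Sq Sq'). Qed.

Lemma aBr q q' r : Sg q -> Sg q' -> Sg r -> a r (q - q') = a r q - a r q'.
Proof. by move=> Sq Sq' Sr; exact: (linear_onB sSg (psdr sSg pa Sr) Sq Sq'). Qed.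

Lemma BBl q q' v : Sg q -> Sg q' -> SU v -> B (q - q') v = B q v - B q' v.
Proof. by move=> Sq Sq' Sv; exact: (linear_onB sSg (Bl Sv) Sq Sq'). Qed.

Lemma BBr q v v' : Sg q -> SU v -> SU v' -> B q (v - v') = B q v - B q v'.
Proof. by move=> Sq Sv Sv'; exact: (linear_onB sSU (Br Sq) Sv Sv'). Qed.

Lemma saddle_difference q u q' u' : Sg q -> Sg q' -> SU u -> SU u' ->
  (forall r, Sg r -> a q r - B r u = - L r) -> (forall r, Sg r -> a q' r - B r u' = - L r) ->
  forall r, Sg r -> a (q - q') r = B r (u - u').
Proof.
move=> Sq Sq' Su Su' h h' r Sr; rewrite aBl// BBr//.
have := h r Sr; have := h' r Sr; lra.
Qed.

(** [nrm] is a squared norm. The inf-sup field gives [nrm v <= 4 * a q r], and Cauchy-Schwarz with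
    [a r r <= Ca * nrm v] allows one factor [nrm v] to be cancelled; 16 is the square of 4. *)
Lemma nrm_le q v : Sg q -> SU v -> (forall r, Sg r -> a q r = B r v) ->
  nrm v <= 16 * Ca * a q q.
Proof.
move=> Sq Sv h; have [r Sr [h1 h2]] := infsup Sv.
have c := psd_cauchy sSg pa Sq Sr; have q0 := psd_ge0 pa Sq.
have [n0|n0] := leP (nrm v) 0; first by apply: le_trans n0 _; rewrite !mulr_ge0.
rewrite -h// in h1.
have h3 : nrm v ^+ 2 <= (4 * a q r) ^+ 2 by rewrite ler_sqr ?nnegrE// ?ltW//; apply: lt_le_trans n0 h1.
have h4 : a q q * a r r <= a q q * (Ca * nrm v) by apply: ler_wpM2l.
rewrite -(ler_pM2r n0) -expr2; apply: le_trans h3 _; rewrite exprMn.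
have -> : 16 * Ca * a q q * nrm v = 4 ^+ 2 * (a q q * (Ca * nrm v)) by ring.
by apply: ler_wpM2l; [exact: sqr_ge0|exact: le_trans c h4].
Qed.

Lemma ev_comb i c : ev i (comb e c) = c 0 i.
Proof.
rewrite (linear_on_comb sSU _ (evl i) eS) (bigD1 i)//= ee eqxx mulr1 big1 ?addr0// => j ji.
by rewrite ee (negbTE ji) mulr0.
Qed.

Lemma comb_ev v : SU v -> comb e (\row_i ev i v) = v.
Proof. by move=> Sv; rewrite [RHS]eE//; apply: eq_bigr => i _; rewrite mxE. Qed.

(** The flux that belongs to each nodal basis function. Eliminating the flux with this family turns
    the saddle point problem into a problem for nodal values, whose matrix is the Gram matrix [G], a
    Schur complement. *)
Lemma solution_family : exists qq : 'I_N -> V, forall i, Sg (qq i) /\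
  forall r, Sg r -> a (qq i) r = B r (e i).
Proof.
have [N' [b gb]] := gSg.
have [] := @choice _ _ (fun i q => Sg q /\ forall r, Sg r -> a q r = B r (e i)); last by move=> qq; exists qq.
move=> i; have ker x : Sg x -> a x x = 0 -> B x (e i) = 0.
  by move=> Sx /(da Sx) ->; exact: (linear_on0 sSg (Bl (eS i))).
by have [q Sq h] := riesz sSg pa gb (Bl (eS i)) ker; exists q.
Qed.

Section gram.
Variable qq : 'I_N -> V.
Hypothesis hqq : forall i, Sg (qq i) /\ forall r, Sg r -> a (qq i) r = B r (e i).
Let Sqq i : Sg (qq i). Proof. by have [] := hqq i. Qed.
Let G : 'M[R]_N := \matrix_(i, j) a (qq i) (qq j).

Lemma a_comb x r : Sg r -> a (comb qq x) r = B r (comb e x).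
Proof.
move=> Sr; rewrite (linear_on_comb sSU _ (Br Sr) eS).
transitivity (\sum_i x 0 i * a (qq i) r); first exact: (linear_on_comb sSg x (psdl pa Sr) Sqq).
by apply: eq_bigr => i _; rewrite (hqq i).2.
Qed.

Lemma gram_form x y : mform G x y = a (comb qq x) (comb qq y).
Proof. by rewrite (psd_comb sSg pa). Qed.

Lemma gram_definite x : x != 0 -> 0 < mform G x x.
Proof.
have Sx := subspace_comb sSg x Sqq.
move=> x0; rewrite lt_neqAle gram_form (psd_ge0 pa Sx) andbT eq_sym; apply/negP => /eqP h.
have Se := subspace_comb sSU x eS.
have [r Sr [h1 _]] := infsup Se.
have z : comb e x = 0.
  apply: nrmz => //; apply/eqP; rewrite eq_le nrm0// andbT.
  by apply: le_trans h1 _; rewrite -a_comb// (psd_null sSg pa Sx Sr h) mulr0.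
move/eqP: x0; apply; apply/rowP => i; rewrite -ev_comb z mxE.
exact: (linear_on0 sSU (evl i)).
Qed.

(** The constant comes from compactness and depends on the mesh; it serves the L^2 convergence of
    the scalar iterates on a fixed mesh. *)
Lemma gram_coercive : exists2 C, 0 <= C & forall q v, Sg q -> SU v ->
  (forall r, Sg r -> a q r = B r v) -> ipU v v <= C * a q q.
Proof.
have [c c0 hc] := @coercive_on _ N 1 0 G (fun x _ => @gram_definite x).
pose W := \sum_i w i; have W0 : 0 <= W by apply: sumr_ge0 => i _; exact: ltW.
exists (W * c^-1); first by rewrite mulr_ge0// invr_ge0 ltW.
move=> q v Sq Sv h; pose x : 'rV[R]_N := \row_i ev i v.
have vx : comb e x = v by exact: comb_ev.
have Sx := subspace_comb sSg x Sqq.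
have ax r : Sg r -> a (comb qq x) r = a q r by move=> Sr; rewrite a_comb// vx h.
have ex : mform G x x = a q q by rewrite gram_form ax// (psdC pa Sq Sx) ax.
have := hc x (mulmx0 _ _); rewrite ex => hx.
rewrite ipE// -mulrA; apply: (@le_trans _ _ (W * sqnorm x)).
  rewrite /sqnorm mulr_sumr; apply: ler_sum => i _; rewrite mxE -expr2.
  apply: ler_wpM2r; first exact: sqr_ge0.
  by rewrite /W (bigD1 i)//= lerDl; apply: sumr_ge0 => j _; exact: ltW.
by apply: ler_wpM2l => //; rewrite ler_pdivlMl.
Qed.

(** In nodal values the constraints form a closed nonempty box, so [quadratic_vi] applies to the
    Gram matrix. The flux is [q0], which represents the boundary datum, plus the combination of the
    family with the nodal values as coefficients. *)
Lemma obstacle_existence : (forall i, ((lo i)%:E <= hi i)%E) -> exists q u, obstacle_solution q u.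
Proof.
move=> lohi; have [N' [b gb]] := gSg.
have lNL : linear_on Sg (fun r => - L r) by move=> t x y Sx Sy; rewrite LL// opprD mulrN.
have [|q0 Sq0 hq0] := riesz sSg pa gb lNL.
  by move=> x Sx /(da Sx) ->; exact: (linear_on0 sSg lNL).
pose l : 'cV[R]_N := \col_j (F (e j) - a q0 (qq j)).
pose D : set 'rV[R]_N := [set c | forall i, lo i <= c 0 i /\ ((c 0 i)%:E <= hi i)%E].
have [y Dy hy] : exists2 y, D y & forall z, D z -> ((z - y) *m l) 0 0 <= mform G y (z - y).
  apply: quadratic_vi.
  - by apply/matrixP => i j; rewrite !mxE; exact: (psdC pa (Sqq _) (Sqq _)).
  - by move=> x; exact: gram_definite.
  - rewrite (_ : D = \bigcap_(i in [set: 'I_N])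
      ((fun c : 'rV[R]_N => c 0 i) @^-1` [set t | lo i <= t /\ (t%:E <= hi i)%E])); last first.
      by apply/seteqP; split => [c h i _|c h i]; apply: h.
    apply: closed_bigI => i _; apply: closed_comp => [c _|]; first exact: coord_continuous.
    rewrite (_ : [set _ | _] = [set t | lo i <= t] `&` [set t | (t%:E <= hi i)%E]); last by apply/seteqP; split => t [? ?]; split.
    apply: closedI; first exact: closed_ge.
    case: (hi i) => [r| |].
    + rewrite (_ : [set _ | _] = [set t | t <= r]); first exact: closed_le.
      by apply/seteqP; split => t /=; rewrite lee_fin.
    + by rewrite (_ : [set _ | _] = setT); [exact: closedT|apply/seteqP; split => t //= _; rewrite leey].
    + by rewrite (_ : [set _ | _] = set0); [exact: closed0|apply/seteqP; split => t //=; rewrite leeNy_eq].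
  - by exists (\row_i lo i) => i; rewrite mxE.
  - move=> x z t Dx Dz /andP[t0 t1] i; rewrite !mxE.
    have [lx xh] := Dx i; have [lz zh] := Dz i; split; first by nra.
    move: xh zh; case: (hi i) => [r| |]; rewrite ?leey ?leeNy_eq// !lee_fin => xh zh; nra.
have Sy := subspace_comb sSg y Sqq; have Sq := subspaceD sSg Sq0 Sy.
have Sc x : SU (comb e x) := subspace_comb sSU x eS.
exists (q0 + comb qq y), (comb e y); split => //.
- by move=> i; rewrite ev_comb; exact: Dy.
- move=> r Sr; rewrite (linear_onD (psdl pa Sr) Sq0 Sy) a_comb// hq0//; ring.
- move=> v Sv fv; pose z : 'rV[R]_N := \row_i ev i v.
  have -> : v - comb e y = comb e (z - y).
    rewrite -[v in LHS]comb_ev// /comb -sumrB; apply: eq_bigr => i _.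
    by rewrite !mxE scalerBl.
  have /hy : D z by move=> i; rewrite mxE; exact: fv.
  set x := z - y; rewrite gram_form.
  have Sx := subspace_comb sSg x Sqq.
  rewrite (linear_on_comb sSU x LF eS) -a_comb// (linear_onD (psdr sSg pa Sx) Sq0 Sy).
  rewrite (psdC pa Sx Sq0) (psdC pa Sx Sy) (linear_on_comb sSg x (psdr sSg pa Sq0) Sqq).
  have -> : (x *m l) 0 0 = \sum_i x 0 i * F (e i) - \sum_i x 0 i * a q0 (qq i).
    by rewrite mxE -sumrB; apply: eq_bigr => i _; rewrite !mxE mulrBr.
  lra.
Qed.
End gram.

(** Testing each inequality with the other solution makes the form [a] of the flux difference
    nonpositive; the scalar difference is then zero by [nrm_le]. *)
Lemma obstacle_uniqueness q u q' u' : obstacle_solution q u -> obstacle_solution q' u' ->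
  q = q' /\ u = u'.
Proof.
move=> [Sq Su fu h1 h2] [Sq' Su' fu' h1' h2'].
have Sd := subspaceB sSg Sq Sq'; have Sv := subspaceB sSU Su Su'.
have sd := saddle_difference Sq Sq' Su Su' h1 h1'.
have z : a (q - q') (q - q') = 0.
  apply/eqP; rewrite eq_le (psd_ge0 pa Sd) andbT sd// BBl//.
  have := h2 _ Su' fu'; have := h2' _ Su fu.
  rewrite !BBr// !(linear_onB sSU LF)//; lra.
split; apply/eqP; rewrite -subr_eq0; apply/eqP; first exact: da.
apply: nrmz => //; apply/eqP; rewrite eq_le nrm0// andbT.
by apply: le_trans (nrm_le Sd Sv sd) _; rewrite z mulr0.
Qed.

Section proximal.
Variables (rho : 'I_N -> R -> \bar R) (ups : 'I_N -> R -> R).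
Hypothesis ent : forall i, entropy_at (lo i) (hi i) (rho i) (ups i).
Variables (alpha : nat -> R) (q : nat -> V) (u psi : nat -> U).
Hypothesis alpha0 : forall k, (0 < k)%N -> 0 < alpha k.
Hypothesis hu : forall k, SU (u k).
Hypothesis hpsi : forall k, SU (psi k).
Hypothesis hqk : forall k, (0 < k)%N -> Sg (q k).
Hypothesis h1 : forall k, (0 < k)%N -> forall v, SU v ->
  alpha k * B (q k) v + ipU (psi k) v = alpha k * F v + ipU (psi k.-1) v.
Hypothesis h2 : forall k, (0 < k)%N -> forall r, Sg r -> a (q k) r - B r (u k) = - L r.
Hypothesis h3 : forall k i, ev i (u k) = ups i (ev i (psi k)).

Definition total_bregman x y := \sum_i w i * node_bregman (rho i) (ev i x) (ev i y).

Lemma feasible_iterate k : feasible (u k).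
Proof.
by move=> i; rewrite h3; have [/ltW ? /ltW ?] := upsilon_range (ent i) (ev i (psi k)).
Qed.

Lemma proximal_step k v : (0 < k)%N -> SU v -> alpha k * (B (q k) v - F v) =
  \sum_i w i * ((ev i (psi k.-1) - ev i (psi k)) * ev i v).
Proof.
move=> k0 Sv; have := h1 k0 Sv; rewrite !ipE// => h.
transitivity (\sum_i w i * (ev i (psi k.-1) * ev i v) - \sum_i w i * (ev i (psi k) * ev i v)).
  by rewrite mulrBr; lra.
by rewrite -sumrB; apply: eq_bigr => i _; ring.
Qed.

Lemma total_bregman_ge0 v k : feasible v -> 0 <= total_bregman v (u k).
Proof.
move=> fv; apply: sumr_ge0 => i _; apply: mulr_ge0; first exact: ltW.
by have [l1 l2] := fv i; rewrite h3; exact: node_bregman_ge0 (ent i) _ _ l1 l2.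
Qed.

Variables (qs : V) (us : U).
Hypothesis sol : obstacle_solution qs us.

Let E k := a (q k - qs) (q k - qs).
Let W k := B qs (u k - us) - F (u k - us).
Let J k := 2^-1 * E k + W k.

Let Sqs : Sg qs. Proof. by case: sol. Qed.
Let Sus : SU us. Proof. by case: sol. Qed.
Let Sd k : (0 < k)%N -> Sg (q k - qs). Proof. by move=> k0; exact: subspaceB (hqk k0) Sqs. Qed.
Let Su k : SU (u k - us). Proof. exact: subspaceB. Qed.
Let W0 k : 0 <= W k. Proof. by case: sol => _ _ _ _; apply=> //; exact: feasible_iterate. Qed.

Lemma error_equation k : (0 < k)%N -> forall r, Sg r -> a (q k - qs) r = B r (u k - us).
Proof.
by move=> k0; case: sol => _ _ _ hs _; exact: saddle_difference (hqk k0) Sqs (hu k) Sus (h2 k0) hs.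
Qed.

(** The error equation turns [E k] into a pairing of the flux error with the scalar error, and
    adding [W k] replaces the exact flux by the load. The result is the proximal step tested with
    [u k - us], to which the three-point identity applies node by node; the distance from [u k.-1]
    to [u k] is dropped. *)
Lemma bregman_descent k : (0 < k)%N ->
  alpha k * (E k + W k) <= total_bregman us (u k.-1) - total_bregman us (u k).
Proof.
move=> k0; rewrite /E error_equation//; last exact: Sd.
rewrite (BBl (hqk k0) Sqs (Su k)).
have -> : B (q k) (u k - us) - B qs (u k - us) + W k = B (q k) (u k - us) - F (u k - us).
  by rewrite /W; ring.
rewrite proximal_step// -subr_ge0 /total_bregman -sumrB -sumrB; apply: sumr_ge0 => i _.
rewrite (linear_onB sSU (evl i) (hu k) Sus).
have := three_point (ent i) (ev i us) (ev i (psi k.-1)) (ev i (psi k)).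
rewrite -!h3 => <-.
rewrite -!mulrBr; apply: mulr_ge0; first exact: ltW.
have [l1 l2] := feasible_iterate k i.
have : 0 <= node_bregman (rho i) (ev i (u k)) (ev i (u k.-1)).
  by rewrite [ev i (u k.-1)]h3; exact: node_bregman_ge0 (ent i) _ _ l1 l2.
lra.
Qed.

(** By convexity of the quadratic part, the decrease of [J] is at least the residual of the step
    [k.+1] tested with [u k - u k.+1]. After division by the step size this is a weighted sum of
    products of differences of latent values and of their images under the increasing map [ups]. The
    half in [J] is what makes the quadratic term convexity-tight. *)
Lemma energy_antitone k : (0 < k)%N -> J k.+1 <= J k.
Proof.
move=> k0; set x := q k - qs; set y := q k.+1 - qs.
have Sx : Sg x := Sd k0; have Sy : Sg y := @Sd k.+1 isT.
have Qn : Sg (q k.+1) := hqk (isT : (0 < k.+1)%N).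
have xy : 0 <= a x x - 2 * a x y + a y y.
  have -> : a x x - 2 * a x y + a y y = a (x - y) (x - y).
    rewrite (aBl Sx Sy (subspaceB sSg Sx Sy)) (aBr Sx Sy Sx) (aBr Sx Sy Sy) (psdC pa Sy Sx); ring.
  exact: (psd_ge0 pa (subspaceB sSg Sx Sy)).
have Sv : SU (u k - u k.+1) by exact: subspaceB.
have := proximal_step (isT : (0 < k.+1)%N) Sv => /= st.
have mono : 0 <= B (q k.+1) (u k - u k.+1) - F (u k - u k.+1).
  rewrite -(pmulr_rge0 _ (@alpha0 k.+1 isT)) st; apply: sumr_ge0 => i _.
  apply: mulr_ge0; first exact: ltW.
  by rewrite (linear_onB sSU (evl i) (hu k) (hu k.+1)) !h3; exact: upsilon_monotone (ent i) _ _.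
have exy : a x y = B y (u k - us) := error_equation k0 Sy.
have eyy : a y y = B y (u k.+1 - us) := error_equation (isT : (0 < k.+1)%N) Sy.
have e4 j : B qs (u j - us) = B qs (u j) - B qs us := BBr Sqs (hu j) Sus.
have e5 j : B y (u j - us) = B (q k.+1) (u j) - B (q k.+1) us - (B qs (u j) - B qs us).
  by rewrite (BBl Qn Sqs (Su j)) (BBr Qn (hu j) Sus) e4.
have e3 j : F (u j - us) = F (u j) - F us := linear_onB sSU LF (hu j) Sus.
rewrite (BBr Qn (hu k) (hu k.+1)) (linear_onB sSU LF (hu k) (hu k.+1)) in mono.
rewrite e5 in exy; rewrite e5 in eyy.
rewrite /J /E /W -/x -/y !e3 !e4; lra.
Qed.

Lemma proximal_decay l :
  (\sum_(1 <= k < l.+1) alpha k) * J l <= total_bregman us (u 0%N) - total_bregman us (u l).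
Proof.
have a0 k : 0 <= \sum_(1 <= j < k.+1) alpha j.
  by rewrite big_nat_cond; apply: sumr_ge0 => j /andP[/andP[j0 _] _]; exact: ltW (alpha0 j0).
elim: l => [|l IH]; first by rewrite big_geq// mul0r subrr.
rewrite big_nat_recr//= mulrDl.
have bd := @bregman_descent l.+1 isT; rewrite /= in bd.
have E0 : 0 <= E l.+1 := psd_ge0 pa (@Sd l.+1 isT).
have h4 : alpha l.+1 * J l.+1 <= alpha l.+1 * (E l.+1 + W l.+1).
  by apply: ler_wpM2l; [exact: ltW (@alpha0 l.+1 isT)|rewrite /J; lra].
have h5 : (\sum_(1 <= j < l.+1) alpha j) * J l.+1 <= (\sum_(1 <= j < l.+1) alpha j) * J l.
  (* [q 0] is arbitrary, so [J 0] carries no information; monotonicity starts at index 1, and for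
     [l] equal to 0 the sum of steps is empty. *)
  case: (l) => [|l']; first by rewrite big_geq// !mul0r.
  by apply: ler_wpM2l => //; exact: energy_antitone.
lra.
Qed.

(** [J l] contains half of the squared flux error plus a nonnegative residual; this half is the
    origin of the factor 2. *)
Lemma proximal_rate l : (0 < l)%N ->
  a (q l - qs) (q l - qs) <= 2 * (total_bregman us (u 0%N) / \sum_(1 <= k < l.+1) alpha k).
Proof.
move=> l0; set S := \sum_(_ <= _ < _) _.
have S0 : 0 < S.
  rewrite /S big_nat_recl//; apply: ltr_pwDl; first exact: alpha0.
  by apply: sumr_ge0 => k _; exact: ltW (alpha0 _).
have := proximal_decay l; rewrite -/S => h.
have b0 : 0 <= total_bregman us (u l) by apply: total_bregman_ge0; case: sol.
rewrite mulrA ler_pdivlMr//.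
have : S * (2^-1 * E l) <= S * J l by apply: ler_wpM2l; [exact: ltW|rewrite /J lerDl].
rewrite -/(E l); lra.
Qed.

End proximal.
End saddle_point_obstacle.

Lemma sum_enum_val (V : nmodType) (I : finType) (F : I -> V) :
  \sum_(k < #|I|) F (enum_val k) = \sum_z F z.
Proof. by rewrite [RHS](reindex (@enum_val I I))//; exact: onW_bij (@enum_val_bij I). Qed.

Lemma sqrt_rate_cvg (R : realType) (S X : nat -> R) (C : R) :
  (forall l, (0 < l)%N -> 0 < S l) -> (forall l, (0 < l)%N -> X l <= C / S l) ->
  S l @[l --> \oo] --> +oo -> Num.sqrt (X l) @[l --> \oo] --> (0 : R).
Proof.
move=> S0 h hS; apply/cvgrPdist_lt => eps e0.
have hC : \forall l \near \oo, C / eps ^+ 2 < S l by move/cvgryPgt : hS; apply.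
near=> l.
have l0 : (0 < l)%N by near: l; exact: nbhs_infty_gt.
have s : C / eps ^+ 2 < S l by near: l.
rewrite sub0r normrN ger0_norm ?sqrtr_ge0// -[ltRHS](ger0_norm (ltW e0)) -sqrtr_sqr.
rewrite ltr_sqrt ?exprn_gt0//; apply: le_lt_trans (h l l0) _.
by rewrite ltr_pdivrMr ?S0// mulrC -ltr_pdivrMr ?exprn_gt0.
Unshelve. all: by end_near. Qed.

Lemma RT_component (R : realType) m K p (r : 'rV[R]_m.+1 -> 'rV[R]_m.+1) i : RT K p r ->
  ref_poly K p.+1 (fun x => r x 0 i).
Proof.
case: K => -[a [b [ha hb e]]].
  apply: (ref_poly_ext (v := fun x => a x 0 i + b x * x 0 i)); first by move=> x; rewrite e !mxE.
  apply: ref_polyD; first exact: ref_poly_le (leqnSn p) (ha i).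
  have h : ref_poly Simplex (p + 1) (fun x => b x * x 0 i).
    by apply: ref_polyM => //; exact: ref_poly_coord.
  by rewrite addn1 in h.
apply: (ref_poly_ext (v := fun x => a x 0 i + b x 0 i * x 0 i)); first by move=> x; rewrite e.
apply: ref_polyD; first exact: ref_poly_le (leqnSn p) (ha i).
have h : ref_poly Cube (p + 1) (fun x => b x 0 i * x 0 i).
  by apply: ref_polyM => //; exact: ref_poly_coord.
by rewrite addn1 in h.
Qed.

(** * Discrete spaces, quadrature nodes and the DG norm *)

Section discrete_spaces.
Variables (R : realType) (m : nat) (K : ref_shape) (M : mesh R m.+1 K).
Local Notation d := m.+1.
Local Notation lam := (lebesgue_rV R d).
Local Notation scalars := (elt M -> 'rV[R]_d -> R).
Local Notation fields := (elt M -> 'rV[R]_d -> 'rV[R]_d).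
Variable Om : set 'rV[R]_d.
Hypotheses (hconf : conforming_partition M Om) (oOm : open Om).
Hypothesis regOm : interior (closure Om) = Om.
Variable p : nat.

Let mO : measurable Om. Proof. exact: measurable_Om oOm. Qed.

Lemma assemble_linear (V : lmodType R) (a : R) (v w : elt M -> 'rV[R]_d -> V) :
  assemble (a *: v + w) = fun x => a *: assemble v x + assemble w x.
Proof. by apply/funext => x; rewrite /assemble scaler_sumr -big_split. Qed.

Lemma assemble_linearR (a : R) (v w : scalars) :
  assemble (a *: v + w) = fun x => a * assemble v x + assemble w x.
Proof. exact: assemble_linear. Qed.

Definition vhat (v : scalars) T (x : 'rV[R]_d) : R := v T (Phi T x).

Lemma pull_vhat v : pull (vhat v) = v.
Proof. by apply/funext => T; apply/funext => x; rewrite /pull /vhat Phi_invK. Qed.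

Lemma vhat_poly q v : Vh q v -> forall T, ref_poly K q (vhat v T).
Proof.
by move=> hv T; have [vt pv e] := hv T; apply: ref_poly_ext pv => x; rewrite /vhat e PhiK.
Qed.

Lemma Vh_continuous q (v : scalars) : Vh q v -> forall T, continuous (v T).
Proof. by move=> hv T; rewrite -(pull_vhat v); exact: (continuous_pull (vhat_poly hv)). Qed.

Lemma Vh_L2 q (v : scalars) : Vh q v -> L2 Om (assemble v).
Proof. by move=> hv; apply: assemble_L2 => // T; exact: Vh_continuous hv T. Qed.

Lemma subspace_Vh q : linear_subspace (@Vh R d K M q).
Proof.
split; first by move=> T; exists (fun=> 0); [exact: ref_poly0|].
move=> a x y hx hy T; have [xh px ex] := hx T; have [yh py ey] := hy T.
exists (fun z => a * xh z + yh z); last by move=> z; rewrite -ex -ey.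
by apply: ref_polyD => //; exact: ref_polyZ.
Qed.

Lemma subspace_Sigmah : linear_subspace (Sigmah (M := M) Om p).
Proof.
have closed_lin (a : R) (x y : fields) : Sigmah Om p x -> Sigmah Om p y -> Sigmah Om p (a *: x + y).
  move=> [Hx hx] [Hy hy]; split; first by rewrite assemble_linear; apply: (Hdiv_linear hconf oOm).
  move=> T; have [xh px ex] := hx T; have [yh py ey] := hy T.
  exists (fun z => a *: xh z + yh z); first by apply: RTD => //; exact: RTZ.
  move=> z; transitivity (a *: x T z + y T z); first by [].
  by rewrite ex ey mulmxDl -scalemxAl scalerDr !scalerA (mulrC a).
split; last exact: closed_lin.
(* Closure under combinations needs one member to start from. The test field of the zero function is
   one, and subtracting it from itself gives the zero field. *)
have h : forall T : elt M, ref_poly K p ((fun _ _ => 0) T : 'rV[R]_d -> R) by move=> T; exact: ref_poly0.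
have S0 := test_Sigmah hconf oOm regOm h 0.
by have := closed_lin (-1) _ _ S0 S0; rewrite scaleN1r addNr.
Qed.

Lemma Sigmah_component r i : Sigmah (M := M) Om p r -> Vh p.+1 (fun T x => r T x 0 i).
Proof.
move=> [_ hr] T; have [rh pr e] := hr T.
exists (fun y => \sum_j ((\det (jac T))^-1 * (jac T)^T j i) * rh y 0 j).
  by apply: ref_poly_sum => j _; apply: ref_polyZ; exact: RT_component.
by move=> x; rewrite e !mxE mulr_sumr; apply: eq_bigr => j _; ring.
Qed.

(** The flux continuity in H(div) prevents an explicit basis. Componentwise the fields lie in broken
    P_{p+1}, which is visibly finitely generated, and [sub_generates] passes to the subspace. *)
Lemma Sigmah_generates : exists N (b : 'I_N -> fields), generates (Sigmah Om p) b.
Proof.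
pose S0 (r : fields) := forall i, Vh p.+1 (fun T x => r T x 0 i).
have [N0 [g [pg hg]]] := generates_ref_poly R d K p.+1.
pose b (z : elt M * 'I_d * 'I_N0) : fields :=
  fun T x => ((T == z.1.1)%:R * g z.2 (Phi_inv T x)) *: delta_mx 0 z.1.2.
have [N [b' gb]] : exists N (b' : 'I_N -> fields), generates S0 b'.
  apply: (@generates_fin _ _ _ _ b).
    move=> [[T0 i0] k] i T; exists (fun y => ((T == T0)%:R * (delta_mx 0 i0 : 'rV[R]_d) 0 i) * g k y).
      by apply: ref_polyZ; exact: pg.
    by move=> x; rewrite /b /= !mxE; ring.
  move=> r hr.
  have /choice[c hc] : forall z : elt M * 'I_d, exists c, forall x,
      r z.1 x 0 z.2 = comb g c (Phi_inv z.1 x).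
    move=> [T i]; have [vt pv e] := hr i T; have [c ec] := hg _ pv.
    by exists c => x; rewrite /= e ec.
  exists (fun z => c z.1 0 z.2).
  apply/funext => T; apply/funext => x; apply/rowP => i.
  rewrite fct_sumE fct_sumE summxE.
  transitivity (\sum_z \sum_k (c z 0 k * ((T == z.1)%:R * g k (Phi_inv T x)) * (delta_mx 0 z.2 : 'rV[R]_d) 0 i)).
    rewrite (bigD1 (T, i))//= [X in _ + X]big1 ?addr0; last first.
      move=> [T' i'] /= ne; rewrite big1// => k _; rewrite mxE eqxx /=.
      case: (eqVneq T T') => [eT|]; last by rewrite !mul0r mulr0 mul0r.
      case: (eqVneq i i') => [ei|]; last by rewrite mulr0.
      by move: ne; rewrite eT ei eqxx.
    rewrite (hc (T, i)) /comb fct_sumE; apply: eq_bigr => k _.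
    by rewrite mxE !eqxx mulr1 mul1r.
  rewrite pair_bigA /=; apply: eq_bigr => z _.
  transitivity (c z.1 0 z.2 * (b z T x) 0 i); last by rewrite [RHS]mxE.
  by rewrite -mulrA; congr (_ * _); rewrite [RHS]mxE.
apply: (sub_generates subspace_Sigmah gb) => r hr i; exact: Sigmah_component.
Qed.

Lemma assemble_null q (v : scalars) : Vh q v -> ip Om (assemble v) (assemble v) = 0 -> v = 0.
Proof.
move=> hv; have cv := Vh_continuous hv; rewrite ip_assemble// => h.
have pv := vhat_poly hv.
have cvh T : continuous (fun x => vhat v T x * vhat v T x).
  by apply: cts_mul; exact: ref_poly_continuous (pv T).
rewrite -[v]pull_vhat; apply/funext => T; apply/funext => x.
apply: (ref_poly_zero (pv T)) => y Iy.
have t0 T' : 0 <= `|\det (JT T')| * \int[lam]_(x in ref_cell K) (v T' (Phi T' x) * v T' (Phi T' x)).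
  by apply: mulr_ge0 => //; apply: ref_int_ge0 => z _; rewrite -expr2 sqr_ge0.
have /(_ T isT) := psumr_eq0P (fun T' _ => t0 T') h.
move/eqP; rewrite mulf_eq0 (gt_eqF (det_JT_gt0 T)) /= => /eqP i0.
have : vhat v T y * vhat v T y = 0.
  by apply: (ref_int0 (cvh T) _ i0 Iy) => z _; rewrite -expr2 sqr_ge0.
by move/eqP; rewrite mulf_eq0 orbb => /eqP.
Qed.

Lemma Sigmah_null r : Sigmah (M := M) Om p r -> ipv Om (assemble r) (assemble r) = 0 -> r = 0.
Proof.
move=> hr; rewrite (ipvE oOm hr.1.1 hr.1.1) => h.
apply/funext => T; apply/funext => x; apply/rowP => i.
have /(_ i isT) := psumr_eq0P (fun i _ => ip_ge0 Om (fun x => assemble r x 0 i)) h.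
rewrite assemble_coord => /(assemble_null (Sigmah_component i hr)) e.
by rewrite [RHS]mxE; exact: (congr1 (fun w : scalars => w T x) e).
Qed.

Section quadrature_nodes.
Variables (n : nat) (xq : 'I_n -> 'rV[R]_d) (wq : 'I_n -> R).
Hypothesis hq : quadrature_rule K xq wq p.
Hypothesis hqc : quadrature_condition xq M p.
Local Notation nodes := (elt M * 'I_n)%type.

Lemma wTE (T : elt M) i : wT wq T i = `|\det (JT T)| * wq i.
Proof. by rewrite /wT vol_cell mulfK// gt_eqF// vol_ref_gt0. Qed.

Lemma wT_gt0 (T : elt M) i : 0 < wT wq T i.
Proof. by rewrite wTE mulr_gt0 ?det_JT_gt0//; case: hq. Qed.

Definition node_value (z : nodes) (v : scalars) : R := v z.1 (xT xq z.1 z.2).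

Lemma ipqE (u v : scalars) :
  ipq xq wq u v = \sum_z wT wq z.1 z.2 * (node_value z u * node_value z v).
Proof.
by rewrite /ipq pair_bigA; apply: eq_bigr => z _; rewrite /node_value mulrC.
Qed.

(** On the reference cell the product of the two polynomials is in P_{2p}, where the rule is
    exact. *)
Lemma ip_quadrature (u v : scalars) : Vh p u -> Vh p v -> ip Om (assemble u) (assemble v) = ipq xq wq u v.
Proof.
move=> hu hv; rewrite ip_assemble; try exact: Vh_continuous; try assumption.
have [_ _ ex] := hq; apply: eq_bigr => T _.
have pm : ref_poly K (2 * p) (fun x => vhat u T x * vhat v T x).
  by rewrite mul2n -addnn; exact: ref_polyM (vhat_poly hu T) (vhat_poly hv T).
rewrite (ex _ pm) mulr_sumr; apply: eq_bigr => i _; rewrite wTE /vhat /xT; ring.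
Qed.

(** The quadrature condition supplies the nodal functions. They span because the interpolation error
    vanishes at every node, and its squared L^2 norm is computed exactly by the quadrature, hence is
    zero. *)
Lemma nodal_basis : exists e : nodes -> scalars, [/\ forall z, Vh p (e z),
  forall z z', node_value z' (e z) = (z == z')%:R &
  forall v, Vh p v -> v = \sum_z node_value z v *: e z].
Proof.
have /choice[psi hpsi] : forall z : nodes, exists psi, polyT p z.1 psi /\ nodal xq z.1 z.2 psi.
  by move=> [T i]; have [k [psi [_ h1 _ h2]]] := hqc T i; exists psi.
pose e (z : nodes) : scalars := fun T x => (T == z.1)%:R * psi (T, z.2) x.
have Se z : Vh p (e z).
  move=> T; have [[vt pv ev] _] := hpsi (T, z.2).
  by exists (fun y => (T == z.1)%:R * vt y); [exact: ref_polyZ|move=> x; rewrite /e ev].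
have ee z z' : node_value z' (e z) = (z == z')%:R.
  case: z z' => [T i] [T' j]; rewrite /node_value /e /=.
  rewrite (hpsi (T', i)).2 /= xpair_eqE eq_sym.
  by case: (T == T'); case: (i == j); rewrite ?mul1r ?mul0r.
exists e; split => // v hv; apply/eqP; rewrite -subr_eq0; apply/eqP.
have sV := subspace_Vh p.
have Ss : Vh p (\sum_z node_value z v *: e z).
  by apply: (subspace_sum sV) => z _; exact: (subspaceZ sV).
have Sd : Vh p (v - \sum_z node_value z v *: e z) by exact: (subspaceB sV).
apply: (assemble_null Sd); rewrite ip_quadrature// ipqE big1// => z _.
suff -> : node_value z (v - \sum_z node_value z v *: e z) = 0 by rewrite mul0r mulr0.
transitivity (node_value z v - (\sum_z node_value z v *: e z) z.1 (xT xq z.1 z.2)); first by [].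
rewrite fct_sumE fct_sumE (bigD1 z)//= big1 ?addr0.
  transitivity (node_value z v - node_value z v * node_value z (e z)); first by [].
  by rewrite ee eqxx mulr1 subrr.
move=> z' ne; transitivity (node_value z' v * node_value z (e z')); first by [].
by rewrite ee (negbTE ne) mulr0.
Qed.

Lemma bregman_nodes rho (u v : scalars) : bregman xq wq rho u v =
  \sum_z wT wq z.1 z.2 * node_bregman (rho (xT xq z.1 z.2)) (node_value z u) (node_value z v).
Proof.
rewrite /bregman !ipqE -sumrB; apply: eq_bigr => z _; rewrite -mulrBr; congr (_ * _).
transitivity ((fine (rho (xT xq z.1 z.2) (node_value z u)) - fine (rho (xT xq z.1 z.2) (node_value z v))) * 1 -
  derive1 (fine \o rho (xT xq z.1 z.2)) (node_value z v) * (node_value z u - node_value z v)); first by [].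
by rewrite mulr1.
Qed.
End quadrature_nodes.

Section dg_norm.
Variables (A : 'rV[R]_d -> 'M[R]_d) (a0 a1 Mb : R).
Hypotheses (a00 : 0 < a0) (a10 : 0 < a1).
Hypothesis mA : forall i j, measurable_fun Om (fun x => A x i j).
Hypothesis bA : {ae lam, forall x, Om x -> forall i j, `|A x i j| <= Mb}.
Hypothesis sA : {ae lam, forall x, Om x -> (A x)^T = A x}.
Hypothesis eA : {ae lam, forall x, Om x -> forall l, eigenvalue (A x) l -> a0 <= l <= a1}.
Variables (sigma : R) (sigma0 : 0 < sigma) (m0 : (0 < m)%N).
Hypothesis reg : forall T : elt M, regular_at sigma T.

(** The entry bound [Mb] serves integrability; the constant is the spectral bound [a1], applied
    almost everywhere. *)
Lemma weighted_gradient_bound (T : elt M) (v : 'rV[R]_d -> R) : Ck 1 v ->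
  ipv (interior (cell T)) (applyA A (grad v)) (grad v) <=
  a1 * \int[lam]_(x in cell T) sqnorm (grad v x).
Proof.
move=> cv; set D := interior (cell T).
have oD : open D by exact: open_interior.
have mD : measurable D by exact: open_measurable_rV.
have DO : D `<=` Om by apply: sub_interior_cell; try exact: hconf; try exact: regOm.
have DC : D `<=` cell T by exact: interior_subset.
have [Bd Bd0 hB] : exists2 B : R, 0 <= B & forall T : elt M, cell T `<=` inbox B.
  by apply: mesh_inbox; try exact: hconf.
have Dfin : (lam D < +oo)%E by apply: (sub_inbox_fin mD) => x /DC /hB; exact.
have cp i : continuous (partial i v) by exact: Ck1_partial.
have L2p i : L2 D (partial i v).
  have [C C0 hC] := continuous_bounded_on Bd (cp i).
  apply: (L2_bounded mD (C := C)) => //.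
    by apply: measurable_funTS; exact: continuous_measurable_rV.
  by move=> x Dx; apply: hC; apply: hB (DC _ Dx).
have eg i : (fun x => grad v x 0 i) = partial i v by apply/funext => x; rewrite mxE.
have Lg : L2v D (grad v) by move=> i; rewrite eg.
have LA : L2v D (applyA A (grad v)).
  move=> i; rewrite (_ : (fun x => _) = fun x => \sum_j A x i j * partial j v x); last first.
    by apply/funext => x; rewrite mxE; apply: eq_bigr => j _; rewrite !mxE mulrC.
  apply: (L2_sum mD) => j _; apply: (@L2M_bounded R d D mD _ _ Mb) => //.
    exact: measurable_funS (mA i j).
  by apply: filterS bA => x h Dx; exact: h (DO _ Dx) i j.
have cs : continuous (fun x => sqnorm (grad v x)).
  rewrite (_ : (fun x => _) = fun x => \sum_i partial i v x ^+ 2); last first.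
    by apply/funext => x; apply: eq_bigr => i _; rewrite mxE.
  by apply: cts_sum => i; exact: cts_sqr.
have cs1 : continuous (fun x => a1 * sqnorm (grad v x)) by exact: cts_scale.
have iD : lam.-integrable D (EFin \o (fun x => a1 * sqnorm (grad v x))).
  by apply: (integrableS (measurable_cell T) mD DC); exact: integrable_cell.
apply: (@le_trans _ _ (\int[lam]_(x in D) (a1 * sqnorm (grad v x)))).
  apply: ae_le_Rintegral => //; first by apply: dot_integrable.
  apply: filterS2 sA eA => x hs he Dx.
  have [_ +] := spectral_bounds (hs (DO _ Dx)) (he (DO _ Dx)) (grad v x).
  rewrite /dot /applyA mformE => h; apply: le_trans _ h.
  rewrite le_eqVlt; apply/orP; left; apply/eqP; rewrite (hs (DO _ Dx)) exchange_big /=.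
  apply: eq_bigr => i _; rewrite [in LHS]mxE mulr_suml; apply: eq_bigr => j _; ring.
rewrite (Rintegral_cell_interior (T := T) (G := fun x => a1 * sqnorm (grad v x)))//; last first.
  by apply: sub_cell_interior.
rewrite !Rintegral_cell// ref_intZ; first by rewrite mulrCA.
by apply: cts_comp cs; exact: continuous_Phi.
Qed.

Lemma dg_norm_bound v : Vh p v ->
  dg_norm_sq A v <= (a1 * (4 * d%:R ^+ 2 * sigma ^+ 2) + 1) * broken_norm (vhat v).
Proof.
move=> hv; have pv := vhat_poly hv.
set k0 := 4 * d%:R ^+ 2 * sigma ^+ 2; have k00 : 0 < k0 by rewrite !mulr_gt0 ?exprn_gt0.
have hg := gradient_bound sigma0 reg pv; have hj := jump_bound sigma0 m0 reg (vhat v).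
rewrite pull_vhat in hg; rewrite pull_vhat in hj.
rewrite /dg_norm_sq broken_normE big_split /= mulrDr; apply: lerD.
  rewrite mulr_sumr; apply: ler_sum => T _.
  have cvT : Ck 1 (v T) by rewrite -(pull_vhat v); exact: pull_Ck1.
  apply: le_trans (weighted_gradient_bound T cvT) _.
  have := hg T; rewrite -/k0; set y := (X in k0 * X) => hT.
  have i0 : 0 <= \int[lam]_(x in cell T) sqnorm (grad (v T) x).
    by rewrite /Rintegral fine_ge0// integral_ge0// => x _; rewrite lee_fin sqnorm_ge0.
  have y0 : 0 <= y by rewrite -(pmulr_rge0 _ k00); exact: le_trans i0 hT.
  rewrite -/y mulrDl mul1r; apply: (@le_trans _ _ (a1 * (k0 * y))); first by rewrite ler_pM2l.
  by rewrite mulrA lerDl.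
apply: le_trans hj _; set Z := (X in X <= _).
have Z0 : 0 <= Z.
  apply: sumr_ge0 => T _; apply: sumr_ge0 => j _; apply: mulr_ge0.
    by have [] := mu_bound sigma0 reg (T, j) m0.
  by apply: ref_int_ge0 => x _; exact: sqr_ge0.
rewrite mulrDl mul1r lerDr; apply: mulr_ge0 => //; apply: mulr_ge0; exact: ltW.
Qed.
End dg_norm.
End discrete_spaces.

(** * Assembly of the estimates on one mesh *)

Section mesh_problem.
Variables (R : realType) (m : nat) (K : ref_shape) (M : mesh R m.+1 K).
Local Notation d := m.+1.
Local Notation lam := (lebesgue_rV R d).
Local Notation scalars := (elt M -> 'rV[R]_d -> R).
Local Notation fields := (elt M -> 'rV[R]_d -> 'rV[R]_d).
Variable Om : set 'rV[R]_d.
Hypotheses (hconf : conforming_partition M Om) (oOm : open Om).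
Hypothesis regOm : interior (closure Om) = Om.
Variables (p n : nat) (xq : 'I_n -> 'rV[R]_d) (wq : 'I_n -> R).
Hypothesis hq : quadrature_rule K xq wq p.
Hypothesis hqc : quadrature_condition xq M p.
Variables (A : 'rV[R]_d -> 'M[R]_d) (a0 a1 Mb : R).
Hypotheses (a00 : 0 < a0) (a10 : 0 < a1).
Hypothesis mA : forall i j, measurable_fun Om (fun x => A x i j).
Hypothesis bA : {ae lam, forall x, Om x -> forall i j, `|A x i j| <= Mb}.
Hypothesis sA : {ae lam, forall x, Om x -> (A x)^T = A x}.
Hypothesis eA : {ae lam, forall x, Om x -> forall l, eigenvalue (A x) l -> a0 <= l <= a1}.
Variables (sigma : R) (sigma0 : 0 < sigma) (m0 : (0 < m)%N).
Hypothesis reg : forall T : elt M, regular_at sigma T.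
Variables (f G : 'rV[R]_d -> R).
Hypotheses (hf : L2 Om f) (hG : H1 Om G).
Variables (Cb : R) (Cb0 : 0 <= Cb).
Hypothesis hCb : forall v, ref_poly K p v ->
  \int[lam]_(x in ref_cell K) sqnorm (grad v x) <= Cb * grad_form K (weight K) v v.
Variables (lo : 'rV[R]_d -> R) (hi : 'rV[R]_d -> \bar R).
Variables (rho : 'rV[R]_d -> R -> \bar R) (ups : 'rV[R]_d -> R -> R).
Hypothesis lohi : forall (T : elt M) i, ((lo (xT xq T i))%:E <= hi (xT xq T i))%E.
Hypothesis ent : forall (T : elt M) i, let x := xT xq T i in
  entropy_at (lo x) (hi x) (rho x) (ups x).

(** The bubble coefficient [beta] of the inf-sup section, the same on every mesh. *)
Definition test_weight : R :=
  (2 * (4 * d%:R * #|facet_ix d K|%:R) * cmu m sigma + 1) * Cb.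
Definition stability_constant : R := a0^-1 * (d%:R ^+ 2 *
  (2 * (4 * d%:R * #|facet_ix d K|%:R) * cmu m sigma + 8 * d%:R ^+ 2 * test_weight ^+ 2)).
(** The 16 times [stability_constant] comes from [nrm_le], the factor with [a1] passes from the
    broken norm to the DG norm, the final 1 accounts for the flux error itself, and the leading 2 is
    that of [proximal_rate]. Only the dimension, the shape, [sigma], [a0], [a1] and [Cb] occur. *)
Definition rate_constant : R :=
  2 * (16 * (a1 * (4 * d%:R ^+ 2 * sigma ^+ 2) + 1) * stability_constant + 1).

Lemma stability_constant_ge0 : 0 <= stability_constant.
Proof.
have c0 : 0 <= cmu m sigma by exact: cmu_ge0.
rewrite /stability_constant mulr_ge0 ?invr_ge0 ?(ltW a00)// mulr_ge0 ?sqr_ge0//.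
have w0 : 0 <= test_weight ^+ 2 by exact: sqr_ge0.
repeat first [exact: sqr_ge0 | exact: ler0n | exact: ler01 | exact: (ltW a10) | exact: c0 | apply: addr_ge0 | apply: mulr_ge0].
Qed.

Lemma rate_constant_gt0 : 0 < rate_constant.
Proof.
have c0 := stability_constant_ge0.
rewrite /rate_constant; apply: mulr_gt0 => //; apply: ltr_wpDl => //.
repeat first [exact: sqr_ge0 | exact: ler0n | exact: ler01 | exact: (ltW a10) | exact: c0 | apply: addr_ge0 | apply: mulr_ge0].
Qed.

Let mO : measurable Om. Proof. exact: measurable_Om oOm. Qed.

Local Notation Sg := (Sigmah (M := M) Om p).
Local Notation SU := (@Vh R d K M p).
Local Notation node := (elt M * 'I_n)%type.
Local Notation N := #|{: node}|.
Local Notation zz k := (enum_val k : node).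

Definition flux_form (q r : fields) : R := aform Om A (assemble q) (assemble r).
Definition div_form (r : fields) (v : scalars) : R := bform Om (assemble r) (assemble v).
Definition scalar_form (u v : scalars) : R := ip Om (assemble u) (assemble v).
Definition boundary_form (r : fields) : R := boundary_pairing Om G (assemble r).
Definition load_form (v : scalars) : R := ip Om f (assemble v).
Definition discrete_norm (v : scalars) : R := broken_norm (vhat v).
Definition node_eval (k : 'I_N) (v : scalars) : R := node_value xq (zz k) v.
Definition node_weight (k : 'I_N) : R := wT (M := M) wq (zz k).1 (zz k).2.
Definition node_lo (k : 'I_N) : R := lo (xT (M := M) xq (zz k).1 (zz k).2).
Definition node_hi (k : 'I_N) : \bar R := hi (xT (M := M) xq (zz k).1 (zz k).2).
Definition node_rho (k : 'I_N) := rho (xT (M := M) xq (zz k).1 (zz k).2).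
Definition node_ups (k : 'I_N) := ups (xT (M := M) xq (zz k).1 (zz k).2).

Lemma VhL2 v : SU v -> L2 Om (assemble v).
Proof. by move=> hv; apply: Vh_L2; first [exact: hv | exact: hconf | exact: oOm | exact: regOm]. Qed.

Lemma wdL2 r : Sg r -> L2 Om (weak_div Om (assemble r)).
Proof. by move=> [hr _]; have [] := weak_divP hr. Qed.

Lemma flux_form_psd : psd_form Sg flux_form.
Proof.
split.
- move=> y [[Ly _] _] a x x' [[Lx _] _] [[Lx' _] _]; rewrite /flux_form assemble_linear.
  exact: (aform_linear oOm a00 mA sA eA).
- by move=> x y [[Lx _] _] [[Ly _] _]; exact: (aformC oOm a00 mA sA eA Lx Ly).
- by move=> x [[Lx _] _]; exact: (aform_ge0 oOm a00 a10 mA sA eA Lx).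
Qed.

Lemma flux_form_definite q : Sg q -> flux_form q q = 0 -> q = 0.
Proof.
move=> Sq h; have [[Lq _] _] := Sq.
apply: Sigmah_null; first [exact: Sq | exact: hconf | exact: oOm | exact: regOm | idtac].
apply/eqP; rewrite eq_le ipv_ge0 andbT.
have := aform_lower oOm a00 mA sA eA Lq; rewrite -/(flux_form q q) h mulr0; exact.
Qed.

Lemma div_form_l v : SU v -> linear_on Sg (fun r => div_form r v).
Proof.
move=> Sv a x y [hx _] [hy _]; rewrite /div_form assemble_linear.
exact: (bform_linear hconf oOm a hx hy (VhL2 Sv)).
Qed.

Lemma ip_linear_r w (a : R) x y : L2 Om w -> SU x -> SU y ->
  ip Om w (assemble (a *: x + y)) = a * ip Om w (assemble x) + ip Om w (assemble y).
Proof.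
move=> Lw /VhL2 Lx /VhL2 Ly; rewrite ![ip Om w _]ipC assemble_linearR.
by rewrite (ipDl mO (L2Z mO a Lx) Ly Lw) (ipZl mO a Lx Lw).
Qed.

Lemma div_form_r r : Sg r -> linear_on SU (div_form r).
Proof. by move=> Sr a x y Sx Sy; exact: ip_linear_r (wdL2 Sr) Sx Sy. Qed.

Lemma boundary_form_linear : linear_on Sg boundary_form.
Proof.
move=> a x y [hx _] [hy _]; rewrite /boundary_form assemble_linear.
exact: (pairing_linear hconf oOm hG a hx hy).
Qed.

Lemma load_form_linear : linear_on SU load_form.
Proof. by move=> a x y Sx Sy; exact: ip_linear_r hf Sx Sy. Qed.

Lemma node_eval_linear k : linear_on SU (node_eval k).
Proof. by move=> a x y _ _. Qed.

Lemma scalar_formE u v : SU u -> SU v ->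
  scalar_form u v = \sum_k node_weight k * (node_eval k u * node_eval k v).
Proof.
move=> Su Sv; transitivity (ipq xq wq u v); first by apply: ip_quadrature; first [exact: hq | exact: Su | exact: Sv | exact: hconf | exact: oOm | exact: regOm].
by rewrite ipqE -sum_enum_val.
Qed.

Lemma node_weight_gt0 k : 0 < node_weight k.
Proof. by rewrite /node_weight; apply: wT_gt0; exact: hq. Qed.

Lemma discrete_norm_ge0 v : SU v -> 0 <= discrete_norm v.
Proof. by move=> _; exact: (broken_norm_ge0 sigma0 m0 reg). Qed.

Lemma discrete_norm_eq0 v : SU v -> discrete_norm v = 0 -> v = 0.
Proof.
move=> Sv h; rewrite -(pull_vhat v); apply/funext => T; apply/funext => x.
exact: (broken_norm_eq0 hconf sigma0 m0 reg (vhat_poly Sv) h).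
Qed.

Lemma inf_sup v : SU v -> exists2 r, Sg r & discrete_norm v <= 4 * div_form r v /\
  flux_form r r <= stability_constant * discrete_norm v.
Proof.
move=> Sv; have pv := vhat_poly Sv.
have Sr := test_Sigmah hconf oOm regOm pv test_weight.
have h1 := inf_sup_coercive hconf oOm regOm sigma0 m0 reg pv hCb.
have h2 := test_field_bound hconf oOm regOm sigma0 m0 reg pv Cb.
rewrite pull_vhat -/test_weight in h1; rewrite -/test_weight in h2.
exists (test_field (vhat v) test_weight) => //; split; first exact: h1.
have [[Lr _] _] := Sr; apply: le_trans (aform_upper oOm a00 mA sA eA Lr) _.
rewrite /stability_constant -[leRHS]mulrA; apply: ler_wpM2l; last exact: h2.
by rewrite invr_ge0 ltW.
Qed.

Local Notation solution := (@obstacle_solution R fields scalars Sg SU N flux_form div_form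
  boundary_form load_form node_eval node_lo node_hi).

Lemma feasibleP u : feasible node_eval node_lo node_hi u <-> forall (T : elt M) i,
  lo (xT xq T i) <= u T (xT xq T i) /\ ((u T (xT xq T i))%:E <= hi (xT xq T i))%E.
Proof.
split => [h T i|h k]; last exact: h.
by have := h (enum_rank (T, i)); rewrite /node_eval /node_lo /node_hi enum_rankK.
Qed.

Lemma solutionP q u : variational_inequality Om A f G p xq lo hi q u <-> solution q u.
Proof.
have e q' u' v : Sg q' -> SU u' -> SU v -> ip Om (weak_div Om (assemble q') - f) (assemble (v - u')) =
    div_form q' (v - u') - load_form (v - u').
  move=> Sq' Su' Sv; have Sd : SU (v - u') by exact: (subspaceB (subspace_Vh M p)).
  exact: (ipBl mO (wdL2 Sq') hf (VhL2 Sd)).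
split.
  move=> [Sq [Su /feasibleP fu] h1 h2]; split => //.
    by move=> r Sr; rewrite /div_form /bform ipC; exact: h1.
  by move=> v Sv /feasibleP fv; rewrite -e//; exact: h2.
move=> [Sq Su /feasibleP fu h1 h2]; split => //.
  by move=> r Sr; rewrite [ip _ _ (weak_div _ _)]ipC; exact: h1.
by move=> v [Sv /feasibleP fv]; rewrite e//; exact: h2.
Qed.

Lemma bregmanE u v : bregman xq wq rho u v =
  total_bregman node_eval node_weight node_rho u v.
Proof. by rewrite bregman_nodes -sum_enum_val. Qed.

Definition divergence_form (q r : fields) : R :=
  ip Om (weak_div Om (assemble q)) (weak_div Om (assemble r)).

(** Norm equivalence on the flux space of one mesh, as the flux form is definite there. The constant
    may depend on the mesh, since it is used only for convergence in H(div). *)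
Lemma divergence_bound : exists2 C, 0 <= C & forall r, Sg r ->
  divergence_form r r <= C * flux_form r r.
Proof.
have [N' [b gb]] := Sigmah_generates hconf oOm regOm p.
have l y : Sg y -> linear_on Sg (fun x => divergence_form x y).
  move=> Sy a x x' [hx _] [hx' _]; rewrite /divergence_form assemble_linear.
  exact: (bform_linear hconf oOm a hx hx' (wdL2 Sy)).
have sS := subspace_Sigmah hconf oOm regOm p.
apply: (psd_dominated sS gb flux_form_psd).
  split; [exact: l | by move=> x y _ _; exact: ipC | by move=> x _; exact: ip_ge0].
move=> x Sx /(flux_form_definite Sx) ->.
exact: (linear_on0 sS (l _ (sS.1))).
Qed.

Lemma mesh_convergence : exists (qs : fields) (us : scalars),
  [/\ variational_inequality Om A f G p xq lo hi qs us,
    forall q u, variational_inequality Om A f G p xq lo hi q u -> q = qs /\ u = us &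
    forall (alpha : nat -> R) (q : nat -> fields) (u psi : nat -> scalars),
    (forall k, (0 < k)%N -> 0 < alpha k) ->
    proximal_iterates Om A f G p xq wq ups alpha q u psi ->
      ((\sum_(1 <= k < l.+1) alpha k) @[l --> \oo] --> +oo ->
        Hdiv_norm Om (assemble (q k - qs)) @[k --> \oo] --> 0 /\
        norm2 Om (assemble (u k - us)) @[k --> \oo] --> 0) /\
      forall l, (0 < l)%N ->
        dg_norm_sq A (u l - us)
          + ipv Om (applyAinv A (assemble (q l - qs))) (assemble (q l - qs))
        <= rate_constant * (bregman xq wq rho us (u 0%N) / \sum_(1 <= k < l.+1) alpha k)].
Proof.
have [e [Se0 ee0 eE0]] : exists e : node -> scalars, [/\ forall z, SU (e z),
    forall z z', node_value xq z' (e z) = (z == z')%:R &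
    forall v, SU v -> v = \sum_z node_value xq z v *: e z].
  by apply: nodal_basis; first [exact: hconf | exact: oOm | exact: regOm | exact: hq | exact: hqc].
pose e' (k : 'I_N) := e (zz k).
have sSg := subspace_Sigmah hconf oOm regOm p.
have sSU := subspace_Vh M p.
have gSg := Sigmah_generates hconf oOm regOm p.
have pa := flux_form_psd; have da := flux_form_definite.
have Bl := div_form_l; have Br := div_form_r.
have LL := boundary_form_linear; have LF := load_form_linear; have evl := node_eval_linear.
have eS (i : 'I_N) : SU (e' i) by exact: Se0.
have eE v : SU v -> v = \sum_i node_eval i v *: e' i.
  by move=> Sv; rewrite [LHS]eE0// -sum_enum_val.
have ee (i j : 'I_N) : node_eval j (e' i) = (i == j)%:R.
  by rewrite /node_eval ee0 (inj_eq enum_val_inj).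
have ipE := scalar_formE; have w0 := node_weight_gt0.
have nrm0 := discrete_norm_ge0; have nrmz := discrete_norm_eq0; have isup := inf_sup.
have Ca0 := stability_constant_ge0.
have [qq hqq] : exists qq : 'I_N -> fields, forall i, Sg (qq i) /\
    forall r, Sg r -> flux_form (qq i) r = div_form r (e' i).
  by apply: solution_family; first [exact: sSg | exact: sSU | exact: gSg | exact: pa | exact: da | exact: Bl | exact: Br | exact: LL | exact: LF | exact: evl | exact: eS | exact: eE | exact: ee | exact: ipE | exact: w0 | exact: nrm0 | exact: nrmz | exact: Ca0 | exact: isup].
have [qs [us sol]] : exists q u, solution q u.
  have lohi' k : ((node_lo k)%:E <= node_hi k)%E by exact: lohi.
  by apply: (obstacle_existence (nrm := discrete_norm) (e := e')); first [exact: sSg | exact: sSU | exact: gSg | exact: pa | exact: da | exact: Bl | exact: Br | exact: LL | exact: LF | exact: evl | exact: eS | exact: eE | exact: ee | exact: ipE | exact: w0 | exact: nrm0 | exact: nrmz | exact: Ca0 | exact: isup | exact: hqq | exact: lohi'].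
have [Cg Cg0 hCg] : exists2 C, 0 <= C & forall q v, Sg q -> SU v ->
    (forall r, Sg r -> flux_form q r = div_form r v) -> scalar_form v v <= C * flux_form q q.
  by apply: (gram_coercive (nrm := discrete_norm) (e := e') (w := node_weight)); first [exact: sSg | exact: sSU | exact: gSg | exact: pa | exact: da | exact: Bl | exact: Br | exact: LL | exact: LF | exact: evl | exact: eS | exact: eE | exact: ee | exact: ipE | exact: w0 | exact: nrm0 | exact: nrmz | exact: Ca0 | exact: isup | exact: hqq].
have [Cd Cd0 hCd] := divergence_bound.
exists qs, us; split; first exact/solutionP.
  move=> q u /solutionP h; apply: (obstacle_uniqueness (nrm := discrete_norm) (Ca := stability_constant)); first [exact: sSg | exact: sSU | exact: gSg | exact: pa | exact: da | exact: Bl | exact: Br | exact: LL | exact: LF | exact: evl | exact: eS | exact: eE | exact: ee | exact: ipE | exact: w0 | exact: nrm0 | exact: nrmz | exact: Ca0 | exact: isup | exact: hqq | exact: h | exact: sol].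
move=> alpha q u psi alpha0 [hup hqk h1 h2 h3].
have hu k : SU (u k) by have [] := hup k.
have hpsi k : SU (psi k) by have [] := hup k.
(* Testing the third equation with a nodal function isolates one node on both sides, and the
   positive weight cancels. This includes [k] equal to 0, which defines [u 0]. *)
have h3' k i : node_eval i (u k) = node_ups i (node_eval i (psi k)).
  have := h3 k (e' i) (eS i).
  have -> : ip Om (assemble (u k)) (assemble (e' i)) = ipq xq wq (u k) (e' i).
    by apply: ip_quadrature; first [exact: hq | exact: hu | exact: eS | exact: hconf | exact: oOm | exact: regOm].
  have ipn X : ipq xq wq X (e' i) = node_weight i * node_eval i X.
    rewrite ipqE (bigD1 (zz i))//= big1 => [|z zi]; last by rewrite /e' ee0 eq_sym (negbTE zi) !mulr0.
    by rewrite /e' ee0 eqxx mulr1 addr0.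
  rewrite (ipn (u k)) (ipn (upsilon_op ups (psi k))) -mulrBr => /eqP.
  rewrite mulf_eq0 (gt_eqF (w0 i)) /= subr_eq0 => /eqP h.
  exact: h.
have ent' k : entropy_at (node_lo k) (node_hi k) (node_rho k) (node_ups k) by exact: ent.
have Sqs : Sg qs by case: sol.
have Sus : SU us by case: sol.
have Sd k : (0 < k)%N -> Sg (q k - qs) by move=> k0; exact: (subspaceB sSg (hqk k k0) Sqs).
have Su k : SU (u k - us) by exact: (subspaceB sSU (hu k) Sus).
have h1' k : (0 < k)%N -> forall v, SU v -> alpha k * div_form (q k) v + scalar_form (psi k) v =
    alpha k * load_form v + scalar_form (psi k.-1) v by exact: h1.
have h2' k : (0 < k)%N -> forall r, Sg r -> flux_form (q k) r - div_form r (u k) = - boundary_form r.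
  by exact: h2.
have err k : (0 < k)%N -> forall r, Sg r -> flux_form (q k - qs) r = div_form r (u k - us).
  move=> k0; have hsol : forall r, Sg r -> flux_form qs r - div_form r us = - boundary_form r by case: sol.
  by apply: saddle_difference; first [exact: sSg | exact: sSU | exact: gSg | exact: pa | exact: da | exact: Bl | exact: Br | exact: LL | exact: LF | exact: evl | exact: eS | exact: eE | exact: ee | exact: ipE | exact: w0 | exact: nrm0 | exact: nrmz | exact: Ca0 | exact: isup | exact: hqq | exact: (hqk k k0) | exact: Sqs | exact: (hu k) | exact: Sus | exact: (h2' k k0) | exact: hsol].
have S0 l : (0 < l)%N -> 0 < \sum_(1 <= k < l.+1) alpha k.
  move=> l0; rewrite big_nat_recl//; apply: ltr_pwDl; first exact: alpha0.
  by apply: sumr_ge0 => k _; exact: ltW (alpha0 _ _).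
have rate l : (0 < l)%N -> flux_form (q l - qs) (q l - qs) <=
    2 * (bregman xq wq rho us (u 0%N) / \sum_(1 <= k < l.+1) alpha k).
  move=> l0; rewrite bregmanE; apply: (proximal_rate (ipU := scalar_form)); first [exact: sSg | exact: sSU | exact: gSg | exact: pa | exact: da | exact: Bl | exact: Br | exact: LL | exact: LF | exact: evl | exact: eS | exact: eE | exact: ee | exact: ipE | exact: w0 | exact: nrm0 | exact: nrmz | exact: Ca0 | exact: isup | exact: hqq | exact: ent' | exact: alpha0 | exact: hpsi | exact: hu | exact: hqk | exact: h1' | exact: h2' | exact: h3' | exact: sol | exact: l0].
set D0 := bregman _ _ _ _ _ in rate *.
split.
  (* The squared H(div) norm is at most [a1 + Cd] times the flux error, and the squared L^2 norm of
     the scalar error at most [Cg] times it; both constants are fixed along the iteration, so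
     divergence of the sum of the steps suffices. *)
  move=> hS; split.
    apply: (sqrt_rate_cvg (C := (a1 + Cd) * (2 * D0)) S0 _ hS) => l l0.
    have [[Lr _] _] := Sd l l0.
    have hl := aform_lower oOm a00 mA sA eA Lr; rewrite -/(flux_form _ _) in hl.
    have hd := hCd _ (Sd l l0); rewrite /divergence_form in hd.
    apply: le_trans (lerD hl hd) _; rewrite -mulrDl -!mulrA.
    by apply: ler_wpM2l; [rewrite addr_ge0// ltW|exact: rate].
  apply: (sqrt_rate_cvg (C := Cg * (2 * D0)) S0 _ hS) => l l0.
  apply: le_trans (hCg _ _ (Sd l l0) (Su l) (err l l0)) _; rewrite -!mulrA.
  by apply: ler_wpM2l => //; exact: rate.
move=> l l0; set X := D0 / _.
have hn : discrete_norm (u l - us) <= 16 * stability_constant * flux_form (q l - qs) (q l - qs).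
  by apply: (nrm_le (Ca := stability_constant)); first [exact: sSg | exact: sSU | exact: gSg | exact: pa | exact: da | exact: Bl | exact: Br | exact: LL | exact: LF | exact: evl | exact: eS | exact: eE | exact: ee | exact: ipE | exact: w0 | exact: nrm0 | exact: nrmz | exact: Ca0 | exact: isup | exact: hqq | exact: (Sd l l0) | exact: (Su l) | exact: (err l l0)].
have hdg : dg_norm_sq A (u l - us) <=
    (a1 * (4 * d%:R ^+ 2 * sigma ^+ 2) + 1) * discrete_norm (u l - us).
  by apply: dg_norm_bound; first [exact: hconf | exact: oOm | exact: regOm | exact: a00 | exact: a10 | exact: sigma0 | exact: mA | exact: bA | exact: sA | exact: eA | exact: m0 | exact: reg | exact: (Su l)].
have hr := rate l l0; rewrite -/X in hr.
rewrite -/(aform Om A (assemble (q l - qs)) (assemble (q l - qs))) -/(flux_form (q l - qs) (q l - qs)).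
set E := flux_form _ _ in hn hr *; set c := a1 * _ + 1 in hdg *.
have c0 : 0 <= c by rewrite /c; repeat first [exact: sqr_ge0 | exact: ler0n | exact: ler01 | exact: (ltW a10) | apply: addr_ge0 | apply: mulr_ge0].
have h4 : dg_norm_sq A (u l - us) <= c * (16 * stability_constant * E).
  by apply: le_trans hdg _; exact: ler_wpM2l.
apply: (@le_trans _ _ ((16 * c * stability_constant + 1) * E)).
  have -> : (16 * c * stability_constant + 1) * E = c * (16 * stability_constant * E) + E by ring.
  by rewrite lerD2r.
rewrite /rate_constant -/c.
have -> : 2 * (16 * c * stability_constant + 1) * X = (16 * c * stability_constant + 1) * (2 * X) by ring.
apply: ler_wpM2l => //.
repeat first [exact: sqr_ge0 | exact: ler0n | exact: ler01 | exact: (ltW a10) | exact: c0 | exact: Ca0 | apply: addr_ge0 | apply: mulr_ge0].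
Qed.

End mesh_problem.

Theorem theorem5p3 (R : realType) (d : nat) (hd : d = 2%N \/ d = 3%N)
  (Om : set 'rV[R]_d) (hOm : polyhedral_domain Om)
  (A : 'rV[R]_d -> 'M[R]_d) (hA : coefficient Om A)
  (lo : 'rV[R]_d -> R) (hlo : H1C Om lo)
  (hi : 'rV[R]_d -> \bar R)
  (hhi : (forall x, hi x = +oo%E) \/
         exists2 w : 'rV[R]_d -> R, H1C Om w & forall x, hi x = (w x)%:E)
  (hlohi : forall x, closure Om x -> ((lo x)%:E <= hi x)%E)
  (* rho is the entropy R(x, y), ups is Upsilon *)
  (rho : 'rV[R]_d -> R -> \bar R) (ups : 'rV[R]_d -> R -> R)
  (hrho : {ae lebesgue_rV R d, forall x, Om x ->
            entropy_at (lo x) (hi x) (rho x) (ups x)})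
  (K : ref_shape) (meshes : set (mesh R d K))
  (hconf : forall M, meshes M -> conforming_partition M Om)
  (hreg : shape_regular meshes)
  (p n : nat) (xq : 'I_n -> 'rV[R]_d) (wq : 'I_n -> R)
  (hq : quadrature_rule K xq wq p)
  (hrhoq : forall M, meshes M -> forall (T : elt M) (i : 'I_n),
    let x := xT xq T i in entropy_at (lo x) (hi x) (rho x) (ups x))
  (hqc : forall M, meshes M -> quadrature_condition xq M p)
  (* G is a lifting of the boundary datum g *)
  (f : 'rV[R]_d -> R) (hf : L2 Om f)
  (G : 'rV[R]_d -> R) (hG : H1 Om G) :
  exists2 C : R, 0 < C & forall M, meshes M ->
    exists (qs : elt M -> 'rV[R]_d -> 'rV[R]_d) (us : elt M -> 'rV[R]_d -> R),
    [/\ variational_inequality Om A f G p xq lo hi qs us,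
        forall q u, variational_inequality Om A f G p xq lo hi q u ->
          q = qs /\ u = us &
        forall (alpha : nat -> R)
          (q : nat -> elt M -> 'rV[R]_d -> 'rV[R]_d)
          (u psi : nat -> elt M -> 'rV[R]_d -> R),
        (forall k, (0 < k)%N -> 0 < alpha k) ->
        proximal_iterates Om A f G p xq wq ups alpha q u psi ->
          ((\sum_(1 <= k < l.+1) alpha k) @[l --> \oo] --> +oo ->
            Hdiv_norm Om (assemble (q k - qs)) @[k --> \oo] --> 0 /\
            norm2 Om (assemble (u k - us)) @[k --> \oo] --> 0) /\
          forall l, (0 < l)%N ->
            dg_norm_sq A (u l - us)
              + ipv Om (applyAinv A (assemble (q l - qs))) (assemble (q l - qs))
            <= C * (bregman xq wq rho us (u 0%N) / \sum_(1 <= k < l.+1) alpha k)].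
Proof.
have [m dm m0] : exists2 m, d = m.+1 & (0 < m)%N by case: hd => ->; [exists 1%N|exists 2%N].
subst d.
have [oOm _ _ _ [regOm _]] := hOm.
have [mA [Mb bA] sA [a0 [a1 [a00 a10 eA]]]] := hA.
have [sigma sigma0 reg] := hreg.
(* [Cb] comes from the reference cell and the degree alone, so the rate constant is fixed before any
   mesh is chosen. *)
have [Cb Cb0 hCb] := bubble_dominates R m K p.
exists (@rate_constant R m K a0 a1 sigma Cb); first by apply: rate_constant_gt0; first [exact: a00 | exact: a10 | exact: sigma0 | exact: m0 | exact: Cb0].
move=> M hM.
have nodes_in (T : elt M) i : closure Om (xT xq T i).
  have [-> _ _] := hconf M hM; exists T => //; exists (xq i) => //.
  by case: hq.
have lohi (T : elt M) i : ((lo (xT xq T i))%:E <= hi (xT xq T i))%E by exact: hlohi.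
by apply: mesh_convergence; first [exact: (hconf M hM) | exact: oOm | exact: regOm | exact: hq |
  exact: (hqc M hM) | exact: a00 | exact: a10 | exact: mA | exact: bA | exact: sA | exact: eA |
  exact: sigma0 | exact: m0 | exact: (reg M hM) | exact: hf | exact: hG | exact: Cb0 | exact: hCb |
  exact: lohi | exact: (hrhoq M hM)].
Qed.
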